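(* Let $\Gamma$ be a discrete countable group and let $\Lambda$ be a discrete countable infinite group. Then: (1) For every subgroup $\Upsilon$ of the free product $\Gamma * \Lambda$ having property (AP), the action of $\Upsilon$ on $\partial_\beta((\Gamma * \Lambda)/\Gamma)$, induced by left translation on the coset space $(\Gamma*\Lambda)/\Gamma$, is topologically amenable. (2) If moreover $\Gamma$ is non-amenable and $\Gamma * \Lambda$ is $C^*$-simple and has property (AP), then the only non-trivial ideal in $\pi_{\Gamma * \Lambda/\Gamma}(C^*(\Gamma * \Lambda))$ is the ideal of compact operators $\mathbb{K}(\ell^2((\Gamma * \Lambda)/\Gamma))$. (3) In particular, for every $r, s \geq 2$, the $C^*$-algebra $\pi_{\mathbb{F}_r * \mathbb{F}_s/\mathbb{F}_r}(C^*(\mathbb{F}_{r+s}))$ (where $\mathbb{F}_{r+s} = \mathbb{F}_r * \mathbb{F}_s$) has a unique non-trivial ideal.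
   Context: For a discrete countable group $G$ and a subgroup $H < G$, $\pi_{G/H} : C^*(G) \to \mathbb{B}(\ell^2(G/H))$ denotes the representation of the full group $C^*$-algebra induced by the quasi-regular unitary representation of $G$ on $\ell^2(G/H)$. ''Non-trivial ideal'' means a closed two-sided ideal that is neither $0$ nor the whole algebra. A group $G$ is $C^*$-simple if its reduced group $C^*$-algebra $C^*_\lambda G$ is simple. $\mathbb{F}_r$ is the free group of rank $r$. For a countable (discrete) set $\mathfrak{X}$, $\partial_\beta \mathfrak{X} = \beta\mathfrak{X} \setminus \mathfrak{X}$ denotes the Stone–Čech boundary (remainder) of $\mathfrak{X}$; an action of a group on $\mathfrak{X}$ extends to $\beta\mathfrak{X}$ and restricts to $\partial_\beta \mathfrak{X}$. Topological amenability: let a discrete countable group $G$ act by homeomorphisms on a compact Hausdorff space $X$. Let $\mathcal{P}(G)$ be the set of probability measures on $G$ (with the topology of pointwise convergence, equivalently the $\ell^1$-norm topology), with $G$ acting by left translation. The action on $X$ is topologically amenable if there is a net of continuous maps $\mu_i : X \to \mathcal{P}(G)$ such that $\lim_i \sup_{x \in X} \|\mu_i(g x) - g \mu_i(x)\|_1 = 0$ for every $g \in G$. Property (AP) (Haagerup–Kraus): let $M_0A(G)$ be the space of completely bounded multipliers of the Fourier algebra $A(G)$ with its cb-multiplier norm, and let $Q(G)$ be its canonical predual, i.e. the completion of $\ell^1(G)$ in the norm $\|f\|_Q = \sup\{|\sum_{g} f(g)\varphi(g)| : \varphi \in M_0A(G), \|\varphi\| \le 1\}$. The group $G$ has (AP)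 if the constant function $1$ belongs to the $\sigma(M_0A(G), Q(G))$-closure of $A(G)$ in $M_0A(G)$. *)

(* Defs.v *)
(* MathComp-Analysis, with the complex numbers R[i] of real_closed over a realType. *)
From HB Require Import structures.
From mathcomp Require Import all_boot all_order all_algebra.
From mathcomp Require Import all_classical all_reals all_analysis.
From mathcomp Require Import sesquilinear ring lra.
From mathcomp.real_closed Require Import complex.
Set Implicit Arguments. Unset Strict Implicit. Unset Printing Implicit Defensive.
Import Order.TTheory GRing.Theory Num.Theory.
Import numFieldNormedType.Exports.
Local Open Scope classical_set_scope.
Local Open Scope ring_scope.
Local Notation Re := complex.Re.
Local Notation Im := complex.Im.

Section Sums.
Variables (R : realType) (X : choiceType).
Local Notation C := (R[i]).

Definition nsum (f : X -> R) : \bar R := \esum_(x in [set: X]) (f x)%:E.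

Definition rsum (f : X -> R) : R :=
  fine (nsum (fun x => Num.max (f x) 0)) -
  fine (nsum (fun x => Num.max (- f x) 0)).

(* Sum of an absolutely summable complex family, through the positive and
   negative parts of its real and imaginary parts. *)
Definition csum (f : X -> C) : C :=
  Complex (rsum (fun x => Re (f x))) (rsum (fun x => Im (f x))).

Definition asummable (f : X -> R) := (nsum (fun x => `|f x|%R) < +oo)%E.

Lemma nsum_ge0 f : (forall x, 0 <= f x) -> (0 <= nsum f)%E.
Proof. by move=> f0; apply: esum_ge0 => x _; rewrite lee_fin. Qed.

Lemma le_nsum f g : (forall x, f x <= g x) -> (nsum f <= nsum g)%E.
Proof. by move=> fg; apply: le_esum => x _; rewrite lee_fin. Qed.

Lemma nsumD f g : (forall x, 0 <= f x) -> (forall x, 0 <= g x) ->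
  nsum (fun x => f x + g x) = (nsum f + nsum g)%E.
Proof. by move=> f0 g0; rewrite /nsum -esumD => // x _; rewrite lee_fin. Qed.

Lemma nsum_fin f : (forall x, 0 <= f x) -> (nsum f < +oo)%E ->
  nsum f \is a fin_num.
Proof. by move=> f0 foo; rewrite ge0_fin_numE// nsum_ge0. Qed.

Lemma nsum_finset_le f (A : set X) : (forall x, 0 <= f x) -> finite_set A ->
  ((\sum_(x \in A) f x)%R%:E <= nsum f)%E.
Proof.
move=> f0 fA; rewrite -fsumEFin//; apply: esum_ge; exists A => //.
Qed.

Lemma nsum_le f (c : \bar R) :
  (forall A, finite_set A -> ((\sum_(x \in A) f x)%R%:E <= c)%E) ->
  (nsum f <= c)%E.
Proof.
move=> h; apply: ge_ereal_sup => _ /= [A [fA _] <-].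
by rewrite fsumEFin//; exact: h.
Qed.

Lemma nsum_ge1 f x : (forall x, 0 <= f x) -> ((f x)%:E <= nsum f)%E.
Proof.
move=> f0; have := nsum_finset_le f0 (finite_set1 x).
by rewrite fsbig_set1.
Qed.

Lemma le_nsumZ a f : 0 <= a -> (forall x, 0 <= f x) ->
  (nsum (fun x => (a * f x)%R) <= a%:E * nsum f)%E.
Proof.
move=> a0 f0; apply: nsum_le => A fA.
rewrite -mulr_fsumr// EFinM lee_wpmul2l// ?lee_fin//.
exact: nsum_finset_le.
Qed.

Lemma nsumZ a f : 0 <= a -> (forall x, 0 <= f x) ->
  nsum (fun x => a * f x) = (a%:E * nsum f)%E.
Proof.
move=> a0 f0; apply/eqP; rewrite eq_le le_nsumZ//=.
case: (eqVneq a 0) => [->|an0].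
  by rewrite mul0e nsum_ge0// => x; rewrite mul0r.
have {}a0 : 0 < a by rewrite lt0r an0.
have : (nsum f <= a^-1%:E * nsum (fun x => (a * f x)%R))%E.
  have := @le_nsumZ a^-1 (fun x => a * f x).
  have -> : (fun x => a^-1 * (a * f x)) = f.
    by apply/funext => x; rewrite mulrA mulVf ?mul1r// gt_eqF.
  by apply => [|x]; rewrite ?invr_ge0 ?mulr_ge0// ltW.
move=> /(lee_wpmul2l (x := a%:E)) h.
have /le_trans := h (ltW a0); apply.
by rewrite muleA -EFinM mulfV ?mul1e// gt_eqF.
Qed.

Lemma rsum_diff p q : (forall x, 0 <= p x) -> (forall x, 0 <= q x) ->
  (nsum p < +oo)%E -> (nsum q < +oo)%E ->
  rsum (fun x => p x - q x) = fine (nsum p) - fine (nsum q).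
Proof.
move=> p0 q0 ps qs; rewrite /rsum.
set u := fun x => Num.max (p x - q x) 0.
set v := fun x => Num.max (- (p x - q x)) 0.
have u0 x : 0 <= u x by rewrite /u le_max lexx orbT.
have v0 x : 0 <= v x by rewrite /v le_max lexx orbT.
have us : (nsum u < +oo)%E.
  by apply: le_lt_trans ps; apply: le_nsum => x; rewrite /u ge_max gerBl// q0 p0.
have vs : (nsum v < +oo)%E.
  apply: le_lt_trans qs; apply: le_nsum => x; rewrite /v opprB.
  by rewrite ge_max gerBl// q0 p0.
have : (nsum u + nsum q = nsum p + nsum v)%E.
  rewrite -!nsumD//; congr nsum; apply/funext => x; rewrite /u /v opprB.
  case: (leP (p x) (q x)) => pq.
    by rewrite (max_idPr _) ?subr_le0// add0r (max_idPl _) ?subr_ge0// addrC subrK.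
  by rewrite (max_idPl _) ?subr_ge0 1?ltW// (max_idPr _) ?subr_le0 1?ltW// subrK addr0.
move=> /(congr1 fine); rewrite !fineD ?nsum_fin// => e.
by apply/eqP; rewrite subr_eq addrAC eq_sym subr_eq -e addrC.
Qed.

Lemma asummable_pos f : asummable f -> (nsum (fun x => Num.max (f x) 0%R) < +oo)%E.
Proof.
apply: le_lt_trans; apply: le_nsum => x.
by rewrite ge_max ler_norm normr_ge0.
Qed.

Lemma asummable_neg f : asummable f -> (nsum (fun x => Num.max (- f x)%R 0%R) < +oo)%E.
Proof.
apply: le_lt_trans; apply: le_nsum => x.
by rewrite ge_max -normrN ler_norm normr_ge0.
Qed.

Lemma pos_negE (a : R) : a = Num.max a 0 - Num.max (- a) 0.
Proof.
case: (leP a 0) => a0.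
  by rewrite (max_idPl _) ?oppr_ge0// sub0r opprK.
by rewrite (max_idPr _) ?subr0// oppr_le0 ltW.
Qed.

Let mx0 (a : R) : 0 <= Num.max a 0. Proof. by rewrite le_max lexx orbT. Qed.

Lemma rsumD f g : asummable f -> asummable g ->
  rsum (fun x => f x + g x) = rsum f + rsum g.
Proof.
move=> fs gs.
have -> : (fun x => f x + g x) = (fun x =>
   (Num.max (f x) 0 + Num.max (g x) 0) - (Num.max (- f x) 0 + Num.max (- g x) 0)).
  by apply/funext => x; rewrite opprD addrACA -!pos_negE.
rewrite rsum_diff ?nsumD//.
- rewrite !fineD; try by apply: nsum_fin => //; exact: asummable_pos.
  2,3: by apply: nsum_fin => //; exact: asummable_neg.
  by rewrite /rsum opprD addrACA.
- by move=> x; rewrite addr_ge0.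
- by move=> x; rewrite addr_ge0.
- by rewrite lte_add_pinfty// asummable_pos.
- by rewrite lte_add_pinfty// asummable_neg.
Qed.

Lemma rsumN f : rsum (fun x => - f x) = - rsum f.
Proof. by rewrite /rsum opprB; congr (_ - fine (nsum _)); apply/funext => x; rewrite opprK. Qed.

Lemma rsumZ a f : asummable f -> rsum (fun x => a * f x) = a * rsum f.
Proof.
have pos b (g : X -> R) : 0 <= b -> asummable g ->
    rsum (fun x => b * g x) = b * rsum g.
  move=> b0 gs; have -> : (fun x => b * g x) =
      (fun x => b * Num.max (g x) 0 - b * Num.max (- g x) 0).
    by apply/funext => x; rewrite -mulrBr -pos_negE.
  have h1 : nsum (fun x => Num.max (g x) 0) \is a fin_num.
    by rewrite nsum_fin// asummable_pos.
  have h2 : nsum (fun x => Num.max (- g x) 0) \is a fin_num.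
    by rewrite nsum_fin// asummable_neg.
  rewrite rsum_diff ?nsumZ//.
  - by rewrite !fineM// /rsum mulrBr.
  - by move=> x; rewrite mulr_ge0.
  - by move=> x; rewrite mulr_ge0.
  - by rewrite -(fineK h1) -EFinM ltry.
  - by rewrite -(fineK h2) -EFinM ltry.
case: (leP 0 a) => [|a0] fs; first exact: pos.
have -> : (fun x => a * f x) = (fun x => - ((- a) * f x)).
  by apply/funext => x; rewrite mulNr opprK.
by rewrite rsumN pos ?oppr_ge0 ?ltW// mulNr opprK.
Qed.

Lemma rsum_ge0E f : (forall x, 0 <= f x) -> rsum f = fine (nsum f).
Proof.
move=> f0; rewrite /rsum [X in _ - fine X](_ : _ = 0%E); last first.
  by apply: esum1 => x _; rewrite (max_idPr _)// oppr_le0.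
rewrite subr0; congr (fine (nsum _)); apply/funext => x.
exact/max_idPl.
Qed.

Definition csummable (f : X -> C) :=
  asummable (fun x => Re (f x)) /\ asummable (fun x => Im (f x)).

Lemma csumD f g : csummable f -> csummable g ->
  csum (fun x => f x + g x) = csum f + csum g.
Proof.
move=> [f1 f2] [g1 g2]; rewrite /csum.
by apply/eqP; rewrite eq_complex /=; apply/andP; split; apply/eqP; rewrite -rsumD//;
  congr rsum; apply/funext => x; case: (f x); case: (g x).
Qed.
Lemma asummableZ a f : asummable f -> asummable (fun x => a * f x).
Proof.
move=> fs; rewrite /asummable.
have -> : (fun x => `|a * f x|) = (fun x => `|a| * `|f x|).
  by apply/funext => x; rewrite normrM.
by rewrite nsumZ// -(fineK (nsum_fin _ fs))// -EFinM ltry.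
Qed.

Lemma csumZ a f : csummable f -> csum (fun x => a * f x) = a * csum f.
Proof.
case: a => a b [f1 f2]; rewrite /csum.
have f2N : asummable (fun x => - (b * Im (f x))).
  rewrite /asummable; under eq_fun do rewrite normrN; exact: (asummableZ b f2).
have eR : rsum (fun x => a * Re (f x) - b * Im (f x)) =
    a * rsum (fun x => Re (f x)) - b * rsum (fun x => Im (f x)).
  by rewrite (rsumD (asummableZ a f1) f2N) rsumN (rsumZ a f1) (rsumZ b f2).
have eI : rsum (fun x => a * Im (f x) + b * Re (f x)) =
    a * rsum (fun x => Im (f x)) + b * rsum (fun x => Re (f x)).
  by rewrite (rsumD (asummableZ a f2) (asummableZ b f1)) (rsumZ a f2) (rsumZ b f1).
apply/eqP; rewrite eq_complex; apply/andP; split; apply/eqP.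
  by rewrite /= -eR; congr rsum; apply/funext => x; case: (f x).
by rewrite /= -eI; congr rsum; apply/funext => x; case: (f x).
Qed.

Lemma csumC f : csum (fun x => (f x)^*%C) = (csum f)^*%C.
Proof.
rewrite /csum /=; congr Complex.
  by congr rsum; apply/funext => x; case: (f x).
by rewrite -rsumN; congr rsum; apply/funext => x; case: (f x).
Qed.

End Sums.

Section SquareNorm.
Variable R : realType.
Local Notation C := (R[i]).

(* Norms over R[i] take values in R[i]; Re brings them back to R. *)
Definition sqn (z : C) : R := Re (`|z| ^+ 2).

Lemma sqnE (z : C) : sqn z = Re z ^+ 2 + Im z ^+ 2.
Proof. by rewrite /sqn -add_Re2_Im2. Qed.

Lemma sqn_ge0 z : 0 <= sqn z.
Proof. by rewrite sqnE addr_ge0 ?sqr_ge0. Qed.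

Lemma sqnC (z : C) : (sqn z)%:C%C = `|z| ^+ 2.
Proof. by rewrite sqnE add_Re2_Im2. Qed.

Lemma sqnM (a z : C) : sqn (a * z) = sqn a * sqn z.
Proof. by case: a z => [a b] [c d]; rewrite !sqnE /=; ring. Qed.

Lemma sqnD_le (z w : C) : sqn (z + w) <= 2 * sqn z + 2 * sqn w.
Proof.
case: z w => [a b] [c d]; rewrite !sqnE /= -subr_ge0.
have -> : 2 * (a ^+ 2 + b ^+ 2) + 2 * (c ^+ 2 + d ^+ 2) -
  ((a + c) ^+ 2 + (b + d) ^+ 2) = (a - c) ^+ 2 + (b - d) ^+ 2 by ring.
by rewrite addr_ge0 ?sqr_ge0.
Qed.

Lemma Re_mulC_le (z w : C) : `|Re (z * w^*%C)| <= sqn z + sqn w.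
Proof.
case: z w => [a b] [c d]; rewrite !sqnE /= ler_norml.
have := (sqr_ge0 (a - c), sqr_ge0 (a + c), sqr_ge0 (b - d), sqr_ge0 (b + d)).
have := (sqr_ge0 a, sqr_ge0 b, sqr_ge0 c, sqr_ge0 d).
by move=> [[[? ?] ?] ?] [[[? ?] ?] ?]; apply/andP; split; nra.
Qed.

Lemma Im_mulC_le (z w : C) : `|Im (z * w^*%C)| <= sqn z + sqn w.
Proof.
case: z w => [a b] [c d]; rewrite !sqnE /= ler_norml.
have := (sqr_ge0 (a - d), sqr_ge0 (a + d), sqr_ge0 (b - c), sqr_ge0 (b + c)).
have := (sqr_ge0 a, sqr_ge0 b, sqr_ge0 c, sqr_ge0 d).
by move=> [[[? ?] ?] ?] [[[? ?] ?] ?]; apply/andP; split; nra.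
Qed.
End SquareNorm.

Section L2.
Variables (R : realType) (X : choiceType).
Local Notation C := (R[i]).

Definition l2_pred : {pred X -> C} :=
  [pred f : X -> C | (nsum (fun x => sqn (f x)) < +oo)%E].

Lemma l2_submod : submod_closed l2_pred.
Proof.
split; rewrite ?inE /=.
  rewrite /nsum esum1 ?ltry// => x _; rewrite sqnE /=.
  by rewrite expr0n addr0.
move=> a f g; rewrite !inE /= => fs gs.
apply: (@le_lt_trans _ _ (nsum (fun x => (2 * sqn a) * sqn (f x) + 2 * sqn (g x))%R)).
  apply: le_nsum => x; apply: le_trans (sqnD_le _ _) _.
  by rewrite lerD2r// -[leRHS]mulrA -sqnM.
rewrite nsumD; try by move=> x; rewrite !mulr_ge0 ?sqn_ge0.
rewrite !nsumZ ?mulr_ge0 ?sqn_ge0//; try by move=> x; rewrite sqn_ge0.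
by rewrite lte_add_pinfty// lte_mul_pinfty// ?lee_fin ?mulr_ge0 ?sqn_ge0.
Qed.

HB.instance Definition _ := GRing.isSubmodClosed.Build C (X -> C) l2_pred l2_submod.

Record l2 := L2 { l2_val :> X -> C; l2_valP : l2_val \in l2_pred }.
HB.instance Definition _ := [isSub for l2_val].
HB.instance Definition _ := [Choice of l2 by <:].
HB.instance Definition _ := [SubChoice_isSubLmodule of l2 by <:].

Lemma l2_fin (f : l2) : (nsum (fun x => sqn (f x)) < +oo)%E.
Proof. exact: (l2_valP f). Qed.

Definition l2_inner (f g : l2) : C := csum (fun x => f x * (g x)^*%C).

Lemma l2_csummable (f g : l2) : csummable (fun x => f x * (g x)^*%C).
Proof.
have h : (nsum (fun x => sqn (f x) + sqn (g x))%R < +oo)%E.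
  by rewrite nsumD ?lte_add_pinfty ?l2_fin// => x; rewrite sqn_ge0.
split; apply: le_lt_trans h; apply: le_nsum => x;
  [exact: Re_mulC_le|exact: Im_mulC_le].
Qed.

Lemma l2_innerC (f g : l2) : l2_inner f g = (l2_inner g f)^*%C.
Proof.
rewrite /l2_inner -csumC; congr csum; apply/funext => x.
by rewrite rmorphM /= conjcK mulrC.
Qed.

Lemma l2_innerDl (f g h : l2) : l2_inner (f + g) h = l2_inner f h + l2_inner g h.
Proof.
rewrite /l2_inner -csumD; try exact: l2_csummable.
by congr csum; apply/funext => x; rewrite -mulrDl.
Qed.

Lemma l2_innerZl a (f h : l2) : l2_inner (a *: f) h = a * l2_inner f h.
Proof.
rewrite /l2_inner -csumZ; last exact: l2_csummable.
by congr csum; apply/funext => x; rewrite mulrA.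
Qed.

Lemma l2_innerNl (f h : l2) : l2_inner (- f) h = - l2_inner f h.
Proof. by rewrite -scaleN1r l2_innerZl mulN1r. Qed.

Definition l2_sq (f : l2) : R := fine (nsum (fun x => sqn (f x))).

Lemma l2_innerE (f : l2) : l2_inner f f = (l2_sq f)%:C%C.
Proof.
rewrite /l2_inner /csum /l2_sq -rsum_ge0E => [|x]; last exact: sqn_ge0.
apply/eqP; rewrite eq_complex; apply/andP; split; apply/eqP => /=.
  by congr rsum; apply/funext => x; rewrite sqnE; case: (f x) => a b /=; ring.
rewrite rsum_ge0E => [|x].
  by rewrite /nsum esum1// => x _; case: (f x) => a b /=; congr (_%:E); ring.
by case: (f x) => a b /=; rewrite mulrN mulrC addNr.
Qed.

End L2.

Section L2Normed.
Variables (R : realType) (X : choiceType).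
Local Notation C := (R[i]).
Local Notation l2 := (l2 R X).
Implicit Types f g h : l2.

Lemma l2_innerDr f g h : l2_inner f (g + h) = l2_inner f g + l2_inner f h.
Proof. by rewrite l2_innerC l2_innerDl rmorphD /= (l2_innerC f g) (l2_innerC f h). Qed.

Lemma l2_innerZr a f g : l2_inner f (a *: g) = a^*%C * l2_inner f g.
Proof. by rewrite l2_innerC l2_innerZl rmorphM /= (l2_innerC f g). Qed.

Lemma l2_sqE f : l2_sq f = Re (l2_inner f f).
Proof. by rewrite l2_innerE. Qed.

Lemma l2_sq_ge0 f : 0 <= l2_sq f.
Proof. by rewrite fine_ge0// nsum_ge0// => x; rewrite sqn_ge0. Qed.

Lemma l2_sq_coord f x : sqn (f x) <= l2_sq f.
Proof.
have f0 y : 0 <= sqn (f y) by exact: sqn_ge0.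
by rewrite -lee_fin fineK ?nsum_fin ?l2_fin// (nsum_ge1 x f0).
Qed.

Lemma l2_sq_eq0 f : l2_sq f = 0 -> f = 0.
Proof.
move=> f0; apply/val_inj/funext => x /=.
have := l2_sq_coord f x; rewrite f0 sqnE => h.
have /eqP : Re (f x) ^+ 2 + Im (f x) ^+ 2 == 0.
  by rewrite eq_le h addr_ge0 ?sqr_ge0.
move=> /eqP; rewrite paddr_eq0 ?sqr_ge0// !sqrf_eq0 => /andP[/eqP a /eqP b].
by apply/eqP; rewrite eq_complex a b !eqxx.
Qed.

Lemma l2_sqD f g : l2_sq (f + g) = l2_sq f + l2_sq g + 2 * Re (l2_inner f g).
Proof.
rewrite !l2_sqE l2_innerDl !l2_innerDr (l2_innerC g f).
case: (l2_inner f f) (l2_inner f g) (l2_inner g g) => [a b] [c d] [u v] /=.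
ring.
Qed.

Lemma l2_sqZ a f : l2_sq (a *: f) = sqn a * l2_sq f.
Proof.
rewrite !l2_sqE l2_innerZl l2_innerZr l2_innerE sqnE.
by case: a => a b /=; ring.
Qed.

Lemma l2_inner0l g : l2_inner 0 g = 0.
Proof. by rewrite -(scale0r g) l2_innerZl mul0r. Qed.

Lemma l2_inner0r g : l2_inner g 0 = 0.
Proof. by rewrite -(scale0r g) l2_innerZr rmorph0 mul0r. Qed.

Lemma l2_CS f g : Re (l2_inner f g) <= Num.sqrt (l2_sq f) * Num.sqrt (l2_sq g).
Proof.
set A := Num.sqrt (l2_sq f); set B := Num.sqrt (l2_sq g).
have A0 : 0 <= A by rewrite sqrtr_ge0.
have B0 : 0 <= B by rewrite sqrtr_ge0.
have A2 : A ^+ 2 = l2_sq f by rewrite sqr_sqrtr// l2_sq_ge0.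
have B2 : B ^+ 2 = l2_sq g by rewrite sqr_sqrtr// l2_sq_ge0.
have [Az|An] := eqVneq A 0.
  have f0 : f = 0 by apply: l2_sq_eq0; rewrite -A2 Az expr0n.
  by rewrite Az mul0r f0 l2_inner0l.
have [Bz|Bn] := eqVneq B 0.
  have g0 : g = 0 by apply: l2_sq_eq0; rewrite -B2 Bz expr0n.
  by rewrite Bz mulr0 g0 l2_inner0r.
have Ap : 0 < A by rewrite lt0r An.
have Bp : 0 < B by rewrite lt0r Bn.
have := l2_sq_ge0 (B%:C%C *: f + (- A%:C%C) *: g).
rewrite l2_sqD !l2_sqZ !sqnE l2_innerZl l2_innerZr -A2 -B2.
case: (l2_inner f g) => [u v] /= h.
have {}h : 0 <= 2 * (A * B) * (A * B - u).
  by apply: (le_trans h); rewrite le_eqVlt; apply/orP; left; apply/eqP; ring.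
move: h.
by rewrite pmulr_rge0 ?subr_ge0// !mulr_gt0.
Qed.

Definition l2_norm f : C := (Num.sqrt (l2_sq f))%:C%C.

Lemma ler_l2_normD f g : l2_norm (f + g) <= l2_norm f + l2_norm g.
Proof.
rewrite /l2_norm -rmorphD /= lecR.
rewrite -(@ler_pXn2r _ 2) ?nnegrE ?addr_ge0 ?sqrtr_ge0//.
rewrite sqr_sqrtr ?l2_sq_ge0// sqrrD !sqr_sqrtr ?l2_sq_ge0// l2_sqD.
rewrite [leRHS]addrAC lerD2l -[leRHS]mulr_natl ler_pM2l ?ltr0n//.
exact: l2_CS.
Qed.

Lemma l2_normZ a f : l2_norm (a *: f) = `|a| * l2_norm f.
Proof.
rewrite /l2_norm l2_sqZ sqrtrM ?sqn_ge0// rmorphM /=; congr (_ * _).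
by rewrite sqnE normc_def.
Qed.

Lemma l2_norm_eq0 f : l2_norm f = 0 -> f = 0.
Proof.
move=> /(congr1 (@complex.Re R)) /= /eqP; rewrite sqrtr_eq0 => h.
by apply: l2_sq_eq0; apply/eqP; rewrite eq_le h l2_sq_ge0.
Qed.

HB.instance Definition _ :=
  Lmodule_isNormed.Build C l2 ler_l2_normD l2_normZ l2_norm_eq0.

Lemma l2_normE f : `|f| = l2_norm f. Proof. by []. Qed.

Lemma l2_complete (F : set_system l2) : ProperFilter F -> cauchy F -> cvg F.
Proof.
move=> FF /cauchy_ballP Fc.
have {}Fc (e : R) : 0 < e -> exists2 A, F A &
    forall f g, A f -> A g -> l2_sq (f - g) <= e ^+ 2.
  move=> e0; have e0' : 0 < e%:C%C :> C by rewrite ltcR.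
  have [[P Q] [/= FP FQ] PQ] := Fc _ e0'.
  exists (P `&` Q); first exact: filterI.
  move=> f g [Pf _] [_ Qg]; have := PQ (f, g) (conj Pf Qg).
  rewrite -ball_normE /= l2_normE ltcR => /ltW.
  by rewrite -(@ler_pXn2r _ 2) ?nnegrE ?sqrtr_ge0 ?(ltW e0)// sqr_sqrtr ?l2_sq_ge0.
have coord (p : C -> R) x : (forall z w, p (z - w) = p z - p w) ->
    (forall z, (p z) ^+ 2 <= sqn z) -> cvg ((fun f : l2 => p (f x)) @ F).
  move=> pB pn; apply: R_complete; apply/cauchy_ballP => e e0.
  have [A FA hA] := Fc (e / 2) (divr_gt0 e0 (ltr0Sn _ 1)).
  exists ([set p (f x) | f in A], [set p (f x) | f in A]) => /=.
    have FpA : F ((fun f : l2 => p (f x)) @^-1` [set p (f x) | f in A]).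
      by apply: filterS FA => f Af; exists f.
    by split; exact: FpA.
  move=> [_ _] /= [[f Af <-] [g Ag <-]]; rewrite /ball /= -pB.
  apply: (@le_lt_trans _ _ (e / 2)); last by rewrite ltr_pdivrMr// ltr_pMr// ltr1n.
  rewrite -(@ler_pXn2r _ 2) ?nnegrE// ?divr_ge0 ?(ltW e0)//.
  rewrite real_normK ?num_real//; apply: le_trans (pn _) _.
  by apply: le_trans (hA f g Af Ag); exact: (l2_sq_coord (f - g)).
have cRe x : cvg ((fun f : l2 => Re (f x)) @ F).
  by apply: coord => [[a b] [c d]|z]//; rewrite sqnE lerDl sqr_ge0.
have cIm x : cvg ((fun f : l2 => Im (f x)) @ F).
  by apply: coord => [[a b] [c d]|z]//; rewrite sqnE lerDr sqr_ge0.
pose phi x : C := Complex (lim ((fun f : l2 => Re (f x)) @ F))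
                          (lim ((fun f : l2 => Im (f x)) @ F)).
have cphi f x : (fun g : l2 => sqn (f x - g x)) @ F --> sqn (f x - phi x).
  have -> : (fun g : l2 => sqn (f x - g x)) =
     (fun g : l2 => (Re (f x) - Re (g x)) * (Re (f x) - Re (g x)) +
                    (Im (f x) - Im (g x)) * (Im (f x) - Im (g x))).
    by apply/funext => g; rewrite sqnE !expr2; case: (f x) (g x) => [a b] [c d].
  have -> : sqn (f x - phi x) =
    (Re (f x) - Re (phi x)) * (Re (f x) - Re (phi x)) +
    (Im (f x) - Im (phi x)) * (Im (f x) - Im (phi x)).
    by rewrite sqnE !expr2; case: (f x) => [a b].
  have cR : (fun g : l2 => Re (f x) - Re (g x)) @ F --> Re (f x) - Re (phi x).
    by apply: cvgB (cRe x); exact: cvg_cst.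
  have cI : (fun g : l2 => Im (f x) - Im (g x)) @ F --> Im (f x) - Im (phi x).
    by apply: cvgB (cIm x); exact: cvg_cst.
  exact: (cvgD (cvgM cR cR) (cvgM cI cI)).
have key (e : R) : 0 < e -> exists2 A, F A &
    forall f, A f -> (nsum (fun x => sqn (f x - phi x)%R) <= (e ^+ 2)%:E)%E.
  move=> e0; have [A FA hA] := Fc e e0; exists A => // f Af.
  apply: nsum_le => S fS; rewrite lee_fin.
  have c : (fun g : l2 => \sum_(x \in S) sqn (f x - g x)) @ F -->
     \sum_(x \in S) sqn (f x - phi x).
    under eq_fun do rewrite fsbig_finite//=.
    by rewrite fsbig_finite//=; apply: cvg_big => [|x _]; [exact: add_continuous|exact: cphi].
  apply: (cvgr_to_le c).
  apply: filterS FA => g Ag.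
  apply: le_trans (hA f g Af Ag).
  rewrite -lee_fin fineK ?nsum_fin ?(l2_fin (f - g))//; last by move=> x; exact: sqn_ge0.
  by apply: (@nsum_finset_le _ _ (fun x => sqn ((f - g) x))) => // x; exact: sqn_ge0.
have [A0 FA0 hA0] := key 1 ltr01.
have [f0 Af0] := filter_ex FA0.
have d0 : (fun x => f0 x - phi x) \in @l2_pred R X.
  by rewrite inE /=; apply: le_lt_trans (hA0 _ Af0) _; rewrite ltry.
pose g0 : l2 := f0 - L2 d0.
have g0E x : g0 x = phi x.
  by change (f0 x - (f0 x - phi x) = phi x); rewrite opprB addrC subrK.
apply/cvg_ex; exists g0; apply/cvg_ballP => e e0.
have eR : e = (Re e)%:C%C.
  by rewrite RRe_real// ger0_real// ltW.
have e'0 : 0 < Re e by rewrite -ltcR -eR.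
have [A FA hA] := key (Re e / 2) (divr_gt0 e'0 (ltr0Sn _ 1)).
apply: filterS FA => f Af; apply: ball_sym.
rewrite -ball_normE /= l2_normE eR ltcR.
apply: (@le_lt_trans _ _ (Re e / 2)); last by rewrite ltr_pdivrMr// ltr_pMr// ltr1n.
rewrite -(@ler_pXn2r _ 2) ?nnegrE ?sqrtr_ge0 ?divr_ge0 ?(ltW e'0)//.
rewrite sqr_sqrtr ?l2_sq_ge0// -lee_fin fineK ?nsum_fin ?(l2_fin (f - g0))//; last first.
  by move=> x; exact: sqn_ge0.
apply: le_trans (hA f Af); apply: le_nsum => x.
by rewrite -g0E.
Qed.

HB.instance Definition _ := Uniform_isComplete.Build l2 l2_complete.

End L2Normed.

Section L2Hilbert.
Variables (R : realType) (X : choiceType).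
Local Notation C := (R[i]).
Local Notation l2 := (l2 R X).

Lemma l2_bilinear :
  bilinear_for *%R (@Num.conj C \; *%R) (@l2_inner R X).
Proof.
split=> [h a f g|f a g h] /=.
  by rewrite l2_innerDl l2_innerZl.
by rewrite l2_innerDr l2_innerZr.
Qed.
HB.instance Definition _ := bilinear_isBilinear.Build C l2 l2 C
  *%R (@Num.conj C \; *%R) (@l2_inner R X) l2_bilinear.

Lemma l2_hermitian (f g : l2) :
  l2_inner f g = (-1) ^+ false * Num.conj (l2_inner g f).
Proof. by rewrite expr0 mul1r l2_innerC. Qed.
HB.instance Definition _ := isHermitianSesquilinear.Build C l2 false Num.conj
  (@l2_inner R X) l2_hermitian.

Lemma l2_norm_inner (f : l2) : l2_inner f f = `|f| ^+ 2.
Proof.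
by rewrite l2_innerE l2_normE /l2_norm -rmorphXn /= sqr_sqrtr ?l2_sq_ge0.
Qed.

Lemma l2_posdef (f : l2) : f != 0 -> 0 < l2_inner f f.
Proof. by move=> f0; rewrite l2_norm_inner exprn_gt0 ?normr_gt0. Qed.
HB.instance Definition _ := isDotProduct.Build C l2 (@l2_inner R X) l2_posdef.
End L2Hilbert.

(* Inner products are linear in the first argument. *)
Record hilbertType (R : realType) := Hilbert {
  hilbert_sort :> completeNormedModType R[i];
  inner : {dot hilbert_sort for Num.conj};
  inner_norm : forall x, inner x x = `|x| ^+ 2 }.

Definition l2_hilbert (R : realType) (X : choiceType) : hilbertType R :=
  @Hilbert R (l2 R X) (@l2_inner R X) (@l2_norm_inner R X).

From mathcomp Require Import generic_quotient.

Module Export Groups.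
Local Open Scope quotient_scope.

(* The group generated by X subject to the relations rel, the inverse of the
   generator x being the generator (inv x): words in X modulo a congruence. *)
Section Presentation.
Variables (X : choiceType) (inv : X -> X) (rel : seq X -> seq X -> Prop).

Inductive pres_cong : seq X -> seq X -> Prop :=
| pres_rel u v : rel u v -> pres_cong u v
| pres_invr x : pres_cong [:: x; inv x] [::]
| pres_invl x : pres_cong [:: inv x; x] [::]
| pres_refl u : pres_cong u u
| pres_sym u v : pres_cong u v -> pres_cong v u
| pres_trans u v w : pres_cong u v -> pres_cong v w -> pres_cong u w
| pres_cat u u' v v' : pres_cong u u' -> pres_cong v v' ->
    pres_cong (u ++ v) (u' ++ v').

Definition pres_eqv (u v : seq X) := `[< pres_cong u v >].

Lemma pres_equiv : equiv_class_of pres_eqv.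
Proof.
split=> [u|u v|v u w].
- exact/asboolP/pres_refl.
- by apply/asboolP/asboolP => /pres_sym.
- by move=> /asboolP uv /asboolP vw; apply/asboolP/(pres_trans uv).
Qed.

Canonical pres_equiv_rel := EquivRelPack pres_equiv.

Definition presented := {eq_quot pres_equiv_rel}.
HB.instance Definition _ := Choice.on presented.
HB.instance Definition _ := EqQuotient.on presented.

Definition winv (w : seq X) := rev (map inv w).

Lemma pres_winvr w : pres_cong (w ++ winv w) [::].
Proof.
elim: w => [|x w IH]; first exact: pres_refl.
rewrite /winv /= rev_cons -cats1 -/(winv w) catA -cat1s.
apply: pres_trans (pres_invr x).
have h := pres_cat (pres_refl [:: x]) (pres_cat IH (pres_refl [:: inv x])).
exact: h.
Qed.

Lemma pres_winvl w : pres_cong (winv w ++ w) [::].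
Proof.
elim: w => [|x w IH]; first exact: pres_refl.
rewrite /winv /= rev_cons -cats1 -/(winv w) -(cat1s x) -catA.
apply: pres_trans IH; apply: pres_cat; first exact: pres_refl.
by rewrite catA; apply: (pres_cat (u' := [::]) (pres_invl x)); exact: pres_refl.
Qed.

Definition pres_class (w : seq X) : presented := \pi_presented w.

Lemma pres_classP u v : pres_class u = pres_class v <-> pres_cong u v.
Proof.
split=> [/eqmodP /asboolP //|uv].
by apply/eqmodP/asboolP.
Qed.

Lemma pres_reprK (a : presented) : pres_class (repr a) = a.
Proof. exact: reprK. Qed.

Lemma pres_repr_class u : pres_cong (repr (pres_class u)) u.
Proof. by apply/pres_classP; exact: pres_reprK. Qed.

Definition pres_one : presented := pres_class [::].
Definition pres_mul (a b : presented) : presented :=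
  pres_class (repr a ++ repr b).
Definition pres_inv (a : presented) : presented := pres_class (winv (repr a)).

Lemma pres_mulE u v :
  pres_mul (pres_class u) (pres_class v) = pres_class (u ++ v).
Proof. by apply/pres_classP; apply: pres_cat; exact: pres_repr_class. Qed.

Lemma pres_ind (P : presented -> Prop) :
  (forall w, P (pres_class w)) -> forall a, P a.
Proof. by move=> h a; rewrite -(pres_reprK a). Qed.

Lemma pres_mulA : associative pres_mul.
Proof.
by do 3!elim/pres_ind=> ?; rewrite !pres_mulE catA.
Qed.
Lemma pres_mul1 : left_id pres_one pres_mul.
Proof. by elim/pres_ind=> u; rewrite pres_mulE. Qed.
Lemma pres_1mul : right_id pres_one pres_mul.
Proof. by elim/pres_ind=> u; rewrite pres_mulE cats0. Qed.
Lemma pres_mulV : left_inverse pres_one pres_inv pres_mul.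
Proof.
move=> a; rewrite -[X in pres_mul _ X]pres_reprK /pres_inv pres_mulE.
exact/pres_classP/pres_winvl.
Qed.
Lemma pres_Vmul : right_inverse pres_one pres_inv pres_mul.
Proof.
move=> a; rewrite -[X in pres_mul X _]pres_reprK /pres_inv pres_mulE.
exact/pres_classP/pres_winvr.
Qed.

HB.instance Definition _ := isGroup.Build presented
  pres_mulA pres_mul1 pres_1mul pres_mulV pres_Vmul.

End Presentation.

Section Universal.
Variables (X : choiceType) (inv : X -> X) (rel : seq X -> seq X -> Prop).
Variables (K : groupType) (f : X -> K).
Local Open Scope group_scope.

Definition word_prod (w : seq X) : K := foldr (fun x k => f x * k) 1 w.

Lemma word_prod_cat u v : word_prod (u ++ v) = word_prod u * word_prod v.
Proof. by elim: u => [|x u IH] /=; rewrite ?mul1g// IH mulgA. Qed.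

Lemma presented_universal :
  (forall x, f (inv x) = (f x)^-1) ->
  (forall u v, rel u v -> word_prod u = word_prod v) ->
  exists! phi : presented inv rel -> K,
    {morph phi : a b / a * b} /\ forall x, phi (pres_class inv rel [:: x]) = f x.
Proof.
move=> fV fR.
have fE u v : pres_cong inv rel u v -> word_prod u = word_prod v.
  elim=> {u v} [u v /fR|x|x|u|u v _ ->|u v w _ -> _ ->|u u' v v' _ uE _ vE]//=.
  - by rewrite fV mulg1 mulgV.
  - by rewrite fV mulg1 mulVg.
  - by rewrite !word_prod_cat uE vE.
have phiE w : word_prod (repr (pres_class inv rel w)) = word_prod w.
  by apply: fE; exact: pres_repr_class.
exists (fun a => word_prod (repr a)); split; first split.
- by move=> a b; rewrite -word_prod_cat -(phiE (repr a ++ repr b)).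
- by move=> x; rewrite phiE /= mulg1.
move=> psi [psiM psiX]; apply/funext; elim/pres_ind => w; rewrite phiE.
elim: w => [|x w IH] /=.
  by apply: (mulgI (psi 1)); rewrite -psiM !mulg1.
have -> : pres_class inv rel (x :: w) =
    pres_class inv rel [:: x] * pres_class inv rel w by rewrite [RHS]pres_mulE.
by rewrite psiM psiX IH.
Qed.

End Universal.

(* The letter (i, b) is the i-th free generator or its inverse, according to b. *)
Section FreeGroup.
Variable r : nat.
Definition free_group : Type :=
  presented (fun x : 'I_r * bool => (x.1, ~~ x.2)) (fun _ _ => False).
HB.instance Definition _ := Group.on free_group.
End FreeGroup.

Section FreeProduct.
Variables (G H : groupType).
Local Open Scope group_scope.

Definition freeprod_inv (x : G + H) : G + H :=
  match x with inl g => inl g^-1 | inr h => inr h^-1 end.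

Inductive freeprod_rel : seq (G + H) -> seq (G + H) -> Prop :=
| freeprod_rel_l g g' : freeprod_rel [:: inl g; inl g'] [:: inl (g * g')]
| freeprod_rel_r h h' : freeprod_rel [:: inr h; inr h'] [:: inr (h * h')].

Definition freeprod : Type := presented freeprod_inv freeprod_rel.
HB.instance Definition _ := Group.on freeprod.

Definition freeprod_inl (g : G) : freeprod :=
  pres_class freeprod_inv freeprod_rel [:: inl g].
Definition freeprod_inr (h : H) : freeprod :=
  pres_class freeprod_inv freeprod_rel [:: inr h].

Lemma freeprod_inlM : {morph freeprod_inl : g g' / g * g'}.
Proof.
move=> g g'; rewrite [RHS]pres_mulE; apply/esym/pres_classP.
exact/pres_rel/freeprod_rel_l.
Qed.

Lemma freeprod_inrM : {morph freeprod_inr : h h' / h * h'}.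
Proof.
move=> h h'; rewrite [RHS]pres_mulE; apply/esym/pres_classP.
exact/pres_rel/freeprod_rel_r.
Qed.

Lemma freeprod_universal (K : groupType) (f : G -> K) (f' : H -> K) :
  {morph f : g g' / g * g'} -> {morph f' : h h' / h * h'} ->
  exists! phi : freeprod -> K, {morph phi : a b / a * b} /\
    (forall g, phi (freeprod_inl g) = f g) /\
    (forall h, phi (freeprod_inr h) = f' h).
Proof.
have mV (L : groupType) (m : L -> K) : {morph m : x y / x * y} ->
    forall x, m x^-1 = (m x)^-1.
  move=> mM x; apply: (mulgI (m x)); rewrite mulgV -mM mulgV.
  by apply: (mulgI (m 1)); rewrite -mM !mulg1.
move=> fM f'M.
pose F (x : G + H) := match x with inl g => f g | inr h => f' h end.
have [||phi [[phiM phiX] phiU]] :=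
  @presented_universal _ freeprod_inv freeprod_rel K F.
- by case=> x /=; exact: mV.
- by move=> _ _ [g g'|h h'] /=; rewrite !mulg1 ?fM ?f'M.
exists phi; split; first by split=> //; split=> x; rewrite phiX.
move=> psi [psiM [psil psir]]; apply: phiU; split=> //.
by case=> x; [exact: psil|exact: psir].
Qed.

End FreeProduct.

End Groups.

Module Export Dynamics.

Record gaction (G : groupType) (X : Type) := GAction {
  gact :> G -> X -> X;
  gact1 : forall x, gact 1%g x = x;
  gactM : forall g h x, gact (g * h)%g x = gact g (gact h x) }.

Section GroupActions.
Variable G : groupType.
Local Open Scope group_scope.

Definition left_translation : gaction G G :=
  @GAction G G (fun g x => g * x) (@mul1g G) (fun g h x => esym (mulgA g h x)).

Lemma gactK (X : Type) (a : gaction G X) g : cancel (a g) (a g^-1).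
Proof. by move=> x; rewrite -gactM mulVg gact1. Qed.

Lemma gactKV (X : Type) (a : gaction G X) g : cancel (a g^-1) (a g).
Proof. by move=> x; rewrite -gactM mulgV gact1. Qed.

(* Elements of coset_space H are the subsets g H of G. *)
Definition left_coset (H : set G) (g : G) : set G := [set g * h | h in H].
Definition cosets (H : set G) : set (set G) := range (left_coset H).
Definition coset_space (H : set G) := set_type (cosets H).
HB.instance Definition _ H := Choice.on (coset_space H).

Lemma left_cosetM (H : set G) g x :
  left_coset (left_coset H x) g = left_coset H (g * x).
Proof.
apply/seteqP; split=> y [z].
  by move=> [h Hh <-] <-; exists h; rewrite // mulgA.
by move=> Hz <-; exists (x * z); rewrite ?mulgA//; exists z.
Qed.

Lemma coset_act_subproof (H : set G) g (A : coset_space H) :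
  left_coset (set_val A) g \in cosets H.
Proof.
case: A => A AH; rewrite set_valE /=; have [x _ <-] := set_mem AH.
by apply/mem_set; exists (g * x); rewrite // left_cosetM.
Qed.

Definition coset_act (H : set G) g (A : coset_space H) : coset_space H :=
  exist _ (left_coset (set_val A) g) (coset_act_subproof g A).

Lemma coset_act1 (H : set G) (A : coset_space H) : coset_act 1 A = A.
Proof.
apply/val_inj => /=; apply/seteqP; split=> y; first by case=> z Az <-; rewrite mul1g.
by move=> Ay; exists y; rewrite ?mul1g.
Qed.

Lemma coset_actM (H : set G) g h (A : coset_space H) :
  coset_act (g * h) A = coset_act g (coset_act h A).
Proof. by apply/val_inj => /=; rewrite left_cosetM. Qed.

Definition coset_action (H : set G) : gaction G (coset_space H) :=
  GAction (@coset_act1 H) (@coset_actM H).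

Definition subgroup (S : groupClosed G) : Type := {g : G | g \in S}.
HB.instance Definition _ S := SubChoice.on (subgroup S).

Lemma subgroup_closed (S : groupClosed G) :
  group_closed (fun g : G => g \in S).
Proof. by split; [exact: gpred1|exact: gpredF]. Qed.

HB.instance Definition _ S :=
  SubChoice_isSubGroup.Build G _ (subgroup S) (subgroup_closed S).

Definition restrict_action (S : groupClosed G) (X : Type) (a : gaction G X) :
    gaction (subgroup S) X :=
  @GAction (subgroup S) X (fun g => a (val g)) (gact1 a)
    (fun g h x => gactM a (val g) (val h) x).

End GroupActions.

(* The Stone-Cech compactification of the discrete space X: the ultrafilters on
   X, with base of open sets {U | A \in U} for A a subset of X; a point x of X is
   identified with the principal ultrafilter at x. *)
Record stone_cech (X : Type) := StoneCech {
  sc_ultra :> set_system X;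
  sc_ultraP : UltraFilter sc_ultra }.
HB.instance Definition _ (X : Type) := gen_eqMixin (stone_cech X).
HB.instance Definition _ (X : Type) := gen_choiceMixin (stone_cech X).

Section StoneCech.
Variable X : Type.
Implicit Types U V : stone_cech X.

Lemma sc_inj U V : sc_ultra U = sc_ultra V -> U = V.
Proof.
case: U V => [U Up] [V Vp] /= UV; case: _ / UV Vp => Vp.
by congr StoneCech; exact: Prop_irrelevance.
Qed.

Definition sc_basic (A : set X) : set (stone_cech X) := [set U | sc_ultra U A].

Lemma sc_basic_cover : \bigcup_(A in [set: set X]) sc_basic A = setT.
Proof.
by apply/seteqP; split=> // U _; exists setT => //; have := sc_ultraP U => ?; exact: filterT.
Qed.

Lemma sc_basic_join (A B : set X) U : [set: set X] A -> [set: set X] B ->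
  sc_basic A U -> sc_basic B U -> exists D,
    [/\ [set: set X] D, sc_basic D U & sc_basic D `<=` sc_basic A `&` sc_basic B].
Proof.
move=> _ _ UA UB; exists (A `&` B); split=> //.
  by have := sc_ultraP U => ?; exact: filterI.
by move=> V VAB; have := sc_ultraP V => ?; split; apply: filterS VAB => x [].
Qed.

HB.instance Definition _ := isBaseTopological.Build (stone_cech X)
  sc_basic_cover sc_basic_join.

Definition sc_point (x : X) : stone_cech X :=
  StoneCech (principal_filter_ultra x).

Definition sc_boundary := set_type (~` range sc_point).
HB.instance Definition _ := Topological.on sc_boundary.

End StoneCech.

Section StoneCechAction.
Variables (G : groupType) (X : Type) (a : gaction G X).

Lemma ultra_fmap (Y Z : Type) (f : Y -> Z) (U : set_system Y) :
  UltraFilter U -> UltraFilter (f @ U).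
Proof.
move=> UU; split=> [|F FF UF]; first exact: fmap_proper_filter.
apply/seteqP; split=> // A FA.
have [//|UnA] := in_ultra_setVsetC (f @^-1` A) UU.
have : F (~` A) by apply: UF.
by move=> /(filterI FA); rewrite setICr => /filter_ex[].
Qed.

Definition sc_act (g : G) (U : stone_cech X) : stone_cech X :=
  StoneCech (ultra_fmap (a g) (sc_ultraP U)).

Lemma sc_act1 U : sc_act 1%g U = U.
Proof.
apply: sc_inj; apply/funext => A /=; rewrite /fmap /=; congr (sc_ultra U _).
by apply/funext => x; rewrite /preimage /= gact1.
Qed.

Lemma sc_actM g h U : sc_act (g * h)%g U = sc_act g (sc_act h U).
Proof.
apply: sc_inj; apply/funext => A /=; rewrite /fmap /=; congr (sc_ultra U _).
by apply/funext => x; rewrite /preimage /= gactM.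
Qed.

Lemma sc_act_point g x : sc_act g (sc_point x) = sc_point (a g x).
Proof.
apply: sc_inj; apply/funext => A; apply/propext.
split; first by move/principal_filterP => h; apply/principal_filterP.
by move/principal_filterP => h; apply/principal_filterP.
Qed.

Lemma sc_act_continuous g : continuous (sc_act g).
Proof.
apply/continuousP => A [D' sD <-].
exists [set a g @^-1` B | B in D'] => //; apply/seteqP; split=> [U|U].
  by move=> [_ [B DB <-] UB]; exists B.
by move=> [B DB UB]; exists (a g @^-1` B) => //; exists B.
Qed.

Lemma sc_boundary_act_subproof g (U : sc_boundary X) :
  sc_act g (set_val U) \in ~` range (@sc_point X).
Proof.
apply/mem_set => -[x _ xU]; case: U xU => U UX; rewrite set_valE /= => xU.
apply: (set_mem UX); exists (a g^-1%g x) => //.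
by rewrite -sc_act_point xU -sc_actM mulVg sc_act1.
Qed.

Definition sc_boundary_act g (U : sc_boundary X) : sc_boundary X :=
  exist _ (sc_act g (set_val U)) (sc_boundary_act_subproof g U).

Lemma sc_boundary_act1 U : sc_boundary_act 1%g U = U.
Proof. by apply/val_inj; exact: sc_act1. Qed.

Lemma sc_boundary_actM g h U :
  sc_boundary_act (g * h)%g U = sc_boundary_act g (sc_boundary_act h U).
Proof. by apply/val_inj; exact: sc_actM. Qed.

Definition boundary_action : gaction G (sc_boundary X) :=
  GAction sc_boundary_act1 sc_boundary_actM.

End StoneCechAction.

Section Amenability.
Variable R : realType.

(* Existence of a left-invariant finitely additive probability on all subsets. *)
Definition amenable (G : groupType) : Prop :=
  exists m : set G -> R,
    [/\ m setT = 1, forall A, 0 <= m A,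
        forall A B, A `&` B = set0 -> m (A `|` B) = m A + m B
      & forall g A, m (left_coset A g) = m A].

Definition prob_measures (G : choiceType) : set (G -> R) :=
  [set mu | (forall g, 0 <= mu g) /\ nsum mu = 1%E].

Definition translate (G : groupType) (g : G) (mu : G -> R) : G -> R :=
  fun h => mu (g^-1 * h)%g.

Definition l1_norm (G : choiceType) (nu : G -> R) : R :=
  fine (nsum (fun g => `|nu g|)).

Record directed (I : Type) (le : I -> I -> Prop) : Prop := Directed {
  directed_inh : inhabited I;
  directed_refl : forall i, le i i;
  directed_trans : forall i j k, le i j -> le j k -> le i k;
  directed_ub : forall i j, exists k, le i k /\ le j k }.

Definition net_tails (I : Type) (le : I -> I -> Prop) : set_system I :=
  [set A | exists i0, forall i, le i0 i -> A i].

(* The codomain carries the topology of pointwise convergence. The real-valued sup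
   below is over a set bounded by 2, and is 0 if X is empty. *)
Definition topologically_amenable (G : groupType) (X : topologicalType)
    (a : gaction G X) : Prop :=
  exists (I : Type) (le : I -> I -> Prop) (mu : I -> X -> {ptws G -> R}),
    [/\ directed le,
        forall i, continuous (mu i),
        forall i x, prob_measures (mu i x)
      & forall g, (fun i => sup [set
            l1_norm (fun h => mu i (a g x) h - translate g (mu i x) h)
          | x in [set: X]]) @ net_tails le --> (0 : R)].

End Amenability.

End Dynamics.

Section Operators.
Variables (R : realType) (H : hilbertType R).
Implicit Types (S T : H -> H) (A I : set (H -> H)).

Definition bounded_ops : set (H -> H) :=
  [set T | linear T /\ exists M : R, forall x, `|T x| <= M%:C%C * `|x|].

Definition opnorm T : \bar R :=
  ereal_sup [set (Re `|T x|)%:E | x in [set x : H | `|x| <= 1]].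

Definition opnorm_cvg (u : nat -> H -> H) T : Prop :=
  opnorm (u n - T) @[n --> \oo] --> (0 : \bar R).

(* Operators mapping the unit ball to a relatively compact set. *)
Definition compact_ops : set (H -> H) :=
  [set T | bounded_ops T /\
           compact (closure (T @` [set x : H | `|x| <= 1]))].

(* Norm-closed two-sided ideals of the algebra A of bounded operators. *)
Definition closed_ideal A I : Prop :=
  [/\ I `<=` A,
      I 0 /\ (forall S T, I S -> I T -> I (S + T)),
      forall (c : R[i]) T, I T -> I (c *: T),
      forall S T, A S -> I T -> I (S \o T) /\ I (T \o S)
    & forall (u : nat -> H -> H) T,
        (forall n, I (u n)) -> A T -> opnorm_cvg u T -> I T].

Definition nontrivial_ideal A I : Prop :=
  [/\ closed_ideal A I, I <> [set 0] & I <> A].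

Definition simple_algebra A : Prop :=
  forall I, closed_ideal A I -> I = [set 0] \/ I = A.

Definition commutant A : set (H -> H) :=
  [set T | bounded_ops T /\ forall S, A S -> T \o S = S \o T].

(* The norm of the n x n matrix T of operators, acting on the Hilbert sum of n
   copies of H. *)
Definition mx_opnorm (n : nat) (T : 'I_n -> 'I_n -> H -> H) : \bar R :=
  ereal_sup [set (Num.sqrt (Re (\sum_i `|\sum_j T i j (x j)| ^+ 2)))%:E
    | x in [set x : 'I_n -> H | \sum_j `|x j| ^+ 2 <= 1]].

End Operators.

(* Cauchy sequences in D for the seminorm p. They represent the elements of the
   completion; equivalent sequences are not identified, as only limits along
   them are used. *)
Record completion (R : realType) (V : zmodType) (D : set V) (p : V -> \bar R) :=
  Completion {
    completion_seq :> nat -> V;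
    completion_mem : forall n, D (completion_seq n);
    completion_cauchy : forall e : R, 0 < e -> exists N, forall m n,
      (N <= m)%N -> (N <= n)%N ->
      (p (completion_seq m - completion_seq n)%R < e%:E)%E }.

Section Representations.
Variables (R : realType) (G : groupType).

Record unitary_rep (H : hilbertType R) := UnitaryRep {
  urep :> G -> H -> H;
  urep_linear : forall g, linear (urep g);
  urep_inner : forall g x y, inner H (urep g x) (urep g y) = inner H x y;
  urep1 : forall x, urep 1%g x = x;
  urepM : forall g h x, urep (g * h)%g x = urep g (urep h x) }.

(* C[G] as finitely supported functions, sending f to sum_g f(g) U(g). *)
Definition group_algebra : set (G -> R[i]) :=
  [set f | finite_set [set g | f g != 0]].

Definition algebra_rep (H : hilbertType R) (U : unitary_rep H)
    (f : G -> R[i]) : H -> H :=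
  fun x => \sum_(g \in [set: G]) f g *: U g x.

Definition universal_norm (f : G -> R[i]) : \bar R :=
  ereal_sup [set e | exists (H : hilbertType R) (U : unitary_rep H),
    e = opnorm (algebra_rep U f)].

(* C*(G) is the completion of C[G] for the supremum of the operator norms over
   all unitary representations. *)
Definition full_cstar := completion group_algebra universal_norm.

(* The image of C*(G) by the extension of U by continuity: the class of the Cauchy
   sequence a is sent to the norm limit of the U(a n). *)
Definition full_image (H : hilbertType R) (U : unitary_rep H) : set (H -> H) :=
  [set T | @bounded_ops R H T /\
     exists a : full_cstar, opnorm_cvg (fun n => algebra_rep U (a n)) T].

Section PermutationRep.
Variables (X : choiceType) (a : gaction G X).

Lemma nsum_gact (f : X -> R) g : nsum (fun x => f (a g x)) = nsum f.
Proof.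
rewrite /nsum; apply/esym.
apply: (@reindex_esum R X X setT setT (a g) (fun x => (f x)%:E)).
split=> //.
- by move=> x y _ _ /(congr1 (a g^-1%g)); rewrite !gactK.
- by move=> x _; exists (a g^-1%g x); rewrite ?gactKV.
Qed.

Lemma perm_rep_subproof g (f : l2 R X) : (fun x => f (a g^-1%g x)) \in l2_pred (R:=R) (X:=X).
Proof. by rewrite inE /= (nsum_gact (fun x => sqn (f x))) l2_fin. Qed.

Definition perm_rep_fun g (f : l2_hilbert R X) : l2_hilbert R X :=
  L2 (perm_rep_subproof g f).

Lemma perm_rep_linear g : linear (perm_rep_fun g).
Proof. by move=> c f h; apply/val_inj/funext => x. Qed.

Lemma csum_gact (f : X -> R[i]) g : csum (fun x => f (a g x)) = csum f.
Proof.
rewrite /csum /rsum; congr (Complex (fine _ - fine _) (fine _ - fine _));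
 [exact: (nsum_gact (fun x => Num.max (Re (f x)) 0))
 |exact: (nsum_gact (fun x => Num.max (- Re (f x)) 0))
 |exact: (nsum_gact (fun x => Num.max (Im (f x)) 0))
 |exact: (nsum_gact (fun x => Num.max (- Im (f x)) 0))].
Qed.

Lemma perm_rep_inner g f h :
  inner (l2_hilbert R X) (perm_rep_fun g f) (perm_rep_fun g h) =
  inner (l2_hilbert R X) f h.
Proof. exact: (csum_gact (fun x => f x * (h x)^*%C)). Qed.

Lemma perm_rep1 f : perm_rep_fun 1%g f = f.
Proof. by apply/val_inj/funext => x /=; rewrite invg1 gact1. Qed.

Lemma perm_repM g h f :
  perm_rep_fun (g * h)%g f = perm_rep_fun g (perm_rep_fun h f).
Proof. by apply/val_inj/funext => x /=; rewrite invgM gactM. Qed.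

Definition perm_rep : unitary_rep (l2_hilbert R X) :=
  UnitaryRep perm_rep_linear perm_rep_inner perm_rep1 perm_repM.

End PermutationRep.

Definition left_regular := perm_rep (left_translation G).

Definition quasi_regular (L : set G) := perm_rep (coset_action L).

(* The norm closure of the image of C[G] in the left regular representation. *)
Definition reduced_cstar : set (l2_hilbert R G -> l2_hilbert R G) :=
  [set T | @bounded_ops R _ T /\ exists u : nat -> G -> R[i],
     (forall n, group_algebra (u n)) /\
     opnorm_cvg (fun n => algebra_rep left_regular (u n)) T].

Definition cstar_simple : Prop := simple_algebra reduced_cstar.

End Representations.

Section ApproximationProperty.
Variables (R : realType) (G : groupType).
Local Notation C := (R[i]).
Local Notation HG := (l2_hilbert R G).
Local Notation lam := (left_regular R G).
Implicit Types (u phi : G -> C).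

Definition coefficient (x y : HG) : G -> C := fun g => inner HG (lam g x) y.

(* A(G) consists of the coefficients of the left regular representation. *)
Definition fourier_algebra : set (G -> C) :=
  [set u | exists x y : HG, u = coefficient x y].

(* The group von Neumann algebra VN(G), the dual of A(G) for the pairing of T with
   coefficient x y given by <T x, y>. *)
Definition group_vn : set (HG -> HG) := commutant (commutant (range lam)).

Definition multipliers : set (G -> C) :=
  [set phi | forall u, fourier_algebra u -> fourier_algebra (phi \* u)].

(* M is the transpose VN(G) -> VN(G) of the multiplication by phi on A(G); its
   values outside VN(G) are irrelevant. *)
Definition transposed_multiplier phi (M : (HG -> HG) -> HG -> HG) : Prop :=
  forall T, group_vn T -> group_vn (M T) /\
    forall x y x' y' : HG, coefficient x' y' = phi \* coefficient x y ->
      inner HG (M T x) y = inner HG (T x') y'.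

Definition cb_bounded_by (M : (HG -> HG) -> HG -> HG) (c : R) : Prop :=
  0 <= c /\ forall n (T : 'I_n -> 'I_n -> HG -> HG),
    (forall i j, group_vn (T i j)) ->
    (mx_opnorm (fun i j => M (T i j)) <= c%:E * mx_opnorm T)%E.

(* The bounds of the cb-norm of the transpose of phi; their infimum is the norm of
   phi in M_0 A(G), and there are none if phi is not in M_0 A(G). *)
Definition cb_multiplier_bounds phi : set R :=
  [set c | multipliers phi /\
           exists2 M, transposed_multiplier phi M & cb_bounded_by M c].

Definition cb_multipliers : set (G -> C) :=
  [set phi | cb_multiplier_bounds phi !=set0].

Definition cb_norm phi : R := inf (cb_multiplier_bounds phi).

Definition l1_functions : set (G -> C) :=
  [set f | (nsum (fun g => Re `|f g|%R) < +oo)%E].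

Definition q_norm (f : G -> C) : \bar R :=
  ereal_sup [set (Re `|csum (fun g => f g * phi g)|)%:E
    | phi in [set phi | cb_multipliers phi /\ cb_norm phi <= 1]].

Definition cb_predual := completion l1_functions q_norm.

(* The duality of M_0 A(G) with Q(G), extended by continuity from l^1(G). *)
Definition q_pairing phi (q : cb_predual) : C :=
  lim ((csum (fun g => q n g * phi g) : C^o) @[n --> \oo]).

(* Closure in M_0 A(G) for the weak topology defined by Q(G). *)
Definition q_weak_closure (S : set (G -> C)) : set (G -> C) :=
  [set phi | cb_multipliers phi /\
     forall (k : nat) (q : 'I_k -> cb_predual) (e : R), 0 < e ->
       exists2 psi, (S `&` cb_multipliers) psi &
         forall j, Re `|q_pairing phi (q j) - q_pairing psi (q j)| < e].

Definition has_AP : Prop := q_weak_closure fourier_algebra (fun _ => 1).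

End ApproximationProperty.

(* Main.v *)
(** Let G = Gamma * Lambda and X = G / Gamma, with quasi-regular representation pi on l^2(X) and
    left regular representation lambda on l^2(G).

    (AP) implies property A. By convex duality, if a group had no almost invariant positive kernels
    of bounded width, there would be at every scale finite matrices with nonnegative entries near the
    diagonal whose quadratic form is at most 1 on localised unit vectors, but larger than 1 at some
    unit vector. The coefficients of the positive parts of these matrices minus 1 converge in the
    predual Q to an element which annihilates the Fourier algebra but not the constant 1. Normal forms
    give a section X -> G which commutes with each g in G off a finite set; composing property A of a
    subgroup with it and taking limits along ultrafilters gives the amenability of the boundary.

    Compressing lambda(f) tensored with 1 by the same maps shows that the essential norm of pi(f) is
    at most the norm of lambda(f). If Gamma is not amenable, powers of an average over Gamma, which
    acts freely on X off the base point, converge to a rank-one projection; hence the image of C*(G)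
    contains the compact operators, and so does each of its nonzero ideals. If an ideal contains a
    non-compact operator, its preimage in C*(G) has a nonzero image in the simple algebra C*_r(G);
    this image contains 1, so the ideal contains 1 up to a compact and a small operator.

    For free groups, moving the vertices of the Cayley graph towards the root gives property A
    directly, and averaging over conjugates as Powers did gives simplicity. *)
Require Import Defs.
From HB Require Import structures.
From mathcomp Require Import all_boot all_order all_algebra.
From mathcomp Require Import all_classical all_reals all_analysis.
From mathcomp Require Import sesquilinear ring lra.
From mathcomp.real_closed Require Import complex.
Set Implicit Arguments. Unset Strict Implicit. Unset Printing Implicit Defensive.
Import Order.TTheory GRing.Theory Num.Theory.
Import numFieldNormedType.Exports.
Local Open Scope classical_set_scope.
Local Open Scope ring_scope.
Local Notation Re := complex.Re.
Local Notation Im := complex.Im.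

(** * Limits along ultrafilters *)

(** (AP) is a weak closure statement with no bound on the approximating multipliers, so the failure
    of property A has to be turned into a single element of the predual that separates 1 from the
    Fourier algebra, and this element must be a norm limit there. A matrix Y of the duality step has
    short propagation, but its positive part need not. Polynomials in Y replace it, with a rate of
    convergence that ignores the size of Y. At a fixed degree their coefficients are functions on G
    with a common finite support, so the limit over the matrices is taken first and the degree grows
    afterwards. Localised vectors see Y as negative, hence the entries of the positive part tend to
    0, and finitely supported coefficients pair to 0 in the limit.

    For the ideals, the obstacle is that the image of C*(G) is defined by sequences which are Cauchy
    for the universal norm, whereas approximations are found in one representation only. A lifting
    argument shows that both notions give the same operators; thereby an element of the
    quasi-regular image can be carried to the reduced algebra. *)

Section UltraLimits.
Variable R : realType.

Definition ulim (T : Type) (U : set_system T) (u : T -> R) : R := lim (u @ U).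

Variables (T : Type) (U : set_system T).
Hypothesis UU : UltraFilter U.
Implicit Types u v : T -> R.

Let FU : ProperFilter U. Proof. exact: ultra_proper. Qed.

Definition bdd u := exists M, forall x, `|u x| <= M.

Lemma ulim_cvg u : bdd u -> u @ U --> ulim U u.
Proof.
move=> [M uM].
have := @segment_compact R (- M) M; rewrite compact_ultra => /(_ (u @ U)).
have UuU : UltraFilter (u @ U) by exact: ultra_fmap.
case=> //=.
  by apply: filterS (filterT) => x _ /=; rewrite in_itv /= -ler_norml.
by move=> p [_ up]; rewrite /ulim (cvg_lim _ up).
Qed.

Lemma ulim_unique u l : u @ U --> l -> ulim U u = l.
Proof. by move=> ul; apply: cvg_lim. Qed.

Lemma bddD u v : bdd u -> bdd v -> bdd (fun x => u x + v x).
Proof.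
move=> [M uM] [N vN]; exists (M + N) => x.
by apply: le_trans (ler_normD _ _) _; apply: lerD.
Qed.

Lemma bddN u : bdd u -> bdd (fun x => - u x).
Proof. by move=> [M uM]; exists M => x; rewrite normrN. Qed.

Lemma bddZ a u : bdd u -> bdd (fun x => a * u x).
Proof.
move=> [M uM]; exists (`|a| * M) => x.
by rewrite normrM ler_wpM2l.
Qed.

Lemma bdd_norm u : bdd u -> bdd (fun x => `|u x|).
Proof. by move=> [M uM]; exists M => x; rewrite normr_id. Qed.

Lemma bdd_cst a : bdd (fun=> a).
Proof. by exists `|a|. Qed.

Lemma bdd_sum (I : Type) (r : seq I) (P : pred I) (f : I -> T -> R) :
  (forall i, bdd (f i)) -> bdd (fun x => \sum_(i <- r | P i) f i x).
Proof.
move=> fb; elim: r => [|i r [M rM]].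
  by exists 0 => x; rewrite big_nil normr0.
have [N fN] := fb i; exists (N + M) => x; rewrite big_cons; case: ifP => _.
  by apply: le_trans (ler_normD _ _) _; apply: lerD.
by apply: le_trans (rM x) _; rewrite lerDr (le_trans _ (fN x)).
Qed.

Lemma ulimD u v : bdd u -> bdd v ->
  ulim U (fun x => u x + v x) = ulim U u + ulim U v.
Proof. by move=> ub vb; apply: ulim_unique; apply: cvgD; exact: ulim_cvg. Qed.

Lemma ulimZ a u : bdd u -> ulim U (fun x => a * u x) = a * ulim U u.
Proof. by move=> ub; apply: ulim_unique; apply: cvgM (ulim_cvg ub); exact: cvg_cst. Qed.

Lemma ulimN u : bdd u -> ulim U (fun x => - u x) = - ulim U u.
Proof. by move=> ub; apply: ulim_unique; apply: cvgN; exact: ulim_cvg. Qed.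

Lemma ulim_cst a : ulim U (fun=> a) = a.
Proof. by apply: ulim_unique; exact: cvg_cst. Qed.

Lemma ulim_sum (I : Type) (r : seq I) (P : pred I) (f : I -> T -> R) :
  (forall i, bdd (f i)) ->
  ulim U (fun x => \sum_(i <- r | P i) f i x) = \sum_(i <- r | P i) ulim U (f i).
Proof.
move=> fb; elim: r => [|i r IH].
  by under eq_fun do rewrite big_nil; rewrite big_nil ulim_cst.
under eq_fun do rewrite big_cons; rewrite big_cons; case: ifP => // _.
by rewrite ulimD ?IH//; exact: bdd_sum.
Qed.

Lemma ulim_norm u : bdd u -> ulim U (fun x => `|u x|) = `|ulim U u|.
Proof. by move=> ub; apply: ulim_unique; apply: cvg_norm; exact: ulim_cvg. Qed.

Lemma ulim_le u a : bdd u -> U [set x | u x <= a] -> ulim U u <= a.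
Proof. by move=> ub ua; apply: cvgr_to_le (ulim_cvg ub) _. Qed.

Lemma ulim_ge u a : bdd u -> U [set x | a <= u x] -> a <= ulim U u.
Proof. by move=> ub ua; apply: cvgr_to_ge (ulim_cvg ub) _. Qed.

Lemma ulim_eq u v : bdd u -> bdd v -> U [set x | u x = v x] -> ulim U u = ulim U v.
Proof.
move=> ub vb uv; apply/eqP; rewrite eq_sym -subr_eq0 -(ulimN ub) -ulimD//; last exact: bddN.
apply/eqP; apply: ulim_unique; apply: cvg_near_cst; apply: filterS uv => x /= ->.
exact: subrr.
Qed.

End UltraLimits.

Lemma nat_ultra : exists U : set_system nat,
  UltraFilter U /\ forall N, U [set n | (N <= n)%N].
Proof.
have [U [UU sU]] := @ultraFilterLemma nat \oo _.
by exists U; split=> // N; apply: sU; exists N.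
Qed.

(** * Positive kernels and convex duality *)

Section ConeAlternative.
Variables (R : realType) (J : finType).
Implicit Types (p w u r : J -> R).

Definition pospart (x : R) : R := Num.max x 0.

Lemma pospart_ge0 x : 0 <= pospart x.
Proof. by rewrite /pospart le_max lexx orbT. Qed.

Lemma pospartM x : pospart x * x = pospart x ^+ 2.
Proof. by rewrite /pospart; case: (leP x 0) => _; rewrite ?mul0r ?expr0n// expr2. Qed.

(** The squared positive part has slope [2 * pospart a] at [a] and curvature at most 2; the expanded
    right-hand square is this second-order upper bound. *)
Lemma pospartB_le a b : pospart (a - b) ^+ 2 <= (pospart a - b) ^+ 2.
Proof.
rewrite /pospart; case: (leP (a - b) 0) => ab; first by rewrite expr0n sqr_ge0.
by case: (leP a 0) => a0 //; nra.
Qed.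

Definition penalty p w : R := \sum_j pospart (p j - w j) ^+ 2.

(* The dual vector is the gradient of the squared distance from p to the
   orthants below the elements of the cone, at an approximate minimiser: as
   only an approximation is needed, the cone need not be closed. *)
Lemma cone_alternative (C : set (J -> R)) p (e K th : R) :
  C (fun=> 0) -> (forall w u a, C w -> C u -> 0 <= a -> C (fun j => w j + a * u j)) ->
  (forall w, C w -> e <= penalty p w) ->
  (forall w, C w -> penalty p w <= penalty p (fun=> 0) + 1 -> \sum_j w j ^+ 2 <= K) ->
  0 < th -> th < 1 ->
  exists r, [/\ forall j, 0 <= r j,
    forall u N, C u -> 0 < N -> \sum_j u j ^+ 2 <= N ^+ 2 -> \sum_j r j * u j <= th * N,
    e - th * (1 + K) / 2 <= \sum_j r j * p j &
    exists2 w, C w & forall j, r j = pospart (p j - w j)].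
Proof.
move=> C0 CD Ce CK th0 th1.
pose S := [set penalty p w | w in C].
have hS : has_inf S.
  split; first by exists (penalty p (fun=> 0)), (fun=> 0).
  exists 0 => _ [w _ <-]; apply: sumr_ge0 => j _; exact: sqr_ge0.
have Sle w : C w -> inf S <= penalty p w.
  by move=> Cw; apply: ge_inf; [case: hS|exists w].
have [_ [w Cw <-] wS] := inf_adherent (exprn_gt0 2 th0) hS.
pose r j := pospart (p j - w j).
have rE : \sum_j r j ^+ 2 = penalty p w by [].
have wK : \sum_j w j ^+ 2 <= K.
  apply: CK => //; apply: le_trans (ltW wS) _; apply: lerD; first exact: Sle.
  by rewrite expr_le1// ltW.
(* Second-order expansion of the penalty along the direction u, with gradient -2 r. *)
have key u (t : R) : \sum_j pospart (p j - (w j + t * u j)) ^+ 2 <=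
    penalty p w - 2 * t * \sum_j r j * u j + t ^+ 2 * \sum_j u j ^+ 2.
  rewrite -rE !mulr_sumr -sumrN -!big_split /=; apply: ler_sum => j _.
  rewrite opprD addrA; apply: le_trans (pospartB_le _ _) _.
  by rewrite -/(r j) le_eqVlt; apply/orP; left; apply/eqP; ring.
exists r; split.
- by move=> j; exact: pospart_ge0.
- move=> u N Cu N0 uN.
  (* The length th / N balances two terms: the penalty at w exceeds its infimum by at most th^2, and
     the quadratic term is at most th^2 as well. *)
  have t0 : 0 < th / N by rewrite divr_gt0.
  have := Sle _ (CD w u _ Cw Cu (ltW t0)).
  move=> /le_trans /(_ (key u (th / N))) h.
  have : (th / N) ^+ 2 * \sum_j u j ^+ 2 <= th ^+ 2.
    rewrite expr_div_n mulrAC ler_pdivrMr ?exprn_gt0//.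
    by rewrite ler_wpM2l// sqr_ge0.
  move=> h2.
  have h3 : 2 * (th / N) * \sum_j r j * u j <= 2 * th ^+ 2 by lra.
  have : (th / N) * \sum_j r j * u j <= (th / N) * (th * N).
    have -> : (th / N) * (th * N) = th ^+ 2 by field; rewrite gt_eqF.
    by lra.
  by rewrite ler_pM2l.
(* Shrinking w by the factor 1 - th stays in the cone; this bounds the pairing of r with w from
   below. *)
- have h : - th * (1 + K) / 2 <= \sum_j r j * w j.
    have Cw' : C (fun j => w j + (- th) * w j).
      have -> : (fun j => w j + - th * w j) = (fun j => 0 + (1 - th) * w j).
        by apply/funext => j; ring.
      by apply: CD => //; rewrite subr_ge0 ltW.
    have := Sle _ Cw'; move=> /le_trans /(_ (key w (- th))) h.
    have : th * (- th * (1 + K)) <= th * (2 * \sum_j r j * w j).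
      have : th ^+ 2 * \sum_j w j ^+ 2 <= th ^+ 2 * K by rewrite ler_wpM2l// sqr_ge0.
      rewrite sqrrN in h; move: h wS; set a := inf S; set b := penalty p w.
      set c := \sum_j r j * w j; set d := th ^+ 2 * \sum_j _; move=> h wS hd.
      have -> : th * (- th * (1 + K)) = - th ^+ 2 - th ^+ 2 * K by ring.
      by lra.
    rewrite ler_pM2l//; lra.
  have -> : \sum_j r j * p j = penalty p w + \sum_j r j * w j.
    rewrite -rE -big_split /=; apply: eq_bigr => j _.
    by rewrite /r -pospartM; ring.
  have := Ce _ Cw; lra.
- by exists w.
Qed.

End ConeAlternative.

Section GramAlternative.
Variables (R : realType) (n : nat) (tube : rel 'I_n) (L : set {ffun 'I_n -> R}).
Hypothesis tubeC : symmetric tube.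
Hypothesis LZ : forall v a, L v -> 0 <= a -> L [ffun i => a * v i].

Definition gram (vs : seq {ffun 'I_n -> R}) i j : R := \sum_(v <- vs) v i * v j.

Lemma gramC vs i j : gram vs i j = gram vs j i.
Proof. by apply: eq_bigr => v _; rewrite mulrC. Qed.

Lemma gram_diag_ge0 vs i : 0 <= gram vs i i.
Proof. by apply: sumr_ge0 => v _; rewrite -expr2 sqr_ge0. Qed.

Lemma gram_polar (vs : seq {ffun 'I_n -> R}) i j :
  \sum_(v <- vs) (v i - v j) ^+ 2 = gram vs i i + gram vs j j - 2 * gram vs i j.
Proof.
rewrite /gram mulr_sumr -sumrN -!big_split /=; apply: eq_bigr => v _; ring.
Qed.

Lemma gram_polarN (vs : seq {ffun 'I_n -> R}) i j :
  \sum_(v <- vs) (v i + v j) ^+ 2 = gram vs i i + gram vs j j + 2 * gram vs i j.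
Proof. by rewrite /gram mulr_sumr -!big_split /=; apply: eq_bigr => v _; ring. Qed.

Lemma gram_le vs i j : `|gram vs i j| <= (gram vs i i + gram vs j j) / 2.
Proof.
have := gram_polar vs i j; have := gram_polarN vs i j.
have : 0 <= \sum_(v <- vs) (v i - v j) ^+ 2 by apply: sumr_ge0 => v _; exact: sqr_ge0.
have : 0 <= \sum_(v <- vs) (v i + v j) ^+ 2 by apply: sumr_ge0 => v _; exact: sqr_ge0.
by move=> h1 h2 e1 e2; rewrite ler_norml; apply/andP; split; lra.
Qed.

Let J : finType := (('I_n * 'I_n) + 'I_n)%type.

(** The diagonal enters once more with a minus sign, so that lower bounds on all coordinates express
    both a lower bound of the kernel on the tube and an upper bound of its diagonal. *)
Let gvec vs (j : J) : R := match j with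
  | inl ij => if tube ij.1 ij.2 then gram vs ij.1 ij.2 else 0
  | inr i => - gram vs i i end.

Let sumJ (f : J -> R) :
  \sum_j f j = \sum_i \sum_j f (inl (i, j)) + \sum_i f (inr i).
Proof.
by rewrite big_sumType /=; congr (_ + _); rewrite pair_bigA; apply: eq_bigr => -[].
Qed.

(** Gram matrices of vectors of L form a convex cone, sums being concatenations. Either some point
    of it falls short of the target (1 - e on the tube, -1 for the negated diagonal) by at most e in
    each coordinate, or [cone_alternative] separates the target from the cone by weights r and d. *)
Lemma gram_alternative (e : R) : 0 < e -> e < 1 ->
  (exists vs, [/\ {in vs, forall v, L v}, forall i, gram vs i i <= 1 + e &
     forall i j, tube i j -> 1 - 2 * e <= gram vs i j])
  \/ (exists (r : 'I_n -> 'I_n -> R) (d : 'I_n -> R),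
     [/\ forall i j, 0 <= r i j, forall i j, ~~ tube i j -> r i j = 0,
       forall i j, r i j = r j i,
       (forall i, 0 < d i) &
       (forall v, L v -> \sum_i \sum_j r i j * (v i * v j) <= \sum_i d i * v i ^+ 2) /\
       \sum_i d i <= (1 - e) * \sum_i \sum_j r i j]).
Proof.
move=> e0 e1.
pose C : set (J -> R) := [set w | exists2 vs, {in vs, forall v, L v} & w = gvec vs].
pose p (j : J) : R := match j with
  | inl ij => if tube ij.1 ij.2 then 1 - e else 0
  | inr i => -1 end.
have [[_ [vs Lvs ->] small]|big] :=
  pselect (exists2 w, C w & penalty p w < e ^+ 2).
  left; exists vs.
  have hj j : p j - gvec vs j <= e.
    have h : pospart (p j - gvec vs j) ^+ 2 <= e ^+ 2.
      apply: le_trans (ltW small); rewrite /penalty (bigD1 j)//= lerDl.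
      by apply: sumr_ge0 => ? _; exact: sqr_ge0.
    have : pospart (p j - gvec vs j) <= e.
      by rewrite -(@ler_pXn2r _ 2)// nnegrE ?pospart_ge0// ltW.
    by apply: le_trans; rewrite /pospart le_max lexx.
  split=> // [i|i j tij].
    by have := hj (inr i) => /=; lra.
  by have := hj (inl (i, j)) => /=; rewrite tij; lra.
right.
have C0 : C (fun=> 0).
  exists [::] => //; apply/funext => -[[i j]|i] /=; rewrite /gram big_nil ?oppr0//.
  by case: ifP.
have CD w u a : C w -> C u -> 0 <= a -> C (fun j => w j + a * u j).
  move=> [vs Lvs ->] [us Lus ->] a0.
  exists (vs ++ [seq [ffun i => Num.sqrt a * v i] | v : {ffun 'I_n -> R} <- us]).
    move=> v; rewrite mem_cat => /orP[/Lvs//|/mapP[v' /Lus Lv' ->]].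
    by apply: LZ; rewrite ?sqrtr_ge0.
  have gE i j : gram (vs ++ [seq [ffun i => Num.sqrt a * v i] |
      v : {ffun 'I_n -> R} <- us]) i j = gram vs i j + a * gram us i j.
    rewrite /gram big_cat /=; congr (_ + _); rewrite big_map mulr_sumr.
    by apply: eq_bigr => v _; rewrite !ffunE mulrACA -expr2 sqr_sqrtr.
  apply/funext => -[[i j]|i] /=; rewrite gE; first by case: ifP; rewrite ?mulr0 ?addr0.
  by rewrite mulrN opprD.
have Ce w : C w -> e ^+ 2 <= penalty p w.
  by move=> Cw; rewrite leNgt; apply/negP => ?; apply: big; exists w.
(* A Gram matrix of penalty at most M has diagonal at most 1 + M, and [gram_le] then bounds its
   other entries. *)
pose M := penalty p (fun=> 0) + 1; pose K := (1 + M) ^+ 2 *+ #|J|.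
have M1 : 1 <= M.
  by rewrite /M lerDr; apply: sumr_ge0 => j _; exact: sqr_ge0.
have K0 : 0 <= K by rewrite mulrn_wge0// sqr_ge0.
have CK w : C w -> penalty p w <= penalty p (fun=> 0) + 1 -> \sum_j w j ^+ 2 <= K.
  move=> [vs _ ->] wM.
  have gM i : gram vs i i <= 1 + M.
    have h : pospart (p (inr i) - gvec vs (inr i)) ^+ 2 <= M.
      apply: le_trans wM; rewrite /penalty (bigD1 (inr i))//= lerDl.
      by apply: sumr_ge0 => ? _; exact: sqr_ge0.
    have : gram vs i i - 1 <= pospart (p (inr i) - gvec vs (inr i)).
      by rewrite /= /pospart le_max opprK addrC lexx.
    move: h (pospart_ge0 (p (inr i) - gvec vs (inr i))).
    set x := pospart _ => h x0 hx.
    by have : x <= M; [nra|lra].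
  rewrite /K -sumr_const; apply: ler_sum => -[[i j]|i] _ /=.
    rewrite -real_normK ?num_real// ler_pXn2r ?nnegrE ?normr_ge0//; last lra.
    case: ifP => _; last by rewrite normr0; lra.
    apply: le_trans (gram_le _ _ _) _; have := gM i; have := gM j; lra.
  rewrite sqrrN ler_pXn2r ?nnegrE ?gM ?gram_diag_ge0//; lra.
(* D collects the losses: (1 + K) / 2 from the alternative, 2 n from the shift of the n diagonal
   weights by 2 th, and 1 for a remaining margin th. *)
pose D : R := (1 + K) / 2 + 2 * n%:R + 1.
have D1 : 1 <= D.
  rewrite /D; have : 0 <= n%:R :> R by []. move: K0; set k := K; set m := n%:R.
  lra.
pose th := e ^+ 2 / D.
have th0 : 0 < th by rewrite divr_gt0 ?exprn_gt0//; lra.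
have th1 : th < 1.
  rewrite /th ltr_pdivrMr ?mul1r; last by lra.
  by apply: lt_le_trans D1; rewrite expr_lt1// ltW.
have [r [r0 rC rp [w [vs Lvs ->] rE]]] := cone_alternative C0 CD Ce CK th0 th1.
(* The alternative controls v up to th times the norm of its Gram vector, which is at most 2 |v|^2;
   adding 2 th to the diagonal absorbs this error and makes d positive. *)
exists (fun i j => r (inl (i, j))), (fun i => r (inr i) + 2 * th); split.
- by move=> i j; exact: r0.
- move=> i j /negbTE tij; rewrite rE /= tij subrr /pospart.
  exact/max_idPr.
- by move=> i j; rewrite !rE /= tubeC gramC.
- by move=> i; have := r0 (inr i); lra.
split=> [v Lv|].
  have Cv : C (gvec [:: v]) by exists [:: v] => // ?; rewrite inE => /eqP ->.
  have gv i j : gram [:: v] i j = v i * v j by rewrite /gram big_seq1.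
  pose N := \sum_i v i ^+ 2.
  have N0 : 0 <= N by apply: sumr_ge0 => i _; exact: sqr_ge0.
  have split_sum : \sum_j r j * gvec [:: v] j =
      \sum_i \sum_j r (inl (i, j)) * (v i * v j) - \sum_i r (inr i) * v i ^+ 2.
    rewrite sumJ -sumrN; congr (_ + _); apply: eq_bigr => i _.
      apply: eq_bigr => j _ /=; rewrite gv; case: ifP => // tij.
      by rewrite mulr0 rE /= tij subrr /pospart (max_idPr _)// mul0r.
    by rewrite /= gv -expr2 mulrN.
  have -> : \sum_i (r (inr i) + 2 * th) * v i ^+ 2 =
      \sum_i r (inr i) * v i ^+ 2 + 2 * th * N.
    by rewrite mulr_sumr -big_split /=; apply: eq_bigr => i _; rewrite mulrDl.
  have [N0'|Npos] := leP N 0.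
    have v0 i : v i = 0.
      have : \sum_i v i ^+ 2 == 0 by rewrite eq_le N0' N0.
      rewrite psumr_eq0 => [/allP /(_ i)|? _]; last exact: sqr_ge0.
      by rewrite mem_index_enum sqrf_eq0 => /(_ isT) /eqP.
    rewrite big1 => [|i _]; last by rewrite big1// => j _; rewrite v0 mul0r mulr0.
    rewrite big1 => [|i _]; last by rewrite v0 expr0n mulr0.
    by rewrite add0r mulr_ge0// mulr_ge0// ltW.
  have := rC _ (2 * N) Cv; rewrite mulr_gt0// => /(_ isT).
  rewrite split_sum; set A := \sum_i \sum_j _; set B := \sum_i _.
  have : \sum_j gvec [:: v] j ^+ 2 <= (2 * N) ^+ 2.
    rewrite sumJ.
    have h1 : \sum_i \sum_j gvec [:: v] (inl (i, j)) ^+ 2 <= N ^+ 2.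
      rewrite expr2 {1}/N mulr_suml; apply: ler_sum => i _.
      rewrite mulr_sumr; apply: ler_sum => j _ /=; rewrite gv.
      by case: ifP; rewrite ?exprMn// expr0n/= => _; rewrite mulr_ge0 ?sqr_ge0.
    have h2 : \sum_i gvec [:: v] (inr i) ^+ 2 <= N ^+ 2.
      rewrite expr2 {1}/N mulr_suml; apply: ler_sum => i _ /=.
      rewrite gv sqrrN exprMn ler_wpM2l ?sqr_ge0// /N (bigD1 i)//= lerDl.
      by apply: sumr_ge0 => ? _; exact: sqr_ge0.
    rewrite exprMn; have := sqr_ge0 N; lra.
  move=> h /(_ h); lra.
have pE : \sum_j r j * p j =
    (1 - e) * \sum_i \sum_j r (inl (i, j)) - \sum_i r (inr i).
  rewrite sumJ mulr_sumr -sumrN; congr (_ + _); apply: eq_bigr => i _; last by rewrite mulrN1.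
  rewrite mulr_sumr; apply: eq_bigr => j _ /=; case: ifP => tij; first by rewrite mulrC.
  by rewrite rE /= tij subrr /pospart (max_idPr _)// mul0r mulr0.
rewrite big_split /= sumr_const card_ord -mulr_natr.
have h : th * D = e ^+ 2 by rewrite /th divfK// gt_eqF//; lra.
move: rp; rewrite pE; set A := \sum_i \sum_j _; set B := \sum_i r (inr i) => rp.
have : e ^+ 2 - th * (1 + K) / 2 - 2 * th * n%:R = th.
  by rewrite -h /D; field.
by move: th0 rp; clear; lra.
Qed.
End GramAlternative.

(** * Positive parts of symmetric matrices *)

Section EuclideanMatrices.
Variables (R : realType) (n : nat).
Implicit Types (u v w : 'cV[R]_n) (A B : 'M[R]_n).

Definition dotv u v : R := \sum_i u i 0 * v i 0.
Definition nv v : R := Num.sqrt (dotv v v).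

Lemma dotvC u v : dotv u v = dotv v u.
Proof. by apply: eq_bigr => i _; rewrite mulrC. Qed.

Lemma dotvDl u v w : dotv (u + v) w = dotv u w + dotv v w.
Proof. by rewrite -big_split /=; apply: eq_bigr => i _; rewrite mxE mulrDl. Qed.

Lemma dotvZl a u v : dotv (a *: u) v = a * dotv u v.
Proof. by rewrite mulr_sumr; apply: eq_bigr => i _; rewrite mxE mulrA. Qed.

Lemma dotvDr u v w : dotv w (u + v) = dotv w u + dotv w v.
Proof. by rewrite dotvC dotvDl !(dotvC w). Qed.

Lemma dotvZr a u v : dotv u (a *: v) = a * dotv u v.
Proof. by rewrite dotvC dotvZl dotvC. Qed.

Lemma dotvNl u v : dotv (- u) v = - dotv u v.
Proof. by rewrite -scaleN1r dotvZl mulN1r. Qed.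

Lemma dotvBl u v w : dotv (u - v) w = dotv u w - dotv v w.
Proof. by rewrite dotvDl dotvNl. Qed.

Lemma dotv_ge0 v : 0 <= dotv v v.
Proof. by apply: sumr_ge0 => i _; rewrite -expr2 sqr_ge0. Qed.

Lemma nv_ge0 v : 0 <= nv v. Proof. exact: sqrtr_ge0. Qed.

Lemma nv2 v : nv v ^+ 2 = dotv v v.
Proof. by rewrite sqr_sqrtr// dotv_ge0. Qed.

Lemma nv0_dotv u v : nv v = 0 -> dotv u v = 0.
Proof.
move=> v0; have : dotv v v = 0 by rewrite -nv2 v0 expr0n.
move=> /eqP; rewrite psumr_eq0 => [|i _]; last by rewrite -expr2 sqr_ge0.
move=> /allP h; rewrite /dotv big1// => i _.
have := h i; rewrite mem_index_enum mulf_eq0 orbb => /(_ isT) /eqP ->.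
by rewrite mulr0.
Qed.

Lemma dotv_CS u v : `|dotv u v| <= nv u * nv v.
Proof.
have [v0|vn0] := eqVneq (nv v) 0; first by rewrite nv0_dotv// normr0 v0 mulr0.
have vp : 0 < nv v by rewrite lt0r vn0 nv_ge0.
rewrite -(@ler_pXn2r _ 2) ?nnegrE ?mulr_ge0 ?nv_ge0//.
rewrite real_normK ?num_real// exprMn !nv2.
have := dotv_ge0 (dotv v v *: u - dotv u v *: v).
rewrite dotvBl !dotvZl dotvC dotvBl !dotvZl [dotv v (_ - _)]dotvC dotvBl !dotvZl.
rewrite (dotvC v u) => h.
have {h} : 0 <= dotv v v * (dotv u u * dotv v v - dotv u v ^+ 2).
  by move: h; congr (0 <= _); ring.
by rewrite pmulr_rge0 ?subr_ge0// -nv2 exprn_gt0.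
Qed.

Lemma nvD u v : nv (u + v) <= nv u + nv v.
Proof.
rewrite -(@ler_pXn2r _ 2) ?nnegrE ?addr_ge0 ?nv_ge0//.
rewrite sqrrD !nv2 dotvDl !dotvDr (dotvC v u).
have := le_trans (ler_norm _) (dotv_CS u v).
by move: (dotv u u) (dotv v v) (dotv u v) (nv u * nv v) => a b c d; lra.
Qed.

Lemma nvZ a v : nv (a *: v) = `|a| * nv v.
Proof. by rewrite /nv dotvZl dotvZr mulrA -expr2 sqrtrM ?sqr_ge0// sqrtr_sqr. Qed.

Lemma nvN v : nv (- v) = nv v.
Proof. by rewrite -scaleN1r nvZ normrN1 mul1r. Qed.

Lemma nv_coord v i : `|v i 0| <= nv v.
Proof.
rewrite -(@ler_pXn2r _ 2) ?nnegrE ?nv_ge0// real_normK ?num_real// nv2.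
rewrite /dotv (bigD1 i)//= expr2 lerDl.
by apply: sumr_ge0 => j _; rewrite -expr2 sqr_ge0.
Qed.

Definition mbd A (c : R) := forall v, nv (A *m v) <= c * nv v.

Lemma mbdD A B a b : mbd A a -> mbd B b -> mbd (A + B) (a + b).
Proof.
move=> hA hB v; rewrite mulmxDl mulrDl.
by apply: le_trans (nvD _ _) _; apply: lerD.
Qed.

Lemma mbdZ A a c : mbd A c -> mbd (a *: A) (`|a| * c).
Proof. by move=> hA v; rewrite -scalemxAl nvZ -mulrA ler_wpM2l. Qed.

Lemma mbdZ_ge0 A a c : 0 <= a -> mbd A c -> mbd (a *: A) (a * c).
Proof. by move=> a0 /(mbdZ a); rewrite ger0_norm. Qed.

Lemma mbdN A c : mbd A c -> mbd (- A) c.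
Proof. by move=> hA v; rewrite mulNmx nvN. Qed.

Lemma mbdM A B a b : 0 <= a -> mbd A a -> mbd B b -> mbd (A *m B) (a * b).
Proof.
move=> a0 hA hB v; rewrite -mulmxA; apply: le_trans (hA _) _.
by rewrite -mulrA ler_wpM2l.
Qed.

Lemma mbd_le A a b : a <= b -> mbd A a -> mbd A b.
Proof. by move=> ab hA v; apply: le_trans (hA v) _; rewrite ler_wpM2r// nv_ge0. Qed.

Lemma mbd0 : mbd 0 0.
Proof. by move=> v; rewrite mul0mx mul0r /nv /dotv big1 ?sqrtr0// => i _; rewrite mxE mul0r. Qed.

Lemma mbd_dot A c u v : mbd A c -> `|dotv (A *m u) v| <= c * nv u * nv v.
Proof.
by move=> hA; apply: le_trans (dotv_CS _ _) _; rewrite ler_wpM2r// nv_ge0.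
Qed.

Lemma dotv_trmx A u v : dotv (A *m u) v = dotv u (A^T *m v).
Proof.
rewrite /dotv; under eq_bigr do rewrite mxE mulr_suml.
rewrite exchange_big /=; apply: eq_bigr => j _; rewrite mxE mulr_sumr.
by apply: eq_bigr => i _; rewrite !mxE; ring.
Qed.

End EuclideanMatrices.

Section AbsoluteValue.
Variable R : realType.

(** The recursion of [abs_q] for the scalar Z = 1, increasing to 1. Its increments dominate those of
    [abs_q] for every contraction Z, in any dimension. *)
Fixpoint abs_al (k : nat) : R :=
  if k is k'.+1 then (1 + abs_al k' ^+ 2) / 2 else 0.

Lemma abs_al_ge0 k : 0 <= abs_al k.
Proof. by case: k => [|k] //=; rewrite divr_ge0// addr_ge0// sqr_ge0. Qed.

Lemma abs_al_le1 k : abs_al k <= 1.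
Proof.
elim: k => [|k IH] /=; first exact: ler01.
by have := abs_al_ge0 k; nra.
Qed.

Lemma abs_al_step k : abs_al k <= abs_al k.+1.
Proof. by rewrite /=; have := sqr_ge0 (abs_al k - 1); nra. Qed.

Lemma abs_al_ndecr : nondecreasing_seq abs_al.
Proof. by apply/nondecreasing_seqP; exact: abs_al_step. Qed.

Lemma abs_al_cauchy (e : R) : 0 < e ->
  exists N, forall k l, (N <= k)%N -> (N <= l)%N -> `|abs_al k - abs_al l| <= e.
Proof.
move=> e0; have cv : cvgn abs_al.
  apply: nondecreasing_is_cvgn; first exact: abs_al_ndecr.
  by exists 1 => _ [k _ <-]; exact: abs_al_le1.
have /cvg_ball /(_ _ (divr_gt0 e0 (ltr0Sn _ 1))) [N _ hN] := cv.
exists N => k l Nk Nl; have := hN k Nk; have := hN l Nl.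
rewrite /ball /=; set x := limn _; move=> h1 h2.
have -> : abs_al k - abs_al l = - (x - abs_al k) + (x - abs_al l) by ring.
by apply: le_trans (ler_normD _ _) _; rewrite normrN [e]splitr; apply: lerD; apply: ltW.
Qed.

Variable n : nat.
Implicit Types Y Z : 'M[R]_n.+1.

(* With Z = 1 - Y^2, the matrices 1 - abs_q Z k converge to |Y|, at a rate which
   does not depend on the dimension. *)
Fixpoint abs_q Z (k : nat) : 'M[R]_n.+1 :=
  if k is k'.+1 then 2^-1 *: (Z + abs_q Z k' ^+ 2) else 0.

Lemma abs_q_comm Z W k : GRing.comm W Z -> GRing.comm W (abs_q Z k).
Proof.
move=> WZ; elim: k => [|k IH] /=; first exact: commr0.
rewrite /GRing.comm -scalerAr -scalerAl; congr (_ *: _).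
by apply: commrD => //; exact: commrX.
Qed.

Lemma abs_q_bound Z k : mbd Z 1 -> mbd (abs_q Z k) (abs_al k).
Proof.
move=> Z1; elim: k => [|k IH] /=; first exact: mbd0.
rewrite mulrC; apply: mbdZ_ge0; first by rewrite invr_ge0.
apply: mbdD => //; rewrite !expr2; apply: mbdM => //; exact: abs_al_ge0.
Qed.

(** Polynomials in Z commute, so each increment is half the sum of two successive terms times the
    previous increment; the scalar sequence satisfies the same identity. *)
Lemma abs_q_step Z k : mbd Z 1 ->
  mbd (abs_q Z k.+1 - abs_q Z k) (abs_al k.+1 - abs_al k).
Proof.
move=> Z1; elim: k => [|k IH].
  rewrite subr0 subr0; exact: abs_q_bound.
have -> : abs_q Z k.+2 - abs_q Z k.+1 =
    2^-1 *: ((abs_q Z k.+1 + abs_q Z k) * (abs_q Z k.+1 - abs_q Z k)).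
  have c : GRing.comm (abs_q Z k.+1) (abs_q Z k).
    by apply/abs_q_comm/commr_sym/abs_q_comm.
  rewrite mulrDl !mulrBr -c addrA subrK -!expr2.
  rewrite -[abs_q Z k.+2]/(2^-1 *: (Z + abs_q Z k.+1 ^+ 2)).
  rewrite -[X in _ - X = _]/(2^-1 *: (Z + abs_q Z k ^+ 2)) -scalerBr; congr (_ *: _).
  by rewrite opprD addrACA subrr add0r.
have -> : abs_al k.+2 - abs_al k.+1 =
    2^-1 * ((abs_al k.+1 + abs_al k) * (abs_al k.+1 - abs_al k)).
  by rewrite /=; field.
apply: mbdZ_ge0; first by rewrite invr_ge0.
apply: mbdM => //; first by rewrite addr_ge0 ?abs_al_ge0.
by apply: mbdD; exact: abs_q_bound.
Qed.

Lemma abs_q_cauchy Z k l : mbd Z 1 ->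
  mbd (abs_q Z k - abs_q Z l) `|abs_al k - abs_al l|.
Proof.
move=> Z1; wlog kl : k l / (l <= k)%N.
  move=> h; case/orP: (leq_total l k) => kl; first exact: h.
  by rewrite distrC -opprB; apply: mbdN; exact: h.
rewrite ger0_norm ?subr_ge0 ?abs_al_ndecr//.
elim: k kl => [|k IH]; first by rewrite leqn0 => /eqP ->; rewrite !subrr; exact: mbd0.
rewrite leq_eqVlt => /predU1P[->|lk]; first by rewrite !subrr; exact: mbd0.
have -> : abs_q Z k.+1 - abs_q Z l = (abs_q Z k.+1 - abs_q Z k) + (abs_q Z k - abs_q Z l).
  by rewrite addrA subrK.
have -> : abs_al k.+1 - abs_al l = (abs_al k.+1 - abs_al k) + (abs_al k - abs_al l).
  by rewrite addrA subrK.
by apply: mbdD; [exact: abs_q_step|exact: IH].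
Qed.

(** For 1 - Z = Y^2, the failure of 1 - q_k to be a square root of Y^2 is twice an increment, hence
    small. *)
Lemma abs_q_sqr Z k : 1 - Z - (1 - abs_q Z k) ^+ 2 = 2 *: (abs_q Z k - abs_q Z k.+1).
Proof.
rewrite -sqrrN opprB sqrrB1 [abs_q Z k.+1]/=.
move: (abs_q Z k) => q; move: (q ^+ 2) => W.
by apply/matrixP => i j; rewrite !mxE; field.
Qed.

Variable Y : 'M[R]_n.+1.
Hypotheses (Ysym : Y^T = Y) (Y1 : mbd Y 1).
Let Z := 1 - Y ^+ 2.

Let Z1 : mbd Z 1.
Proof.
move=> v; rewrite mul1r -(@ler_pXn2r _ 2) ?nnegrE ?nv_ge0// !nv2.
rewrite /Z mulmxBl mul1mx expr2 -mulmxA; set y := Y *m v.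
have yE : dotv v (Y *m y) = dotv y y by rewrite {1}/y -{1}Ysym -dotv_trmx.
rewrite dotvBl dotvC dotvBl (dotvC (Y *m y) (_ - _)) dotvBl yE dotvC yE.
have : dotv (Y *m y) (Y *m y) <= dotv y y.
  rewrite -!nv2 ler_pXn2r ?nnegrE ?nv_ge0//.
  by apply: le_trans (Y1 _) _; rewrite mul1r.
by have := dotv_ge0 y; move: (dotv _ _) (dotv _ _) (dotv _ _) => a b c; lra.
Qed.

(** An approximation of |Y| + Y, twice the positive part of Y. *)
Definition abs_a k : 'M[R]_n.+1 := 1 - abs_q (1 - Y ^+ 2) k + Y.

Lemma abs_a_cauchy k l : mbd (abs_a k - abs_a l) `|abs_al k - abs_al l|.
Proof.
have -> : abs_a k - abs_a l = - (abs_q Z k - abs_q Z l).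
  by apply/matrixP => i j; rewrite !mxE; ring.
exact/mbdN/abs_q_cauchy.
Qed.

Lemma mbd1 : mbd (1 : 'M[R]_n.+1) 1.
Proof. by move=> v; rewrite mul1mx mul1r. Qed.

Lemma abs_a_bound k : mbd (abs_a k) 3.
Proof.
have -> : 3 = 1 + 1 + 1 :> R by ring.
apply: mbdD => //; apply: mbdD; first exact: mbd1.
apply: mbdN; apply: mbd_le (abs_q_bound k Z1); exact: abs_al_le1.
Qed.

Lemma abs_b_pos k v : 0 <= dotv ((1 - abs_q Z k) *m v) v.
Proof.
rewrite mulmxBl mul1mx dotvBl subr_ge0 -nv2.
apply: le_trans (ler_norm _) _; apply: le_trans (mbd_dot v v (abs_q_bound k Z1)) _.
rewrite -mulrA -expr2 ler_piMl ?sqr_ge0//; exact: abs_al_le1.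
Qed.

Lemma abs_a_ge k v : dotv (Y *m v) v <= dotv (abs_a k *m v) v.
Proof. by rewrite /abs_a mulmxDl dotvDl lerDr abs_b_pos. Qed.

(** With b = 1 - q_k one has Y (b + Y) = b (b + Y) + (Y^2 - b^2): the first term gives a nonnegative
    form because b is positive, and the second is small by [abs_q_sqr]. *)
Lemma abs_a_nonneg k v w : w = abs_a k *m v ->
  - (2 * (abs_al k.+1 - abs_al k)) * nv v * nv w <= dotv (Y *m w) w.
Proof.
move=> wE; pose b := 1 - abs_q Z k.
have c : GRing.comm Y b.
  apply: commrB; [exact: commr1|apply: abs_q_comm].
  by apply: commrB; [exact: commr1|apply: commrX].
have YE : Y *m w = b *m w + (- (2 *: (abs_q Z k.+1 - abs_q Z k))) *m v.
  have <- : Y ^+ 2 - b ^+ 2 = - (2 *: (abs_q Z k.+1 - abs_q Z k)).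
    by rewrite -scalerN opprB -abs_q_sqr /Z opprB addrCA subrr addr0.
  rewrite wE !mulmxA -mulmxDl; congr (_ *m _).
  change (Y * (b + Y) = b * (b + Y) + (Y ^+ 2 - b ^+ 2)).
  have {}c : Y * b = b * Y by exact: c.
  rewrite mulrDr c [b * (b + Y)]mulrDr -!expr2.
  by rewrite [b ^+ 2 + _]addrC -addrA [b ^+ 2 + _]addrC subrK.
rewrite YE dotvDl -[leLHS]add0r; apply: lerD; first exact: abs_b_pos.
have := mbd_dot v w (mbdN (mbdZ_ge0 (ler0n _ 2) (abs_q_step k Z1))).
rewrite ler_norml => /andP[+ _]; apply: le_trans.
by rewrite !mulNr.
Qed.

End AbsoluteValue.

(** * Finite sets with and without kernels of bounded width *)

Section Blocks.
Variables (R : realType) (G : groupType).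
Local Open Scope group_scope.
Implicit Types (E F : seq G) (g h : G).

Fixpoint gball E m : seq G :=
  if m is m'.+1 then [seq g * h | g <- 1 :: E, h <- gball E m'] else [:: 1].

Lemma gballSP E m g : reflect (exists a b, [/\ a \in 1 :: E, b \in gball E m & g = a * b])
  (g \in gball E m.+1).
Proof.
apply: (iffP allpairsP) => [[[a b] [aE bE ->]]|[a [b [aE bE ->]]]]; last by exists (a, b).
by exists a, b.
Qed.

Lemma gball_mul E m m' g h : g \in gball E m -> h \in gball E m' ->
  g * h \in gball E (m + m').
Proof.
elim: m g => [|m IH] g; first by rewrite inE => /eqP ->; rewrite mul1g add0n.
move=> /gballSP[a [b [aE bE ->]]] hE; rewrite addSn -mulgA.
by apply/gballSP; exists a, (b * h); split=> //; exact: IH.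
Qed.

Lemma gball1 E m : 1 \in gball E m.
Proof.
elim: m => [|m IH]; first by rewrite inE.
by apply/gballSP; exists 1, 1; split=> //; rewrite ?mulg1// inE eqxx.
Qed.

Lemma gball_mono E m m' : (m <= m')%N -> {subset gball E m <= gball E m'}.
Proof.
move=> /subnKC <- g gE; rewrite -[g]mulg1; apply: gball_mul => //; exact: gball1.
Qed.

Local Close Scope group_scope.
Variables (n : nat) (pos : 'I_n.+1 -> G).
Implicit Types (A B : 'M[R]_n.+1).

Definition reach E A m := forall i j, A i j != 0 -> (pos i * (pos j)^-1)%g \in gball E m.

Lemma reach_le E A m m' : (m <= m')%N -> reach E A m -> reach E A m'.
Proof. by move=> mm hA i j /hA; exact: gball_mono. Qed.

Lemma reachD E A B m : reach E A m -> reach E B m -> reach E (A + B) m.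
Proof.
move=> hA hB i j; rewrite mxE; have [->|/hA//] := eqVneq (A i j) 0.
by rewrite add0r => /hB.
Qed.

Lemma reachN E A m : reach E A m -> reach E (- A) m.
Proof. by move=> hA i j; rewrite mxE oppr_eq0 => /hA. Qed.

Lemma reachZ E A a m : reach E A m -> reach E (a *: A) m.
Proof. by move=> hA i j; rewrite mxE mulf_eq0 negb_or => /andP[_ /hA]. Qed.

Lemma reachM E A B m m' : reach E A m -> reach E B m' -> reach E (A * B) (m + m').
Proof.
move=> hA hB i j; rewrite mxE => h.
have [k /= kn] : exists k, A i k * B k j != 0.
  apply/existsP; apply: contraNT h; rewrite negb_exists => /forallP h.
  by rewrite big1// => k _; apply/eqP; rewrite -[_ == _]negbK h.
move: kn; rewrite mulf_eq0 negb_or => /andP[/hA ak /hB bk].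
by have := gball_mul ak bk; rewrite -mulgA mulKg.
Qed.

Lemma reach1 E m : reach E 1 m.
Proof.
move=> i j; rewrite mxE pnatr_eq0 eqb0 negbK => /eqP ->; rewrite mulgV; exact: gball1.
Qed.

Fixpoint abs_deg (k : nat) : nat := if k is k'.+1 then 2 * abs_deg k' + 2 else 0.

Lemma reach_abs_a E Y k : reach E Y 1 -> reach E (abs_a Y k) (abs_deg k + 1).
Proof.
move=> hY; have hZ : reach E (1 - Y ^+ 2) 2.
  apply: reachD; first exact: reach1.
  by apply: reachN; rewrite expr2; exact: (reachM hY hY).
apply: reachD; last by apply: reach_le hY; rewrite leq_addl.
apply: reachD; first exact: reach1.
apply: reachN; apply: (@reach_le _ _ (abs_deg k)); first by rewrite leq_addr.
elim: k => [|k IH] /=; first by move=> i j; rewrite mxE eqxx.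
apply: reachZ; apply: reachD; first by apply: reach_le hZ; rewrite leq_addl.
apply: (@reach_le _ _ (abs_deg k + abs_deg k)); last by rewrite expr2; exact: reachM.
by rewrite mul2n addnn leq_addr.
Qed.

Definition near_in F (w : 'I_n.+1 -> R) :=
  exists y, forall i, w i != 0 -> (pos i * y^-1)%g \in F.

Definition kernel_at E F (e : R) := exists vs : seq {ffun 'I_n.+1 -> R},
  [/\ {in vs, forall v : {ffun 'I_n.+1 -> R}, near_in F v},
     forall i, gram vs i i <= 1 + e &
     forall i j, (pos i * (pos j)^-1)%g \in E -> 1 - 2 * e <= gram vs i j].

(** Y is normalised to a contraction, as the approximation of |Y| requires; th measures both its
    positivity at xi and its negativity on localised vectors. *)
Definition block E F (th : R) (Y : 'M[R]_n.+1) (xi : 'cV[R]_n.+1) :=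
  [/\ Y^T = Y, mbd Y 1, reach E Y 1, nv xi = 1 /\ th <= dotv (Y *m xi) xi &
    forall w : 'cV[R]_n.+1, near_in F (w^~ 0) -> dotv (Y *m w) w <= - th * dotv w w].

Lemma dotv_delta m (u : 'cV[R]_m) j : dotv u (delta_mx j 0) = u j 0.
Proof.
rewrite /dotv (bigD1 j)//= mxE !eqxx mulr1 big1 ?addr0// => i ij.
by rewrite mxE (negbTE ij) mulr0.
Qed.

Lemma mulmx_delta m (A : 'M[R]_m) i j : (A *m (delta_mx i 0 : 'cV[R]_m)) j 0 = A j i.
Proof. by rewrite -colE mxE. Qed.

(** Schur test: Cauchy-Schwarz on each row with weights sqrt(T i j), after which symmetry turns
    column sums into row sums. *)
Lemma mbd_rows (T : 'M[R]_n.+1) c : T^T = T -> 0 <= c -> (forall i j, 0 <= T i j) ->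
  (forall i, \sum_j T i j <= c) -> mbd T c.
Proof.
move=> Tsym c0 T0 Tc v.
rewrite -(@ler_pXn2r _ 2) ?nnegrE ?mulr_ge0 ?nv_ge0// exprMn !nv2.
apply: (@le_trans _ _ (\sum_i c * \sum_j T i j * v j 0 ^+ 2)).
  apply: ler_sum => i _; rewrite -expr2.
  pose a : 'cV[R]_n.+1 := \col_j Num.sqrt (T i j).
  pose b : 'cV[R]_n.+1 := \col_j (Num.sqrt (T i j) * v j 0).
  have -> : (T *m v) i 0 = dotv a b.
    by rewrite mxE; apply: eq_bigr => j _; rewrite !mxE mulrA -expr2 sqr_sqrtr.
  rewrite -real_normK ?num_real//.
  apply: (@le_trans _ _ ((nv a * nv b) ^+ 2)).
    by rewrite ler_pXn2r ?nnegrE ?mulr_ge0 ?nv_ge0//; exact: dotv_CS.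
  have -> : \sum_j T i j * v j 0 ^+ 2 = dotv b b.
    by apply: eq_bigr => j _; rewrite !mxE mulrACA -!expr2 sqr_sqrtr.
  rewrite exprMn !nv2 ler_wpM2r ?dotv_ge0//; apply: le_trans (Tc i).
  by apply: ler_sum => j _; rewrite !mxE -expr2 sqr_sqrtr.
rewrite -mulr_sumr exchange_big /= expr2 -mulrA ler_wpM2l// /dotv mulr_sumr.
apply: ler_sum => j _; rewrite -mulr_suml -expr2 ler_wpM2r ?sqr_ge0//.
apply: le_trans (Tc j); rewrite le_eqVlt; apply/orP; left; apply/eqP.
by apply: eq_bigr => i _; rewrite -{1}Tsym mxE.
Qed.

(** Conjugating the dual weights r by the diagonal matrix of square roots of d gives T, whose form
    is at most 1 on localised unit vectors but larger at the direction of the vector of these square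
    roots. Subtracting a scalar in between and dividing by a bound of the norm gives Y. *)
Lemma kernel_or_block E F (e : R) : injective pos ->
  0 < e -> e < 1 -> {subset 1%g :: E <= F} -> (forall g, g \in E -> g^-1%g \in E) ->
  kernel_at E F e \/
  exists Y xi, block E F ((e / 2) / (2 * (size E)%:R + 3)) Y xi.
Proof.
move=> posI e0 e1 EF EV.
pose tube i j := (pos i * (pos j)^-1)%g \in E.
pose L := [set v : {ffun 'I_n.+1 -> R} | near_in F v].
have tubeC : symmetric tube.
  have h i j : tube i j -> tube j i by move=> /EV; rewrite invgM invgK.
  by move=> i j; apply/idP/idP; exact: h.
have LZ (v : {ffun 'I_n.+1 -> R}) (a : R) : L v -> 0 <= a -> L [ffun i => a * v i].
  by move=> [y hy] _; exists y => i; rewrite ffunE mulf_eq0 negb_or => /andP[_ /hy].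
have [[vs [h1 h2 h3]]|[r [d [r0 rt rC d0 [rL rd]]]]] :=
  gram_alternative tubeC LZ e0 e1; first by left; exists vs.
right; pose s i := Num.sqrt (d i).
have s0 i : 0 < s i by rewrite sqrtr_gt0.
have s2 i : s i ^+ 2 = d i by rewrite sqr_sqrtr// ltW.
pose T : 'M[R]_n.+1 := \matrix_(i, j) (r i j / (s i * s j)).
have T0 i j : 0 <= T i j by rewrite mxE divr_ge0// mulr_ge0// ltW.
have Tsym : T^T = T by apply/matrixP => i j; rewrite !mxE rC (mulrC (s j)).
have TE (w : 'cV[R]_n.+1) : dotv (T *m w) w =
    \sum_i \sum_j r i j * ((w i 0 / s i) * (w j 0 / s j)).
  apply: eq_bigr => i _; rewrite mxE mulr_suml; apply: eq_bigr => j _.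
  by rewrite mxE; field; rewrite !gt_eqF.
have Tloc (w : 'cV[R]_n.+1) : near_in F (w^~ 0) -> dotv (T *m w) w <= dotv w w.
  move=> [y hy]; have := rL [ffun i => w i 0 / s i].
  have Lw : L [ffun i => w i 0 / s i].
    by exists y => i; rewrite ffunE mulf_eq0 negb_or => /andP[/hy].
  move=> /(_ Lw); rewrite TE; under eq_bigr do under eq_bigr do rewrite !ffunE.
  move=> /le_trans; apply; apply: ler_sum => i _; rewrite ffunE -s2 expr_div_n.
  by rewrite mulrCA divff ?mulr1 ?expr2// mulf_neq0// gt_eqF.
(* Tested on a sum of two delta vectors, which is localised because F contains 1 and E. *)
have T2 i j : T i j <= 2.
  have [tij|/rt rij] := boolP (tube i j); last by rewrite mxE rij mul0r.
  have := Tloc (delta_mx i 0 + delta_mx j 0).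
  have nr : near_in F ((delta_mx i 0 + delta_mx j 0 : 'cV[R]_n.+1)^~ 0).
    exists (pos j) => k; rewrite !mxE !andbT => h.
    have [/eqP ->|] := boolP (k == j).
      by rewrite mulgV EF// inE eqxx.
    move=> /negbTE kj; move: h; rewrite kj addr0 pnatr_eq0 eqb0 negbK => /eqP ->.
    by apply: EF; rewrite inE orbC; apply/orP; left.
  move=> /(_ nr); rewrite mulmxDr !dotvDl !dotvDr !dotv_delta !mulmx_delta !mxE !eqxx /=.
  have := T0 i i; have := T0 j j; rewrite !andbT.
  have : r j i / (s j * s i) = r i j / (s i * s j) by rewrite rC (mulrC (s j)).
  move=> ->; rewrite !mxE.
  by case: (i == j); case: (j == i); rewrite /=; lra.
pose N : R := (size E)%:R.
have N0 : 0 <= N by [].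
(* As [pos] is injective, a row has at most one entry for each element of E. *)
have Trow i : \sum_j T i j <= 2 * N.
  apply: (@le_trans _ _ (\sum_j \sum_(g <- E) 2 * (pos j == (g^-1 * pos i)%g)%:R)).
    apply: ler_sum => j _; have [tij|/rt rij] := boolP (tube i j); last first.
      by rewrite mxE rij mul0r; apply: sumr_ge0 => ? _; rewrite mulr_ge0.
    rewrite (big_rem _ tij) /= invgM invgK -mulgA mulVg mulg1 eqxx mulr1.
    by apply: le_trans (T2 i j) _; rewrite lerDl; apply: sumr_ge0 => ? _; rewrite mulr_ge0.
  rewrite exchange_big /= /N -sum1_size natr_sum mulr_sumr; apply: ler_sum => g _.
  rewrite mulr1; have [j /eqP jE|none] := pickP (fun j => pos j == (g^-1 * pos i)%g).
    rewrite (bigD1 j)//= jE eqxx mulr1 big1 ?addr0// => k kj.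
    by rewrite -jE (inj_eq posI) (negbTE kj) mulr0.
  by rewrite big1// => j _; rewrite none mulr0.
have TN : mbd T (2 * N) by apply: mbd_rows => //; rewrite mulr_ge0.
pose c := 2 * N + 3; have c0 : 0 < c by rewrite /c; lra.
(* Halfway between the bound 1 on localised vectors and the value 1 + e which is reached at the
   vector of square roots. *)
pose k := 1 + e / 2.
pose Y := c^-1 *: (T - k%:M).
have cV0 : 0 <= c^-1 by rewrite invr_ge0 ltW.
have YE w : dotv (Y *m w) w = c^-1 * (dotv (T *m w) w - k * dotv w w).
  by rewrite -scalemxAl dotvZl mulmxBl mul_scalar_mx dotvBl dotvZl.
pose D := \sum_i d i.
have D0 : 0 < D.
  rewrite /D (bigD1 ord0)//= ltr_wpDr// sumr_ge0// => i _; exact: ltW.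
pose sv : 'cV[R]_n.+1 := \col_i s i.
have svD : dotv sv sv = D by apply: eq_bigr => i _; rewrite !mxE -expr2 s2.
have nvD : nv sv ^+ 2 = D by rewrite nv2.
have nv0 : 0 < nv sv by rewrite lt0r nv_ge0 andbT; apply: contraTneq D0 => h; rewrite -nvD h expr0n ltxx.
exists Y, ((nv sv)^-1 *: sv); split.
- by rewrite linearZ /= linearB /= Tsym tr_scalar_mx.
- apply: (@mbd_le _ _ _ (c^-1 * c)); first by rewrite mulVf// gt_eqF.
  apply: mbdZ_ge0 => //; apply: (@mbd_le _ _ _ (2 * N + `|k|)).
    by rewrite /c /k ger0_norm; lra.
  apply: mbdD => //; apply: mbdN => v; rewrite mul_scalar_mx nvZ; exact: lexx.
- move=> i j; have [-> _|ij Yij] := eqVneq i j; first by rewrite mulgV gball1.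
  have tij : tube i j.
    apply: contraNT Yij => /rt h.
    by rewrite !mxE h (negbTE ij) mul0r mulr0n subrr mulr0.
  apply/gballSP; exists (pos i * (pos j)^-1)%g, 1%g.
  by rewrite mulg1; split=> //; rewrite ?inE ?eqxx// orbC; apply/orP; left.
- split; first by rewrite nvZ ger0_norm ?invr_ge0 ?ltW// mulVf// gt_eqF.
  rewrite YE -scalemxAr !(dotvZl, dotvZr) svD TE.
  have -> : \sum_i \sum_j r i j * (sv i 0 / s i * (sv j 0 / s j)) = \sum_i \sum_j r i j.
    apply: eq_bigr => i _; apply: eq_bigr => j _.
    by rewrite !mxE !divff ?mulr1// gt_eqF.
  move: rd; rewrite -/D; set S := \sum_i \sum_j _ => rd.
  rewrite [leRHS]mulrC [leLHS]mulrC -/c [leLHS]mulrC ler_pM2r ?invr_gt0//.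
  have -> : (nv sv)^-1 * ((nv sv)^-1 * S) - k * ((nv sv)^-1 * ((nv sv)^-1 * D)) = S / D - k.
    by rewrite -nvD; field; rewrite gt_eqF.
  have : 1 + e <= S / D; last by rewrite /k; lra.
  rewrite ler_pdivlMr//; have : (1 + e) * D <= (1 + e) * ((1 - e) * S).
    by rewrite ler_wpM2l//; lra.
  move=> /le_trans; apply.
  have S0 : 0 <= S by apply: sumr_ge0 => ? _; apply: sumr_ge0.
  have -> : (1 + e) * ((1 - e) * S) = S - e ^+ 2 * S by ring.
  by rewrite gerBl mulr_ge0// sqr_ge0.
- move=> w /Tloc h; rewrite YE -/c.
  have -> : - (e / 2 / c) * dotv w w = c^-1 * (- (e / 2) * dotv w w) by ring.
  by rewrite ler_wpM2l// /k; lra.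
Qed.

End Blocks.

(** * Norms and sums *)

Section ComplexModulus.
Variable R : realType.
Local Notation C := (R[i]).
Implicit Types z w : C.

Definition mag z : R := Re `|z|.

Lemma magE z : `|z| = (mag z)%:C%C.
Proof. by rewrite /mag RRe_real// ger0_real. Qed.

Lemma mag_ge0 z : 0 <= mag z.
Proof. by rewrite -lecR rmorph0 -magE. Qed.

Lemma magM z w : mag (z * w) = mag z * mag w.
Proof. by apply: complexI; rewrite rmorphM /= -!magE normrM. Qed.

Lemma magD z w : mag (z + w) <= mag z + mag w.
Proof. by rewrite -lecR rmorphD /= -!magE ler_normD. Qed.

Lemma magN z : mag (- z) = mag z.
Proof. by rewrite /mag normrN. Qed.

Lemma mag0 : mag 0 = 0. Proof. by rewrite /mag normr0. Qed.

Lemma magC (a : R) : mag a%:C%C = `|a|.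
Proof. by apply: complexI; rewrite -magE normc_def /= expr0n addr0 sqrtr_sqr. Qed.

Lemma mag_conj z : mag (z^*%C) = mag z.
Proof. by apply: complexI; rewrite -!magE !normc_def; case: z => a b /=; rewrite sqrrN. Qed.

Lemma mag2 z : mag z ^+ 2 = sqn z.
Proof. by apply: complexI; rewrite rmorphXn /= -magE -sqnC. Qed.

Lemma mag_sum (I : Type) (r : seq I) (P : pred I) (f : I -> C) :
  mag (\sum_(i <- r | P i) f i) <= \sum_(i <- r | P i) mag (f i).
Proof.
elim/big_ind2: _ => //; first by rewrite mag0.
by move=> a b c d h1 h2; apply: le_trans (magD _ _) (lerD h1 h2).
Qed.

Lemma Re_le_mag z : `|Re z| <= mag z.
Proof.
rewrite -(@ler_pXn2r _ 2) ?nnegrE ?mag_ge0// real_normK ?num_real// mag2 sqnE.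
by rewrite lerDl sqr_ge0.
Qed.

Lemma Im_le_mag z : `|Im z| <= mag z.
Proof.
rewrite -(@ler_pXn2r _ 2) ?nnegrE ?mag_ge0// real_normK ?num_real// mag2 sqnE.
by rewrite lerDr sqr_ge0.
Qed.

Lemma mag_le_ReIm z : mag z <= `|Re z| + `|Im z|.
Proof.
rewrite -(@ler_pXn2r _ 2) ?nnegrE ?mag_ge0 ?addr_ge0// mag2 sqnE sqrrD.
rewrite !real_normK ?num_real// -addrA lerD2l lerDr.
by rewrite mulrn_wge0// mulr_ge0.
Qed.

End ComplexModulus.

Section RealNorm.
Variables (R : realType) (V : normedModType R[i]).
Implicit Types x y : V.

(* Norms of complex vector spaces take their values in R[i]. *)
Definition nm x : R := Re `|x|.

Lemma nmE x : `|x| = (nm x)%:C%C.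
Proof. by rewrite /nm RRe_real// ger0_real. Qed.

Lemma nm_ge0 x : 0 <= nm x.
Proof. by rewrite -lecR rmorph0 -nmE. Qed.

Lemma nmD x y : nm (x + y) <= nm x + nm y.
Proof. by rewrite -lecR rmorphD /= -!nmE ler_normD. Qed.

Lemma nmN x : nm (- x) = nm x.
Proof. by rewrite /nm normrN. Qed.

Lemma nmB x y : nm (x - y) <= nm x + nm y.
Proof. by rewrite -(nmN y) nmD. Qed.

Lemma nmZ (c : R[i]) x : nm (c *: x) = mag c * nm x.
Proof. by apply: complexI; rewrite rmorphM /= -magE -!nmE normrZ. Qed.

Lemma nmZr (a : R) x : nm (a%:C%C *: x) = `|a| * nm x.
Proof. by rewrite nmZ magC. Qed.

Lemma nm0 : nm (0 : V) = 0. Proof. by rewrite /nm normr0. Qed.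

Lemma nm_eq0 x : nm x = 0 -> x = 0.
Proof. by move=> h; apply/normr0_eq0; rewrite nmE h. Qed.

Lemma nm_sum (I : Type) (r : seq I) (P : pred I) (f : I -> V) :
  nm (\sum_(i <- r | P i) f i) <= \sum_(i <- r | P i) nm (f i).
Proof.
elim/big_ind2: _ => //; first by rewrite nm0.
by move=> a b c d h1 h2; apply: le_trans (nmD _ _) (lerD h1 h2).
Qed.

Lemma nm_distC x y : nm (x - y) = nm (y - x).
Proof. by rewrite -opprB nmN. Qed.

End RealNorm.

Section FiniteSums.
Variables (R : realType) (X : choiceType).

Lemma nsum_sum (I : Type) (r : seq I) (f : I -> X -> R) :
  (forall i x, 0 <= f i x) ->
  nsum (fun x => \sum_(i <- r) f i x) = (\sum_(i <- r) nsum (f i))%E.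
Proof.
move=> f0; elim: r => [|i r IH].
  by rewrite big_nil /nsum esum1// => x _; rewrite big_nil.
rewrite big_cons -IH -nsumD//; last by move=> x; apply: sumr_ge0.
by congr nsum; apply/funext => x; rewrite big_cons.
Qed.

Lemma nsum_ge_seq (s : seq X) (f : X -> R) : uniq s -> (forall x, 0 <= f x) ->
  ((\sum_(x <- s) f x)%:E <= nsum f)%E.
Proof.
move=> us f0; have := nsum_finset_le f0 (finite_seq s).
by rewrite -fsbig_seq.
Qed.

Lemma nsum_le_seq (f : X -> R) (c : R) : 
  (forall s : seq X, uniq s -> \sum_(x <- s) f x <= c) -> (nsum f <= c%:E)%E.
Proof.
move=> h; apply: nsum_le => A fA; rewrite lee_fin fsbig_finite//=.
exact: h.
Qed.

Lemma sum_supp_le (s r : seq X) (f : X -> R) : uniq s -> (forall x, 0 <= f x) ->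
  (forall x, x \notin r -> f x = 0) -> \sum_(x <- s) f x <= \sum_(x <- r) f x.
Proof.
move=> us f0 fr.
rewrite (bigID (mem r)) /= [X in _ + X]big1 ?addr0; last by move=> x; exact: fr.
rewrite -big_filter; have : {subset [seq x <- s | x \in r] <= r}.
  by move=> x; rewrite mem_filter => /andP[].
move: (filter_uniq (mem r) us) => {us fr}.
move: [seq x <- s | x \in r] => q; elim: q r => [|x q IH] r uq sub.
  by rewrite big_nil; apply: sumr_ge0.
have xr : x \in r by apply: sub; rewrite inE eqxx.
rewrite big_cons (big_rem _ xr) /= lerD2l; move: uq => /= /andP[xq uq].
apply: IH => // y yq; have := sub y; rewrite inE yq orbT => /(_ isT) yr.
have := perm_mem (perm_to_rem xr) y; rewrite yr inE => /esym /orP[/eqP e|//].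
by move: xq; rewrite -e yq.
Qed.

Lemma nsum_supp (r : seq X) (f : X -> R) : uniq r -> (forall x, 0 <= f x) ->
  (forall x, x \notin r -> f x = 0) -> nsum f = (\sum_(x <- r) f x)%:E.
Proof.
move=> ur f0 fr; apply/eqP; rewrite eq_le nsum_ge_seq// andbT.
by apply: nsum_le_seq => s us; exact: sum_supp_le.
Qed.

Lemma nsum_approx (f : X -> R) (e : R) : (forall x, 0 <= f x) -> (nsum f < +oo)%E -> 0 < e ->
  exists s : seq X, uniq s /\ (nsum (fun x => if x \in s then 0 else f x)%R <= e%:E)%E.
Proof.
move=> f0 foo e0; have fin := nsum_fin f0 foo.
have : (nsum f - e%:E < nsum f)%E.
  by rewrite lteBlDr// lteDl// lte_fin.
rewrite {2}/nsum => /ereal_sup_gt[_ [A [fA _] <-]].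
rewrite fsumEFin//= fsbig_finite//=.
have us := finmap.fset_uniq (fset_set A).
move: us; set s : seq X := finmap.enum_fset _ => us lt.
exists s; split=> //.
have : nsum f = (nsum (fun x => if x \in s then f x else 0)%R +
   nsum (fun x => if x \in s then 0 else f x)%R)%E.
  rewrite -nsumD; first by congr nsum; apply/funext => x; case: ifP; rewrite ?addr0 ?add0r.
    by move=> x; case: ifP.
  by move=> x; case: ifP.
rewrite (@nsum_supp s (fun x => if x \in s then f x else 0))//; first last.
- by move=> x /negbTE ->.
- by move=> x; case: ifP.
rewrite big_seq_cond (eq_bigr f) => [|x /andP[-> _]//]; rewrite -big_seq_cond.
move: lt; set S := (\sum_(x <- _) f x)%:E => lt eqn.
move: lt; rewrite eqn; set N := nsum _ => lt.
have Nfin : N \is a fin_num.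
  apply: nsum_fin; first by move=> x; case: ifP.
  by apply: le_lt_trans foo; apply: le_nsum => x; case: ifP.
move: lt; rewrite -(fineK Nfin) /S -!EFinD lte_fin lee_fin; lra.
Qed.

End FiniteSums.

Section L2Vectors.
Variables (R : realType) (X : choiceType).
Local Notation C := (R[i]).
Local Notation l2 := (l2 R X).
Implicit Types (f g : l2) (s : seq X) (x y : X).

Lemma nm_l2 f : nm f = Num.sqrt (l2_sq f).
Proof. by []. Qed.

Lemma nm2_l2 f : nm f ^+ 2 = l2_sq f.
Proof. by rewrite nm_l2 sqr_sqrtr// l2_sq_ge0. Qed.

Lemma l2_sq_nsum f : (l2_sq f)%:E = nsum (fun x => sqn (f x)).
Proof. by rewrite /l2_sq fineK// nsum_fin// ?l2_fin// => x; exact: sqn_ge0. Qed.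

Lemma l2_sq_le f (c : R) : (nsum (fun x => sqn (f x)) <= c%:E)%E -> l2_sq f <= c.
Proof. by rewrite -l2_sq_nsum lee_fin. Qed.

Lemma nm_l2_le f (c : R) : 0 <= c -> (nsum (fun x => sqn (f x)) <= (c ^+ 2)%:E)%E -> nm f <= c.
Proof.
move=> c0 /l2_sq_le h; rewrite -(@ler_pXn2r _ 2) ?nnegrE ?nm_ge0//.
by rewrite nm2_l2.
Qed.

Lemma nm_coord f x : mag (f x) <= nm f.
Proof.
rewrite -(@ler_pXn2r _ 2) ?nnegrE ?nm_ge0 ?mag_ge0// mag2 nm2_l2.
exact: l2_sq_coord.
Qed.

Lemma sqn0 : sqn (0 : C) = 0.
Proof. by rewrite -mag2 mag0 expr0n. Qed.

Lemma l2_supp_subproof s (h : X -> C) : (fun x => if x \in s then h x else 0) \in @l2_pred R X.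
Proof.
rewrite inE /=; rewrite (@nsum_supp _ _ (undup s)) ?undup_uniq ?ltry//.
  by move=> x; exact: sqn_ge0.
by move=> x; rewrite mem_undup => /negbTE ->; exact: sqn0.
Qed.

Definition l2_supp s (h : X -> C) : l2 := L2 (l2_supp_subproof s h).

Definition delta x : l2 := l2_supp [:: x] (fun=> 1).

Lemma deltaE x y : delta x y = (y == x)%:R.
Proof. by rewrite /delta /= inE; case: eqP. Qed.

Lemma l2E f g : (forall x, f x = g x) -> f = g.
Proof. by move=> fg; apply/val_inj/funext. Qed.

Lemma l2_addE f g x : (f + g) x = f x + g x. Proof. by []. Qed.
Lemma l2_scaleE (c : C) f x : (c *: f) x = c * f x. Proof. by []. Qed.
Lemma l2_oppE f x : (- f) x = - f x. Proof. by []. Qed.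
Lemma l2_zeroE x : (0 : l2) x = 0. Proof. by []. Qed.

Lemma l2_sumE (I : Type) (r : seq I) (P : pred I) (F : I -> l2) x :
  (\sum_(i <- r | P i) F i) x = \sum_(i <- r | P i) F i x.
Proof.
elim: r => [|i r IH]; rewrite ?big_nil// !big_cons.
by case: ifP => //; rewrite l2_addE IH.
Qed.

Lemma l2_supp_sum s h : uniq s -> l2_supp s h = \sum_(x <- s) h x *: delta x.
Proof.
move=> us; apply: l2E => y; rewrite l2_sumE [LHS]/=.
under eq_bigr do rewrite l2_scaleE deltaE; case: ifP => [ys|/negbT ys].
  rewrite (bigD1_seq y)//= eqxx mulr1 big1 ?addr0// => x /negbTE xy.
  by rewrite eq_sym xy mulr0.
rewrite big_seq big1// => x xs; case: eqP => [yx|]; last by rewrite mulr0.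
by move: ys; rewrite yx xs.
Qed.

Lemma l2_sq_supp s f : uniq s -> (forall x, x \notin s -> f x = 0) ->
  l2_sq f = \sum_(x <- s) sqn (f x).
Proof.
move=> us fs; apply: EFin_inj; rewrite l2_sq_nsum; apply: nsum_supp => //.
- by move=> x; exact: sqn_ge0.
- by move=> x /fs ->; exact: sqn0.
Qed.

Lemma nm_delta x : nm (delta x) = 1.
Proof.
rewrite nm_l2 (@l2_sq_supp [:: x])//; last by move=> y; rewrite inE deltaE => /negbTE ->.
by rewrite big_seq1 deltaE eqxx -mag2 magC normr1 expr1n sqrtr1.
Qed.

Lemma l2_sqB_supp s f : (l2_sq (f - l2_supp s f))%:E =
  nsum (fun x => if x \in s then 0 else sqn (f x)).
Proof.
rewrite l2_sq_nsum; congr nsum; apply/funext => x.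
rewrite l2_addE l2_oppE /=; case: ifP => _; first by rewrite subrr sqn0.
by rewrite subr0.
Qed.

Lemma l2_approx f (e : R) : 0 < e -> exists s, uniq s /\ nm (f - l2_supp s f) <= e.
Proof.
move=> e0; have [|||s [us hs]] := @nsum_approx R X (fun x => sqn (f x)) (e ^+ 2).
- by move=> x; exact: sqn_ge0.
- exact: l2_fin.
- by rewrite exprn_gt0.
exists s; split=> //; rewrite -(@ler_pXn2r _ 2) ?nnegrE ?nm_ge0 ?(ltW e0)// nm2_l2.
by rewrite -lee_fin l2_sqB_supp.
Qed.

Lemma nm_supp_le s f : nm (l2_supp s f) <= nm f.
Proof.
apply: nm_l2_le; first exact: nm_ge0.
rewrite nm2_l2 l2_sq_nsum; apply: le_nsum => x /=; case: ifP => // _.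
by rewrite sqn0 sqn_ge0.
Qed.

Lemma nm_cosupp_le s f : nm (f - l2_supp s f) <= nm f.
Proof.
apply: nm_l2_le; first exact: nm_ge0.
rewrite nm2_l2 l2_sq_nsum; apply: le_nsum => x.
rewrite l2_addE l2_oppE /=; case: ifP => // _.
  by rewrite subrr sqn0 sqn_ge0.
by rewrite subr0.
Qed.

Lemma mag_inner_le f g : mag (l2_inner f g) <= nm f * nm g.
Proof.
set z := l2_inner f g; have [z0|zn0] := eqVneq (mag z) 0.
  by rewrite z0 mulr_ge0// nm_ge0.
have zp : 0 < mag z by rewrite lt0r zn0 mag_ge0.
rewrite -(ler_pM2l zp) -expr2.
have -> : mag z ^+ 2 = Re (l2_inner (z^*%C *: f) g).
  by rewrite l2_innerZl mag2 sqnE -/z; case: z {zn0 zp} => a b /=; ring.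
apply: le_trans (l2_CS _ _) _; rewrite -!nm_l2 nmZ mag_conj mulrA.
exact: lexx.
Qed.

Lemma inner_delta f x : l2_inner f (delta x) = f x.
Proof.
rewrite /l2_inner /csum /rsum.
have h (p : C -> R) : p 0 = 0 ->
    fine (nsum (fun y => Num.max (p (f y * (delta x y)^*%C)) 0)) -
    fine (nsum (fun y => Num.max (- p (f y * (delta x y)^*%C)) 0)) = p (f x).
  move=> p0; rewrite !(@nsum_supp _ _ [:: x])//.
  - have c1 : ((true%:R : C)^*)%C = 1 by rewrite /= oppr0.
    by rewrite !big_seq1 !deltaE eqxx c1 mulr1 -pos_negE.
  - by move=> y; rewrite le_max lexx orbT.
  - by move=> y; rewrite inE deltaE => /negbTE ->; rewrite rmorph0 mulr0 p0 oppr0 maxxx.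
  - by move=> y; rewrite le_max lexx orbT.
  - by move=> y; rewrite inE deltaE => /negbTE ->; rewrite rmorph0 mulr0 p0 maxxx.
by rewrite (h (@complex.Re R))// (h (@complex.Im R))//; case: (f x).
Qed.

End L2Vectors.

Section MatrixOnL2.
Variables (R : realType) (X : choiceType) (n : nat).

Lemma sqn_mat (A : 'M[R]_n) c (z : 'I_n -> R[i]) : mbd A c -> 
  \sum_i sqn (\sum_j (A i j)%:C%C * z j) <= c ^+ 2 * \sum_j sqn (z j).
Proof.
move=> hA.
pose a : 'cV[R]_n := \col_j Re (z j); pose b : 'cV[R]_n := \col_j Im (z j).
have part (p : R[i] -> R) : (forall u v, p (u + v) = p u + p v) -> p 0 = 0 ->
    (forall r u, p (r%:C%C * u) = r * p u) ->
    forall i, p (\sum_j (A i j)%:C%C * z j) = (A *m \col_j p (z j)) i 0.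
  move=> pD p0 pZ i; rewrite (big_morph p pD p0) mxE.
  by apply: eq_bigr => j _; rewrite pZ mxE.
have RE : forall i, Re (\sum_j (A i j)%:C%C * z j) = (A *m a) i 0.
  by apply: (part (@complex.Re R)) => [[? ?] [? ?]||r [? ?]]//=; rewrite mul0r subr0.
have IE : forall i, Im (\sum_j (A i j)%:C%C * z j) = (A *m b) i 0.
  by apply: (part (@complex.Im R)) => [[? ?] [? ?]||r [? ?]]//=; rewrite mul0r addr0.
under eq_bigr do rewrite sqnE RE IE; rewrite big_split /=.
have -> : \sum_j sqn (z j) = nv a ^+ 2 + nv b ^+ 2.
  rewrite !nv2 -big_split; apply: eq_bigr => j _.
  by rewrite sqnE !mxE !expr2.
have h (v : 'cV[R]_n) : \sum_i (A *m v) i 0 ^+ 2 <= c ^+ 2 * nv v ^+ 2.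
  have -> : \sum_i (A *m v) i 0 ^+ 2 = nv (A *m v) ^+ 2.
    by rewrite nv2; apply: eq_bigr => i _; rewrite expr2.
  by rewrite -exprMn ler_pXn2r ?nnegrE ?nv_ge0// (le_trans (nv_ge0 _) (hA v)).
by rewrite mulrDr; apply: lerD.
Qed.

(** The matrix acts separately at each point of X, so tensoring it with the identity does not
    increase its norm. *)
Lemma l2_mat (A : 'M[R]_n) c (y : 'I_n -> l2 R X) : mbd A c ->
  \sum_i l2_sq (\sum_j (A i j)%:C%C *: y j) <= c ^+ 2 * \sum_j l2_sq (y j).
Proof.
move=> hA; rewrite -lee_fin EFinM -!sumEFin.
under eq_bigr do rewrite l2_sq_nsum; under [in leRHS]eq_bigr do rewrite l2_sq_nsum.
rewrite -!nsum_sum; try by move=> *; exact: sqn_ge0.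
rewrite -nsumZ ?sqr_ge0//; last by move=> x; apply: sumr_ge0 => *; exact: sqn_ge0.
apply: le_nsum => x; apply: le_trans (sqn_mat _ hA).
rewrite le_eqVlt; apply/orP; left; apply/eqP; apply: eq_bigr => i _.
by rewrite l2_sumE; congr sqn; apply: eq_bigr => j _; rewrite l2_scaleE.
Qed.

End MatrixOnL2.

Section UnitaryReps.
Variables (R : realType) (G : groupType) (H : hilbertType R) (U : unitary_rep G H).
Implicit Types (v w : H) (g : G).

Lemma urep_add g v w :
  U g (v + w) = U g v + U g w.
Proof. by have := urep_linear U g 1 v w; rewrite !scale1r. Qed.

Lemma urep_0 g : U g 0 = 0.
Proof. by have := urep_linear U g (-1) 0 0; rewrite !scaleN1r !addNr. Qed.

Lemma urep_scale g c v :
  U g (c *: v) = c *: U g v.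
Proof. by have := urep_linear U g c v 0; rewrite !addr0 urep_0 addr0. Qed.

Lemma urep_sum g (I : Type) (r : seq I)
    (v : I -> H) :
  U g (\sum_(i <- r) v i) = \sum_(i <- r) U g (v i).
Proof. by apply: big_morph; [exact: urep_add|exact: urep_0]. Qed.

Lemma nm_urep g v : nm (U g v) = nm v.
Proof.
apply/eqP; rewrite -(@eqrXn2 _ 2) ?nm_ge0//; apply/eqP; apply: complexI.
by rewrite !rmorphXn /= -!nmE -!inner_norm urep_inner.
Qed.

End UnitaryReps.

(** * From (AP) to property A *)

Section SchurForms.
Variables (R : realType) (G : groupType).
Local Notation C := (R[i]).
Local Notation HG := (l2 R G).
Local Notation lam := (left_regular R G).
Implicit Types (f x y : HG).

Lemma lamE g f h : lam g f h = f (g^-1 * h)%g.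
Proof. by []. Qed.

Lemma lam_delta g h : lam g (delta R h) = delta R (g * h)%g.
Proof. by apply: l2E => k; rewrite lamE !deltaE (can2_eq (mulVKg g) (mulKg g)). Qed.

Lemma sum_normsq (V : normedModType C) (I : Type) (r : seq I) (v : I -> V) :
  \sum_(i <- r) `|v i| ^+ 2 = (\sum_(i <- r) nm (v i) ^+ 2)%:C%C.
Proof. by rewrite rmorph_sum; apply: eq_bigr => i _; rewrite rmorphXn /= -nmE. Qed.

Variables (n : nat) (pos : 'I_n -> G).

(** The quadratic form, at xi, of the Schur product of A with the kernel phi(pos i pos j^-1). *)
Definition schur_form (phi : G -> C) (A : 'M[R]_n) (xi : 'cV[R]_n) : C :=
  \sum_i \sum_j phi (pos i * (pos j)^-1)%g * (A i j * xi i 0 * xi j 0)%:C%C.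

Lemma weighted_sum_le (xi : 'cV[R]_n) (z : 'I_n -> R) (c : R) : nv xi = 1 -> 0 <= c ->
  (forall i, 0 <= z i) ->
  \sum_i z i ^+ 2 <= c ^+ 2 -> \sum_i z i * `|xi i 0| <= c.
Proof.
move=> xi1 c0 z0 zc.
pose u : 'cV[R]_n := \col_i z i; pose v : 'cV[R]_n := \col_i `|xi i 0|.
have -> : \sum_i z i * `|xi i 0| = dotv u v by apply: eq_bigr => i _; rewrite !mxE.
apply: le_trans (ler_norm _) _; apply: le_trans (dotv_CS _ _) _.
have -> : nv v = 1.
  rewrite -xi1 /nv; congr (Num.sqrt _); apply: eq_bigr => i _.
  by rewrite !mxE -!expr2 real_normK ?num_real.
rewrite mulr1 -(@ler_pXn2r _ 2) ?nnegrE ?nv_ge0// nv2.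
by apply: le_trans zc; apply: ler_sum => i _; rewrite !mxE expr2.
Qed.

(** The kernel of a coefficient has entries <lam(pos j)^-1 x, lam(pos i)^-1 y>; such a factorisation
    bounds the Schur product by |x| |y| times the norm of A. *)
Lemma schur_form_coefficient x y (A : 'M[R]_n) c xi : 0 <= c -> mbd A c -> nv xi = 1 ->
  mag (schur_form (coefficient x y) A xi) <= c * nm x * nm y.
Proof.
move=> c0 hA xi1.
pose v i : HG := \sum_j (A i j)%:C%C *: ((xi j 0)%:C%C *: lam (pos j)^-1%g x).
have -> : schur_form (coefficient x y) A xi =
    \sum_i (xi i 0)%:C%C * l2_inner (lam (pos i) (v i)) y.
  apply: eq_bigr => i _; rewrite /v urep_sum.
  have -> : forall w : 'I_n -> HG, l2_inner (\sum_j w j) y = \sum_j l2_inner (w j) y.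
    by move=> w; apply: (big_morph (fun f => l2_inner f y)) => [? ?|]; rewrite ?l2_innerDl ?l2_inner0l.
  rewrite mulr_sumr; apply: eq_bigr => j _.
  rewrite !urep_scale !l2_innerZl -urepM /coefficient !rmorphM /= -/(l2_inner _ _).
  by ring.
apply: le_trans (mag_sum _ _ _) _.
apply: (@le_trans _ _ ((\sum_i nm (v i) * `|xi i 0|) * nm y)).
  rewrite mulr_suml; apply: ler_sum => i _; rewrite magM magC [leRHS]mulrAC mulrC.
  rewrite ler_wpM2r//; apply: le_trans (mag_inner_le _ _) _.
  by rewrite (nm_urep lam).
rewrite ler_wpM2r ?nm_ge0//; apply: weighted_sum_le => // [|i|].
- by rewrite mulr_ge0 ?nm_ge0.
- exact: nm_ge0.
under eq_bigr do rewrite nm2_l2; apply: le_trans (l2_mat _ hA) _.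
rewrite exprMn ler_wpM2l ?sqr_ge0//.
have -> : \sum_j l2_sq ((xi j 0)%:C%C *: lam (pos j)^-1%g x) = nv xi ^+ 2 * nm x ^+ 2.
  rewrite nv2 mulr_suml; apply: eq_bigr => j _.
  rewrite -nm2_l2 nmZr (nm_urep lam) exprMn real_normK ?num_real//.
by rewrite xi1 expr1n mul1r.
Qed.

Lemma group_vn_lam g (a : C) : @group_vn R G (fun f => a *: lam g f).
Proof.
have lin : linear (fun f => a *: lam g f).
  by move=> c v w; rewrite urep_add urep_scale scalerDr scalerA mulrC -scalerA.
split; first split=> //.
  exists (mag a) => v; rewrite (nmE (_ : HG)) (nmE v) -rmorphM /= lecR.
  by rewrite nmZ (nm_urep lam).
move=> S [[Slin _] Scomm]; apply/funext => v /=.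
have Sg : S (lam g v) = lam g (S v).
  have /(congr1 (fun F => F v)) /= := Scomm (lam g) (ex_intro2 _ _ g I erefl).
  by [].
have S0 : S 0 = 0 by have := Slin (-1) 0 0; rewrite !scaleN1r !addNr.
by have := Slin a (lam g v) 0; rewrite S0 !addr0 Sg.
Qed.

(** A is encoded as the operator matrix with entries A i j lam(pos i pos j^-1). Diagonal unitaries
    conjugate it to A tensored with the identity, and the transposed multiplier acts on it as the
    Schur product. *)
Lemma schur_form_cb phi (A : 'M[R]_n) c xi : cb_multipliers phi -> cb_norm phi <= 1 ->
  0 <= c -> mbd A c -> nv xi = 1 -> mag (schur_form phi A xi) <= c.
Proof.
move=> cb cb1 c0 hA xi1.
suff h c' : cb_multiplier_bounds phi c' -> mag (schur_form phi A xi) <= c' * c.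
  apply/ler_addgt0Pr => e e0.
  have hS : has_inf (cb_multiplier_bounds phi).
    by split=> //; exists 0 => c' [_ [M _ []]].
  have d0 : 0 < e / (c + 1) by rewrite divr_gt0//; lra.
  have [c' hc' c'lt] := inf_adherent d0 hS.
  apply: le_trans (h c' hc') _.
  have : c' * c <= (1 + e / (c + 1)) * c.
    by rewrite ler_wpM2r// ltW// (lt_le_trans c'lt)// lerD2r.
  move=> /le_trans; apply; rewrite mulrDl mul1r lerD2l mulrAC ler_pdivrMr; last lra.
  by rewrite ler_pM2l//; lra.
move=> [phim [M Mphi [c'0 Mcb]]].
pose T i j : HG -> HG := fun f => (A i j)%:C%C *: lam (pos i * (pos j)^-1)%g f.
have vnT i j : group_vn (T i j) by exact: group_vn_lam.
(* [M] multiplies lam(g) by phi(g), as its pairings with coefficients show. *)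
have MT i j f : M (T i j) f = ((A i j)%:C%C * phi (pos i * (pos j)^-1)%g) *: lam (pos i * (pos j)^-1)%g f.
  apply: l2E => g; rewrite -!inner_delta.
  have [x' [y' e']] := phim _ (ex_intro _ f (ex_intro _ (delta R g) erefl)).
  have [_ /(_ _ _ _ _ (esym e'))] := Mphi _ (vnT i j).
  rewrite -[inner _ _ _]/(l2_inner _ _) => ->; rewrite /T -[inner _ _ _]/(l2_inner _ _) !l2_innerZl -mulrA.
  congr (_ * _); have := congr1 (fun F => F (pos i * (pos j)^-1)%g) e'.
  by move=> /esym.
have := Mcb n T vnT.
have hT : (@mx_opnorm R (l2_hilbert R G) n T <= c%:E)%E.
  apply: ge_ereal_sup => _ [x /= + <-].
  rewrite !sum_normsq /= -[1 : C]/(1%:C%C) lecR => x1; rewrite lee_fin.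
  rewrite -(@ler_pXn2r _ 2) ?nnegrE ?sqrtr_ge0// sqr_sqrtr; last first.
    by apply: sumr_ge0 => i _; exact: sqr_ge0.
  have e1 i : \sum_j T i j (x j) = lam (pos i) (\sum_j (A i j)%:C%C *: lam (pos j)^-1%g (x j)).
    rewrite urep_sum; apply: eq_bigr => j _; by rewrite urep_scale -urepM.
  under eq_bigr do rewrite e1 (nm_urep lam) nm2_l2.
  apply: le_trans (l2_mat _ hA) _; rewrite -[leRHS]mulr1 ler_wpM2l ?sqr_ge0//.
  apply: le_trans x1; apply: ler_sum => j _.
  by rewrite -nm2_l2 (nm_urep lam).
move=> /le_trans /(_ (lee_wpmul2l _ hT)); rewrite lee_fin => /(_ c'0).
pose eta i := \sum_j phi (pos i * (pos j)^-1)%g * (A i j * xi j 0)%:C%C.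
move=> hM; have {hM} : Num.sqrt (\sum_i mag (eta i) ^+ 2) <= c' * c.
  rewrite -lee_fin EFinM; apply: le_trans hM; apply: ereal_sup_ubound.
  (* lam(pos i pos j^-1) maps [delta (pos j)] to [delta (pos i)], so row i of the result is a
     multiple of a single delta vector. *)
  exists (fun j => (xi j 0)%:C%C *: delta R (pos j)).
    rewrite /= sum_normsq -[1 : C]/(1%:C%C) lecR.
    have -> : \sum_j nm ((xi j 0)%:C%C *: delta R (pos j)) ^+ 2 = nv xi ^+ 2.
      rewrite nv2; apply: eq_bigr => j _; rewrite nmZr nm_delta mulr1.
      by rewrite real_normK ?num_real// expr2.
    by rewrite xi1 expr1n.
  congr (Num.sqrt _)%:E; rewrite sum_normsq /=; apply: eq_bigr => i _.
  have -> : \sum_j M (T i j) ((xi j 0)%:C%C *: delta R (pos j)) = eta i *: delta R (pos i).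
    rewrite scaler_suml; apply: eq_bigr => j _.
    rewrite MT urep_scale lam_delta -mulgA mulVg mulg1 scalerA; congr (_ *: _).
    by rewrite rmorphM /=; ring.
  by rewrite nmZ nm_delta mulr1.
move=> hM.
have -> : schur_form phi A xi = \sum_i eta i * (xi i 0)%:C%C.
  apply: eq_bigr => i _; rewrite mulr_suml; apply: eq_bigr => j _.
  by rewrite !rmorphM /=; ring.
apply: le_trans (mag_sum _ _ _) _; under eq_bigr do rewrite magM magC.
apply: weighted_sum_le => //.
- by rewrite mulr_ge0.
- by move=> i; exact: mag_ge0.
rewrite -(@ler_pXn2r _ 2) ?nnegrE ?sqrtr_ge0 ?mulr_ge0// sqr_sqrtr in hM.
  exact: hM.
by apply: sumr_ge0 => i _; exact: sqr_ge0.
Qed.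

End SchurForms.

Section CsumFacts.
Variables (R : realType) (X : choiceType).
Local Notation C := (R[i]).

Lemma rsum_supp (s : seq X) (f : X -> R) : uniq s -> (forall x, x \notin s -> f x = 0) ->
  rsum f = \sum_(x <- s) f x.
Proof.
move=> us fs; rewrite /rsum !(@nsum_supp _ _ s)//=.
- by rewrite -sumrB; apply: eq_bigr => x _; rewrite -pos_negE.
- by move=> x; rewrite le_max lexx orbT.
- by move=> x /fs ->; rewrite oppr0 maxxx.
- by move=> x; rewrite le_max lexx orbT.
- by move=> x /fs ->; rewrite maxxx.
Qed.

Lemma csum_supp (s : seq X) (f : X -> C) : uniq s -> (forall x, x \notin s -> f x = 0) ->
  csum f = \sum_(x <- s) f x.
Proof.
move=> us fs; rewrite /csum !(@rsum_supp s)//; try by move=> x /fs ->.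
have reD : {morph (@complex.Re R) : a b / a + b} by case=> ? ? [].
have imD : {morph (@complex.Im R) : a b / a + b} by case=> ? ? [].
rewrite -(big_morph _ reD (erefl : Re (0 : C) = 0)) -(big_morph _ imD (erefl : Im (0 : C) = 0)).
by case: (\sum_(x <- s) _).
Qed.

Lemma cvg_magP (u : nat -> C) (l : C) :
  (forall e : R, 0 < e -> exists N, forall k, (N <= k)%N -> mag (l - u k) <= e) ->
  (u k : C^o) @[k --> \oo] --> (l : C^o).
Proof.
move=> h; apply/cvgrPdist_le => e e0.
have eE : e = (Re e)%:C%C by rewrite RRe_real// ger0_real// ltW.
have [|N hN] := h (Re e); first by rewrite -ltcR rmorph0 -eE.
by exists N => // k Nk; rewrite eE [leLHS]magE lecR; exact: hN.
Qed.

End CsumFacts.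

Section Budget.
Variables (R : realFieldType) (a b d e : R).

Lemma budget_gt0 : 0 <= a -> 0 <= b -> 0 < 12 * (a + b + 1) + 1.
Proof. by move=> a0 b0; lra. Qed.

Lemma budget_le : d * (12 * (a + b + 1) + 1) = e -> 0 <= d ->
  6 * (d * b) + 6 * (d * a) + e / 2 <= e.
Proof. by move=> <- d0; nra. Qed.

End Budget.

(** * The element of the predual which contradicts (AP) *)

Section NoBlocks.
Variables (R : realType) (G : groupType) (E : seq G) (th : R).
Local Notation C := (R[i]).
Hypothesis th0 : 0 < th.
Variables (N : nat -> nat) (pos : forall n, 'I_(N n).+1 -> G).
Variables (Y : forall n, 'M[R]_((N n).+1)) (xi : forall n, 'cV[R]_((N n).+1)).
Hypothesis posI : forall n, injective (@pos n).
Hypothesis blk : forall n, block (@pos n) E (gball E n) th (Y n) (xi n).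

Let xi1 n : nv (xi n) = 1. Proof. by have [_ _ _ []] := blk n. Qed.

(** Collecting the terms of a Schur form by the value of pos i pos j^-1 writes it as the pairing of
    phi with this function of g. *)
Definition diag_sum n g (A : 'M[R]_((N n).+1)) : R :=
  \sum_i \sum_j (pos i * (pos j)^-1 == g)%g%:R * (A i j * xi n i 0 * xi n j 0).

Lemma sum_le1_inj (I : finType) (P : pred I) : (forall i j, P i -> P j -> i = j) ->
  \sum_i (P i)%:R <= 1 :> R.
Proof.
move=> Pu; have [i Pi|P0] := pickP P.
  rewrite (bigD1 i)//= Pi big1 ?addr0// => j ji.
  by case: (boolP (P j)) => // Pj; move: ji; rewrite (Pu _ _ Pi Pj) eqxx.
by rewrite big1// => i _; rewrite P0.
Qed.

(** For fixed g each row and each column holds at most one pair, since [pos] is injective; 2 |xi_i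
    xi_j| <= xi_i^2 + xi_j^2 then reduces the bound to the unit norm of xi. *)
Lemma diag_sum_le n g (A : 'M[R]_((N n).+1)) (c : R) : (forall i j, `|A i j| <= c) -> `|diag_sum g A| <= c.
Proof.
move=> Ac; have c0 : 0 <= c := le_trans (normr_ge0 _) (Ac ord0 ord0 : _ <= c).
pose P (i j : 'I_(N n).+1) := (pos i * (pos j)^-1 == g)%g.
have xi2 : \sum_i xi n i 0 ^+ 2 = 1.
  by rewrite -(expr1n R 2) -(xi1 n) nv2; apply: eq_bigr => i _; rewrite expr2.
apply: (@le_trans _ _ (\sum_i \sum_j ((P i j)%:R * (c / 2) * xi n i 0 ^+ 2 +
                                      (P i j)%:R * (c / 2) * xi n j 0 ^+ 2))).
  apply: le_trans (ler_norm_sum _ _ _) _; apply: ler_sum => i _.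
  apply: le_trans (ler_norm_sum _ _ _) _; apply: ler_sum => j _.
  rewrite normrM normr_nat -!mulrA -mulrDr ler_wpM2l// mulrA -mulrDr !normrM.
  have h : `|xi n i 0| * `|xi n j 0| <= (xi n i 0 ^+ 2 + xi n j 0 ^+ 2) / 2.
    rewrite -[xi n i 0 ^+ 2]real_normK ?num_real// -[xi n j 0 ^+ 2]real_normK ?num_real//.
    by have := sqr_ge0 (`|xi n i 0| - `|xi n j 0|); nra.
  rewrite -mulrA; apply: (@le_trans _ _ (c * ((xi n i 0 ^+ 2 + xi n j 0 ^+ 2) / 2))).
    by apply: ler_pM => //; rewrite mulr_ge0.
  by rewrite -mulrDr [X in _ <= c * X]mulrC.
under eq_bigr do rewrite big_split /=; rewrite big_split /=.
have half : \sum_i c / 2 * xi n i 0 ^+ 2 = c / 2 by rewrite -mulr_sumr xi2 mulr1.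
rewrite [leRHS]splitr; apply: lerD; rewrite -[leRHS]half.
  apply: ler_sum => i _.
  rewrite -mulr_suml ler_wpM2r ?sqr_ge0// -mulr_suml ler_piMl ?divr_ge0//.
  apply: sum_le1_inj => j k; rewrite /P => /eqP <- /eqP e; apply: posI.
  by have /mulgI /invg_inj -> := e.
rewrite exchange_big /=; apply: ler_sum => j _.
rewrite -mulr_suml ler_wpM2r ?sqr_ge0// -mulr_suml ler_piMl ?divr_ge0//.
apply: (@sum_le1_inj _ (P^~ j)) => i k; rewrite /P => /eqP <- /eqP e; apply: posI.
by have /mulIg -> := e.
Qed.

Lemma schur_form_diag n (phi : G -> C) (A : 'M[R]_((N n).+1)) m S : reach (@pos n) E A m -> uniq S ->
  {subset gball E m <= S} ->
  schur_form (@pos n) phi A (xi n) = \sum_(g <- S) phi g * (diag_sum g A)%:C%C.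
Proof.
move=> hA uS mS.
under [RHS]eq_bigr do rewrite rmorph_sum mulr_sumr.
rewrite exchange_big /=; apply: eq_bigr => i _.
under [RHS]eq_bigr do rewrite rmorph_sum mulr_sumr.
rewrite exchange_big /=; apply: eq_bigr => j _.
have [Aij|/hA/mS pS] := eqVneq (A i j) 0.
  by rewrite Aij !mul0r mulr0 big1// => g _; rewrite mulr0 rmorph0 mulr0.
rewrite (bigD1_seq _ pS uS)/= eqxx mul1r big1 ?addr0// => g; rewrite eq_sym => /negbTE ->.
by rewrite mul0r rmorph0 mulr0.
Qed.

Variable U : set_system nat.
Hypotheses (UU : UltraFilter U) (Uoo : forall k, U [set n | (k <= n)%N]).

(** The matrices have varying sizes, but their coefficients all live on G, where a limit over n
    makes sense. *)
Definition qlim (D : forall n, 'M[R]_((N n).+1)) (g : G) : R :=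
  ulim U (fun n => diag_sum g (D n)).

Lemma bdd_diag (D : forall n, 'M[R]_((N n).+1)) (c : R) g : (forall n i j, `|D n i j| <= c) -> bdd (fun n => diag_sum g (D n)).
Proof. by move=> Dc; exists c => n; exact: diag_sum_le. Qed.

Lemma qlim_sum (D : forall n, 'M[R]_((N n).+1)) (c : R) S (h : G -> R) : (forall n i j, `|D n i j| <= c) -> 
  \sum_(g <- S) h g * qlim D g = ulim U (fun n => \sum_(g <- S) h g * diag_sum g (D n)).
Proof.
move=> Dc; rewrite (ulim_sum UU) => [|g]; last by apply: bddZ; exact: bdd_diag Dc.
by apply: eq_bigr => g _; rewrite (ulimZ UU)//; exact: bdd_diag Dc.
Qed.

(** The factor 2 comes from treating real and imaginary parts separately, as the limits along U are
    real. *)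
Lemma qlim_pair_le (D : forall n, 'M[R]_((N n).+1)) (c : R) m (phi : G -> C) S B : (forall n i j, `|D n i j| <= c) ->
  (forall n, reach (@pos n) E (D n) m) -> uniq S -> {subset gball E m <= S} ->
  (forall n, mag (schur_form (@pos n) phi (D n) (xi n)) <= B) ->
  mag (\sum_(g <- S) phi g * (qlim D g)%:C%C) <= 2 * B.
Proof.
move=> Dc hD uS mS hB.
have part (p : C -> R) : (forall a b, p (a + b) = p a + p b) -> p 0 = 0 ->
    (forall z r, p (z * r%:C%C) = p z * r) -> (forall z, `|p z| <= mag z) ->
    `|p (\sum_(g <- S) phi g * (qlim D g)%:C%C)| <= B.
  move=> pD p0 pZ pm; rewrite (big_morph p pD p0).
  under eq_bigr do rewrite pZ.
  rewrite (qlim_sum _ _ Dc) -(ulim_norm UU); last first.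
    by apply: bdd_sum => g; apply: bddZ; exact: bdd_diag Dc.
  apply: (ulim_le UU).
    by apply: bdd_norm; apply: bdd_sum => g; apply: bddZ; exact: bdd_diag Dc.
  apply: filterS (filterT) => n _ /=; apply: le_trans (hB n).
  rewrite (schur_form_diag phi (hD n) uS mS); apply: le_trans (pm _).
  by rewrite (big_morph p pD p0); under [in leRHS]eq_bigr do rewrite pZ.
apply: le_trans (mag_le_ReIm _) _; rewrite mulr_natl mulr2n; apply: lerD; apply: part => //.
- by case=> ? ? [].
- by case=> a b r /=; rewrite mulr0 subr0.
- exact: Re_le_mag.
- by case=> ? ? [].
- by case=> a b r /=; rewrite mulr0 add0r.
- exact: Im_le_mag.
Qed.


Let a k n : 'M[R]_((N n).+1) := abs_a (Y n) k.
Let rho k : R := abs_al R k.+1 - abs_al R k.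
Let Sk k := undup (gball E (abs_deg k + 1)).

Let reach_a k n : reach (@pos n) E (a k n) (abs_deg k + 1).
Proof. by have [_ _ hY _ _] := blk n; exact: reach_abs_a. Qed.

Lemma mat_entry_le n (A : 'M[R]_((N n).+1)) c i j : mbd A c -> `|A i j| <= c.
Proof.
move=> hA; rewrite -mulmx_delta; apply: le_trans (nv_coord _ _) _.
apply: le_trans (hA _) _; rewrite /nv dotv_delta mxE !eqxx sqrtr1 mulr1.
exact: lexx.
Qed.

Let bound_a k n : mbd (a k n) 3.
Proof. by have [s b _ _ _] := blk n; exact: abs_a_bound. Qed.

Let entry_a k n i j : `|a k n i j| <= 3.
Proof. exact: mat_entry_le. Qed.

(* Columns of a k n are localised once gball E n contains the propagation of a k n,
   and there the quadratic form of Y n is negative, whereas Y is nearly |Y| on the range of a k. *)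
Let entry_a_small k n i j : (abs_deg k + 1 <= n)%N -> `|a k n i j| <= 2 * rho k / th.
Proof.
move=> kn; have [Ysym Y1 _ _ Yloc] := blk n.
rewrite -mulmx_delta; apply: le_trans (nv_coord _ _) _.
set w := _ *m _.
have wloc : near_in (@pos n) (gball E n) (w^~ 0).
  exists (pos j) => l; rewrite mulmx_delta => /reach_a.
  exact: gball_mono.
have := le_trans (abs_a_nonneg Ysym Y1 (erefl w)) (Yloc w wloc).
rewrite -nv2 {1}/nv dotv_delta mxE !eqxx sqrtr1 mulr1 -/(rho k) => h.
rewrite ler_pdivlMr//; have [w0|wn] := leP (nv w) 0.
  have -> : nv w = 0 by apply/eqP; rewrite eq_le w0 nv_ge0.
  by rewrite mul0r mulr_ge0// subr_ge0 abs_al_step.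
rewrite -(ler_pM2r wn); lra.
Qed.

Let q k (g : G) : R := qlim (a k) g.

Let rho_ge0 k : 0 <= rho k.
Proof. by rewrite subr_ge0 abs_al_step. Qed.

Let q_supp k g : g \notin Sk k -> q k g = 0.
Proof.
rewrite mem_undup => gS; rewrite -[RHS](ulim_cst UU); congr (ulim U _).
apply/funext => n; rewrite /diag_sum big1// => i _; rewrite big1// => j _.
have [aij|/reach_a] := eqVneq (a k n i j) 0; first by rewrite aij !mul0r mulr0.
by case: eqP => [->|]; rewrite ?mul0r// (negbTE gS).
Qed.

Let q_small k g : `|q k g| <= 2 * rho k / th.
Proof.
have b : bdd (fun n => diag_sum g (a k n)) by exact: bdd_diag (@entry_a k).
rewrite -(ulim_norm UU b); apply: (ulim_le UU); first exact: bdd_norm.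
apply: filterS (Uoo (abs_deg k + 1)) => n kn /=.
by apply: diag_sum_le => i j; exact: entry_a_small.
Qed.

Let qC k (g : G) : C := (q k g)%:C%C.

Let qlim_sub k l g : qlim (fun n => a k n - a l n) g = q k g - q l g.
Proof.
have b m : bdd (fun n => diag_sum g (a m n)) by exact: bdd_diag (@entry_a m).
rewrite /q /qlim -(ulimN UU (b l)) -(ulimD UU)//; last exact: bddN.
congr (ulim U _); apply/funext => n; rewrite /diag_sum -sumrN -big_split /=.
apply: eq_bigr => i _; rewrite -sumrN -big_split /=; apply: eq_bigr => j _.
by rewrite !mxE; ring.
Qed.

Let pair_diff k l (phi : G -> C) B :
  (forall n, mag (schur_form (@pos n) phi (a k n - a l n) (xi n)) <= B) ->
  mag (csum (fun g => (qC k - qC l) g * phi g)) <= 2 * B.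
Proof.
move=> hB; pose m := (abs_deg k + 1 + (abs_deg l + 1))%N; pose S := undup (gball E m).
have sk : {subset Sk k <= S}.
  by move=> g; rewrite !mem_undup; apply: gball_mono; exact: leq_addr.
have sl : {subset Sk l <= S}.
  by move=> g; rewrite !mem_undup; apply: gball_mono; exact: leq_addl.
rewrite (@csum_supp _ _ S) ?undup_uniq//; last first.
  move=> g gS; rewrite -[(_ - _) g]/(qC k g - qC l g) /qC !q_supp ?subrr ?mul0r//.
    by apply: contraNN gS; exact: sl.
  by apply: contraNN gS; exact: sk.
have -> : \sum_(g <- S) (qC k - qC l) g * phi g =
    \sum_(g <- S) phi g * (qlim (fun n => a k n - a l n) g)%:C%C.
  apply: eq_bigr => g _; rewrite mulrC qlim_sub rmorphB; by [].
apply: (@qlim_pair_le _ 6 m) => //.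
- move=> n i j; apply: mat_entry_le; have -> : 6 = 3 + 3 :> R by ring.
  by apply: mbdD; [|apply: mbdN].
- move=> n; apply: reachD; first by apply: reach_le _ (@reach_a k n); exact: leq_addr.
  by apply: reachN; apply: reach_le _ (@reach_a l n); exact: leq_addl.
- exact: undup_uniq.
- by move=> g; rewrite mem_undup.
Qed.

Let csum_diff k l phi : csum (fun g => (qC k - qC l) g * phi g) =
  csum (fun g => qC k g * phi g) - csum (fun g => qC l g * phi g).
Proof.
pose S := undup (Sk k ++ Sk l).
have hk g : g \notin S -> qC k g = 0.
  by rewrite mem_undup mem_cat negb_or => /andP[/q_supp h _]; rewrite /qC h.
have hl g : g \notin S -> qC l g = 0.
  by rewrite mem_undup mem_cat negb_or => /andP[_ /q_supp h]; rewrite /qC h.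
rewrite !(@csum_supp _ _ S) ?undup_uniq//.
- by rewrite -sumrB; apply: eq_bigr => g _; rewrite -mulrBl.
- by move=> g /hl ->; rewrite mul0r.
- by move=> g /hk ->; rewrite mul0r.
- by move=> g gS; rewrite -[(_ - _) g]/(qC k g - qC l g) hk// hl// subrr mul0r.
Qed.

Let mbd_diff k l n : mbd (a k n - a l n) `|abs_al R k - abs_al R l|.
Proof. by have [s b _ _ _] := blk n; exact: abs_a_cauchy. Qed.

Let qC_l1 k : l1_functions (qC k).
Proof.
rewrite /l1_functions /= (@nsum_supp _ _ (Sk k)) ?undup_uniq ?ltry//.
by move=> g /q_supp -> /=; rewrite expr0n addr0 sqrtr0.
Qed.

(** Multipliers of norm at most 1 do not increase the bound of a form ([schur_form_cb]), so the
    operator-norm convergence of the polynomials, uniform in n, passes to [q_norm]. *)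
Let qC_cauchy (e : R) : 0 < e -> exists K, forall k l, (K <= k)%N -> (K <= l)%N ->
  (q_norm (qC k - qC l)%R < e%:E)%E.
Proof.
move=> e0; have [K hK] := abs_al_cauchy (divr_gt0 e0 (ltr0Sn R 3)).
exists K => k l Kk Kl; apply: (@le_lt_trans _ _ (e / 2)%:E).
  apply: ge_ereal_sup => _ [phi [cb cb1] <-]; rewrite lee_fin.
  have := @pair_diff k l phi `|abs_al R k - abs_al R l|.
  move=> /(_ (fun n => schur_form_cb _ cb cb1 (normr_ge0 _) (@mbd_diff k l n) (xi1 n))).
  by move=> /le_trans; apply; have := hK k l Kk Kl; lra.
by rewrite lte_fin; lra.
Qed.

Let Q : cb_predual R G := Completion qC_l1 qC_cauchy.

Let pair_cvg phi (l : C) :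
  (forall e : R, 0 < e -> exists K, forall k, (K <= k)%N ->
     mag (l - csum (fun g => qC k g * phi g)) <= e) ->
  q_pairing phi Q = l.
Proof.
move=> hl; have h := cvg_magP hl; rewrite /q_pairing.
apply: (cvg_lim _ h); exact: norm_hausdorff.
Qed.

Let rho_small (e : R) : 0 < e -> exists K, forall k, (K <= k)%N -> rho k <= e.
Proof.
move=> /abs_al_cauchy[K hK]; exists K => k Kk.
by apply: le_trans (hK k.+1 k _ _) => //; [exact: ler_norm|exact: leqW].
Qed.

Lemma schur_form1 n (A : 'M[R]_((N n).+1)) :
  schur_form (@pos n) (fun=> 1) A (xi n) = (dotv (A *m xi n) (xi n))%:C%C.
Proof.
rewrite /schur_form /dotv rmorph_sum; apply: eq_bigr => i _.
rewrite mxE mulr_suml rmorph_sum; apply: eq_bigr => j _.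
by rewrite mul1r; congr (_%:C%C); ring.
Qed.

(** Against the constant 1 the Schur form is the form of [abs_a] itself, which dominates that of Y
    and is therefore at least th at xi. *)
Let pair1 : exists2 t : R, th <= t & q_pairing (fun=> 1) Q = t%:C%C.
Proof.
pose t k := \sum_(g <- Sk k) q k g.
have csumE k : csum (fun g => qC k g * 1) = (t k)%:C%C.
  rewrite (@csum_supp _ _ (Sk k)) ?undup_uniq//; last by move=> g /q_supp h; rewrite /qC h mul0r.
  by rewrite rmorph_sum; apply: eq_bigr => g _; rewrite mulr1.
have t_ge k : th <= t k.
  rewrite /t; under eq_bigr do rewrite -[q k _]mul1r.
  rewrite (qlim_sum _ (fun=> 1) (@entry_a k)).
  apply: (ulim_ge UU).
    by apply: bdd_sum => g; apply: bddZ; exact: bdd_diag (@entry_a k).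
  apply: filterS (filterT) => n _ /=.
  have [Ysym Y1 _ [_ hxi] _] := blk n.
  apply: le_trans hxi _; apply: le_trans (abs_a_ge Ysym Y1 k (xi n)) _.
  have h0 : {subset gball E (abs_deg k + 1) <= Sk k} by move=> g; rewrite mem_undup.
  have := schur_form_diag (fun=> 1) (@reach_a k n) (undup_uniq _) h0.
  rewrite schur_form1 => e; rewrite -lecR e rmorph_sum le_eqVlt; apply/orP; left; apply/eqP.
  by apply: eq_bigr => g _; rewrite rmorphM /= rmorph1.
have tc k l : `|t k - t l| <= 2 * `|abs_al R k - abs_al R l|.
  rewrite -magC rmorphB /= -!csumE -csum_diff; apply: pair_diff => n.
  rewrite schur_form1 magC; apply: le_trans (mbd_dot _ _ (@mbd_diff k l n)) _.
  by rewrite xi1 !mulr1.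
have tcv : cvgn t.
  apply: R_complete; apply/cauchy_ballP => e e0.
  have [K hK] := abs_al_cauchy (divr_gt0 e0 (ltr0Sn R 3)).
  exists ([set t k | k in [set k | (K <= k)%N]], [set t k | k in [set k | (K <= k)%N]]).
    by split; exists K => // k /= Kk; exists k.
  move=> [_ _] /= [[k Kk <-] [l Kl <-]]; rewrite /ball /=.
  by apply: le_lt_trans (tc k l) _; have := hK k l Kk Kl; lra.
exists (limn t); first by apply: limr_ge => //; apply: nearW.
apply: pair_cvg => e e0; have /cvgrPdist_le /(_ e e0) [K _ hK] := tcv.
by exists K => k Kk; rewrite csumE -rmorphB /= magC; exact: hK.
Qed.

Let coefficient_zero (s r : seq G) (x y : l2 R G) g :
  g \notin [seq t * u^-1 | t <- r, u <- s]%g ->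
  coefficient (l2_supp s x) (l2_supp r y) g = 0.
Proof.
move=> gW; rewrite /coefficient -[inner _ _ _]/(l2_inner _ _) /l2_inner.
rewrite (@csum_supp _ _ [::])//; first by rewrite big_nil.
move=> h _; rewrite lamE /=; case: ifP => hs; last by rewrite mul0r.
case: ifP => hr; last by rewrite rmorph0 mulr0.
move: gW => /negP[]; apply/allpairsP; exists (h, (g^-1 * h)%g); split=> //=.
by rewrite invgM invgK mulVKg.
Qed.

(** Here 6 = 2 * 3, with 3 the norm bound of [abs_a] and 2 the factor of [qlim_pair_le]. *)
Let bddA k x y : mag (csum (fun g => qC k g * coefficient x y g)) <= 6 * (nm x * nm y).
Proof.
have -> : 6 * (nm x * nm y) = 2 * (3 * nm x * nm y) by ring.
rewrite (@csum_supp _ _ (Sk k)) ?undup_uniq//; last by move=> g /q_supp h; rewrite /qC h mul0r.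
under eq_bigr do rewrite mulrC.
apply: (@qlim_pair_le (a k) 3 _ _ _ _ (@entry_a k) (@reach_a k)) => [||n].
- exact: undup_uniq.
- by move=> g; rewrite mem_undup.
- by apply: schur_form_coefficient => //; exact: bound_a.
Qed.

Let coefE (x y : l2 R G) g : coefficient x y g = l2_inner (left_regular R G g x) y.
Proof. by []. Qed.

Let csum_coefD k (x y x' y' : l2 R G) g : qC k g * coefficient x y g =
  qC k g * coefficient (x - x') y g + qC k g * coefficient x' (y - y') g +
  qC k g * coefficient x' y' g.
Proof.
rewrite -!mulrDr; congr (_ * _); rewrite !coefE.
rewrite -addrA -l2_innerDr subrK.
have {1}-> : x = (x - x') + x' by rewrite subrK.
by rewrite (urep_add (left_regular R G)) l2_innerDl.
Qed.

Let csum_qD k f h i : csum (fun g => qC k g * f g + qC k g * h g + qC k g * i g) =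
  csum (fun g => qC k g * f g) + csum (fun g => qC k g * h g) + csum (fun g => qC k g * i g).
Proof.
rewrite !(@csum_supp _ _ (Sk k)) ?undup_uniq ?big_split// => g /q_supp e; rewrite /qC e ?mul0r ?addr0//.
Qed.

(** If x and y have finite support, so does their coefficient, and the values of q k tend to 0
    uniformly. The general case follows by density, as [bddA] is uniform in k. *)
Let pairA psi : fourier_algebra psi -> q_pairing psi Q = 0.
Proof.
move=> [x [y ->]]; apply: pair_cvg => e e0.
(* By [bddA], truncating x and y costs at most 6 d (|x| + |y|), which is at most e / 2 for this
   d. *)
pose d := e / (12 * (nm x + nm y + 1) + 1).
have nx0 := nm_ge0 x; have ny0 := nm_ge0 y.
have d0 : 0 < d by rewrite divr_gt0// budget_gt0.
have [s [us xs]] := l2_approx x d0; have [r [ur yr]] := l2_approx y d0.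
pose x' := l2_supp s x; pose y' := l2_supp r y.
pose W := [seq t * u^-1 | t <- r, u <- s]%g.
pose B := \sum_(g <- W) mag (coefficient x' y' g).
have B0 : 0 <= B by apply: sumr_ge0 => g _; exact: mag_ge0.
have [|K hK] := @rho_small ((e / 2) / (2 / th * (B + 1))).
  by rewrite !divr_gt0// mulr_gt0 ?divr_gt0// ltr_wpDl.
exists K => k /hK rk; rewrite sub0r magN.
have -> : (fun g => qC k g * coefficient x y g) =
   (fun g => (qC k g * coefficient (x - x') y g + qC k g * coefficient x' (y - y') g) +
     qC k g * coefficient x' y' g).
  by apply/funext => g; rewrite -csum_coefD.
rewrite csum_qD.
have h1 : mag (csum (fun g => qC k g * coefficient (x - x') y g)) <= 6 * (d * nm y).
  apply: le_trans (bddA _ _ _) _; rewrite ler_wpM2l// ler_wpM2r//.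
have h2 : mag (csum (fun g => qC k g * coefficient x' (y - y') g)) <= 6 * (d * nm x).
  apply: le_trans (bddA _ _ _) _; rewrite ler_wpM2l// mulrC.
  by apply: ler_pM; rewrite ?nm_ge0// nm_supp_le.
have h3 : mag (csum (fun g => qC k g * coefficient x' y' g)) <= e / 2.
  rewrite (@csum_supp _ _ (Sk k)) ?undup_uniq//; last by move=> g /q_supp h; rewrite /qC h mul0r.
  apply: le_trans (mag_sum _ _ _) _; under eq_bigr do rewrite magM magC.
  apply: (@le_trans _ _ (\sum_(g <- Sk k) 2 * rho k / th * mag (coefficient x' y' g))).
    by apply: ler_sum => g _; rewrite ler_wpM2r ?mag_ge0// q_small.
  rewrite -mulr_sumr; apply: (@le_trans _ _ (2 * rho k / th * B)).
    rewrite ler_wpM2l ?divr_ge0 ?mulr_ge0 ?rho_ge0 ?(ltW th0)//.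
    apply: sum_supp_le; first exact: undup_uniq.
      by move=> g; exact: mag_ge0.
    by move=> g gW; rewrite coefficient_zero ?mag0.
  move: rk; rewrite ler_pdivlMr; last first.
    by rewrite mulr_gt0 ?divr_gt0// ltr_wpDl.
  apply: le_trans; rewrite mulrAC [leRHS]mulrA [X in _ <= X * _]mulrCA mulrA mulrAC.
  by rewrite ler_wpM2l//; [rewrite !mulr_ge0 ?invr_ge0 ?(ltW th0)|rewrite lerDl].
have hd : d * (12 * (nm x + nm y + 1) + 1) = e.
  by rewrite /d divfK// gt_eqF// budget_gt0.
apply: le_trans (magD _ _) _; apply: (@le_trans _ _ (6 * (d * nm y) + 6 * (d * nm x) + e / 2)).
  by apply: lerD => //; apply: le_trans (magD _ _) _; exact: lerD.
exact: budget_le hd (ltW d0).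
Qed.

(** One functional and the tolerance th suffice: [Q] is at least th at 1 and 0 on the Fourier
    algebra. *)
Lemma no_blocks_AP : ~ has_AP R G.
Proof.
move=> [_ AP]; have [t tth t1] := pair1.
have [psi [psiF _] /(_ ord0)] := AP 1%N (fun=> Q) th th0.
rewrite -/(mag _) t1 (pairA psiF) subr0 magC => /(le_lt_trans (ler_norm _)).
by rewrite ltNge tth.
Qed.
End NoBlocks.

(** * Property A from kernels of bounded width *)

Section PropertyA.
Variables (R : realType) (G : groupType).

(** The form of property A which expresses amenability of left translation on the Stone-Cech
    compactification of G. In the coordinate y = h^-1 x the function mu x is a probability carried
    by points near x; in the coordinate h the support F is fixed and closeness of neighbouring
    measures becomes approximate equivariance. Finite sums over B stand for the l^1 norm. *)
Definition propA := forall (E : seq G) (e : R), 0 < e ->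
  exists (F : seq G) (mu : G -> G -> R), [/\ uniq F,
    forall x h, 0 <= mu x h,
    forall x h, h \notin F -> mu x h = 0,
    forall x, \sum_(h <- F) mu x h = 1 &
    forall g x (B : seq G), g \in E -> uniq B ->
      \sum_(h <- B) `|mu (g * x)%g h - mu x (g^-1 * h)%g| <= e].

(** If every width failed, each m would yield a block of width [gball E m], of a size that may
    depend on m, all with the same th; [no_blocks_AP] excludes this. *)
Lemma AP_kernels (E : seq G) (e : R) : has_AP R G -> 0 < e -> e < 1 ->
  (forall g, g \in E -> g^-1%g \in E) ->
  exists m, forall n (pos : 'I_n.+1 -> G), injective pos -> kernel_at pos E (gball E m) e.
Proof.
move=> AP e0 e1 EV; apply: contrapT => none.
pose th : R := (e / 2) / (2 * (size E)%:R + 3).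
have th0 : 0 < th by rewrite !divr_gt0// addr_ge0_gt0 ?mulr_ge0.
pose T := {n : nat & (('I_n.+1 -> G) * 'M[R]_n.+1 * 'cV[R]_n.+1)%type}.
have ex m : exists t : T, injective (projT2 t).1.1 /\
    block (projT2 t).1.1 E (gball E m) th (projT2 t).1.2 (projT2 t).2.
  (* The radius is m.+1 because the duality requires 1 and E inside the ball; a block for the larger
     ball is one for the smaller. *)
  have /existsNP[n /existsNP[pos /not_implyP[posI nk]]] :
      ~ forall n (pos : 'I_n.+1 -> G), injective pos -> kernel_at pos E (gball E m.+1) e.
    by move=> h; apply: none; exists m.+1.
  have sub : {subset 1%g :: E <= gball E m.+1}.
    move=> g gE; apply/gballSP; exists g, 1%g; split=> //; first exact: gball1.
    by rewrite mulg1.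
  have [//|[Y [xi [Y1 Y2 Y3 Y4 Y5]]]] := kernel_or_block posI e0 e1 sub EV.
  exists (existT _ n (pos, Y, xi)); split=> //; split=> // w [y hy]; apply: Y5.
  by exists y => i /hy; apply: gball_mono.
have [f hf] := choice ex.
have [U [UU Uoo]] := nat_ultra.
apply: (@no_blocks_AP R G E th th0 (fun m => projT1 (f m)) (fun m => (projT2 (f m)).1.1)
  (fun m => (projT2 (f m)).1.2) (fun m => (projT2 (f m)).2) _ _ U UU Uoo AP).
- by move=> m; have [] := hf m.
- by move=> m; have [] := hf m.
Qed.

(* A positive kernel which is a sum of rank-one kernels of bounded support
   becomes a family of measures: the mass of each summand is moved to a base point of its support. *)
Lemma kernel_measures (E F : seq G) (e : R) n (pos : 'I_n.+1 -> G) :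
  1%g \in F -> kernel_at pos E F (e ^+ 2) -> 0 < e -> e < 1 ->
  exists eta : 'I_n.+1 -> G -> R, [/\ forall i y, 0 <= eta i y,
    forall i y, (pos i * y^-1)%g \notin F -> eta i y = 0,
    forall i (S : seq G), uniq S -> (forall f, f \in F -> (f^-1 * pos i)%g \in S) ->
      \sum_(y <- S) eta i y = 1 &
    forall i j (S : seq G), uniq S -> (pos i * (pos j)^-1)%g \in E ->
      \sum_(y <- S) `|eta i y - eta j y| <= 13 * e].
Proof.
move=> F1 [vs [vsF k1 kE]] e0 e1.
pose yv (v : {ffun 'I_n.+1 -> R}) : G :=
  xget 1%g [set y | forall i, v i != 0 -> (pos i * y^-1)%g \in F].
have yvP v i : v \in vs -> v i != 0 -> (pos i * (yv v)^-1)%g \in F.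
  move=> /vsF hv; rewrite /yv; case: xgetP => [y _ hy|no]; first exact: hy.
  by case: hv => y /no.
(* Scaling by c keeps every total mass at most 1; the missing mass is put at [pos i]. *)
pose c := (1 + e ^+ 2)^-1.
have c0 : 0 < c by rewrite invr_gt0 ltr_pwDl// sqr_ge0.
have cE : c * (1 + e ^+ 2) = 1 by rewrite mulVf// gt_eqF// ltr_pwDl// sqr_ge0.
have c1 : c <= 1 by rewrite invf_le1 ?lerDl ?sqr_ge0// ltr_pwDl// sqr_ge0.
have kc i : c * gram vs i i <= 1 by rewrite -cE ler_pM2l.
pose eta i y := \sum_(v <- vs) (y == yv v)%:R * (c * v i ^+ 2) +
  (y == pos i)%:R * (1 - c * gram vs i i).
have kg i : c * gram vs i i = \sum_(v <- vs) c * v i ^+ 2.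
  by rewrite /gram mulr_sumr; apply: eq_bigr => v _; rewrite expr2.
have mass (S : seq G) (z : G) (r : R) : uniq S -> \sum_(y <- S) (y == z)%:R * r = (z \in S)%:R * r.
  move=> uS; have [zS|zS] := boolP (z \in S).
    rewrite (bigD1_seq z)//= eqxx big1 ?addr0// => y /negbTE ->.
    by rewrite mul0r.
  rewrite big_seq big1 ?mul0r// => y yS; case: eqP => [yz|]; last by rewrite mul0r.
  by move: zS; rewrite -yz yS.
exists eta; split.
- move=> i y; apply: addr_ge0; last by rewrite mulr_ge0// subr_ge0.
  by apply: sumr_ge0 => v _; rewrite mulr_ge0// mulr_ge0 ?sqr_ge0// ltW.
- move=> i y nF; rewrite /eta; have -> : (y == pos i) = false.
    by apply: contraNF nF => /eqP ->; rewrite mulgV.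
  rewrite mul0r addr0 big_seq big1// => v vvs; case: eqP => [yE|]; last by rewrite mul0r.
  have [->|vi] := eqVneq (v i) 0; first by rewrite expr0n/= !mulr0.
  by move: nF; rewrite yE yvP.
- move=> i S uS FS; rewrite /eta big_split /= mass//.
  have -> : pos i \in S by have := FS _ F1; rewrite invg1 mul1g.
  rewrite exchange_big /= mul1r.
  have -> : \sum_(v <- vs) \sum_(y <- S) (y == yv v)%:R * (c * v i ^+ 2) = c * gram vs i i.
    rewrite kg big_seq [RHS]big_seq; apply: eq_bigr => v vvs; rewrite mass//.
    have [->|vi] := eqVneq (v i) 0; first by rewrite expr0n/= !mulr0.
    have := FS _ (yvP v i vvs vi); rewrite invgM invgK -mulgA mulVg mulg1 => ->.
    by rewrite mul1r.
  by rewrite addrC subrK.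
- move=> i j S uS ijE.
  have kij := kE _ _ ijE.
  have polar := gram_polar vs i j; have polarN := gram_polarN vs i j.
  have P0 : 0 <= \sum_(v <- vs) (v i - v j) ^+ 2 by apply: sumr_ge0 => v _; exact: sqr_ge0.
  have N0 : 0 <= \sum_(v <- vs) (v i + v j) ^+ 2 by apply: sumr_ge0 => v _; exact: sqr_ge0.
  have ki := kc i; have kj := kc j; have k1i := k1 i; have k1j := k1 j.
  apply: (@le_trans _ _ (\sum_(v <- vs) c * `|v i ^+ 2 - v j ^+ 2| +
      ((1 - c * gram vs i i) + (1 - c * gram vs j j)))).
    apply: (@le_trans _ _ (\sum_(y <- S) (\sum_(v <- vs) (y == yv v)%:R * (c * `|v i ^+ 2 - v j ^+ 2|) +
       ((y == pos i)%:R * (1 - c * gram vs i i) + (y == pos j)%:R * (1 - c * gram vs j j))))).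
      apply: ler_sum => y _; rewrite /eta opprD addrACA -sumrB.
      apply: le_trans (ler_normD _ _) _; apply: lerD.
        apply: le_trans (ler_norm_sum _ _ _) _; apply: ler_sum => v _.
        by rewrite -mulrBr -mulrBr !normrM normr_nat (gtr0_norm c0).
      apply: le_trans (ler_normB _ _) _.
      by rewrite !normrM !normr_nat !ger0_norm ?subr_ge0.
    rewrite !big_split /= !mass// exchange_big /=; apply: lerD.
      apply: ler_sum => v _; rewrite mass// ler_piMl ?lern1 ?leq_b1//.
      by rewrite mulr_ge0// ltW.
    by apply: lerD; rewrite ler_piMl ?lern1 ?leq_b1// subr_ge0.
  (* |a^2 - b^2| = |a - b| |a + b| is split with weights 1 / e and e, since the differences are
     small and the sums only bounded. *)
  have h1 : \sum_(v <- vs) c * `|v i ^+ 2 - v j ^+ 2| <=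
      c * (((gram vs i i + gram vs j j - 2 * gram vs i j) / e +
       e * (gram vs i i + gram vs j j + 2 * gram vs i j)) / 2).
    rewrite -polar -polarN -mulr_sumr ler_pM2l// mulr_suml mulr_sumr -big_split mulr_suml /=.
    apply: ler_sum => v _; rewrite subr_sqr normrM.
    rewrite -[(v i - v j) ^+ 2]real_normK ?num_real// -[(v i + v j) ^+ 2]real_normK ?num_real//.
    move: `|v i - v j| `|v i + v j| => a b.
    have : 0 <= (a - e * b) ^+ 2 / e by rewrite divr_ge0 ?sqr_ge0// ltW.
    have -> : (a - e * b) ^+ 2 / e = a ^+ 2 / e + e * b ^+ 2 - 2 * (a * b).
      by field; rewrite gt_eqF.
    lra.
  have h2 : gram vs i i + gram vs j j - 2 * gram vs i j <= 6 * e ^+ 2 by lra.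
  have h3 : gram vs i i + gram vs j j + 2 * gram vs i j <= 8 by nra.
  (* (6 e + 8 e) / 2 = 7 e; together with 6 e for the missing masses this is the 13 e of the
     statement. *)
  have h4 : c * (((gram vs i i + gram vs j j - 2 * gram vs i j) / e +
       e * (gram vs i i + gram vs j j + 2 * gram vs i j)) / 2) <= 7 * e.
    set A := gram vs i i + gram vs j j - _ in h2 *; set B := _ + _ + _ in h3 *.
    have A0 : 0 <= A / e by rewrite divr_ge0 ?(ltW e0)// /A -polar.
    have B0 : 0 <= e * B by rewrite mulr_ge0 ?(ltW e0)// /B -polarN.
    have : A / e <= 6 * e by rewrite ler_pdivrMr// -mulrA -expr2.
    have : e * B <= e * 8 by rewrite ler_pM2l.
    move=> hB hA; apply: (@le_trans _ _ (1 * ((A / e + e * B) / 2))).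
      by rewrite ler_wpM2r// divr_ge0// addr_ge0.
    lra.
  have h5 : (1 - c * gram vs i i) + (1 - c * gram vs j j) <= 6 * e.
    have : 2 * (1 - 2 * e ^+ 2) <= gram vs i i + gram vs j j by lra.
    rewrite -(ler_pM2l c0).
    have ee : e ^+ 2 <= e by rewrite expr2 ger_pMr// ltW.
    have ce : c * e ^+ 2 <= e by apply: le_trans ee; rewrite ler_piMl ?sqr_ge0.
    have -> : c * (2 * (1 - 2 * e ^+ 2)) = 2 * (c * (1 + e ^+ 2)) - 6 * (c * e ^+ 2) by ring.
    rewrite cE mulrDr; clear -ce; lra.
  by apply: le_trans (lerD h1 h5) _; lra.
Qed.



(** The width m is the same for all finite sets, so the measures obtained on an exhaustion of G by
    finite sets keep a common support in the limit along an ultrafilter. *)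
Lemma propA_of_AP : has_AP R G -> countable [set: G] -> propA.
Proof.
move=> AP /countable_injP[f fI] E e e0.
have {}fI : injective f by move=> x y; apply: fI; rewrite inE.
pose E' := E ++ [seq g^-1%g | g <- E].
have E'V g : g \in E' -> g^-1%g \in E'.
  rewrite !mem_cat => /orP[gE|/mapP[h hE ->]]; apply/orP; [right|left].
    by apply/mapP; exists g.
  by rewrite invgK.
pose d := e / (13 * (1 + e)).
have d0 : 0 < d by rewrite divr_gt0// mulr_gt0//; lra.
have de : 13 * d <= e.
  rewrite /d mulrCA -[leRHS]mulr1 ler_pM2l// ler_pdivrMr; first by lra.
  by rewrite mulr_gt0//; lra.
have d1 : d < 1 by rewrite /d ltr_pdivrMr ?mul1r; lra.
have [|m hm] := AP_kernels AP (exprn_gt0 2 d0) _ E'V; first by rewrite expr_lt1// ltW.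
(* Adding 1 keeps X n nonempty, as the matrices are indexed by ordinals below a successor. *)
pose X n := undup (1%g :: [seq xget 1%g [set g | f g = k] | k <- iota 0 n]).
have XP g n : (f g < n)%N -> g \in X n.
  move=> gn; rewrite mem_undup inE; apply/orP; right; apply/mapP; exists (f g).
    by rewrite mem_iota.
  by case: xgetP => [h _ /fI ->|/(_ g) []].
have X0 n : size (X n) = (size (X n)).-1.+1.
  have : 1%g \in X n by rewrite mem_undup inE eqxx.
  by case: (X n).
pose pos n (i : 'I_((size (X n)).-1.+1)) := nth 1%g (X n) i.
have posI n : injective (@pos n).
  move=> i j /eqP; rewrite nth_uniq ?undup_uniq -?X0 ?[X in (_ < X)%N]X0//.
  by move=> /eqP ij; exact/val_inj.
pose idx n g : 'I_((size (X n)).-1.+1) := inord (index g (X n)).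
have idxK n g : g \in X n -> pos n (idx n g) = g.
  by move=> gX; rewrite /pos inordK ?nth_index// -X0 index_mem.
pose F := undup (gball E' m).
have F1 : 1%g \in gball E' m by exact: gball1.
have /choice[mun hmun] n : exists M : G -> G -> R, [/\ forall x h, 0 <= M x h <= 1,
    forall x h, x \in X n -> h \notin F -> M x h = 0,
    forall x, x \in X n -> \sum_(h <- F) M x h = 1 &
    forall g x (B : seq G), g \in E -> uniq B -> x \in X n -> (g * x)%g \in X n ->
      \sum_(h <- B) `|M (g * x)%g h - M x (g^-1 * h)%g| <= e].
  have [eta [h1 h2 h3 h4]] := kernel_measures F1 (hm _ _ (posI n)) d0 d1.
  have eta01 i y : 0 <= eta i y <= 1.
    rewrite h1/= -(h3 i (undup (y :: [seq (g^-1 * pos n i)%g | g <- gball E' m]))) ?undup_uniq//.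
      by rewrite (bigD1_seq y) ?undup_uniq ?mem_undup ?inE ?eqxx//= lerDl sumr_ge0.
    by move=> g gE; rewrite mem_undup inE (map_f (fun g => (g^-1 * pos n i)%g) gE) orbT.
  (* In the coordinate h = x y^-1 the support near x becomes the fixed set F. *)
  exists (fun x h => eta (idx n x) (h^-1 * x)%g); split.
  - by move=> x h; exact: eta01.
  - move=> x h xX hF; apply: h2.
    by rewrite idxK// invgM invgK mulVKg; rewrite mem_undup in hF.
  - move=> x xX.
    rewrite -(h3 (idx n x) [seq (h^-1 * x)%g | h <- F]); first by rewrite big_map.
      by rewrite map_inj_uniq ?undup_uniq// => a b /mulIg /invg_inj.
    by move=> g gF; rewrite idxK//; apply/mapP; exists g; rewrite ?mem_undup.
  - move=> g x B gE uB xX gxX.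
    have -> : \sum_(h <- B) `|eta (idx n (g * x)%g) (h^-1 * (g * x))%g -
        eta (idx n x) ((g^-1 * h)^-1 * x)%g| =
        \sum_(y <- [seq (h^-1 * (g * x))%g | h <- B]) `|eta (idx n (g * x)%g) y - eta (idx n x) y|.
      by rewrite big_map; apply: eq_bigr => h _; rewrite invgM invgK mulgA.
    apply: le_trans de; apply: h4.
      by rewrite map_inj_uniq// => a b /mulIg /invg_inj.
    by rewrite !idxK// -mulgA mulgV mulg1 mem_cat gE.
have [U [UU Uoo]] := nat_ultra.
have bdm x h : bdd (fun n => mun n x h).
  by exists 1 => n; have [/(_ x h)/andP[? ?] _ _ _] := hmun n; rewrite ger0_norm.
have ev g (P : nat -> Prop) : (forall n, g \in X n -> P n) -> U [set n | P n].
  by move=> h; apply: filterS (Uoo (f g).+1) => n /= gn; apply: h; exact: XP.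
exists F, (fun x h => ulim U (fun n => mun n x h)); split.
- exact: undup_uniq.
- move=> x h; apply: (ulim_ge UU) => //; apply: filterS (filterT) => n _ /=.
  by have [/(_ x h)/andP[? ?] _ _ _] := hmun n.
- move=> x h hF; rewrite -[RHS](ulim_cst UU); apply: (ulim_eq UU) => //; first exact: bdd_cst.
  by apply: (ev x) => n xX; have [_ h2 _ _] := hmun n; exact: h2.
- move=> x; rewrite -(ulim_sum UU)// -[RHS](ulim_cst UU); apply: (ulim_eq UU).
  + exact: bdd_sum.
  + exact: bdd_cst.
  + by apply: (ev x) => n xX; have [_ _ h3 _] := hmun n; exact: h3.
- move=> g x B gE uB.
  have bd h : bdd (fun n => mun n (g * x)%g h - mun n x (g^-1 * h)%g).
    by apply: bddD => //; exact: bddN.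
  under eq_bigr do rewrite -(ulimN UU (bdm _ _)) -(ulimD UU (bdm _ _) (bddN (bdm _ _))) -(ulim_norm UU (bd _)).
  rewrite -(ulim_sum UU) => [|h]; last exact: bdd_norm.
  apply: (ulim_le UU); first by apply: bdd_sum => h; exact: bdd_norm.
  have FU : ProperFilter U by exact: ultra_proper.
  have UX : U ([set n | (g * x)%g \in X n] `&` [set n | x \in X n]).
    by apply: filterI; [exact: (ev (g * x)%g)|exact: (ev x)].
  apply: filterS UX => n /= [gxX xX].
  by have [_ _ _ h4] := hmun n; exact: h4.
Qed.

End PropertyA.

(** * Free products *)

Section FreeProductNormalForm.
Variables (G H : groupType).
Local Open Scope group_scope.
Local Notation L := (G + H)%type.
Local Notation FP := (freeprod G H).
Local Notation cl := (pres_class (@freeprod_inv G H) (@freeprod_rel G H)).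
Implicit Types (x y : L) (u v w : seq L).

Definition is_left x := if x is inl _ then true else false.
Definition nontriv x := match x with inl g => g != 1 | inr h => h != 1 end.
Definition reduced w := all nontriv w && sorted (fun x y => is_left x != is_left y) w.

(** The action of a letter on reduced words, as in van der Waerden's proof: once this action
    satisfies the relations of the free product, normal forms are unique and no confluence argument
    is needed. *)
Definition push x w := match x, w with
  | inl g, inl g' :: w' => if g * g' == 1 then w' else inl (g * g') :: w'
  | inr h, inr h' :: w' => if h * h' == 1 then w' else inr (h * h') :: w'
  | _, _ => if nontriv x then x :: w else w end.

Definition pushes u w := foldr push w u.

Lemma reduced_cons x w : reduced (x :: w) =
  [&& nontriv x, reduced w & if w is y :: _ then is_left x != is_left y else true].
Proof. by rewrite /reduced; case: w => [|y w] /=; case: (nontriv x); rewrite /= ?andbT// -!andbA; case: (nontriv y); case: (all _ _); rewrite /= ?andbF// andbC. Qed.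

Lemma reduced_tl x w : reduced (x :: w) -> reduced w.
Proof. by rewrite reduced_cons => /and3P[]. Qed.

Lemma push_reduced x w : reduced w -> reduced (push x w).
Proof.
case: x w => [g|h] [|[g'|h'] w] //= rw.
- by case: ifP => // g1; rewrite reduced_cons /= g1.
- case: eqP => [_|/eqP e]; first exact: reduced_tl rw.
  by move: rw; rewrite !reduced_cons /= e => /and3P[_ -> ].
- by case: ifP => // g1; rewrite reduced_cons /= g1 rw.
- by case: ifP => // g1; rewrite reduced_cons /= g1.
- by case: ifP => // g1; rewrite reduced_cons /= g1 rw.
- case: eqP => [_|/eqP e]; first exact: reduced_tl rw.
  by move: rw; rewrite !reduced_cons /= e => /and3P[_ -> ].
Qed.

Lemma push1l w : reduced w -> push (inl 1) w = w.
Proof.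
case: w => [|[g'|h'] w] /=; rewrite ?eqxx// reduced_cons mul1g /= => /and3P[/negbTE -> _ _] //.
Qed.

Lemma push1r w : reduced w -> push (inr 1) w = w.
Proof.
case: w => [|[g'|h'] w] /=; rewrite ?eqxx// reduced_cons mul1g /= => /and3P[/negbTE -> _ _] //.
Qed.

Lemma pushMl g g' w : reduced w -> push (inl g) (push (inl g') w) = push (inl (g * g')) w.
Proof.
case: w => [|[k|h] w] rw /=.
- have [->|g1] /= := eqVneq g' 1; first by rewrite mulg1.
  by case: ifP; rewrite // => /negbFE /eqP ->; rewrite eqxx.
- have [e|ne] /= := eqVneq (g' * k) 1; last by rewrite mulgA.
  rewrite -mulgA e mulg1; move: rw; rewrite reduced_cons.
  by case: w => [|[k'|h] w] /and3P[_ _]//= _; case: eqP.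
- have [->|g1] /= := eqVneq g' 1; first by rewrite mulg1.
  by case: ifP; rewrite // => /negbFE /eqP ->; rewrite eqxx.
Qed.

Lemma pushMr g g' w : reduced w -> push (inr g) (push (inr g') w) = push (inr (g * g')) w.
Proof.
case: w => [|[k|h] w] rw /=.
- have [->|g1] /= := eqVneq g' 1; first by rewrite mulg1.
  by case: ifP; rewrite // => /negbFE /eqP ->; rewrite eqxx.
- have [->|g1] /= := eqVneq g' 1; first by rewrite mulg1.
  by case: ifP; rewrite // => /negbFE /eqP ->; rewrite eqxx.
- have [e|ne] /= := eqVneq (g' * h) 1; last by rewrite mulgA.
  rewrite -mulgA e mulg1; move: rw; rewrite reduced_cons.
  by case: w => [|[k|h'] w] /and3P[_ _]//= _; case: eqP.
Qed.

Lemma pushes_reduced u w : reduced w -> reduced (pushes u w).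
Proof. by move=> rw; elim: u => //= x u; exact: push_reduced. Qed.

Lemma pushes_cat u v w : pushes (u ++ v) w = pushes u (pushes v w).
Proof. by rewrite /pushes foldr_cat. Qed.

Lemma pushes_cong u v : pres_cong (@freeprod_inv G H) (@freeprod_rel G H) u v ->
  forall w, reduced w -> pushes u w = pushes v w.
Proof.
elim=> {u v} [_ _ [g g'|h h']|x|x|u|u v _ IH|u v w _ IH1 _ IH2|u u' v v' _ IH1 _ IH2] w' rw //=.
- exact: pushMl.
- exact: pushMr.
- by case: x => [g|h]; rewrite [freeprod_inv _]/= ?pushMl ?pushMr// mulgV ?push1l ?push1r.
- by case: x => [g|h]; rewrite [freeprod_inv _]/= ?pushMl ?pushMr// mulVg ?push1l ?push1r.
- by rewrite IH.
- by rewrite IH1// IH2.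
- by rewrite !pushes_cat IH2// IH1// pushes_reduced.
Qed.

Definition nf (a : FP) : seq L := pushes (repr a) [::].

Lemma nf_reduced a : reduced (nf a).
Proof. exact: pushes_reduced. Qed.

Lemma nf_cl u : nf (cl u) = pushes u [::].
Proof. by apply: pushes_cong => //; exact: pres_repr_class. Qed.

Lemma nf1 : nf 1 = [::]. Proof. exact: nf_cl [::]. Qed.

Lemma nf_mul u (a : FP) : nf (cl u * a) = pushes u (nf a).
Proof. by rewrite -[a]pres_reprK [_ * _]pres_mulE !nf_cl pushes_cat. Qed.

Lemma nf_inl g (a : FP) : nf (freeprod_inl H g * a) = push (inl g) (nf a).
Proof. exact: (nf_mul [:: inl g]). Qed.

Lemma nf_inr h (a : FP) : nf (freeprod_inr G h * a) = push (inr h) (nf a).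
Proof. exact: (nf_mul [:: inr h]). Qed.

Lemma freeprod_inl1 : freeprod_inl H (1 : G) = 1.
Proof. by apply: (mulgI (freeprod_inl H 1)); rewrite -freeprod_inlM !mulg1. Qed.

Lemma freeprod_inr1 : freeprod_inr G (1 : H) = 1.
Proof. by apply: (mulgI (freeprod_inr G 1)); rewrite -freeprod_inrM !mulg1. Qed.

Lemma freeprod_inlV (g : G) : freeprod_inl H g^-1 = (freeprod_inl H g)^-1.
Proof. by apply: (mulgI (freeprod_inl H g)); rewrite -freeprod_inlM !mulgV freeprod_inl1. Qed.

Lemma freeprod_inrV (h : H) : freeprod_inr G h^-1 = (freeprod_inr G h)^-1.
Proof. by apply: (mulgI (freeprod_inr G h)); rewrite -freeprod_inrM !mulgV freeprod_inr1. Qed.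

Lemma cl_cons x w : cl (x :: w) = cl [:: x] * cl w.
Proof. by rewrite [RHS]pres_mulE. Qed.

Lemma cl_push x w : cl (push x w) = cl (x :: w).
Proof.
have triv y : ~~ nontriv y -> cl [:: y] = 1.
  by case: y => [g|h] /= /negbNE /eqP ->; [exact: freeprod_inl1|exact: freeprod_inr1].
have def : cl (if nontriv x then x :: w else w) = cl (x :: w).
  by case: ifPn => // /triv e; rewrite cl_cons e mul1g.
case: x w def => [g|h] [|[g'|h'] w] //= _.
  rewrite cl_cons (cl_cons (inl g')) mulgA -[cl [:: inl g] * _]freeprod_inlM.
  case: eqP => [->|_]; first by rewrite freeprod_inl1 mul1g.
  by rewrite cl_cons.
rewrite cl_cons (cl_cons (inr h')) mulgA -[cl [:: inr h] * _]freeprod_inrM.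
case: eqP => [->|_]; first by rewrite freeprod_inr1 mul1g.
by rewrite cl_cons.
Qed.

Lemma nfK a : cl (nf a) = a.
Proof.
rewrite -[RHS]pres_reprK /nf; elim: (repr a) => //= x u IH.
by rewrite cl_push cl_cons IH -cl_cons.
Qed.

Lemma pushes_reducedE w : reduced w -> pushes w [::] = w.
Proof.
elim: w => //= x w IH rw; rewrite IH ?(reduced_tl rw)//.
by move: rw; rewrite reduced_cons; case: x w {IH} => [g|h] [|[g'|h'] w] /and3P[]//= ->.
Qed.

Lemma nf_reducedE w : reduced w -> nf (cl w) = w.
Proof. by move=> rw; rewrite nf_cl pushes_reducedE. Qed.

Lemma freeprod_ind (P : FP -> Prop) : P 1 ->
  (forall g a, P a -> P (freeprod_inl H g * a)) ->
  (forall h a, P a -> P (freeprod_inr G h * a)) -> forall a, P a.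
Proof.
move=> P1 Pl Pr a; rewrite -(nfK a); elim: (nf a) => // -[g|h] w IH; rewrite cl_cons.
  exact: Pl.
exact: Pr.
Qed.

Lemma freeprod_inl_inj : injective (@freeprod_inl G H).
Proof.
move=> g g' e; apply/divg1_eq.
have : freeprod_inl H (g / g') = 1 by rewrite freeprod_inlM freeprod_inlV e mulgV.
by move=> /(congr1 nf); rewrite nf1 nf_cl /=; case: ifP => // /negbFE /eqP.
Qed.

Lemma freeprod_inr_eq1 (h : H) : freeprod_inr G h = 1 -> h = 1.
Proof. by move=> /(congr1 nf); rewrite nf1 nf_cl /=; case: ifP => // /negbFE /eqP. Qed.

(** Dropping a last letter in G gives the shortest word of the coset. *)
Fixpoint strip w := match w with
  | [::] => [::]
  | [:: inl _] => [::]
  | x :: w' => x :: strip w' end.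

Lemma strip_cons x w : w != [::] -> strip (x :: w) = x :: strip w.
Proof. by case: w => [|y w]//; case: x. Qed.

Lemma strip_rcons w (g : G) : strip (rcons w (inl g)) = w.
Proof. by elim: w => // x w IH; rewrite rcons_cons strip_cons ?IH//; case: (w). Qed.

Lemma strip_reduced w : reduced w -> reduced (strip w) /\ strip (strip w) = strip w.
Proof.
elim: w => // x [|y w] IH rw; first by case: x {IH} rw.
rewrite strip_cons//; have [r1 r2] := IH (reduced_tl rw).
move: rw; rewrite reduced_cons => /and3P[nx ry xy].
case: w IH r1 r2 ry => [|t w] _ r1 r2 ry.
  case: y xy r1 r2 ry => [k|k] xy _ _ ry; case: x nx xy => [g|h] nx xy //.
    by split=> //; rewrite [strip _]/= reduced_cons nx.
  by split=> //; rewrite [strip _]/= reduced_cons nx ry.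
move: r1 r2; rewrite [strip [:: y, t & w]]strip_cons// => r1 r2.
rewrite [strip (x :: _)]strip_cons// r2; split=> //.
by rewrite reduced_cons nx r1.
Qed.

Lemma strip_spec w : reduced w -> exists g : G, cl w = cl (strip w) * freeprod_inl H g.
Proof.
elim: w => [|x w IH] rw; first by exists 1; rewrite freeprod_inl1 mulg1.
case: w IH rw => [|y w] IH rw.
  case: x rw => [g|h] _; first by exists g; rewrite mul1g.
  by exists 1; rewrite freeprod_inl1 mulg1.
have [g e] := IH (reduced_tl rw); exists g.
by rewrite strip_cons// cl_cons e mulgA -cl_cons.
Qed.

(** Right multiplication by G only alters what [strip] removes, so the stripped word depends on the
    coset alone. *)
Lemma strip_inl v (g : G) : reduced v -> strip v = v ->
  strip (nf (cl v * freeprod_inl H g)) = v.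
Proof.
move=> rv sv; have [->|g1] := eqVneq g 1.
  by rewrite freeprod_inl1 mulg1 nf_reducedE.
rewrite [_ * _]pres_mulE cats1 nf_reducedE ?strip_rcons//.
elim: v rv sv => [|x v IH] rv sv; first by rewrite /reduced /= g1.
rewrite rcons_cons reduced_cons.
move: rv; rewrite reduced_cons => /and3P[-> rv' xv].
case: v IH rv' sv xv => [|y v] IH rv' sv xv.
  by rewrite /reduced /= g1; case: x sv.
rewrite IH//=.
by move: sv; rewrite strip_cons// => -[].
Qed.

Lemma strip_push_inr (h : H) v : strip v = v -> strip (push (inr h) v) = push (inr h) v.
Proof.
case: v => [|[g|k] v] sv /=; first by case: ifP.
  by case: ifP => // _; congr (_ :: _).
have sv' : strip v = v.
  by case: v sv => // y v; rewrite strip_cons// => -[].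
by case: ifP => // _; case: v sv sv' => // y v _ sv'; rewrite strip_cons// sv'.
Qed.

(** On the empty word the new letter would be stripped again: the base point is the only place where
    the section may fail to commute with a letter of G. *)
Lemma strip_push_inl (g : G) v : v != [::] -> strip v = v ->
  strip (push (inl g) v) = push (inl g) v.
Proof.
case: v => [|[k|h] v] // _ sv /=; last by case: ifP => // _; rewrite -[in RHS]sv.
have [sv' vn] : strip v = v /\ v != [::].
  by case: v sv => // y v; rewrite strip_cons// => -[].
by case: ifP => // _; rewrite strip_cons// sv'.
Qed.

Local Notation K := (range (@freeprod_inl G H)).
Local Notation X := (coset_space K).

Lemma coset_subproof (a : FP) : left_coset K a \in cosets K.
Proof. by apply/mem_set; exists a. Qed.

Definition gcoset (a : FP) : X := exist _ (left_coset K a) (coset_subproof a).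

Lemma gcosetP (A : X) : exists a, A = gcoset a.
Proof.
case: A => A AK; have [a _ aA] := set_mem AK.
by exists a; apply/val_inj.
Qed.

Lemma gcoset_act a b : coset_action K a (gcoset b) = gcoset (a * b).
Proof. by apply/val_inj; rewrite /= left_cosetM. Qed.

Lemma gcoset_eq a b : gcoset a = gcoset b <-> exists g : G, b = a * freeprod_inl H g.
Proof.
split=> [/(congr1 val) /= e|[g ->]].
  have : left_coset K b b by exists 1; rewrite ?mulg1//; exists 1 => //; exact: freeprod_inl1.
  by rewrite -e => -[_ [g _ <-] <-]; exists g.
apply/val_inj => /=; apply/seteqP; split=> _ [_ [k _ <-] <-].
  exists (freeprod_inl H (g^-1 * k)); first by exists (g^-1 * k).
  by rewrite freeprod_inlM mulgA freeprod_inlV mulgK.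
exists (freeprod_inl H (g * k)); first by exists (g * k).
by rewrite freeprod_inlM mulgA.
Qed.

Definition csection (A : X) : FP := cl (strip (nf (xget 1 [set a | A = gcoset a]))).

Lemma csectionE a : csection (gcoset a) = cl (strip (nf a)).
Proof.
rewrite /csection; case: xgetP => [b _ /= /gcoset_eq[g ->]|/(_ a)[]//].
have [g' e] := strip_spec (nf_reduced a).
have [r1 r2] := strip_reduced (nf_reduced a).
rewrite -{1}(nfK a) e -mulgA -freeprod_inlM strip_inl//.
Qed.

Lemma csectionK A : gcoset (csection A) = A.
Proof.
have [a ->] := gcosetP A; rewrite csectionE; apply/gcoset_eq.
by have [g e] := strip_spec (nf_reduced a); exists g; rewrite -e nfK.
Qed.

Lemma csection1 : csection (gcoset 1) = 1.
Proof. by rewrite csectionE nf1. Qed.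

Lemma csection_fix A : strip (nf (csection A)) = nf (csection A).
Proof.
have [a ->] := gcosetP A; rewrite csectionE.
by have [r1 r2] := strip_reduced (nf_reduced a); rewrite nf_reducedE.
Qed.

Lemma csection_inr (h : H) A :
  csection (coset_action K (freeprod_inr G h) A) = freeprod_inr G h * csection A.
Proof.
rewrite -{1}(csectionK A) gcoset_act csectionE nf_inr strip_push_inr ?csection_fix//.
by rewrite -nf_inr nfK.
Qed.

Lemma csection_inl (g : G) A : A <> gcoset 1 ->
  csection (coset_action K (freeprod_inl H g) A) = freeprod_inl H g * csection A.
Proof.
move=> A1; rewrite -{1}(csectionK A) gcoset_act csectionE nf_inl.
rewrite strip_push_inl ?csection_fix//; first by rewrite -nf_inl nfK.
apply/eqP => e; apply: A1; rewrite -(csectionK A); congr gcoset.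
by rewrite -(nfK (csection A)) e.
Qed.

(** Each letter of G adds one exceptional point, the one which the rest of the word moves to the
    base point; letters of H add none. *)
Lemma csection_almost_equivariant a : exists S : seq X, forall A, A \notin S ->
  csection (coset_action K a A) = a * csection A.
Proof.
elim/freeprod_ind: a => [|g a [S hS]|h a [S hS]].
- by exists [::] => A _; rewrite gact1 mul1g.
- exists (coset_action K a^-1 (gcoset 1) :: S) => A; rewrite inE negb_or => /andP[/eqP A1 /hS e].
  rewrite gactM csection_inl ?e ?mulgA// => h; apply: A1.
  by rewrite -h gactK.
- by exists S => A /hS e; rewrite gactM csection_inr e mulgA.
Qed.

Lemma gcoset1_inl (g : G) : coset_action K (freeprod_inl H g) (gcoset 1) = gcoset 1.
Proof. by rewrite gcoset_act mulg1; apply/esym/gcoset_eq; exists g; rewrite mul1g. Qed.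

Lemma inl_free (g : G) A : A <> gcoset 1 -> coset_action K (freeprod_inl H g) A = A -> g = 1.
Proof.
move=> A1 /(congr1 csection); rewrite csection_inl// => e.
apply: freeprod_inl_inj; rewrite freeprod_inl1.
by apply: (mulIg (csection A)); rewrite mul1g.
Qed.

(** It makes the coset space infinite as soon as H is. *)
Lemma gcoset_inr_inj (h h' : H) : gcoset (freeprod_inr G h) = gcoset (freeprod_inr G h') -> h = h'.
Proof.
move=> /(congr1 csection).
have e k : csection (gcoset (freeprod_inr G k)) = freeprod_inr G k.
  by rewrite -[freeprod_inr G k in LHS]mulg1 -gcoset_act csection_inr csection1 mulg1.
rewrite !e => eh; apply/eqP; rewrite -divg_eq1; apply/eqP/freeprod_inr_eq1.
by rewrite freeprod_inrM freeprod_inrV eh mulgV.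
Qed.

End FreeProductNormalForm.

(** * The boundary of the coset space *)

Section AmenableBoundary.
Variable R : realType.

Lemma sc_basic_open (X : Type) (B : set X) : open (sc_basic B).
Proof.
exists [set B] => //; apply/seteqP; split=> [U [_ -> //]|U UB].
by exists B.
Qed.

Lemma nsum_seq_le (X : choiceType) (f : X -> R) (e : R) :
  (forall x, 0 <= f x) -> (forall B : seq X, uniq B -> \sum_(x <- B) f x <= e) ->
  0 <= fine (nsum f) <= e.
Proof.
move=> f0 h; have h0 := nsum_ge0 f0; have h1 := nsum_le_seq h.
have fin : nsum f \is a fin_num by apply: nsum_fin => //; apply: le_lt_trans h1 _; rewrite ltry.
by rewrite -!lee_fin fineK// h0.
Qed.

Section Countability.

Lemma countable_freeprod (G H : groupType) : countable [set: G] -> countable [set: H] ->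
  countable [set: freeprod G H].
Proof.
move=> /countable_injP[f fI] /countable_injP[h hI].
pose e (x : G + H) : nat + nat := match x with inl g => inl (f g) | inr k => inr (h k) end.
have eI : injective e.
  by move=> [x|x] [y|y] //= [] xy; [rewrite (fI x y)|rewrite (hI x y)]; rewrite ?inE.
apply/countable_injP; exists (fun a => pickle (map e (nf a))) => a b _ _ ab.
rewrite -(nfK a) -(nfK b); congr pres_class.
by apply: (inj_map eI); apply: pcan_inj ab; exact: pickleK.
Qed.

Lemma countable_subgroup (G : groupType) (S : groupClosed G) : countable [set: G] ->
  countable [set: subgroup S].
Proof.
move=> /countable_injP[f fI]; apply/countable_injP.
by exists (fun u => f (val u)) => a b _ _ /fI ab; apply/val_inj/ab; rewrite inE.
Qed.

Lemma countable_exhaust (T : choiceType) (t0 : T) : countable [set: T] ->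
  exists E : nat -> seq T, forall t, exists N, forall n, (N <= n)%N -> t \in E n.
Proof.
move=> /countable_injP[f fI].
exists (fun n => [seq xget t0 [set g | f g = k] | k <- iota 0 n]) => t.
exists (f t).+1 => n tn; apply/mapP; exists (f t); first by rewrite mem_iota.
by case: xgetP => [h _ /fI ->|/(_ t) []]//; rewrite inE.
Qed.

End Countability.

(** The map is x t(x)^-1 for a chosen representative t(x) of the right coset of x. With it, property
    A of the subgroup can be evaluated along a section with values in the whole group. *)
Lemma subgroup_retract (G : groupType) (S : groupClosed G) :
  exists r : G -> subgroup S, forall (u : subgroup S) x, r (val u * x)%g = (u * r x)%g.
Proof.
pose C x := [set y | (y * x^-1)%g \in S].
pose t x := xget 1%g (C x).
have Ct (u : subgroup S) x : t (val u * x)%g = t x.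
  have uS : val u \in S by case: (u).
  rewrite /t; congr (xget _ _); apply/seteqP; split=> y; rewrite /C /= invgM.
    by rewrite mulgA (gpredFr _ uS).
  by rewrite mulgA (gpredFr _ uS).
have tP x : (x * (t x)^-1)%g \in S.
  rewrite -gpredV invgM invgK /t; case: xgetP => // /(_ x) []; rewrite /C /= mulgV.
  exact: gpred1.
exists (fun x => exist _ (x * (t x)^-1)%g (tP x)) => u x; apply/val_inj => /=.
by rewrite Ct mulgA.
Qed.

Lemma ptws_cvg (T : Type) (F : set_system {ptws T -> R}) (f : {ptws T -> R}) : Filter F ->
  (forall t, (fun g : {ptws T -> R} => g t) @ F --> f t) -> F --> f.
Proof.
move=> FF h; rewrite cvg_sup => t.
rewrite cvg_image; last by rewrite eqEsubset; split=> v // _; exists (cst v).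
move=> W /= Q; have Q' := h t W Q; exists (@^~ t @^-1` W) => //.
by rewrite eqEsubset; split => [j [? + <-//]|j Wj]; exists (fun _ => j).
Qed.

Variables Gamma Lambda : groupType.
Local Notation FP := (freeprod Gamma Lambda).
Local Notation K := (range (@freeprod_inl Gamma Lambda)).
Local Notation X := (coset_space K).

(** An ultrafilter which contains a singleton is principal. *)
Lemma cofinite_boundary (U : sc_boundary X) (S : seq X) : sc_ultra (val U) [set A | A \notin S].
Proof.
have UU := sc_ultraP (val U); have FU : ProperFilter (sc_ultra (val U)) by exact: ultra_proper.
elim: S => [|B S IH]; first by apply: filterS filterT.
have nB : sc_ultra (val U) (~` [set B]).
  have [h|//] := in_ultra_setVsetC [set B] UU.
  case: U UU FU {IH} h => U UP /= UU FU h; case: (set_mem UP); exists B => //.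
  apply: sc_inj; apply: esym; apply: (@max_filter _ _ (principal_filter_ultra B)) => //.
  by move=> A /principal_filterP AB; apply: filterS h => _ ->.
apply: filterS (filterI nB IH) => A [/= AB AS]; rewrite inE negb_or AS andbT.
by apply/eqP.
Qed.

(** The measures of property A are evaluated at the retracted section, and their limit is taken
    along the boundary point U itself. The section is equivariant off a finite set, which U does not
    see, so the approximate equivariance of the measures survives. *)
Lemma boundary_amenable (S : groupClosed FP) :
  countable [set: Gamma] -> countable [set: Lambda] -> propA R (subgroup S) ->
  topologically_amenable R (restrict_action S (boundary_action (coset_action K))).
Proof.
move=> cG cL pA.
have [E hE] := countable_exhaust 1%g (countable_subgroup S (countable_freeprod cG cL)).
have [r hr] := subgroup_retract S.
have /choice[Fm hFm] n : exists Fm : seq (subgroup S) * (subgroup S -> subgroup S -> R),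
    [/\ uniq Fm.1, forall x h, 0 <= Fm.2 x h, forall x h, h \notin Fm.1 -> Fm.2 x h = 0,
      forall x, \sum_(h <- Fm.1) Fm.2 x h = 1 &
      forall g x (B : seq (subgroup S)), g \in E n -> uniq B ->
        \sum_(h <- B) `|Fm.2 (g * x)%g h - Fm.2 x (g^-1 * h)%g| <= n.+1%:R^-1].
  have [|F [m hm]] := pA (E n) n.+1%:R^-1; first by rewrite invr_gt0.
  by exists (F, m).
pose sig (A : X) := r (csection A).
pose mu n (U : sc_boundary X) (h : subgroup S) : R :=
  ulim (sc_ultra (val U)) (fun A => (Fm n).2 (sig A) h).
have m01 n x h : 0 <= (Fm n).2 x h <= 1.
  have [uF F0 Fs F1 _] := hFm n; rewrite F0/=.
  have [hF|/Fs ->//] := boolP (h \in (Fm n).1).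
  by rewrite -(F1 x) (bigD1_seq h)//= lerDl sumr_ge0.
have bd n h : bdd (fun A => (Fm n).2 (sig A) h).
  by exists 1 => A; have /andP[h0 h1] := m01 n (sig A) h; rewrite ger0_norm.
have UU (U : sc_boundary X) : UltraFilter (sc_ultra (val U)) by exact: sc_ultraP.
have prob n U : prob_measures (mu n U).
  have [uF F0 Fs F1 _] := hFm n.
  have mu0 h : 0 <= mu n U h by apply: (ulim_ge (UU U)) => //; apply: filterS filterT => A _ /=.
  split=> //; rewrite (@nsum_supp _ _ (Fm n).1)//; last first.
    move=> h hF; rewrite /mu -[RHS](ulim_cst (UU U)); congr (ulim _ _).
    by apply/funext => A; exact: Fs.
  rewrite -(ulim_sum (UU U))// -[1%E]/(1%:E) -(ulim_cst (UU U) 1); congr (ulim _ _)%:E.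
  by apply/funext => A; exact: F1.
have almost n g U B : g \in E n -> uniq B ->
    \sum_(h <- B) `|mu n (restrict_action S (boundary_action (coset_action K)) g U) h -
      translate g (mu n U) h| <= n.+1%:R^-1.
  move=> gE uB; have [uF F0 Fs F1 Fe] := hFm n.
  have muE h : mu n (restrict_action S (boundary_action (coset_action K)) g U) h =
      ulim (sc_ultra (val U)) (fun A => (Fm n).2 (sig (coset_action K (val g) A)) h) by [].
  have bd' : forall h, bdd (fun A => (Fm n).2 (sig (coset_action K (val g) A)) h).
    by move=> h; have [M hM] := bd n h; exists M => A.
  have bd2 h : bdd (fun A => (Fm n).2 (sig (coset_action K (val g) A)) h - (Fm n).2 (sig A) (g^-1 * h)%g).
    by apply: bddD => //; exact: bddN.
  under eq_bigr => h _.
    rewrite muE /translate /mu -(ulimN (UU U) (bd _ _)) -(ulimD (UU U) (bd' _) (bddN (bd _ _))).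
    rewrite -(ulim_norm (UU U) (bd2 _)); over.
  rewrite -(ulim_sum (UU U)) => [|h]; last exact: bdd_norm.
  apply: (ulim_le (UU U)); first by apply: bdd_sum => h; exact: bdd_norm.
  have [T hT] := csection_almost_equivariant (val g).
  apply: filterS (cofinite_boundary U T) => A /= AT.
  by rewrite {1}/sig hT// hr; exact: Fe.
exists nat, (fun m n => (m <= n)%N : Prop), mu; split.
- split.
  + exact: (inhabits 0%N).
  + by move=> i.
  + by move=> i j k; exact: leq_trans.
  + by move=> i j; exists (maxn i j); rewrite leq_maxl leq_maxr.
- move=> n U; have FN : Filter (nbhs (U : sc_boundary X)) by exact: nbhs_filter.
  have FF : Filter (fmap (mu n : sc_boundary X -> {ptws (subgroup S) -> R}) (nbhs U)).
    exact: fmap_filter.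
  apply: (@ptws_cvg _ _ _ FF) => h; apply/cvgrPdist_lt => e e0.
  have e20 : 0 < e / 2 by rewrite divr_gt0.
  pose B := [set A | `|mu n U h - (Fm n).2 (sig A) h| <= e / 2].
  have UB : sc_ultra (val U) B.
    have := ulim_cvg (UU U) (bd n h) => /cvgrPdist_le /(_ _ e20); exact.
  (* A boundary point V near U contains B, and then the limit along V stays within e / 2 of the
     limit along U. *)
  have : nbhs U (set_val @^-1` (sc_basic B) : set (sc_boundary X)).
    have := @initial_continuous (sc_boundary X) _ set_val.
    move=> /continuousP /(_ _ (sc_basic_open B)) oB.
    exact: open_nbhs_nbhs.
  apply: filterS => V /= VB.
  apply: (@le_lt_trans _ _ (e / 2)); last by rewrite ltr_pdivrMr// ltr_pMr// ltr1n.
  have FV : ProperFilter (sc_ultra (val V)) by exact: ultra_proper.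
  rewrite distrC ler_distl; apply/andP; split.
    apply: (ulim_ge (UU V)) => //; apply: filterS VB => A /=; rewrite /B /=.
    by rewrite distrC ler_distl => /andP[].
  apply: (ulim_le (UU V)) => //; apply: filterS VB => A /=; rewrite /B /=.
  by rewrite distrC ler_distl => /andP[].
- exact: prob.
- have FT : Filter (net_tails (fun m n => (m <= n)%N : Prop)).
    split=> [|P Q [m hm] [n hn]|P Q PQ [m hm]]; first by exists 0%N.
      by exists (maxn m n) => k; rewrite geq_max => /andP[mk nk]; split; [exact: hm|exact: hn].
    by exists m => k /hm /PQ.
  move=> g; apply/cvgrPdist_le => e e0.
  have [N hN] := hE g; have [M _ hM] := near_infty_natSinv_lt (PosNum e0).
  exists (maxn N M) => n; rewrite geq_max => /andP[Nn Mn] /=.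
  rewrite sub0r normrN; set T := [set _ | _ in _].
  have TP t : T t -> 0 <= t <= n.+1%:R^-1.
    move=> [U _ <-]; apply: nsum_seq_le => [h|B uB]; first exact: normr_ge0.
    by apply: almost => //; exact: hN.
  have [->|/set0P[t Tt]] := eqVneq T set0; first by rewrite sup0 normr0 ltW.
  have ub : ubound T n.+1%:R^-1 by move=> x /TP/andP[].
  have s1 : sup T <= n.+1%:R^-1 by apply: ge_sup => //; exists t.
  have s0 : 0 <= sup T.
    have /andP[t0 _] := TP t Tt; apply: le_trans t0 _; apply: ub_le_sup => //.
    by exists n.+1%:R^-1.
  by rewrite ger0_norm//; apply: le_trans s1 _; exact: ltW (hM n Mn).
Qed.
End AmenableBoundary.

(** * The full group algebra and its images *)

Section HilbertFacts.
Variables (R : realType) (H : hilbertType R).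
Implicit Types x y z : H.

Lemma innerDl x y z : inner H (x + y) z = inner H x z + inner H y z.
Proof. exact: linearDl. Qed.

Lemma innerZl c x z : inner H (c *: x) z = c * inner H x z.
Proof. exact: linearZl_LR. Qed.

Lemma innerC x y : inner H x y = (inner H y x)^*%C.
Proof. by have := hermC (inner H) x y; rewrite expr0 mul1r. Qed.

Lemma innerDr x y z : inner H z (x + y) = inner H z x + inner H z y.
Proof. by rewrite innerC innerDl rmorphD /= -!innerC. Qed.

Lemma innerZr c x z : inner H z (c *: x) = c^*%C * inner H z x.
Proof. by rewrite innerC innerZl rmorphM /= -innerC. Qed.

Lemma inner0l z : inner H 0 z = 0.
Proof. by rewrite -(scale0r z) innerZl mul0r. Qed.

Lemma inner0r z : inner H z 0 = 0.
Proof. by rewrite innerC inner0l rmorph0. Qed.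

Lemma inner_nm x : inner H x x = (nm x ^+ 2)%:C%C.
Proof. by rewrite inner_norm nmE -rmorphXn. Qed.

Lemma nm2D x y : nm (x + y) ^+ 2 = nm x ^+ 2 + nm y ^+ 2 + 2 * Re (inner H x y).
Proof.
apply: complexI; rewrite -inner_nm innerDl !innerDr !inner_nm (innerC y x).
case: (inner H x y) => a b; rewrite !rmorphD !rmorphM /=.
by apply/eqP; rewrite eq_complex /=; apply/andP; split; apply/eqP; ring.
Qed.

Lemma Re_inner_le x y : Re (inner H x y) <= nm x * nm y.
Proof.
have : nm (x + y) ^+ 2 <= (nm x + nm y) ^+ 2.
  by rewrite ler_pXn2r ?nnegrE ?addr_ge0 ?nm_ge0// nmD.
rewrite nm2D; lra.
Qed.

End HilbertFacts.

Section OperatorBounds.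
Variables (R : realType) (H : hilbertType R).
Implicit Types (S T : H -> H) (x y : H).

Definition opb T (c : R) := forall x, nm (T x) <= c * nm x.

Lemma lin0 T : linear T -> T 0 = 0.
Proof. by move=> hT; have := hT (-1) 0 0; rewrite !scaleN1r !addNr. Qed.

Lemma linZ T : linear T -> forall c x, T (c *: x) = c *: T x.
Proof. by move=> hT c x; have := hT c x 0; rewrite (lin0 hT) !addr0. Qed.

Lemma linD T : linear T -> forall x y, T (x + y) = T x + T y.
Proof. by move=> hT x y; have := hT 1 x y; rewrite !scale1r. Qed.

Lemma linN T : linear T -> forall x, T (- x) = - T x.
Proof. by move=> hT x; rewrite -scaleN1r (linZ hT) scaleN1r. Qed.

Lemma linB T : linear T -> forall x y, T (x - y) = T x - T y.
Proof. by move=> hT x y; rewrite (linD hT) (linN hT). Qed.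

Lemma lin_sum T (I : Type) (r : seq I) (f : I -> H) : linear T ->
  T (\sum_(i <- r) f i) = \sum_(i <- r) T (f i).
Proof. by move=> hT; apply: big_morph; [exact: linD|exact: lin0]. Qed.

Lemma linear_comp S T : linear S -> linear T -> linear (S \o T).
Proof. by move=> hS hT c x y; rewrite /= hT hS. Qed.

Lemma linear_add S T : linear S -> linear T -> linear (S + T).
Proof. by move=> hS hT c x y; rewrite -![(_ + _) _]/(S _ + T _) hS hT scalerDr addrACA. Qed.

Lemma linear_scale c T : linear T -> linear (c *: T).
Proof.
by move=> hT d x y; rewrite -![(c *: T) _]/(c *: T _) hT scalerDr !scalerA mulrC.
Qed.

Lemma linear_sub S T : linear S -> linear T -> linear (S - T).
Proof. by move=> hS hT c x y; rewrite -![(_ - _) _]/(S _ - T _) hS hT scalerBr opprD addrACA. Qed.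

Lemma opb_ge0_le T c d : c <= d -> opb T c -> opb T d.
Proof. by move=> cd hT x; apply: le_trans (hT x) _; rewrite ler_wpM2r// nm_ge0. Qed.

Lemma opbD S T c d : opb S c -> opb T d -> opb (S + T) (c + d).
Proof. by move=> hS hT x; apply: le_trans (nmD _ _) _; rewrite mulrDl lerD. Qed.

Lemma opbN T c : opb T c -> opb (- T) c.
Proof. by move=> hT x; rewrite -[(- T) x]/(- T x) nmN. Qed.

Lemma opbB S T c d : opb S c -> opb T d -> opb (S - T) (c + d).
Proof. by move=> hS hT; apply: opbD => //; exact: opbN. Qed.

Lemma opb_distC S T c : opb (S - T) c -> opb (T - S) c.
Proof. by move=> h; rewrite -opprB; exact: opbN. Qed.

Lemma opb_trans S T W c d : opb (S - T) c -> opb (T - W) d -> opb (S - W) (c + d).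
Proof.
by move=> h1 h2; have := opbD h1 h2; rewrite addrA subrK.
Qed.

Lemma opb_comp S T c d : 0 <= c -> opb S c -> opb T d -> opb (S \o T) (c * d).
Proof.
by move=> c0 hS hT x; apply: le_trans (hS _) _; rewrite -mulrA ler_wpM2l.
Qed.

Lemma opbZ a T c : opb T c -> opb (a *: T) (mag a * c).
Proof. by move=> hT x; rewrite nmZ -mulrA ler_wpM2l// mag_ge0. Qed.

Lemma bounded_opsP T : @bounded_ops R H T <-> linear T /\ exists2 c, 0 <= c & opb T c.
Proof.
split=> [[hT [M hM]]|[hT [c c0 hc]]]; split=> //.
  exists (Num.max M 0); first by rewrite le_max lexx orbT.
  move=> x; apply: le_trans (_ : M * nm x <= _); last by rewrite ler_wpM2r ?nm_ge0// le_max lexx.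
  by rewrite -lecR rmorphM /= -!nmE.
by exists c => x; rewrite !nmE -rmorphM /= lecR.
Qed.

Lemma opnorm_le T c : 0 <= c -> opb T c -> (opnorm T <= c%:E)%E.
Proof.
move=> c0 hT; apply: ge_ereal_sup => _ [x /= x1 <-]; rewrite lee_fin.
apply: le_trans (hT x) _; rewrite -[leRHS]mulr1 ler_wpM2l//.
by rewrite -lecR -nmE.
Qed.

Lemma opnorm_opb T c : linear T -> (opnorm T <= c%:E)%E -> opb T c.
Proof.
move=> hT hc x; have [x0|xn] := eqVneq (nm x) 0.
  by rewrite (nm_eq0 x0) (lin0 hT) !nm0 mulr0.
have xp : 0 < nm x by rewrite lt0r xn nm_ge0.
pose y := ((nm x)^-1)%:C%C *: x.
have y1 : nm y = 1 by rewrite nmZr ger0_norm ?invr_ge0 ?nm_ge0// mulVf.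
have : ((nm (T y))%:E <= c%:E)%E.
  apply: le_trans hc; apply: ereal_sup_ubound; exists y => //=.
  by rewrite nmE y1 lexx.
rewrite lee_fin (linZ hT) nmZr ger0_norm ?invr_ge0 ?nm_ge0// mulrC ler_pdivrMr//.
Qed.

Lemma opnorm_cvgP (u : nat -> H -> H) T : (forall n, linear (u n)) -> linear T ->
  opnorm_cvg u T <-> forall e, 0 < e -> exists N, forall n, (N <= n)%N -> opb (u n - T) e.
Proof.
move=> hu hT; split=> [/fine_cvgP[[N1 _ fin] /cvgrPdist_le h] e e0|h].
  have [N2 _ hN2] := h e e0; exists (maxn N1 N2) => n; rewrite geq_max => /andP[n1 n2].
  apply: opnorm_opb; first exact: linear_sub.
  have := hN2 n n2; rewrite sub0r normrN => /(le_trans (ler_norm _)).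
  by rewrite -lee_fin /= fineK//; exact: fin.
have fin n (e : R) : 0 <= e -> opb (u n - T) e -> (0 <= opnorm (u n - T)%R <= e%:E)%E.
  move=> e0 he; rewrite opnorm_le// andbT.
  apply: (@le_trans _ _ (nm ((u n - T) 0))%:E); first by rewrite lee_fin nm_ge0.
  by apply: ereal_sup_ubound; exists 0 => //=; rewrite normr0.
have finN n (e : R) : 0 <= e -> opb (u n - T) e -> opnorm (u n - T)%R \is a fin_num.
  move=> e0 /(fin n e e0)/andP[h1 h2]; rewrite ge0_fin_numE//.
  by apply: le_lt_trans h2 _; rewrite ltry.
apply/fine_cvgP; split.
  by have [N hN] := h 1 ltr01; exists N => // n Nn; apply: (finN n 1) => //; exact: hN.
apply/cvgrPdist_le => e e0; have [N hN] := h e e0; exists N => // n Nn.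
have /andP[h1 h2] := fin n e (ltW e0) (hN n Nn).
have f := finN n e (ltW e0) (hN n Nn).
by rewrite sub0r normrN ger0_norm ?fine_ge0// -lee_fin fineK.
Qed.

End OperatorBounds.

Section GroupAlgebraLists.
Variables (R : realType) (G : groupType).
Local Notation C := (R[i]).
(* Elements of C[G] are handled as lists of pairs (coefficient, group element). *)
Local Notation gl := (seq (C * G)).
Implicit Types l : gl.

Definition glrep (H : hilbertType R) (U : unitary_rep G H) l (x : H) : H :=
  \sum_(p <- l) p.1 *: U p.2 x.

Definition glfun l (g : G) : C := \sum_(p <- l | p.2 == g) p.1.
Definition glmul l l' : gl := [seq (p.1 * q.1, (p.2 * q.2)%g) | p <- l, q <- l'].
Definition glstar l : gl := [seq (p.1^*%C, p.2^-1%g) | p <- l].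
Definition glscale (c : C) l : gl := [seq (c * p.1, p.2) | p <- l].
Definition gl1 : gl := [:: (1, 1%g)].
Definition gln l : R := \sum_(p <- l) mag p.1.

Section Rep.
Variables (H : hilbertType R) (U : unitary_rep G H).
Local Notation rep := (glrep U).

Lemma glrep_linear l : linear (rep l).
Proof.
move=> c x y; rewrite /glrep scaler_sumr -big_split /=; apply: eq_bigr => p _.
by rewrite urep_linear scalerDr !scalerA mulrC.
Qed.

Lemma glrep_cat l l' x : rep (l ++ l') x = rep l x + rep l' x.
Proof. by rewrite /glrep big_cat. Qed.

Lemma glrep_scale c l x : rep (glscale c l) x = c *: rep l x.
Proof. by rewrite /glrep big_map scaler_sumr; apply: eq_bigr => p _; rewrite scalerA. Qed.

Lemma glrep1 x : rep gl1 x = x.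
Proof. by rewrite /glrep big_seq1 urep1 scale1r. Qed.

Lemma glrep_mul l l' x : rep (glmul l l') x = rep l (rep l' x).
Proof.
rewrite /glrep big_allpairs_dep /=; apply: eq_bigr => p _.
rewrite urep_sum scaler_sumr; apply: eq_bigr => q _.
by rewrite urep_scale scalerA urepM.
Qed.

Lemma glrep_sub l l' : rep (l ++ glscale (-1) l') = rep l - rep l'.
Proof.
by apply/funext => x; rewrite glrep_cat glrep_scale scaleN1r.
Qed.

Lemma urep_adj g x y : inner H (U g x) y = inner H x (U g^-1%g y).
Proof. by rewrite -(urep_inner U g x) -urepM mulgV urep1. Qed.

Lemma glrep_star l x y : inner H (rep l x) y = inner H x (rep (glstar l) y).
Proof.
elim: l => [|p l IH]; first by rewrite /glrep !big_nil inner0l inner0r.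
rewrite /glrep /= !big_cons innerDl innerDr -/(glrep U l x) IH /glstar.
by rewrite -/(glrep U _ y) innerZl innerZr conjcK urep_adj.
Qed.

Lemma gln_ge0 l : 0 <= gln l.
Proof. by apply: sumr_ge0 => p _; exact: mag_ge0. Qed.

Lemma opb_gln l : opb (rep l) (gln l).
Proof.
move=> x; rewrite /glrep /gln; apply: le_trans (nm_sum _ _ _) _.
by rewrite mulr_suml; apply: ler_sum => p _; rewrite nmZ nm_urep.
Qed.

Lemma glrep_bounded l : @bounded_ops R H (rep l).
Proof.
apply/bounded_opsP; split; first exact: glrep_linear.
by exists (gln l); [exact: gln_ge0|exact: opb_gln].
Qed.

Lemma algebra_rep_supp (f : G -> C) (S : seq G) x : uniq S -> (forall g, f g != 0 -> g \in S) ->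
  algebra_rep U f x = \sum_(g <- S) f g *: U g x.
Proof.
move=> uS fS; rewrite /algebra_rep (fsbigE S _ uS)//.
  by apply: eq_bigl => g; rewrite in_setT.
move=> g _; apply: contraNeq => h; apply: fS; apply: contraNneq h => ->.
by rewrite scale0r.
Qed.

Lemma algebra_rep_glfun l : algebra_rep U (glfun l) = rep l.
Proof.
apply/funext => x; rewrite (@algebra_rep_supp _ (undup (map snd l))) ?undup_uniq//.
  rewrite /glfun; under eq_bigr do rewrite scaler_suml.
  rewrite (exchange_big_dep xpredT)//= /glrep big_seq [RHS]big_seq; apply: eq_bigr => p pl.
  rewrite big_mkcond (bigD1_seq p.2) ?undup_uniq ?mem_undup ?map_f//= eqxx big1 ?addr0// => g.
  by rewrite eq_sym => /negbTE ->.
move=> g; apply: contraNT; rewrite mem_undup => gl; apply/eqP; rewrite /glfun big_seq_cond big1// => p /andP[pl /eqP e].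
by move: gl; rewrite -e map_f.
Qed.

End Rep.

Lemma glfun_supp l : group_algebra (glfun l).
Proof.
apply: (@sub_finite_set _ _ [set` map snd l]); last exact: finite_seq.
move=> g /=; apply: contraNT => gl; apply/eqP; rewrite /glfun big_seq_cond big1// => p /andP[pl /eqP e].
by move: gl; rewrite -e map_f.
Qed.

Lemma glfun_surj f : group_algebra f -> exists l, glfun l = f.
Proof.
move=> fS; have [S fE] : exists S : seq G, forall g, f g != 0 -> g \in S.
  move: fS => /finite_seqP[S e]; exists S => g gf.
  by have : [set g | f g != 0] g by []; rewrite e.
exists [seq (f g, g) | g <- undup S]; apply/funext => g; rewrite /glfun big_map /=.
have [gS|gS] := boolP (g \in S).
  rewrite big_mkcond (bigD1_seq g) ?mem_undup ?undup_uniq//= eqxx big1 ?addr0// => h /negbTE -> //.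
rewrite big_seq_cond big1 => [|h]; last by rewrite mem_undup => /andP[hS /eqP e]; move: gS; rewrite -e hS.
by apply/esym; apply: contraNeq gS => /fE.
Qed.

Lemma glfun_sub l l' : glfun l - glfun l' = glfun (l ++ glscale (-1) l').
Proof.
apply/funext => g; rewrite -[LHS]/(glfun l g - glfun l' g) /glfun big_cat; congr (_ + _).
by rewrite big_map -sumrN; apply: eq_bigr => p _; rewrite mulN1r.
Qed.

Lemma universal_norm_le l (c : R) : 0 <= c ->
  (forall (H : hilbertType R) (U : unitary_rep G H), opb (glrep U l) c) ->
  (universal_norm (glfun l) <= c%:E)%E.
Proof.
move=> c0 h; apply: ge_ereal_sup => _ [H [U ->]]; rewrite algebra_rep_glfun.
exact: opnorm_le.
Qed.

End GroupAlgebraLists.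

(** * Lifting from one representation to the universal norm *)

Section QuotientNorm.
Variables (R : realType) (G : groupType).
Local Notation C := (R[i]).
Local Notation gl := (seq (C * G)).
Implicit Types l z : gl.

(** The partial sum 1 + z + ... + z^k, taken in C[G] so that it has a meaning in all representations
    at once. *)
Fixpoint neumann z k : gl := if k is k'.+1 then gl1 R G ++ glmul z (neumann z k') else gl1 R G.

Lemma gln_star l : gln (glstar l) = gln l.
Proof. by rewrite /gln big_map; apply: eq_bigr => p _; rewrite mag_conj. Qed.

Lemma expr_small (th e : R) : 0 <= th -> th < 1 -> 0 < e -> exists N, forall n, (N <= n)%N -> th ^+ n <= e.
Proof.
move=> t0 t1 e0; have : th ^+ n @[n --> \oo] --> 0 by apply: cvg_expr; rewrite ger0_norm.
move=> /cvgrPdist_le /(_ e e0) [N _ h]; exists N => n Nn.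
by have := h n Nn; rewrite sub0r normrN ger0_norm// exprn_ge0.
Qed.

Section Rep.
Variables (H : hilbertType R) (U : unitary_rep G H) (l : gl) (t : R).
Hypothesis t0 : 0 <= t.
Local Notation L := (glrep U l).
Local Notation Ls := (glrep U (glstar l)).
Implicit Types v w : H.
Let M := gln l ^+ 2.
Let D := 1 + t * M.
(** Chosen so that 1 + t L^* L = D (1 - Z), with Z a strict contraction in every representation by
    the same ratio, because M bounds L^* L everywhere. *)
Definition resolvent_list : gl :=
  glscale (t / D)%:C%C (glscale M%:C%C (gl1 R G) ++ glscale (-1) (glmul (glstar l) l)).
Local Notation Z := (glrep U resolvent_list).

Let M0 : 0 <= M. Proof. exact: sqr_ge0. Qed.
Let D1 : 1 <= D. Proof. by rewrite lerDl mulr_ge0. Qed.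
Let D0 : 0 < D. Proof. exact: lt_le_trans ltr01 D1. Qed.

Lemma inner_square v : inner H v (Ls (L v)) = (nm (L v) ^+ 2)%:C%C.
Proof. by rewrite -glrep_star inner_nm. Qed.

Lemma resolventE v : Z v = (t / D)%:C%C *: (M%:C%C *: v - Ls (L v)).
Proof. by rewrite glrep_scale glrep_cat !glrep_scale glrep1 scaleN1r glrep_mul. Qed.

(** Replaces the operator inequality 0 <= L^* L <= M: in the expanded square the cross term -2 M |L
    v|^2 outweighs the norm of L^* L v squared. *)
Lemma positive_sub_le v : nm (M%:C%C *: v - Ls (L v)) <= M * nm v.
Proof.
rewrite -(@ler_pXn2r _ 2) ?nnegrE ?(mulr_ge0 M0) ?nm_ge0// nm2D nmN nmZr ger0_norm//.
have -> : Re (inner H (M%:C%C *: v) (- Ls (L v))) = - (M * nm (L v) ^+ 2).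
  by rewrite innerZl -scaleN1r innerZr inner_square /=; ring.
have : nm (Ls (L v)) ^+ 2 <= M * nm (L v) ^+ 2.
  rewrite -exprMn ler_pXn2r ?nnegrE ?mulr_ge0 ?nm_ge0 ?gln_ge0//.
  by rewrite -gln_star; exact: opb_gln.
have : 0 <= M * nm (L v) ^+ 2 by rewrite mulr_ge0// sqr_ge0.
by move: (M * _) => a; lra.
Qed.

Lemma resolvent_bound : opb Z (t * M / D).
Proof.
move=> v; rewrite resolventE nmZr ger0_norm ?divr_ge0 ?(ltW D0)//.
have -> : t * M / D * nm v = t / D * (M * nm v) by ring.
by rewrite ler_wpM2l ?divr_ge0 ?(ltW D0)//; exact: positive_sub_le.
Qed.

Lemma neumannE k v : glrep U (neumann resolvent_list k) v - Z (glrep U (neumann resolvent_list k) v) =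
  v - iter k.+1 Z v.
Proof.
have lin := glrep_linear U resolvent_list.
elim: k => [|k IH]; first by rewrite glrep1.
rewrite -[neumann _ k.+1]/(gl1 R G ++ glmul _ (neumann _ k)) glrep_cat glrep1 glrep_mul (linD lin) opprD addrACA -(linB lin) IH.
by rewrite (linB lin) addrA subrK.
Qed.

Lemma iter_bound k v : nm (iter k Z v) <= (t * M / D) ^+ k * nm v.
Proof.
elim: k => [|k IH]; first by rewrite expr0 mul1r.
rewrite iterS exprS -mulrA; apply: le_trans (resolvent_bound _) _.
by rewrite ler_wpM2l//; exact: (divr_ge0 (mulr_ge0 t0 M0) (ltW D0)).
Qed.

Lemma resolvent_ratio : 0 <= t * M / D < 1.
Proof.
rewrite (divr_ge0 (mulr_ge0 t0 M0) (ltW D0))/= ltr_pdivrMr// mul1r /D.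
by rewrite ltrDr ltr01.
Qed.

(* u is nearly (1 + t L^* L)^-1 v. *)
Lemma resolvent_spec k v : let u := glrep U (glscale D^-1%:C%C (neumann resolvent_list k)) v in
  let v' := v - iter k.+1 Z v in
  [/\ u + t%:C%C *: Ls (L u) = v', nm v' <= 2 * nm v, nm u <= nm v' &
     2 * t * nm (L u) ^+ 2 <= nm v' ^+ 2].
Proof.
move=> u v'.
have lin := glrep_linear U resolvent_list.
have uv : u + t%:C%C *: Ls (L u) = v'.
  rewrite /v' -neumannE; set s := glrep U (neumann _ k) v.
  have uE : u = D^-1%:C%C *: s by rewrite /u glrep_scale.
  have sE : s = D%:C%C *: u by rewrite uE scalerA -rmorphM /= divff ?scale1r// gt_eqF.
  rewrite {1}sE sE (linZ lin) resolventE scalerA -rmorphM /= mulrCA divff ?gt_eqF// mulr1.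
  rewrite [in RHS]scalerBr [in RHS]opprB [RHS]addrCA scalerA -rmorphM /= -scalerBl -rmorphB /=.
  by rewrite /D addrK scale1r addrC.
have v'2 : nm v' <= 2 * nm v.
  have -> : 2 * nm v = nm v + nm v by ring.
  apply: le_trans (nmB _ _) _; rewrite lerD2l; apply: le_trans (iter_bound _ _) _.
  rewrite ler_piMl ?nm_ge0//; have /andP[r0 r1] := resolvent_ratio.
  by apply: exprn_ile1 => //; exact: ltW.
have e : nm v' ^+ 2 = nm u ^+ 2 + nm (t%:C%C *: Ls (L u)) ^+ 2 + 2 * (t * nm (L u) ^+ 2).
  rewrite -uv nm2D; congr (_ + 2 * _).
  by rewrite innerZr inner_square /=; ring.
have h1 := sqr_ge0 (nm (t%:C%C *: Ls (L u))).
have h2 : 0 <= t * nm (L u) ^+ 2 by rewrite mulr_ge0// sqr_ge0.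
split=> //; last first.
  by rewrite e; move: (sqr_ge0 (nm u)) h1 h2; rewrite -!mulrA; move: (_ ^+ 2) (_ ^+ 2) (t * _) => a b c; lra.
rewrite -(@ler_pXn2r _ 2) ?nnegrE ?nm_ge0// e.
by move: h1 h2; move: (_ ^+ 2) (_ ^+ 2) (t * _) => a b c; lra.
Qed.

Lemma opb_star c : 0 <= c -> opb L c -> opb Ls c.
Proof.
move=> c0 hL w; have [w0|wp] := leP (nm (Ls w)) 0.
  by apply: le_trans w0 _; rewrite mulr_ge0 ?nm_ge0.
rewrite -(ler_pM2l wp) -expr2.
have -> : nm (Ls w) ^+ 2 = Re (inner H (L (Ls w)) w) by rewrite glrep_star inner_nm.
apply: le_trans (Re_inner_le _ _) _.
apply: le_trans (ler_wpM2r (nm_ge0 w) (hL (Ls w))) _.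
by rewrite mulrAC mulrC.
Qed.

End Rep.

(* A quantitative form of the fact that the range of a *-homomorphism is closed. *)
Lemma lift_step (H : hilbertType R) (U : unitary_rep G H) l (c : R) : 0 < c -> opb (glrep U l) c ->
  exists l', (forall (H' : hilbertType R) (U' : unitary_rep G H'), opb (glrep U' l') (6 * c)) /\
    opb (glrep U l - glrep U l') (c / 2).
Proof.
(* The lift is l' = l g with g close to (1 + t L^* L)^-1. In any representation |L g v| is at most 2
   |v| / sqrt(2 t) <= 6 c |v|; in the given one, t is small enough for L - L g to have norm at most
   c / 8 + c / 4. *)
move=> c0 hc; pose t := (16 * c ^+ 2)^-1.
have c2 : 0 < 16 * c ^+ 2 by rewrite mulr_gt0 ?exprn_gt0.
have t0 : 0 <= t by rewrite invr_ge0 ltW.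
have tE : t * (16 * c ^+ 2) = 1 by rewrite mulVf// gt_eqF.
have /andP[r0 r1] := resolvent_ratio l t0.
have q0 : 0 < 4^-1 :> R by rewrite invr_gt0.
have [k hk] := expr_small r0 r1 q0.
pose g := glscale (1 + t * gln l ^+ 2)^-1%:C%C (neumann (resolvent_list l t) k).
exists (glmul l g); split=> [H' U' v|v].
  rewrite glrep_mul; have [_ h1 _ h2] := resolvent_spec U' l t0 k v.
  set u := glrep U' _ v in h2 *; set v' := v - _ in h1 h2.
  rewrite -(@ler_pXn2r _ 2) ?nnegrE ?mulr_ge0 ?nm_ge0 ?(ltW c0)//.
  have t0' : 0 < 2 * t by rewrite mulr_gt0// invr_gt0.
  rewrite -(ler_pM2l t0'); apply: le_trans h2 _.
  apply: (@le_trans _ _ ((2 * nm v) ^+ 2)).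
    by rewrite ler_pXn2r ?nnegrE ?mulr_ge0 ?nm_ge0.
  have -> : 2 * t * (6 * c * nm v) ^+ 2 = (t * (16 * c ^+ 2)) * ((9 / 2) * nm v ^+ 2) by field.
  rewrite tE mul1r exprMn ler_wpM2r ?sqr_ge0//; lra.
rewrite -[(_ - _) v]/(glrep U l v - glrep U (glmul l g) v) glrep_mul.
have [e h1 h2 _] := resolvent_spec U l t0 k v.
have lin := glrep_linear U.
set u := glrep U g v in e h2 *; set it := iter _ _ _ in e h1 h2.
have -> : glrep U l v - glrep U l u = glrep U l (t%:C%C *: glrep U (glstar l) (glrep U l u) + it).
  rewrite -(linB (lin l)); congr (glrep U l _); apply/eqP.
  by rewrite subr_eq -addrA [it + u]addrC addrA [_ + u]addrC e subrK.
rewrite (linD (lin l)) (linZ (lin l)).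
have cs := opb_star (ltW c0) hc.
have a1 : nm (t%:C%C *: glrep U l (glrep U (glstar l) (glrep U l u))) <= c / 8 * nm v.
  rewrite nmZr ger0_norm//; have h3 : nm u <= 2 * nm v by exact: le_trans h2 h1.
  apply: (@le_trans _ _ (t * (c * (c * (c * (2 * nm v)))))).
    rewrite ler_wpM2l//; apply: le_trans (hc _) _; rewrite ler_wpM2l ?(ltW c0)//.
    apply: le_trans (cs _) _; rewrite ler_wpM2l ?(ltW c0)//.
    by apply: le_trans (hc _) _; rewrite ler_wpM2l ?(ltW c0).
  have -> : t * (c * (c * (c * (2 * nm v)))) = (t * (16 * c ^+ 2)) * (c / 8 * nm v) by field.
  by rewrite tE mul1r.
have a2 : nm (glrep U l it) <= c / 4 * nm v.
  apply: le_trans (hc _) _; rewrite -mulrA ler_wpM2l ?(ltW c0)//.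
  by apply: le_trans (iter_bound _ _ t0 _ _) _; rewrite ler_wpM2r ?nm_ge0// hk.
apply: le_trans (nmD _ _) _; apply: le_trans (lerD a1 a2) _.
have := mulr_ge0 (ltW c0) (nm_ge0 v); move: (c) (nm v) => a b ab.
by lra.
Qed.

Lemma group_algebra_cvg_approx (H : hilbertType R) (U : unitary_rep G H) (u : nat -> G -> C) T :
  (forall n, group_algebra (u n)) -> linear T -> opnorm_cvg (fun n => algebra_rep U (u n)) T ->
  forall e, 0 < e -> exists l, opb (glrep U l - T) e.
Proof.
move=> hu lT uT e e0; have /choice[ls hls] n : exists l, algebra_rep U (u n) = glrep U l.
  by have [l <-] := glfun_surj (hu n); exists l; exact: algebra_rep_glfun.
have h : opnorm_cvg (fun n => glrep U (ls n)) T.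
  by move: uT; congr opnorm_cvg; apply/funext => n; exact: hls.
have [N hN] := (opnorm_cvgP (fun n => glrep_linear U (ls n)) lT).1 h e e0.
by exists (ls N); exact: hN.
Qed.

Lemma group_algebra_approx_cvg (H : hilbertType R) (U : unitary_rep G H) T : linear T ->
  (forall e : R, 0 < e -> exists l, opb (glrep U l - T) e) ->
  exists u : nat -> G -> C, (forall n, group_algebra (u n)) /\
    opnorm_cvg (fun n => algebra_rep U (u n)) T.
Proof.
move=> lT hT; have /choice[ls hls] (n : nat) : exists l, opb (glrep U l - T) (n.+1%:R^-1).
  by apply: hT; rewrite invr_gt0.
exists (fun n => glfun (ls n)); split=> [n|]; first exact: glfun_supp.
have -> : (fun n => algebra_rep U (glfun (ls n))) = (fun n => glrep U (ls n)).
  by apply/funext => n; exact: algebra_rep_glfun.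
apply/opnorm_cvgP => [n||e e0]; [exact: glrep_linear|by []|].
have ei : 0 <= e^-1 by rewrite invr_ge0 ltW.
exists (Num.bound e^-1) => n Nn; apply: opb_ge0_le (hls n).
rewrite -[e]invrK lef_pV2 ?posrE ?invr_gt0 ?ltr0n//.
by apply: le_trans (ltW (archi_boundP ei)) _; rewrite ler_nat ltnW.
Qed.

(** Approximants in U alone need not form a Cauchy sequence for the universal norm. Each correction
    is therefore replaced by its lift from [lift_step], of comparable norm in all representations,
    and the lifts are summed. *)
Lemma full_imageP (H : hilbertType R) (U : unitary_rep G H) (T : H -> H) :
  full_image U T <-> @bounded_ops R H T /\ forall e, 0 < e -> exists l, opb (glrep U l - T) e.
Proof.
split=> [[bT [a aT]]|[bT hT]]; split=> //; have [linT _] := (bounded_opsP T).1 bT.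
  exact: group_algebra_cvg_approx (completion_mem a) linT aT.
(* A correction of size 9/8 c n has a lift of norm at most 27/4 c n <= 7 c n everywhere, and leaves
   the error 1/8 + 9/16 <= 3/4 of c n. *)
pose r : R := 3 / 4; pose c n := r ^+ n.
have r0 : 0 <= r by rewrite /r; lra.
have r1 : r < 1 by rewrite /r; lra.
have c0 n : 0 < c n by rewrite exprn_gt0// /r; lra.
have /choice[f hf] (p : nat * gl) : exists l', opb (glrep U p.2 - T) (c p.1) ->
    opb (glrep U (p.2 ++ l') - T) (c p.1.+1) /\
    forall (H' : hilbertType R) (U' : unitary_rep G H'), opb (glrep U' l') (7 * c p.1).
  case: p => n l /=; have [hl|nh] := pselect (opb (glrep U l - T) (c n)); last by exists [::].
  have [|m hm] := hT (c n / 8); first by rewrite divr_gt0.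
  have hml : opb (glrep U (m ++ glscale (-1) l)) (9 / 8 * c n).
    rewrite glrep_sub; have := opb_trans hm (opb_distC hl).
    by apply: opb_ge0_le; lra.
  have [|l' [h1 h2]] := lift_step _ hml; first by rewrite mulr_gt0//; lra.
  exists l' => _; split.
    have -> : glrep U (l ++ l') - T =
        (glrep U m - T) - (glrep U (m ++ glscale (-1) l) - glrep U l').
      rewrite glrep_sub; apply/funext => x.
      rewrite /GRing.add /GRing.opp /= glrep_cat.
      move: (T x) (glrep U l x) (glrep U m x) (glrep U l' x) => a b b' b''.
      have e : b' = b + b'' + (b' - b - b'') by rewrite -addrA [b'' + _]addrC subrK addrC subrK.
      by move: e; move: (b' - b - b'') => d ->; rewrite [RHS]addrAC addrK.
    apply: opb_ge0_le (opbB hm h2); rewrite /c exprS -/(c n) /r; have := c0 n; lra.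
  move=> H' U'; apply: opb_ge0_le (h1 H' U'); have := c0 n; lra.
have [|l0 hl0] := hT 1; first exact: ltr01.
pose L := fix L n := if n is n'.+1 then L n' ++ f (n', L n') else l0.
have LS n : L n.+1 = L n ++ f (n, L n) by [].
have hL n : opb (glrep U (L n) - T) (c n).
  elim: n => [|n IH]; first by rewrite /c expr0.
  by have [] := hf (n, L n) IH.
have inc n (H' : hilbertType R) (U' : unitary_rep G H') : opb (glrep U' (f (n, L n))) (7 * c n).
  by have [_] := hf (n, L n) (hL n); exact.
(* 28 = 7 / (1 - 3/4) sums the geometric series of corrections. *)
have tail n k (H' : hilbertType R) (U' : unitary_rep G H') :
    opb (glrep U' (L (n + k)%N) - glrep U' (L n)) (28 * (c n - c (n + k)%N)).
  elim: k => [|k IH]; first by rewrite addn0 !subrr mulr0 => x; rewrite nm0 mul0r.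
  have h : opb (glrep U' (L (n + k).+1) - glrep U' (L (n + k)%N)) (7 * c (n + k)%N).
    move=> x; have := @inc (n + k)%N H' U' x; congr (nm _ <= _).
    rewrite LS -[RHS]/(glrep U' (L _ ++ _) x - glrep U' (L _) x) glrep_cat.
    by rewrite addrAC subrr add0r.
  rewrite addnS; apply: opb_ge0_le (opb_trans h IH); rewrite /c exprS /r; lra.
have close e : 0 < e -> exists N, forall n, (N <= n)%N -> c n <= e.
  by move=> e0; exact: expr_small.
have cau (e : R) : 0 < e -> exists N, forall m n, (N <= m)%N -> (N <= n)%N ->
    (universal_norm (glfun (L m) - glfun (L n))%R < e%:E)%E.
  move=> e0; have [|N hN] := close (e / 57); first by rewrite divr_gt0.
  exists N => m n Nm Nn; apply: (@le_lt_trans _ _ (e * (56 / 57))%:E); last by rewrite lte_fin; lra.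
  rewrite glfun_sub; apply: universal_norm_le => [|H' U']; first by rewrite mulr_ge0 ?(ltW e0).
  have h k : (N <= k)%N -> opb (glrep U' (L k) - glrep U' (L N)) (e * (28 / 57)).
    move=> /subnKC <-; apply: opb_ge0_le (tail _ _ _ _).
    have := hN N (leqnn N); have := c0 (N + (k - N))%N; lra.
  rewrite glrep_sub; apply: opb_ge0_le (opb_trans (h m Nm) (opb_distC (h n Nn))); lra.
exists (Completion (fun n => glfun_supp (L n)) cau).
have -> : (fun n => algebra_rep U (glfun (L n))) = (fun n => glrep U (L n)).
  by apply/funext => n; exact: algebra_rep_glfun.
apply/opnorm_cvgP => [n||e e0]; [exact: glrep_linear|by []|].
have [N hN] := close e e0; exists N => n Nn; apply: opb_ge0_le (hL n); exact: hN.
Qed.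

(** Cauchy for the universal norm means Cauchy in each representation: the lists which approximate T
    in U will also be used in the regular representation. *)
Lemma full_image_lists (H : hilbertType R) (U : unitary_rep G H) T : full_image U T ->
  exists ls : nat -> gl,
    (forall e : R, 0 < e -> exists N, forall n, (N <= n)%N -> opb (glrep U (ls n) - T) e) /\
    forall (H' : hilbertType R) (U' : unitary_rep G H') (e : R), 0 < e ->
      exists N, forall m n, (N <= m)%N -> (N <= n)%N -> opb (glrep U' (ls m) - glrep U' (ls n)) e.
Proof.
move=> [/bounded_opsP[lT _] [u uT]].
have /choice[ls hls] n : exists l, glfun l = u n by exact: glfun_surj (completion_mem u n).
exists ls; split.
  apply/opnorm_cvgP => //; first by move=> n; exact: glrep_linear.
  by move: uT; congr opnorm_cvg; apply/funext => n; rewrite -hls algebra_rep_glfun.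
move=> H' U' e e0; have [N hN] := completion_cauchy u e0; exists N => m n Nm Nn.
rewrite -glrep_sub; apply: (opnorm_opb (glrep_linear _ _)); apply: le_trans (ltW (hN m n Nm Nn)).
rewrite -!hls glfun_sub -algebra_rep_glfun.
by apply: ereal_sup_ubound; exists H', U'.
Qed.

End QuotientNorm.

(** * Essential norms and compact operators *)

Lemma infinite_notin (T : choiceType) : infinite_set [set: T] -> forall F : seq T, exists x, x \notin F.
Proof.
move=> iT F; apply: contrapT => nx; apply: iT; apply: (@sub_finite_set _ _ [set` F]); last exact: finite_seq.
by move=> x _ /=; apply: contrapT => xF; apply: nx; exists x; apply/negP.
Qed.

Section EssentialBounds.
Variables (R : realType) (X : choiceType).
Local Notation C := (R[i]).
Local Notation HX := (l2_hilbert R X).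
Implicit Types (S T : HX -> HX) (F s : seq X) (v w : HX).

Definition prj F : HX -> HX := fun v => l2_supp F v.

(* The distance from T to the compact operators is at most c. *)
Definition essle T (c : R) := forall d : R, 0 < d -> exists F,
  forall v, nm (T v - prj F (T v)) <= (c + d) * nm v.

Lemma prjE F v x : prj F v x = if x \in F then v x else 0.
Proof. by []. Qed.

Lemma prj_linear F : linear (prj F).
Proof.
move=> c v w; apply: l2E => x; rewrite l2_addE l2_scaleE !prjE l2_addE l2_scaleE.
by case: ifP => // _; rewrite mulr0 addr0.
Qed.

Lemma prj_le F v : nm (prj F v) <= nm v.
Proof. exact: nm_supp_le. Qed.

Lemma coprj_le F v : nm (v - prj F v) <= nm v.
Proof. exact: nm_cosupp_le. Qed.

Lemma coprj_linear F : linear (fun v => v - prj F v).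
Proof.
by move=> c v w; rewrite (prj_linear F c v w) scalerBr opprD addrACA.
Qed.

Lemma coprj_near F v w : nm (v - prj F v) <= nm (v - w) + nm (w - prj F w).
Proof.
have /= := linD (coprj_linear F) (v - w) w; rewrite subrK => ->.
by apply: le_trans (nmD _ _) _; rewrite lerD2r coprj_le.
Qed.

Lemma coprj_mono F s v : {subset F <= s} -> nm (v - prj s v) <= nm (v - prj F v).
Proof.
move=> Fs; have -> : v - prj s v = (v - prj F v) - prj s (v - prj F v).
  apply: l2E => x; rewrite !(l2_addE, l2_oppE, prjE).
  case: ifPn => [xs|xs]; first by rewrite !subrr.
  by rewrite (contraNF (Fs x) xs) !subr0.
exact: coprj_le.
Qed.

Lemma prj_sum F v : uniq F -> prj F v = \sum_(x <- F) (v x : C) *: (delta R x : HX).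
Proof. exact: l2_supp_sum. Qed.

Lemma opb_essle T c : opb T c -> essle T c.
Proof.
move=> h d d0; exists [::] => v; apply: le_trans (coprj_le _ _) _.
by apply: le_trans (h v) _; rewrite ler_wpM2r ?nm_ge0// lerDl ltW.
Qed.

Lemma essle_weak T c : (forall e, 0 < e -> essle T (c + e)) -> essle T c.
Proof.
move=> h d d0; have d2 : 0 < d / 2 by rewrite divr_gt0.
have [F hF] := h _ d2 _ d2; exists F => v; apply: le_trans (hF v) _.
by rewrite ler_wpM2r ?nm_ge0//; lra.
Qed.

Lemma essle_le T c c' : c <= c' -> essle T c -> essle T c'.
Proof.
move=> cc h d d0; have [F hF] := h d d0; exists F => v; apply: le_trans (hF v) _.
by rewrite ler_wpM2r ?nm_ge0// lerD2r.
Qed.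

Lemma essleD S T c c' : essle S c -> essle T c' -> essle (S + T) (c + c').
Proof.
move=> hS hT d d0; have d2 : 0 < d / 2 by rewrite divr_gt0.
have [F hF] := hS _ d2; have [F' hF'] := hT _ d2; exists (F ++ F') => v.
rewrite -[(S + T) v]/(S v + T v) (linD (prj_linear _)) opprD addrACA.
apply: le_trans (nmD _ _) _.
apply: (@le_trans _ _ ((c + d / 2) * nm v + (c' + d / 2) * nm v)).
  apply: lerD.
    by apply: le_trans (hF v); apply: coprj_mono => x; rewrite mem_cat => ->.
  by apply: le_trans (hF' v); apply: coprj_mono => x; rewrite mem_cat orbC => ->.
by rewrite -mulrDl ler_wpM2r ?nm_ge0//; lra.
Qed.

Lemma essleN T c : essle T c -> essle (- T) c.
Proof.
move=> h d d0; have [F hF] := h d d0; exists F => v.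
by rewrite -[(- T) v]/(- T v) (linN (prj_linear _)) -opprD nmN.
Qed.

Lemma essleB S T c c' : essle S c -> essle T c' -> essle (S - T) (c + c').
Proof. by move=> hS hT; apply: essleD => //; exact: essleN. Qed.

Lemma essleZ a T c : essle T c -> essle (a *: T) (mag a * c).
Proof.
move=> h d d0; have m0 := mag_ge0 a.
have m1 : 0 < mag a + 1 by rewrite ltr_wpDl.
have [|F hF] := h (d / (mag a + 1)); first by rewrite divr_gt0.
exists F => v; rewrite -[(a *: T) v]/(a *: T v) (linZ (prj_linear _)) -scalerBr nmZ.
apply: le_trans (ler_wpM2l m0 (hF v)) _; rewrite mulrA ler_wpM2r ?nm_ge0//.
rewrite mulrDr lerD2l mulrCA ler_piMr ?(ltW d0)//.
by rewrite ler_pdivrMr// mul1r lerDl.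
Qed.

Lemma essle_compr S T c k : 0 <= c -> 0 <= k -> opb S k -> essle T c -> essle (T \o S) (c * k).
Proof.
move=> c0 k0 hS h d d0; have k1 : 0 < k + 1 by rewrite ltr_wpDl.
have [|F hF] := h (d / (k + 1)); first by rewrite divr_gt0.
exists F => v; apply: le_trans (hF (S v)) _.
apply: le_trans (ler_wpM2l _ (hS v)) _; first by rewrite addr_ge0 ?divr_ge0 ?(ltW d0) ?(ltW k1).
rewrite mulrA ler_wpM2r ?nm_ge0// mulrDl lerD2l -mulrA ler_piMr ?(ltW d0)//.
by rewrite mulrC ler_pdivrMr// mul1r lerDl.
Qed.

Lemma opb_approx_supp T s e : 0 < e -> exists F, forall x, x \in s ->
  nm (T (delta R x) - prj F (T (delta R x))) <= e.
Proof.
move=> e0; elim: s => [|x s [F hF]]; first by exists [::].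
have [F' [_ hF']] := l2_approx (T (delta R x)) e0.
exists (F' ++ F) => y; rewrite inE => /orP[/eqP ->|ys].
  by apply: le_trans hF'; apply: coprj_mono => z; rewrite mem_cat => ->.
by apply: le_trans (hF y ys); apply: coprj_mono => z; rewrite mem_cat orbC => ->.
Qed.

(** Up to a small error T takes values in the span of finitely many delta vectors, with coefficients
    at most M |v|, and S maps each of these almost into finitely many coordinates. *)
Lemma essle_compl S T c k M : 0 <= k -> linear S -> opb S k -> 0 <= M -> opb T M ->
  essle T c -> essle (S \o T) (k * c).
Proof.
move=> k0 lS hS M0 hT h d d0; have k1 : 0 < k + 1 by rewrite ltr_wpDl.
have [|s0 hs0] := h (d / 2 / (k + 1)); first by rewrite !divr_gt0.
pose s := undup s0; have us : uniq s by exact: undup_uniq.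
have hs v : nm (T v - prj s (T v)) <= (c + d / 2 / (k + 1)) * nm v.
  by apply: le_trans (hs0 v); apply: coprj_mono => x; rewrite mem_undup.
pose N : R := (size s)%:R; pose e : R := d / 2 / (N * M + 1).
have NM : 0 < N * M + 1 by rewrite ltr_wpDl ?mulr_ge0.
have e0 : 0 < e by rewrite !divr_gt0.
have [F hF] := opb_approx_supp S s e0; exists F => v.
pose P : HX -> HX := fun v => v - prj F v; have lP : linear P by exact: coprj_linear.
rewrite -[X in nm X]/(P (S (T v))) -[T v in X in nm X](subrK (prj s (T v))) (linD lS) (linD lP).
apply: le_trans (nmD _ _) _.
have a1 : nm (P (S (T v - prj s (T v)))) <= (k * c + d / 2) * nm v.
  apply: le_trans (coprj_le _ _) _; apply: le_trans (hS _) _.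
  apply: le_trans (ler_wpM2l k0 (hs v)) _; rewrite mulrA ler_wpM2r ?nm_ge0//.
  rewrite mulrDr lerD2l mulrCA ler_piMr ?divr_ge0 ?(ltW d0)//.
  by rewrite ler_pdivrMr// mul1r lerDl.
have a2 : nm (P (S (prj s (T v)))) <= d / 2 * nm v.
  rewrite prj_sum// (lin_sum _ _ lS) (lin_sum _ _ lP).
  apply: le_trans (nm_sum _ _ _) _.
  apply: (@le_trans _ _ (\sum_(x <- s) M * nm v * e)).
    rewrite big_seq [leRHS]big_seq; apply: ler_sum => x xs.
    rewrite (linZ lS) (linZ lP) nmZ; apply: ler_pM; rewrite ?mag_ge0 ?nm_ge0//; last exact: hF.
    by apply: le_trans (nm_coord _ _) (hT v).
  rewrite big_const_seq count_predT iter_addr_0 -[_ *+ size s]mulr_natl.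
  have -> : (size s)%:R * (M * nm v * e) = (N * M / (N * M + 1)) * (d / 2 * nm v) by rewrite /e -/N; field; rewrite gt_eqF.
  rewrite ler_piMl ?mulr_ge0 ?nm_ge0 ?divr_ge0 ?(ltW d0)//.
  by rewrite ler_pdivrMr// mul1r lerDl.
apply: le_trans (lerD a1 a2) _; rewrite -mulrDl ler_wpM2r ?nm_ge0//; lra.
Qed.

Lemma essle_prj F T c : 0 <= c -> essle (prj F \o T) c.
Proof.
move=> c0 d d0; exists F => v /=.
have -> : prj F (prj F (T v)) = prj F (T v).
  by apply: l2E => x; rewrite !prjE; case: (x \in F).
by rewrite subrr nm0 mulr_ge0 ?nm_ge0// addr_ge0// ltW.
Qed.

Lemma essle_id_ge1 c : infinite_set [set: X] -> essle (@id HX) c -> 1 <= c.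
Proof.
move=> iX h; rewrite leNgt; apply/negP => c1.
have [|F hF] := h ((1 - c) / 2); first by rewrite divr_gt0// subr_gt0.
have [x xF] := infinite_notin iX F.
have := hF (delta R x : HX); have -> : prj F (delta R x) = 0.
  apply: l2E => y; rewrite prjE deltaE l2_zeroE; case: ifP => // yF.
  by case: eqP => // yx; move: xF; rewrite -yx yF.
rewrite subr0 nm_delta mulr1; lra.
Qed.

(** Riesz representation: the coordinates are the conjugate values of phi at delta vectors, and
    testing phi on their finite truncations bounds the l^2 norm by M. *)
Lemma functional_l2 (phi : HX -> C) (M : R) :
  (forall c v w, phi (c *: v + w) = c * phi v + phi w) -> 0 <= M ->
  (forall v, mag (phi v) <= M * nm v) -> exists a : HX, forall v, phi v = l2_inner v a.
Proof.
move=> lphi M0 hphi.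
have phi0 : phi 0 = 0 by have := lphi (-1) 0 0; rewrite scaleN1r addNr mulN1r addNr.
have phiZ c v : phi (c *: v) = c * phi v by have := lphi c v 0; rewrite !addr0 phi0 addr0.
have phiD v w : phi (v + w) = phi v + phi w by have := lphi 1 v w; rewrite scale1r mul1r.
have phiS s (f : X -> C) : phi (\sum_(x <- s) f x *: (delta R x : HX)) = \sum_(x <- s) f x * phi (delta R x).
  rewrite (big_morph phi phiD phi0); by apply: eq_bigr => x _; rewrite phiZ.
pose a x : C := ((phi (delta R x))^*)%C.
have fin : a \in @l2_pred R X.
  rewrite inE /=; apply: (@le_lt_trans _ _ (M ^+ 2)%:E); last exact: ltry.
  apply: nsum_le_seq => s us; pose v : HX := \sum_(x <- s) a x *: (delta R x : HX).
  have vE : v = l2_supp s a by rewrite l2_supp_sum.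
  set A := \sum_(x <- s) _.
  have A0 : 0 <= A by apply: sumr_ge0 => x _; exact: sqn_ge0.
  have nv2 : nm v ^+ 2 = A.
    rewrite vE nm2_l2 (@l2_sq_supp _ _ s)//; last by move=> x /negbTE /= ->.
    by rewrite big_seq [RHS]big_seq; apply: eq_bigr => x /= ->.
  have pv : phi v = A%:C%C.
    rewrite /v phiS /A rmorph_sum; apply: eq_bigr => x _.
    by rewrite /a sqnE; case: (phi _) => p q; apply/eqP; rewrite eq_complex /=; apply/andP; split; apply/eqP; ring.
  have := hphi v; rewrite pv magC ger0_norm// => h.
  have [->|An] := eqVneq A 0; first exact: sqr_ge0.
  have Ap : 0 < A by rewrite lt0r An.
  have : A ^+ 2 <= (M * nm v) ^+ 2 by rewrite ler_pXn2r ?nnegrE ?mulr_ge0 ?nm_ge0.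
  by rewrite exprMn nv2 expr2 ler_pM2r.
exists (L2 fin) => v; apply/eqP; rewrite -subr_eq0; apply/eqP.
set z := _ - _; suff : mag z <= 0.
  by move=> z0; apply/eqP; rewrite -normr_eq0 magE (_ : mag z = 0)//; apply/eqP; rewrite eq_le z0 mag_ge0.
apply/ler_addgt0Pl => e e0; rewrite addr0.
have N0 := nm_ge0 (L2 fin); have MN : 0 < M + nm (L2 fin) + 1 by rewrite ltr_wpDl// addr_ge0.
have [|s [us hs]] := @l2_approx _ _ v (e / (M + nm (L2 fin) + 1)); first by rewrite divr_gt0.
have fE : phi (prj s v) = l2_inner (prj s v) (L2 fin).
  rewrite prj_sum// phiS.
  rewrite (big_morph (fun w : HX => l2_inner w (L2 fin)) (fun u w => l2_innerDl u w _) (l2_inner0l _)).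
  apply: eq_bigr => x _; rewrite l2_innerZl l2_innerC inner_delta.
  by rewrite /= /a conjcK.
have -> : z = phi (v - prj s v) - l2_inner (v - prj s v) (L2 fin).
  have phiB (u w : HX) : phi (u - w) = phi u - phi w.
    by rewrite -scaleN1r phiD phiZ mulN1r.
  by rewrite phiB l2_innerDl l2_innerNl fE /z; ring.
apply: le_trans (magD _ _) _; rewrite magN.
apply: le_trans (lerD (hphi _) (mag_inner_le _ _)) _.
have -> : M * nm (v - prj s v) + nm (v - prj s v) * nm (L2 fin) = (M + nm (L2 fin)) * nm (v - prj s v) by ring.
apply: (@le_trans _ _ ((M + nm (L2 fin) + 1) * (e / (M + nm (L2 fin) + 1)))).
  by apply: ler_pM => //; rewrite ?addr_ge0 ?nm_ge0// lerDl.
by rewrite mulrCA divff ?mulr1// gt_eqF.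
Qed.

End EssentialBounds.

(** * Compactness as approximation by finitely many coordinates *)

Section CompactOperators.
Variables (R : realType) (X : choiceType).
Local Notation C := (R[i]).
Local Notation HX := (l2_hilbert R X).
Implicit Types (S T : HX -> HX) (F s : seq X) (v w : HX).

Lemma nbhs_nm (V : normedModType C) (p : V) (e : R) : 0 < e -> nbhs p [set y : V | nm (y - p) < e].
Proof.
move=> e0; have e0' : 0 < e%:C%C :> C by rewrite ltcR.
apply: filterS (nbhsx_ballx p _ e0') => y; rewrite -ball_normE /= nmE ltcR.
by rewrite nm_distC.
Qed.

(** If no finite F worked for d, the points of the compact closure at distance at least d from their
    truncation to F would form a filter base. It would have a cluster point, which is nearly
    supported on a finite set. *)
Lemma essle_of_compact T : @compact_ops R HX T -> essle T 0.
Proof.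
move=> [/bounded_opsP[lT _] cT] d d0; apply: contrapT => nF.
have hF F : exists y, (closure (T @` [set x : HX | `|x| <= 1])) y /\ d <= nm (y - prj F y).
  apply: contrapT => ny; apply: nF; exists F => v; rewrite add0r leNgt; apply/negP => lt.
  have vp : 0 < nm v.
    rewrite lt0r nm_ge0 andbT; apply: contraTneq lt => v0.
    by rewrite (nm_eq0 v0) (lin0 lT) (lin0 (prj_linear F)) subrr nm0 mulr0 ltxx.
  pose a : C := ((nm v)^-1)%:C%C; apply: ny; exists (T (a *: v)); split.
    apply: subset_closure; exists (a *: v) => //=.
    by rewrite nmE nmZr ger0_norm ?invr_ge0 ?nm_ge0// mulVf ?gt_eqF.
  rewrite (linZ lT) (linZ (prj_linear F)) -scalerBr nmZr ger0_norm ?invr_ge0 ?nm_ge0//.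
  by rewrite mulrC ler_pdivlMr// ltW.
pose B F : set HX := [set y | (closure (T @` [set x : HX | `|x| <= 1])) y /\ d <= nm (y - prj F y)].
have BF : Filter (filter_from [set: seq X] B).
  apply: filter_from_filter => [|F s _ _]; first by exists [::].
  exists (F ++ s) => // y [yK yd]; split; split=> //; apply: le_trans yd _; apply: coprj_mono => x;
    by rewrite mem_cat => ->; rewrite ?orbT.
have BP : ProperFilter (filter_from [set: seq X] B).
  by apply: filter_from_proper => F _; have [y hy] := hF F; exists y.
have [|p [pK pc]] := cT _ BP; first by exists [::] => // y [].
have d3 : 0 < d / 3 by rewrite divr_gt0.
have [s [_ hs]] := l2_approx p d3.
have [|y [[_ yd] /= yp]] := pc (B s) _ _ (nbhs_nm p d3); first by exists s.
have := coprj_near s y p; move: yd yp hs; rewrite -[l2_supp s p]/(prj s p).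
set a := nm _; set b := nm _; set c := nm _; lra.
Qed.

Lemma closure_approx (A : set HX) y (e : R) : closure A y -> 0 < e ->
  exists2 z, A z & nm (y - z) < e.
Proof.
move=> yA e0; have [z [Az zy]] := yA _ (nbhs_nm y e0).
by exists z; rewrite // nm_distC.
Qed.

(** On the image of the ball finitely many coordinates determine a vector up to a small error, and
    each coordinate converges along an ultrafilter; hence ultrafilters there are Cauchy. *)
Lemma compact_of_essle T : @bounded_ops R HX T -> essle T 0 -> @compact_ops R HX T.
Proof.
move=> bT eT; split=> //; have [lT [M M0 hM]] := (bounded_opsP T).1 bT.
set K := closure _.
have K1 y : K y -> nm y <= M.
  move=> yK; apply/ler_addgt0Pl => e e0.
  have [_ [v /= v1 <-] h] := closure_approx yK e0.
  have {}v1 : nm v <= 1 by rewrite -lecR -nmE.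
  rewrite -[y](subrK (T v)); apply: le_trans (nmD _ _) _; rewrite lerD ?(ltW h)//.
  by apply: le_trans (hM v) _; rewrite -[leRHS]mulr1 ler_wpM2l.
have K2 d : 0 < d -> exists s, uniq s /\ forall y, K y -> nm (y - prj s y) <= d.
  move=> d0; have d2 : 0 < d / 2 by rewrite divr_gt0.
  have [s hs] := eT _ d2; exists (undup s); split=> [|y yK]; first exact: undup_uniq.
  have [_ [v /= v1 <-] h] := closure_approx yK d2.
  have {}v1 : nm v <= 1 by rewrite -lecR -nmE.
  apply: le_trans (_ : nm (y - prj s y) <= _); first by apply: coprj_mono => x; rewrite mem_undup.
  have := coprj_near s y (T v); have := hs v; rewrite add0r.
  have : d / 2 * nm v <= d / 2 by rewrite ger_pMr.
  by move: h; set a := nm _; set b := nm _; set c := nm _; set f := nm _; lra.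
rewrite compact_ultra => F FU FK.
have FP : ProperFilter F by exact: ultra_proper.
(* Set to 0 outside the ball of radius M, because limits are controlled for functions bounded on the
   whole space. *)
pose u (p : C -> R) x (y : HX) := if nm y <= M then p (y x) else 0.
have ub (p : C -> R) x : (forall z, `|p z| <= mag z) -> bdd (u p x).
  move=> hp; exists M => y; rewrite /u; case: ifP => [yM|_]; last by rewrite normr0.
  by apply: le_trans (hp _) _; apply: le_trans (nm_coord _ _) yM.
have near1 (p : C -> R) x (e : R) : (forall z, `|p z| <= mag z) -> 0 < e ->
    F [set y | K y /\ `|ulim F (u p x) - p (y x)| <= e].
  move=> hp e0; have /cvgrPdist_le/(_ e e0) h := ulim_cvg FU (ub p x hp).
  apply: filterS (filterI FK h) => y [yK] /=; rewrite {2}/u (K1 _ yK) => hy.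
  by split.
have cF : cauchy F.
  apply/cauchy_ballP => eC eC0.
  have eE : eC = (Re eC)%:C%C by rewrite RRe_real// ger0_real// ltW.
  set e := Re eC in eE; have e0 : 0 < e by rewrite -ltcR -eE.
  have [|s [us hs]] := K2 (e / 4); first by rewrite divr_gt0.
  (* Two points of A differ by at most 4 t in each of the N coordinates, e / 5 in all; their tails
     contribute e / 4 each. *)
  pose N : R := (size s)%:R; pose t : R := e / (20 * (N + 1)).
  have N1 : 0 < N + 1 by rewrite ltr_wpDl.
  have t0 : 0 < t by rewrite divr_gt0// mulr_gt0.
  pose A := [set y | K y /\ forall x, x \in s ->
    `|ulim F (u (@complex.Re R) x) - Re (y x)| <= t /\ `|ulim F (u (@complex.Im R) x) - Im (y x)| <= t].
  have FA : F A.
    rewrite /A; elim: (s) => [|x r IH]; first by apply: filterS FK.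
    have h1 := near1 _ x t (@Re_le_mag R) t0; have h2 := near1 _ x t (@Im_le_mag R) t0.
    apply: filterS (filterI (filterI h1 h2) IH) => y [[[yK a] [_ b]] [_ h]].
    by split=> // z; rewrite inE => /orP[/eqP ->|/h].
  exists (A, A) => //= -[y z] [/= [yK hy] [zK hz]].
  rewrite -ball_normE /= nmE eE ltcR.
  have close x : x \in s -> mag (y x - z x) <= 4 * t.
    move=> xs; have [a1 a2] := hy x xs; have [b1 b2] := hz x xs.
    apply: le_trans (mag_le_ReIm _) _.
    have tri (l p q : R) : `|l - p| <= t -> `|l - q| <= t -> `|p - q| <= 2 * t.
      rewrite !ler_norml => /andP[? ?] /andP[? ?]; apply/andP; split; lra.
    have h1 := tri _ _ _ a1 b1; have h2 := tri _ _ _ a2 b2.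
    case: (y x) (z x) h1 h2 => [p q] [p' q'] /= h1 h2.
    by move: h1 h2; set a := `|_|; set b := `|_|; lra.
  have : nm (prj s (y - z)) <= N * (4 * t).
    rewrite prj_sum//; apply: le_trans (nm_sum _ _ _) _.
    apply: (@le_trans _ _ (\sum_(x <- s) 4 * t)).
      rewrite big_seq [leRHS]big_seq; apply: ler_sum => x xs.
      by rewrite nmZ nm_delta mulr1; exact: close.
    by rewrite big_const_seq count_predT iter_addr_0 -[_ *+ size s]mulr_natl.
  have : N * (4 * t) <= e / 5.
    have -> : N * (4 * t) = N / (N + 1) * (e / 5) by rewrite /t; field; rewrite gt_eqF.
    by rewrite ler_piMl ?divr_ge0 ?(ltW e0)// ler_pdivrMr// mul1r lerDl.
  have : nm (y - z) <= nm (y - prj s y) + nm (z - prj s z) + nm (prj s (y - z)).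
    rewrite -{1}[y - z](subrK (prj s (y - z))); apply: le_trans (nmD _ _) _.
    rewrite lerD2r; have /= -> := linB (coprj_linear s) y z; exact: nmB.
  have := hs y yK; have := hs z zK.
  by set a := nm _; set b := nm _; set c := nm _; set f := nm _; lra.
have /cvg_ex[p Fp] := @cauchy_cvg _ F FP cF.
exists p; split=> //.
by apply: (closed_cvg (u_ := id) _ (@closed_closure _ _) _ _ Fp).
Qed.

Lemma compact_opsP T : @compact_ops R HX T <-> @bounded_ops R HX T /\ essle T 0.
Proof.
split=> [h|[]]; last exact: compact_of_essle.
by split; [case: h|exact: essle_of_compact].
Qed.

End CompactOperators.

Section OperatorLimits.
Variables (R : realType) (H : hilbertType R).

Lemma hilbert_complete (u : nat -> H) :
  (forall e, 0 < e -> exists N, forall m n, (N <= m)%N -> (N <= n)%N -> nm (u m - u n) <= e) ->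
  exists w, forall e, 0 < e -> exists N, forall n, (N <= n)%N -> nm (u n - w) <= e.
Proof.
move=> hu.
have cu : cauchy (u @ \oo).
  apply/cauchy_ballP => eC eC0.
  have eE : eC = (Re eC)%:C%C by rewrite RRe_real// ger0_real// ltW.
  set e := Re eC in eE; have e0 : 0 < e by rewrite -ltcR -eE.
  have [|N hN] := hu (e / 2); first by rewrite divr_gt0.
  pose A := [set u n | n in [set n | (N <= n)%N]].
  have FA : (u @ \oo) A by exists N => // n Nn; exists n.
  exists (A, A) => //= -[_ _] [/= [m Nm <-] [n Nn <-]].
  rewrite -ball_normE /= nmE eE ltcR; apply: le_lt_trans (hN m n Nm Nn) _.
  by rewrite ltr_pdivrMr// ltr_pMr// ltr1n.
have uP : ProperFilter (u @ \oo) by exact: fmap_proper_filter.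
have /cvg_ex[w uw] := @cauchy_cvg _ _ uP cu.
exists w => e e0; have [N _ hN] := uw _ (nbhs_nm w e0).
by exists N => n Nn; apply: ltW; exact: hN.
Qed.

Lemma operator_limit (u : nat -> H -> H) : (forall n, @bounded_ops R H (u n)) ->
  (forall e, 0 < e -> exists N, forall m n, (N <= m)%N -> (N <= n)%N -> opb (u m - u n) e) ->
  exists2 S, @bounded_ops R H S &
    forall e, 0 < e -> exists N, forall n, (N <= n)%N -> opb (u n - S) e.
Proof.
move=> bu hu.
have lu n := ((bounded_opsP (u n)).1 (bu n)).1.
have /choice[S hS] v : exists w, forall e, 0 < e -> exists N, forall n, (N <= n)%N -> nm (u n v - w) <= e.
  apply: hilbert_complete => e e0.
  have v1 : 0 < nm v + 1 by rewrite ltr_wpDl ?nm_ge0.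
  have [|N hN] := hu (e / (nm v + 1)); first by rewrite divr_gt0.
  exists N => m n Nm Nn; apply: le_trans (hN m n Nm Nn v) _.
  rewrite mulrAC ler_pdivrMr// ler_pM2l// lerDl//.
have uS e : 0 < e -> exists N, forall n, (N <= n)%N -> opb (u n - S) e.
  move=> e0; have [N hN] := hu e e0; exists N => n Nn v.
  apply/ler_addgt0Pl => d d0; have [N' hN'] := hS v d d0.
  have := hN n (maxn N N') Nn (leq_maxl _ _) v.
  have := hN' (maxn N N') (leq_maxr _ _).
  move=> h1 h2; apply: le_trans (_ : _ <= _) (lerD h1 h2); apply: le_trans (_ : _ <= _) (nmD _ _).
  rewrite -[(u n - S) v]/(u n v - S v) -[(u n - u _) v]/(u n v - u _ v).
  by rewrite [X in _ <= nm X]addrC addrA subrK.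
have small (z : H) : (forall e, 0 < e -> nm z <= e) -> z = 0.
  move=> hz; apply: nm_eq0; apply/eqP; rewrite eq_le nm_ge0 andbT.
  by apply/ler_addgt0Pl => e e0; rewrite addr0 hz.
exists S => //; apply/bounded_opsP; split.
  move=> c v w; apply/eqP; rewrite -subr_eq0; apply/eqP/small => e e0.
  have c1 : 0 < mag c + 1 by rewrite ltr_wpDl ?mag_ge0.
  pose d := e / 4 / (mag c + 1); have d0 : 0 < d by rewrite !divr_gt0.
  have e4 : 0 < e / 4 by rewrite divr_gt0.
  have [N1 h1] := hS (c *: v + w) _ e4; have [N2 h2] := hS v d d0; have [N3 h3] := hS w _ e4.
  pose n := maxn N1 (maxn N2 N3).
  have {}h1 := h1 n (leq_maxl _ _).
  have {}h2 := h2 n (leq_trans (leq_maxl _ _) (leq_maxr _ _)).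
  have {}h3 := h3 n (leq_trans (leq_maxr _ _) (leq_maxr _ _)).
  have -> : S (c *: v + w) - (c *: S v + S w) =
      (c *: (u n v - S v) + (u n w - S w)) - (u n (c *: v + w) - S (c *: v + w)).
    rewrite (lu n c v w) scalerBr addrACA -opprD.
    by rewrite [in RHS]opprB [RHS]addrC addrA subrK.
  apply: le_trans (nmB _ _) _; apply: le_trans (lerD (nmD _ _) (lexx _)) _.
  have : nm (c *: (u n v - S v)) <= e / 4.
    rewrite nmZ; apply: le_trans (ler_wpM2l (mag_ge0 c) h2) _.
    rewrite /d mulrCA ler_piMr ?(ltW e4)// ler_pdivrMr// mul1r lerDl//.
  by move: h1 h3; set p := nm _; set q := nm _; set r := nm _; lra.
have [N hN] := uS 1 ltr01; have [_ [M M0 hM]] := (bounded_opsP _).1 (bu N).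
exists (M + 1); first by rewrite addr_ge0.
have -> : S = u N - (u N - S) by rewrite opprB addrC subrK.
by apply: opbB => //; exact: hN.
Qed.

Definition norm_closed (A : set (H -> H)) := forall T, @bounded_ops R H T ->
  (forall e, 0 < e -> exists2 S, A S & opb (S - T) e) -> A T.

Lemma closed_ideal_norm_closed (A I : set (H -> H)) : A `<=` @bounded_ops R H ->
  norm_closed A -> closed_ideal A I -> norm_closed I.
Proof.
move=> bA cA [IA _ _ _ cI] T bT hT.
have AT : A T by apply: cA => // e e0; have [S IS h] := hT e e0; exists S => //; exact: IA.
have /choice[u hu] (n : nat) : exists S, I S /\ opb (S - T) (n.+1%:R^-1).
  by have [|S IS h] := hT n.+1%:R^-1; [rewrite invr_gt0|exists S].
apply: (cI u) => // [n|]; first by have [] := hu n.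
apply/opnorm_cvgP => [n||e e0].
- by have [/IA/bA/bounded_opsP[]] := hu n.
- by have /bA/bounded_opsP[] := AT.
have [N hN] : exists N : nat, e^-1 <= N%:R.
  have ei : 0 <= e^-1 by rewrite invr_ge0 ltW.
  by exists (Num.bound e^-1); apply: ltW; have := archi_boundP ei.
exists N => n Nn; apply: opb_ge0_le (proj2 (hu n)).
rewrite -[e]invrK lef_pV2 ?posrE ?invr_gt0 ?ltr0n//.
by apply: le_trans hN _; rewrite ler_nat ltnW.
Qed.

(** Neumann series inside the ideal: with E = id - W, the operators id - E^n lie in I by induction
    and tend to id. *)
Lemma ideal_near_id (A I : set (H -> H)) W (k : R) : A `<=` @bounded_ops R H -> closed_ideal A I ->
  norm_closed I -> A id -> I W -> 0 <= k -> k < 1 -> opb (id - W) k -> I id.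
Proof.
move=> bA [IA [I0 ID] IZ IM _] nI Aid IW k0 k1 hW.
pose E : H -> H := id - W.
have [lW _] := (bounded_opsP W).1 (bA _ (IA _ IW)).
have lE : linear E by apply: linear_sub.
have Iit n : I (id - iter n (fun S : H -> H => E \o S) id).
  elim: n => [|n IH]; first by rewrite subrr.
  have -> : id - iter n.+1 (fun S : H -> H => E \o S) id =
      W + (id - iter n (fun S : H -> H => E \o S) id) +
      (-1) *: (W \o (id - iter n (fun S : H -> H => E \o S) id)).
    apply/funext => v; set S' := iter n _ id.
    rewrite -[LHS]/(v - E (S' v)) -[RHS]/(W v + (v - S' v) + (-1) *: W (v - S' v)).
    have -> : E (S' v) = S' v - W (S' v) by [].
    rewrite (linB lW) scaleN1r; move: (S' v) (W v) (W (S' v)) => p q r.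
    by rewrite !opprB [q + _]addrC -[RHS]addrA [q + (r - q)]addrC subrK -[RHS]addrA [- p + r]addrC.
  apply: (ID _ _ (ID _ _ IW IH)); apply: IZ.
  by apply: (IM _ _ _ IH).1; exact: IA.
apply: nI => [|e e0]; first exact: bA.
have [N hN] := expr_small k0 k1 e0.
exists (id - iter N (fun S : H -> H => E \o S) id) => //.
apply: opb_distC; rewrite opprB addrC subrK.
apply: opb_ge0_le (hN N (leqnn N)) _.
elim: (N) => [|n IH] v; first by rewrite expr0 mul1r.
rewrite iterS exprS -mulrA; apply: le_trans (hW _) _.
by rewrite ler_wpM2l.
Qed.

End OperatorLimits.

Section FullImage.
Variables (R : realType) (G : groupType) (H : hilbertType R) (U : unitary_rep G H).
Local Notation A := (full_image U).
Implicit Types S T : H -> H.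

Lemma full_image_bounded : A `<=` @bounded_ops R H.
Proof. by move=> T []. Qed.

Lemma full_image_closed : norm_closed A.
Proof.
move=> T bT hT; apply/full_imageP; split=> // e e0.
have e2 : 0 < e / 2 by rewrite divr_gt0.
have [S /full_imageP[_ hS] h] := hT _ e2; have [l hl] := hS _ e2; exists l.
by apply: opb_ge0_le (opb_trans hl h); lra.
Qed.

Lemma full_image_glrep l : A (glrep U l).
Proof.
apply/full_imageP; split; first exact: glrep_bounded.
by move=> e e0; exists l => x; rewrite subrr nm0 mulr_ge0 ?nm_ge0 ?(ltW e0).
Qed.

Lemma full_image_id : A id.
Proof.
have -> : id = glrep U (gl1 R G) by apply/funext => x; rewrite glrep1.
exact: full_image_glrep.
Qed.

Lemma bounded_ops0 : @bounded_ops R H 0.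
Proof.
apply/bounded_opsP; split; first by move=> c x y; rewrite scaler0 addr0.
by exists 0 => // x; rewrite nm0 mul0r.
Qed.

Lemma bounded_opsD S T : @bounded_ops R H S -> @bounded_ops R H T -> @bounded_ops R H (S + T).
Proof.
move=> /bounded_opsP[lS [c c0 hS]] /bounded_opsP[lT [d d0 hT]]; apply/bounded_opsP.
by split; [exact: linear_add|exists (c + d); [exact: addr_ge0|exact: opbD]].
Qed.

Lemma bounded_opsZ a T : @bounded_ops R H T -> @bounded_ops R H (a *: T).
Proof.
move=> /bounded_opsP[lT [d d0 hT]]; apply/bounded_opsP.
by split; [exact: linear_scale|exists (mag a * d); [rewrite mulr_ge0 ?mag_ge0|exact: opbZ]].
Qed.

Lemma bounded_ops_comp S T : @bounded_ops R H S -> @bounded_ops R H T -> @bounded_ops R H (S \o T).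
Proof.
move=> /bounded_opsP[lS [c c0 hS]] /bounded_opsP[lT [d d0 hT]]; apply/bounded_opsP.
by split; [exact: linear_comp|exists (c * d); [exact: mulr_ge0|exact: opb_comp]].
Qed.

Lemma full_imageD S T : A S -> A T -> A (S + T).
Proof.
move=> /full_imageP[bS hS] /full_imageP[bT hT]; apply/full_imageP.
split=> [|e e0]; first exact: bounded_opsD.
have e2 : 0 < e / 2 by rewrite divr_gt0.
have [l hl] := hS _ e2; have [l' hl'] := hT _ e2; exists (l ++ l').
have -> : glrep U (l ++ l') - (S + T) = (glrep U l - S) + (glrep U l' - T).
  by rewrite addrACA -opprD; congr (_ - _); apply/funext => x; rewrite glrep_cat.
by apply: opb_ge0_le (opbD hl hl'); lra.
Qed.

Lemma full_imageZ a T : A T -> A (a *: T).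
Proof.
move=> /full_imageP[bT hT]; apply/full_imageP; split=> [|e e0]; first exact: bounded_opsZ.
have a1 : 0 < mag a + 1 by rewrite ltr_wpDl ?mag_ge0.
have [|l hl] := hT (e / (mag a + 1)); first by rewrite divr_gt0.
exists (glscale a l).
have -> : glrep U (glscale a l) - a *: T = a *: (glrep U l - T).
  by rewrite scalerBr; congr (_ - _); apply/funext => x; rewrite glrep_scale.
apply: opb_ge0_le (opbZ a hl); rewrite mulrCA ler_piMr ?(ltW e0)//.
by rewrite ler_pdivrMr// mul1r lerDl.
Qed.

Lemma full_image_comp S T : A S -> A T -> A (S \o T).
Proof.
move=> AS /full_imageP[bT hT]; have bS := full_image_bounded AS.
have [lS [c c0 hS]] := (bounded_opsP S).1 bS; have [lT [d d0 hd]] := (bounded_opsP T).1 bT.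
have c1 : 0 < c + 1 by rewrite ltr_wpDl.
apply: full_image_closed => [|e e0]; first exact: bounded_ops_comp.
have [|l hl] := hT (e / (c + 1)); first by rewrite divr_gt0.
exists (S \o glrep U l); last first.
  have -> : (S \o glrep U l) - (S \o T) = S \o (glrep U l - T).
    by apply/funext => x /=; rewrite (linB lS).
  apply: opb_ge0_le (opb_comp c0 hS hl); rewrite mulrCA ler_piMr ?(ltW e0)//.
  by rewrite ler_pdivrMr// mul1r lerDl.
have /full_imageP[_ hS'] := AS; apply/full_imageP; split=> [|e' e'0].
  by apply: bounded_ops_comp => //; exact: glrep_bounded.
have n1 : 0 < gln l + 1 by rewrite ltr_wpDl ?gln_ge0.
have [|m hm] := hS' (e' / (gln l + 1)); first by rewrite divr_gt0.
exists (glmul m l); have -> : glrep U (glmul m l) - (S \o glrep U l) = (glrep U m - S) \o glrep U l.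
  by apply/funext => x; rewrite -[LHS]/(glrep U (glmul m l) x - S (glrep U l x)) glrep_mul.
apply: opb_ge0_le (opb_comp _ hm (@opb_gln _ _ _ U l)); last by rewrite divr_ge0 ?(ltW e'0) ?(ltW n1).
by rewrite mulrAC -mulrA ler_piMr ?(ltW e'0)// ler_pdivrMr// mul1r lerDl.
Qed.

End FullImage.

Section MatrixUnits.
Variables (R : realType) (X : choiceType).
Local Notation C := (R[i]).
Local Notation HX := (l2_hilbert R X).
Implicit Types (S T : HX -> HX) (F s : seq X) (v w : HX) (x y : X).

Definition eu x y : HX -> HX := fun v => (v y : C) *: (delta R x : HX).

Lemma eu_linear x y : linear (eu x y).
Proof. by move=> c v w; rewrite /eu l2_addE l2_scaleE scalerDl scalerA. Qed.

Lemma opb_eu x y : opb (eu x y) 1.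
Proof. by move=> v; rewrite nmZ nm_delta mulr1 mul1r; exact: nm_coord. Qed.

Lemma eu_bounded x y : @bounded_ops R HX (eu x y).
Proof. by apply/bounded_opsP; split; [exact: eu_linear|exists 1 => //; exact: opb_eu]. Qed.

Lemma prj_delta F x : x \in F -> prj F (delta R x) = delta R x :> HX.
Proof.
move=> xF; apply: l2E => y; rewrite prjE deltaE; case: ifPn => // yF.
by case: eqP => // e; move: yF; rewrite e xF.
Qed.

Lemma essle_eu x y : essle (eu x y) 0.
Proof.
move=> d d0; exists [:: x] => v.
by rewrite /eu (linZ (prj_linear _)) prj_delta ?mem_head// subrr nm0 mulr_ge0 ?nm_ge0// add0r ltW.
Qed.

Lemma eu_sandwich T p x z q : linear T ->
  eu p x \o T \o eu z q = (T (delta R z) x : C) *: eu p q.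
Proof.
move=> lT; apply/funext => v; rewrite /eu /= -[RHS]/(_ *: (_ *: _)).
by rewrite (linZ lT) l2_scaleE scalerA mulrC.
Qed.

Lemma op_delta_neq0 T M : linear T -> 0 <= M -> opb T M -> T <> 0 ->
  exists z x, T (delta R z) x != 0.
Proof.
move=> lT M0 hT Tn; apply: contrapT => nz; apply: Tn; apply/funext => v.
have T0 z : T (delta R z) = 0.
  apply: l2E => x; apply: contrapT => /eqP h; apply: nz; by exists z, x.
apply: nm_eq0; apply/eqP; rewrite eq_le nm_ge0 andbT.
apply/ler_addgt0Pl => e e0; rewrite addr0.
have M1 : 0 < M + 1 by rewrite ltr_wpDl.
have [|s [us hs]] := @l2_approx _ _ v (e / (M + 1)); first by rewrite divr_gt0.
have Ts : T (prj s v) = 0.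
  rewrite prj_sum// (lin_sum _ _ lT) big1// => x _.
  by rewrite (linZ lT) T0 scaler0.
have -> : T v = T (v - prj s v) by rewrite (linB lT) Ts subr0.
apply: le_trans (hT _) _; apply: le_trans (ler_wpM2l M0 hs) _.
by rewrite mulrCA ler_piMr ?(ltW e0)// ler_pdivrMr// mul1r lerDl.
Qed.

(** The finitely many rows of T that matter are inner products with vectors, by [functional_l2].
    Truncating these vectors leaves a finite combination of matrix units. *)
Lemma compact_ops_sub (A : set (HX -> HX)) : A 0 ->
  (forall S T, A S -> A T -> A (S + T)) -> (forall c T, A T -> A (c *: T)) ->
  norm_closed A -> (forall x y, A (eu x y)) -> @compact_ops R HX `<=` A.
Proof.
move=> A0 AD AZ cA Ae T /compact_opsP[bT eT]; apply: cA => // e e0.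
have [lT [M M0 hM]] := (bounded_opsP T).1 bT.
have e2 : 0 < e / 2 by rewrite divr_gt0.
have [s0 hs0] := eT _ e2.
pose s := undup s0; have us : uniq s by exact: undup_uniq.
have hs v : nm (T v - prj s (T v)) <= e / 2 * nm v.
  rewrite -[e / 2]add0r; apply: le_trans (hs0 v); apply: coprj_mono => x; by rewrite mem_undup.
have /choice[a ha] x : exists a : HX, forall v, T v x = l2_inner v a.
  apply: (functional_l2 (M := M)) => // [c v w|v]; first by rewrite lT.
  by apply: le_trans (hM v); exact: nm_coord.
pose N : R := (size s)%:R; pose t : R := e / 2 / (N + 1).
have N1 : 0 < N + 1 by rewrite ltr_wpDl.
have t0 : 0 < t by rewrite divr_gt0.
have /choice[r hr] x : exists r, uniq r /\ nm (a x - prj r (a x)) <= t by exact: l2_approx.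
exists (\sum_(x <- s) \sum_(y <- r x) ((a x y)^*)%C *: eu x y).
  apply: (big_ind A) => // x _; apply: (big_ind A) => // y _; apply: AZ; exact: Ae.
have -> : \sum_(x <- s) \sum_(y <- r x) ((a x y)^*)%C *: eu x y =
    fun v => \sum_(x <- s) (l2_inner v (prj (r x) (a x))) *: (delta R x : HX).
  apply/funext => v; rewrite fct_sumE; apply: eq_bigr => x _.
  rewrite fct_sumE prj_sum; last by have [] := hr x.
  rewrite l2_innerC (big_morph (fun w : HX => l2_inner w v) (fun u w => l2_innerDl u w _) (l2_inner0l _)).
  rewrite rmorph_sum scaler_suml; apply: eq_bigr => y _.
  rewrite -[RHS]/((l2_inner (a x y *: delta R y) v)^*%C *: _) -l2_innerC l2_innerZr inner_delta.
  by rewrite -[LHS]/(_ *: (_ *: _)) scalerA.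
apply: opb_distC => v; rewrite -[(T - _) v]/(T v - _) /=.
rewrite -[T v](subrK (prj s (T v))) -addrA; apply: le_trans (nmD _ _) _.
rewrite [e]splitr mulrDl; apply: lerD; first exact: hs.
rewrite prj_sum// -sumrB; apply: le_trans (nm_sum _ _ _) _.
apply: (@le_trans _ _ (\sum_(x <- s) t * nm v)).
  apply: ler_sum => x _; rewrite -scalerBl nmZ nm_delta mulr1 ha.
  have -> : l2_inner v (a x) - l2_inner v (prj (r x) (a x)) = l2_inner v (a x - prj (r x) (a x)).
    by rewrite l2_innerDr -[- prj _ _]scaleN1r l2_innerZr rmorphN rmorph1 mulN1r.
  apply: le_trans (mag_inner_le _ _) _; rewrite mulrC ler_wpM2r ?nm_ge0//.
  by have [] := hr x.
rewrite big_const_seq count_predT iter_addr_0 -[_ *+ size s]mulr_natl mulrA ler_wpM2r ?nm_ge0//.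
rewrite -/N /t mulrCA ler_piMr ?(ltW e2)//.
by rewrite ler_pdivrMr// mul1r lerDl.
Qed.

End MatrixUnits.

Lemma reduced_cstarP (R : realType) (G : groupType) (S : l2_hilbert R G -> l2_hilbert R G) :
  reduced_cstar S <-> @bounded_ops R _ S /\
    forall e : R, 0 < e -> exists l, opb (glrep (left_regular R G) l - S) e.
Proof.
split=> [[bS [u [hu uS]]]|[bS hS]]; split=> //; have [lS _] := (bounded_opsP S).1 bS.
  exact: group_algebra_cvg_approx hu lS uS.
exact: group_algebra_approx_cvg lS hS.
Qed.

(** By [full_imageP] both sides consist of the bounded operators that are norm limits of lam(C[G]);
    it gives the reduced algebra the closure properties proved for full images. *)
Lemma reduced_cstarE (R : realType) (G : groupType) :
  @reduced_cstar R G = full_image (left_regular R G).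
Proof.
apply/seteqP; split=> S; first by move=> /reduced_cstarP h; apply/full_imageP.
by move=> /full_imageP h; apply/reduced_cstarP.
Qed.

(** * Ideals of the image and simplicity of the reduced algebra *)

Section Ideals.
Variables (R : realType) (G : groupType) (X : choiceType) (a : gaction G X) (x0 : X).
Local Notation C := (R[i]).
Local Notation HX := (l2_hilbert R X).
Local Notation pi := (perm_rep R a).
Local Notation lam := (left_regular R G).
Local Notation A := (full_image pi).
Local Notation K := (@compact_ops R HX).
Hypothesis Ax0 : A (eu x0 x0).
Hypothesis trans : forall x, exists g, a g x0 = x.
Hypothesis iX : infinite_set [set: X].
Hypothesis ess : forall l (c : R), 0 <= c -> opb (glrep lam l) c -> essle (glrep pi l) c.
Hypothesis cs : cstar_simple R G.

Lemma full_image_urep g : A (pi g).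
Proof.
have -> : pi g = glrep pi [:: (1, g)] by apply/funext => v; rewrite /glrep big_seq1 scale1r.
exact: full_image_glrep.
Qed.

Lemma full_image_eu x y : A (eu x y).
Proof.
have [g gx] := trans x; have [h hy] := trans y.
have -> : eu x y = pi g \o (eu x0 x0 \o pi h^-1%g).
  apply/funext => v; rewrite -[RHS]/(pi g (eu x0 x0 (pi h^-1%g v))) /eu urep_scale; congr (_ *: _).
    by rewrite -hy /= invgK.
  apply: l2E => z; rewrite deltaE [RHS]deltaE -gx; congr (_%:R); congr nat_of_bool.
  by apply/eqP/eqP => [->|<-]; rewrite ?gactK ?gactKV.
by apply: full_image_comp; [exact: full_image_urep|apply: full_image_comp; [exact: Ax0|exact: full_image_urep]].
Qed.

(** A nonzero operator has a nonzero matrix entry; cutting it out between two matrix units gives a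
    multiple of any prescribed matrix unit. *)
Lemma compact_sub_ideal I : closed_ideal A I -> I <> [set 0] -> K `<=` I.
Proof.
move=> cI In; have [IA [I0 ID] IZ IM _] := cI.
have nI : norm_closed I.
  by apply: closed_ideal_norm_closed cI; [exact: full_image_bounded|exact: full_image_closed].
have [T IT Tn] : exists2 T, I T & T <> 0.
  apply: contrapT => h; apply: In; apply/seteqP; split=> [T IT /=|_ -> //].
  by apply: contrapT => Tn; apply: h; exists T.
have [lT [M M0 hM]] := (bounded_opsP T).1 (full_image_bounded (IA T IT)).
have [z [x Tzx]] := op_delta_neq0 lT M0 hM Tn.
apply: compact_ops_sub => // p q.
have -> : eu p q = (T (delta R z) x : C)^-1 *: (eu p x \o T \o eu z q).
  rewrite eu_sandwich//; apply/funext => v; rewrite -[RHS]/(_ *: (_ *: _)) scalerA.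
  by rewrite mulVf ?scale1r.
apply: IZ; have [_ h] := IM _ _ (full_image_eu z q) (IM _ _ (full_image_eu p x) IT).1.
exact: h.
Qed.

Lemma compact_ideal : closed_ideal A K.
Proof.
have b0 := @bounded_ops0 R HX.
have KA : K `<=` A.
  apply: compact_ops_sub; [|exact: full_imageD|exact: full_imageZ|exact: full_image_closed|exact: full_image_eu].
  by apply/full_imageP; split=> // e e0; exists [::] => v; rewrite /glrep -[(_ - _) v]/(_ - 0) big_nil subrr nm0 mulr_ge0 ?nm_ge0// ltW.
split=> //.
- split=> [|S T /compact_opsP[bS eS] /compact_opsP[bT eT]]; apply/compact_opsP; split=> //.
  + by apply: opb_essle => v; rewrite nm0 mul0r.
  + exact: bounded_opsD.
  + by rewrite -[0]addr0; exact: essleD.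
- move=> c T /compact_opsP[bT eT]; apply/compact_opsP; split; first exact: bounded_opsZ.
  by rewrite -(mulr0 (mag c)); exact: essleZ.
- move=> S T /full_image_bounded bS /compact_opsP[bT eT].
  have [lS [c c0 hS]] := (bounded_opsP S).1 bS; have [lT [d d0 hT]] := (bounded_opsP T).1 bT.
  split; apply/compact_opsP; split; try exact: bounded_ops_comp.
  + by rewrite -(mulr0 c); exact: (essle_compl c0 lS hS d0 hT).
  + by rewrite -(mul0r c); exact: essle_compr.
move=> u T Ku /full_image_bounded bT uT; apply/compact_opsP; split=> //.
have lT := ((bounded_opsP T).1 bT).1; apply: essle_weak => e e0.
have lu n : linear (u n) by have /compact_opsP[/bounded_opsP[]] := Ku n.
have [N hN] := (opnorm_cvgP lu lT).1 uT e e0.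
have -> : T = u N - (u N - T) by rewrite opprB addrC subrK.
apply: essleB; first by have /compact_opsP[] := Ku N.
by apply: opb_essle; exact: hN.
Qed.

Lemma compact_nontrivial : nontrivial_ideal A K.
Proof.
split; first exact: compact_ideal.
  move=> e; have : K (eu x0 x0) by apply/compact_opsP; split; [exact: eu_bounded|exact: essle_eu].
  rewrite e => /(congr1 (fun T : HX -> HX => (T (delta R x0) : l2 R X) x0)).
  rewrite /eu l2_scaleE !deltaE eqxx mulr1 => /eqP; by rewrite l2_zeroE oner_eq0.
move=> e; have : K id by rewrite e; exact: full_image_id.
by move=> /compact_opsP[_ /(essle_id_ge1 iX)]; rewrite ler10.
Qed.

(** Expressed by approximation in C[G], so that no preimages in C*(G) have to be chosen. The regular
    side is compared in norm, the other one modulo compact operators, which will lie in I. *)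
Definition reduced_ideal I : set (l2_hilbert R G -> l2_hilbert R G) :=
  [set S | reduced_cstar S /\ forall e : R, 0 < e -> exists l T,
     [/\ I T, opb (glrep lam l - S) e & essle (glrep pi l - T) e]].

Lemma reduced_cstar_comp (S B : l2_hilbert R G -> l2_hilbert R G) :
  reduced_cstar S -> reduced_cstar B -> reduced_cstar (S \o B).
Proof. by rewrite reduced_cstarE; exact: full_image_comp. Qed.

Lemma reduced_idealP I : closed_ideal A I -> closed_ideal (@reduced_cstar R G) (reduced_ideal I).
Proof.
move=> cI; have [IA [I0 ID] IZ IM _] := cI.
split.
- by move=> S [].
- split.
    split=> [|e e0].
      apply/reduced_cstarP; split; first exact: bounded_ops0.
      by move=> e e0; exists [::] => v; rewrite /glrep -[(_ - _) v]/(_ - 0) big_nil subrr nm0 mulr_ge0 ?nm_ge0// ltW.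
    by exists [::], 0; split=> //; [|apply: opb_essle]; move=> v; rewrite /glrep -[(_ - _) v]/(_ - 0) big_nil subrr nm0 mulr_ge0 ?nm_ge0// ltW.
  move=> S T [/reduced_cstarP[bS _] hS] [/reduced_cstarP[bT _] hT].
  have h (e : R) : 0 < e -> exists l W,
      [/\ I W, opb (glrep lam l - (S + T)) e & essle (glrep pi l - W) e].
    move=> e0; have e2 : 0 < e / 2 by rewrite divr_gt0.
    have [l [W [IW h1 h2]]] := hS _ e2; have [l' [W' [IW' h1' h2']]] := hT _ e2.
    exists (l ++ l'), (W + W'); split; first exact: ID.
    + have -> : glrep lam (l ++ l') - (S + T) = (glrep lam l - S) + (glrep lam l' - T).
        by rewrite addrACA -opprD; congr (_ - _); apply/funext => x; rewrite glrep_cat.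
      by apply: opb_ge0_le (opbD h1 h1'); lra.
    + have -> : glrep pi (l ++ l') - (W + W') = (glrep pi l - W) + (glrep pi l' - W').
        by rewrite addrACA -opprD; congr (_ - _); apply/funext => x; rewrite glrep_cat.
      by apply: essle_le (essleD h2 h2'); lra.
  split=> //; apply/reduced_cstarP; split; first exact: bounded_opsD.
  by move=> e e0; have [l [W [_ h1 _]]] := h e e0; exists l.
- move=> c S [/reduced_cstarP[bS _] hS].
  have h (e : R) : 0 < e -> exists l W,
      [/\ I W, opb (glrep lam l - c *: S) e & essle (glrep pi l - W) e].
    move=> e0; have c1 : 0 < mag c + 1 by rewrite ltr_wpDl ?mag_ge0.
    have small : mag c * (e / (mag c + 1)) <= e.
      by rewrite mulrCA ler_piMr ?(ltW e0)// ler_pdivrMr// mul1r lerDl.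
    have [|l [W [IW h1 h2]]] := hS (e / (mag c + 1)); first by rewrite divr_gt0.
    exists (glscale c l), (c *: W); split; first exact: IZ.
    + have -> : glrep lam (glscale c l) - c *: S = c *: (glrep lam l - S).
        by rewrite scalerBr; congr (_ - _); apply/funext => x; rewrite glrep_scale.
      exact: opb_ge0_le (opbZ c h1).
    + have -> : glrep pi (glscale c l) - c *: W = c *: (glrep pi l - W).
        by rewrite scalerBr; congr (_ - _); apply/funext => x; rewrite glrep_scale.
      exact: essle_le (essleZ c h2).
  split=> //; apply/reduced_cstarP; split; first exact: bounded_opsZ.
  by move=> e e0; have [l [W [_ h1 _]]] := h e e0; exists l.
- move=> B S rB [rS hS]; have [bB hB] := (reduced_cstarP B).1 rB; have [bS _] := (reduced_cstarP S).1 rS.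
  have [lB [b b0 hb]] := (bounded_opsP B).1 bB; have [lS [s s0 hs]] := (bounded_opsP S).1 bS.
  have s1 : 0 < s + 1 by rewrite ltr_wpDl.
  (* The list m is chosen first, since the tolerance for l depends on [gln m]. *)
  have approx (e : R) : 0 < e -> exists m l W, [/\ I W, s * (e / (s + 1)) <= e,
      opb (glrep lam m - B) (e / (s + 1)), gln m * (e / (gln m + 1)) <= e &
      opb (glrep lam l - S) (e / (gln m + 1)) /\ essle (glrep pi l - W) (e / (gln m + 1))].
    move=> e0; have [|m hm] := hB (e / (s + 1)); first by rewrite divr_gt0.
    have m1 : 0 < gln m + 1 by rewrite ltr_wpDl ?gln_ge0.
    have [|l [W [IW h1 h2]]] := hS (e / (gln m + 1)); first by rewrite divr_gt0.
    exists m, l, W; split=> //.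
      by rewrite mulrCA ler_piMr ?(ltW e0)// ler_pdivrMr// mul1r lerDl.
    by rewrite mulrCA ler_piMr ?(ltW e0)// ler_pdivrMr// mul1r lerDl.
  have lW W : I W -> linear W by move=> /IA/full_image_bounded/bounded_opsP[].
  have bW W : I W -> exists2 c, 0 <= c & opb W c by move=> /IA/full_image_bounded/bounded_opsP[].
  split; split; try exact: reduced_cstar_comp.
    move=> e e0; have e2 : 0 < e / 2 by rewrite divr_gt0.
    have [m [l [W [IW sm hm sm' [h1 h2]]]]] := approx _ e2; have g0 := gln_ge0 m.
    exists (glmul m l), (glrep pi m \o W); split.
    + by apply: (IM _ _ _ IW).1; exact: full_image_glrep.
    + have -> : glrep lam (glmul m l) - (B \o S) =
          (glrep lam m \o (glrep lam l - S)) + ((glrep lam m - B) \o S).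
        apply/funext => x; rewrite -[LHS]/(glrep lam (glmul m l) x - B (S x)) glrep_mul.
        rewrite -[RHS]/(glrep lam m (glrep lam l x - S x) + (glrep lam m (S x) - B (S x))).
        by rewrite (linB (glrep_linear lam m)) addrA subrK.
      apply: opb_ge0_le (opbD (opb_comp g0 (opb_gln lam m) h1) (opb_comp _ hm hs)).
        by rewrite [leRHS]splitr lerD// mulrC.
      by rewrite divr_ge0 ?(ltW e2) ?(ltW s1).
    + have -> : glrep pi (glmul m l) - (glrep pi m \o W) = glrep pi m \o (glrep pi l - W).
        apply/funext => x; rewrite -[LHS]/(glrep pi (glmul m l) x - glrep pi m (W x)) glrep_mul.
        by rewrite /= (linB (glrep_linear pi m)).
      have [c c0 hc] := bW _ IW.
      apply: essle_le (essle_compl g0 (glrep_linear pi m) (opb_gln pi m) _ (opbB (opb_gln pi l) hc) h2).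
        by apply: le_trans sm' _; lra.
      by rewrite addr_ge0 ?gln_ge0.
  move=> e e0; have e2 : 0 < e / 2 by rewrite divr_gt0.
  have [m [l [W [IW sm hm sm' [h1 h2]]]]] := approx _ e2; have g0 := gln_ge0 m.
  have q0 : 0 <= e / 2 / (gln m + 1) by rewrite divr_ge0 ?(ltW e2)// addr_ge0.
  exists (glmul l m), (W \o glrep pi m); split.
  + by apply: (IM _ _ _ IW).2; exact: full_image_glrep.
  + have -> : glrep lam (glmul l m) - (S \o B) =
        ((glrep lam l - S) \o glrep lam m) + (S \o (glrep lam m - B)).
      apply/funext => x; rewrite -[LHS]/(glrep lam (glmul l m) x - S (B x)) glrep_mul.
      rewrite -[RHS]/(glrep lam l (glrep lam m x) - S (glrep lam m x) + S (glrep lam m x - B x)).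
      by rewrite (linB lS) addrA subrK.
    apply: opb_ge0_le (opbD (opb_comp q0 h1 (opb_gln lam m)) (opb_comp s0 hs hm)).
    by rewrite [leRHS]splitr lerD// mulrC.
  + have -> : glrep pi (glmul l m) - (W \o glrep pi m) = (glrep pi l - W) \o glrep pi m.
      by apply/funext => x; rewrite -[LHS]/(glrep pi (glmul l m) x - W _) glrep_mul.
    apply: essle_le (essle_compr q0 g0 (opb_gln pi m) h2).
    by rewrite mulrC; apply: le_trans sm' _; lra.
move=> u S Ju rS uS; split=> // e e0.
have [/bounded_opsP[lS _] _] := (reduced_cstarP S).1 rS.
have lu n : linear (u n) by have [/reduced_cstarP[/bounded_opsP[]]] := Ju n.
have e2 : 0 < e / 2 by rewrite divr_gt0.
have [N hN] := (opnorm_cvgP lu lS).1 uS _ e2.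
have [_ /(_ _ e2)[l [W [IW h1 h2]]]] := Ju N; exists l, W; split=> //.
  by apply: opb_ge0_le (opb_trans h1 (hN N (leqnn N))); lra.
by apply: essle_le h2; lra.
Qed.

(* The image in the reduced algebra of the preimage of I in C*(G) is an ideal, so it is
   everything once I contains a non-compact operator. *)
Lemma noncompact_ideal_id I T : closed_ideal A I -> K `<=` I -> I T -> ~ K T -> I id.
Proof.
move=> cI KI IT nK; have [IA [I0 ID] IZ IM _] := cI.
have AT := IA T IT; have bT := full_image_bounded AT; have [lT _] := (bounded_opsP T).1 bT.
have nI : norm_closed I.
  by apply: closed_ideal_norm_closed cI; [exact: full_image_bounded|exact: full_image_closed].
have [d d0 nd] : exists2 d, 0 < d & ~ essle T d.
  apply: contrapT => h; apply: nK; apply/compact_opsP; split=> //.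
  by apply: essle_weak => e e0; rewrite add0r; apply: contrapT => he; apply: h; exists e.
have [ls [uls cls]] := full_image_lists AT.
(* The lists approximating T also converge in the regular representation; S is the image there of a
   preimage of T. *)
have [|e e0|S bS hS] := @operator_limit R _ (fun n => glrep lam (ls n)).
- by move=> n; exact: glrep_bounded.
- exact: cls.
have JS : reduced_ideal I S.
  split; first by apply/reduced_cstarP; split=> // e e0; have [N hN] := hS e e0; exists (ls N); exact: hN.
  move=> e e0; have [N hN] := hS e e0; have [N' hN'] := uls e e0.
  exists (ls (maxn N N')), T; split=> //; first by apply: hN; exact: leq_maxl.
  by apply: opb_essle; apply: hN'; exact: leq_maxr.
(* If S were 0, the lists would be small in the regular representation, and [ess] would bring T
   within d of the compact operators. *)
have Sn : S <> 0.
  move=> S0; apply: nd; have d2 : 0 < d / 2 by rewrite divr_gt0.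
  have [N hN] := hS _ d2; have [N' hN'] := uls _ d2.
  pose n := maxn N N'; have := hN n (leq_maxl _ _); rewrite S0 subr0 => /(ess (ltW d2)) h1.
  have -> : T = glrep pi (ls n) - (glrep pi (ls n) - T) by rewrite opprB addrC subrK.
  apply: essle_le (essleB h1 (opb_essle (hN' n (leq_maxr _ _)))); lra.
have Jid : reduced_ideal I id.
  have [J0|->] := cs (reduced_idealP cI); first by move: JS; rewrite J0.
  by rewrite reduced_cstarE; exact: full_image_id.
have q0 : 0 < 4^-1 :> R by rewrite invr_gt0.
have [_ /(_ _ q0)[l [W [IW h1 h2]]]] := Jid.
have h3 : essle (id - W) (1 / 2).
  have h4 : essle (glrep pi (l ++ glscale (-1) (gl1 R G))) 4^-1.
    apply: ess (ltW q0) _; have -> : glrep lam (l ++ glscale (-1) (gl1 R G)) = glrep lam l - id.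
      by rewrite glrep_sub; congr (_ - _); apply/funext => x; exact: glrep1.
    exact: h1.
  have -> : id - W = (glrep pi l - W) - glrep pi (l ++ glscale (-1) (gl1 R G)).
    rewrite glrep_sub [in RHS]opprB [RHS]addrC addrA subrK; congr (_ - _).
    by apply/funext => x; rewrite glrep1.
  by apply: essle_le (essleB h2 h4); lra.
have [F hF] := h3 _ q0.
(* E is the part of id - W off the finite set F, of norm at most 1/2 + 1/4; as id - E differs from W
   by a compact operator, it lies in I and is close to id. *)
pose D : HX -> HX := id - W; pose E : HX -> HX := D - (prj F \o D).
have bW : @bounded_ops R HX W := full_image_bounded (IA _ IW).
have bD : @bounded_ops R HX D.
  have -> : D = id + (-1) *: W by rewrite scaleN1r.
  by apply: bounded_opsD; [exact: full_image_bounded (full_image_id pi)|exact: bounded_opsZ].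
have bprj : @bounded_ops R HX (prj F).
  by apply/bounded_opsP; split; [exact: prj_linear|exists 1 => // v; rewrite mul1r; exact: prj_le].
have IE : I (id - E).
  have eD : id - D = W by rewrite /D opprB addrC subrK.
  have -> : id - E = W + (prj F \o D) by rewrite -eD /E opprB [LHS]addrCA [LHS]addrC.
  apply: ID => //; apply: KI; apply/compact_opsP; split; first exact: bounded_ops_comp.
  exact: essle_prj.
have hE : opb (id - (id - E)) (3 / 4).
  by rewrite opprB addrC subrK => v; apply: le_trans (hF v) _; rewrite ler_wpM2r ?nm_ge0//; lra.
apply: (ideal_near_id (@full_image_bounded _ _ _ pi) cI nI (full_image_id pi) IE _ _ hE); lra.
Qed.

Theorem nontrivial_ideal_compact I : nontrivial_ideal A I <-> I = K.
Proof.
split=> [[cI In IA]|->]; last exact: compact_nontrivial.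
have KI := compact_sub_ideal cI In; apply/seteqP; split=> // T IT.
apply: contrapT => nK; apply: IA; have [IA [I0 ID] IZ IM _] := cI.
apply/seteqP; split=> // S AS; have Iid := noncompact_ideal_id cI KI IT nK.
exact: (IM S id AS Iid).1.
Qed.

End Ideals.

(** * Ideals of the quasi-regular image *)

Section AlmostEquivariant.
Variables (R : realType) (G : groupType) (X : choiceType) (a : gaction G X).
Local Notation C := (R[i]).
Local Notation HX := (l2_hilbert R X).
Local Notation HG := (l2_hilbert R G).
Local Notation pi := (perm_rep R a).
Local Notation lam := (left_regular R G).

Lemma l2_of_nsum (Y : choiceType) (f : Y -> C) (c : R) : 0 <= c ->
  (nsum (fun x => sqn (f x)) <= (c ^+ 2)%:E)%E -> exists2 w : l2_hilbert R Y, (forall x, w x = f x) & nm w <= c.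
Proof.
move=> c0 hf; have fl : f \in @l2_pred R Y by rewrite inE /=; apply: le_lt_trans hf (ltry _).
by exists (L2 fl) => //; exact: nm_l2_le.
Qed.

Lemma l2_dominated (v : HX) (f : X -> C) (c : R) : 0 <= c ->
  (forall x, mag (f x) <= c * mag (v x)) -> exists2 w : HX, (forall x, w x = f x) & nm w <= c * nm v.
Proof.
move=> c0 hf; apply: l2_of_nsum; first by rewrite mulr_ge0 ?nm_ge0.
rewrite exprMn EFinM nm2_l2 l2_sq_nsum -nsumZ ?sqr_ge0//; last by move=> x; exact: sqn_ge0.
apply: le_nsum => x; rewrite -!mag2 -exprMn ler_pXn2r ?nnegrE ?mulr_ge0 ?mag_ge0//.
Qed.

Lemma restr_subproof (P : set X) (v : HX) : (fun x => if `[< P x >] then v x else 0) \in @l2_pred R X.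
Proof.
rewrite inE /=; apply: le_lt_trans (l2_fin v); apply: le_nsum => x.
by case: ifP => // _; rewrite sqn0 sqn_ge0.
Qed.

Definition restr P v : HX := L2 (restr_subproof P v).

Lemma restrE P v x : restr P v x = if `[< P x >] then v x else 0.
Proof. by []. Qed.

Lemma sqn_sum_le (F : seq G) (p : G -> R) (b : G -> C) : (forall h, 0 <= p h) ->
  \sum_(h <- F) p h ^+ 2 = 1 ->
  sqn (\sum_(h <- F) (p h)%:C%C * b h) <= \sum_(h <- F) sqn (b h).
Proof.
move=> p0 p1; pose s := \sum_(h <- F) p h * mag (b h).
have s0 : 0 <= s by apply: sumr_ge0 => h _; rewrite mulr_ge0 ?mag_ge0.
apply: (@le_trans _ _ (s ^+ 2)).
  rewrite -mag2 ler_pXn2r ?nnegrE ?mag_ge0//; apply: le_trans (mag_sum _ _ _) _.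
  by apply: ler_sum => h _; rewrite magM magC ger0_norm.
under eq_bigr do rewrite -mag2; rewrite -subr_ge0.
have sqE (t : R) : \sum_(h <- F) (mag (b h) - t * p h) ^+ 2 =
    \sum_(h <- F) mag (b h) ^+ 2 - 2 * t * \sum_(h <- F) p h * mag (b h) + t ^+ 2 * \sum_(h <- F) p h ^+ 2.
  by rewrite !mulr_sumr -sumrB -big_split /=; apply: eq_bigr => h _; ring.
have -> : \sum_(h <- F) mag (b h) ^+ 2 - s ^+ 2 = \sum_(h <- F) (mag (b h) - s * p h) ^+ 2.
  by rewrite sqE p1 -/s; ring.
by apply: sumr_ge0 => h _; exact: sqr_ge0.
Qed.

(** The geometric mean lies between p and q. Hence the square roots of two close probabilities
    overlap up to an error linear in their l^1 distance. *)
Lemma sqrt_mul_close (p q : R) : 0 <= p -> 0 <= q ->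
  `|Num.sqrt p * Num.sqrt q - p| <= `|p - q|.
Proof.
move=> p0 q0; rewrite -sqrtrM//.
have [pq|qp] := leP p q.
  have h1 : p <= Num.sqrt (p * q).
    rewrite -[X in X <= _]ger0_norm// -sqrtr_sqr ler_sqrt ?mulr_ge0//.
    by rewrite expr2 ler_wpM2l.
  have h2 : Num.sqrt (p * q) <= q.
    rewrite -[X in _ <= X]ger0_norm// -sqrtr_sqr ler_sqrt ?sqr_ge0//.
    by rewrite expr2 ler_wpM2r.
  by rewrite ger0_norm ?subr_ge0// distrC ger0_norm ?subr_ge0// lerD2r.
have h1 : q <= Num.sqrt (p * q).
  rewrite -[X in X <= _]ger0_norm// -sqrtr_sqr ler_sqrt ?mulr_ge0//.
  by rewrite expr2 ler_wpM2r// ltW.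
have h2 : Num.sqrt (p * q) <= p.
  rewrite -[X in _ <= X]ger0_norm// -sqrtr_sqr ler_sqrt ?sqr_ge0//.
  by rewrite expr2 ler_wpM2l// ltW.
by rewrite distrC ger0_norm ?subr_ge0// [leRHS]ger0_norm ?subr_ge0 ?(ltW qp)// lerD2l lerN2.
Qed.

Section Compression.
Variables (F : seq G) (zeta : X -> G -> R) (l : seq (C * G)) (c : R) (v : HX).
Hypotheses (uF : uniq F) (z0 : forall x h, 0 <= zeta x h)
  (zF : forall x h, h \notin F -> zeta x h = 0)
  (z1 : forall x, \sum_(h <- F) zeta x h ^+ 2 = 1)
  (c0 : 0 <= c) (hl : opb (glrep lam l) c).

(* The compression of lam l tensored with the identity by the isometry
   v |-> (h, z) |-> v (h z) zeta_(h z) (h). *)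
Lemma compression_bound : exists2 w : HX,
  (forall x, w x = \sum_(p <- l) p.1 *
     ((\sum_(h <- F) zeta x h * zeta (a p.2^-1%g x) (p.2^-1 * h)%g)%:C%C * v (a p.2^-1%g x))) &
  nm w <= c * nm v.
Proof.
(* [A z] is the slice at z of the image of v under the isometry, [b z] that slice after lam(l), and
   r applies the adjoint of the isometry. *)
pose A z : HG := l2_supp F (fun h => v (a h z) * (zeta (a h z) h)%:C%C).
have AE z h : A z h = v (a h z) * (zeta (a h z) h)%:C%C.
  by rewrite /A /=; case: ifPn => // /zF ->; rewrite rmorph0 mulr0.
pose b z : HG := glrep lam l (A z).
pose r x : C := \sum_(h <- F) (zeta x h)%:C%C * b (a h^-1%g x) h.
have rE x : r x = \sum_(p <- l) p.1 *
     ((\sum_(h <- F) zeta x h * zeta (a p.2^-1%g x) (p.2^-1 * h)%g)%:C%C * v (a p.2^-1%g x)).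
  under eq_bigr do rewrite rmorph_sum mulr_suml mulr_sumr.
  rewrite exchange_big; apply: eq_bigr => h _ /=.
  rewrite /b /glrep l2_sumE mulr_sumr; apply: eq_bigr => p _.
  have lamE g (y : HG) : (lam g y : l2 R G) h = y (g^-1 * h)%g by [].
  rewrite l2_scaleE lamE AE -gactM -mulgA mulgV mulg1.
  rewrite rmorphM /=; ring.
have := @l2_of_nsum X r (c * nm v); case.
- by rewrite mulr_ge0 ?nm_ge0.
- apply: (@le_trans _ _ (nsum (fun x => \sum_(h <- F) sqn (b (a h^-1%g x) h)))).
    by apply: le_nsum => x; exact: sqn_sum_le.
  rewrite nsum_sum => [|h x]; last exact: sqn_ge0.
  under eq_bigr do rewrite (nsum_gact a (fun z => sqn (b z _))).
  rewrite -nsum_sum => [|h x]; last exact: sqn_ge0.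
  rewrite exprMn EFinM nm2_l2 l2_sq_nsum -nsumZ ?sqr_ge0//; last by move=> x; exact: sqn_ge0.
  apply: (@le_trans _ _ (nsum (fun z => c ^+ 2 * \sum_(h <- F) sqn (v (a h z)) * zeta (a h z) h ^+ 2))).
    apply: le_nsum => z; apply: (@le_trans _ _ (nm (b z) ^+ 2)).
      rewrite -lee_fin nm2_l2 l2_sq_nsum; apply: nsum_ge_seq => // h; exact: sqn_ge0.
    apply: (@le_trans _ _ ((c * nm (A z)) ^+ 2)).
      by rewrite ler_pXn2r ?nnegrE ?mulr_ge0 ?nm_ge0//; exact: hl.
    rewrite exprMn ler_wpM2l ?sqr_ge0// nm2_l2 (@l2_sq_supp _ _ F)//.
      rewrite le_eqVlt; apply/orP; left; apply/eqP/eq_bigr => h _.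
      by rewrite AE sqnM -(mag2 (_%:C%C)) magC ger0_norm.
    by move=> h hF; rewrite /A /= (negbTE hF).
  rewrite !nsumZ ?sqr_ge0//; try by move=> x; rewrite ?sqn_ge0 ?sumr_ge0// => h _; rewrite mulr_ge0 ?sqn_ge0 ?sqr_ge0.
  rewrite lee_wpmul2l ?lee_fin ?sqr_ge0//.
  rewrite nsum_sum => [|h x]; last by rewrite mulr_ge0 ?sqn_ge0 ?sqr_ge0.
  under eq_bigr do rewrite (nsum_gact a (fun x => sqn (v x) * zeta x _ ^+ 2)).
  rewrite -nsum_sum => [|h x]; last by rewrite mulr_ge0 ?sqn_ge0 ?sqr_ge0.
  by apply: le_nsum => x; rewrite -mulr_sumr z1 mulr1.
by move=> w wE hw; exists w => // x; rewrite wE rE.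
Qed.

End Compression.

Variable s : X -> G.
Hypothesis s_equiv : forall g, exists S : seq X, forall x, x \notin S -> s (a g x) = (g * s x)%g.
Hypothesis PA : propA R G.

(** Compression by the square roots of the measures mu (s x) multiplies each term pi(g) by a
    function of overlaps. Off finitely many points s is equivariant, so this function is within e of
    1 there. *)
Lemma essle_of_propA l (c : R) : 0 <= c -> opb (glrep lam l) c -> essle (glrep pi l) c.
Proof.
move=> c0 hl d d0.
have g1 : 0 < gln l + 1 by rewrite ltr_wpDl ?gln_ge0.
pose e := d / (gln l + 1); have e0 : 0 < e by rewrite divr_gt0.
have [F [mu [uF mu0 muF mu1 hmu]]] := PA (map snd l) e0.
have /choice[S hS] g := s_equiv g.
(* For x off B, the point g^-1 x avoids the exceptional set of g, for every g occurring in l. *)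
pose B := flatten [seq map (a g) (S g) | g <- map snd l].
pose zeta x h := Num.sqrt (mu (s x) h).
have z2 x h : zeta x h ^+ 2 = mu (s x) h by rewrite sqr_sqrtr.
exists B => v.
have [w wE hw] : exists2 w : HX,
  (forall x, w x = \sum_(p <- l) p.1 *
     ((\sum_(h <- F) zeta x h * zeta (a p.2^-1%g x) (p.2^-1 * h)%g)%:C%C * v (a p.2^-1%g x))) &
  nm w <= c * nm v.
  apply: compression_bound => //.
  - by move=> x h; exact: sqrtr_ge0.
  - by move=> x h /muF e1; rewrite /zeta e1 sqrtr0.
  - by move=> x; under eq_bigr do rewrite z2.
pose k g x := \sum_(h <- F) zeta x h * zeta (a g^-1%g x) (g^-1 * h)%g.
have kE g x : g \in map snd l -> x \notin B -> `|k g x - 1| <= e.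
  move=> gl xB; rewrite -(mu1 (s x)) /k -sumrB; apply: le_trans (ler_norm_sum _ _ _) _.
  have sE : s x = (g * s (a g^-1%g x))%g.
    rewrite -hS ?gactKV//; apply: contra xB => xS; apply/flattenP.
    by exists (map (a g) (S g)); [exact: map_f|rewrite -[x](gactKV a g) map_f].
  apply: le_trans (hmu g (s (a g^-1%g x)) F gl uF); rewrite -sE.
  by apply: ler_sum => h _; exact: sqrt_mul_close.
have /choice[D hD] g : exists w' : HX, g \in map snd l ->
    (forall x, w' x = if x \in B then 0 else (1 - k g x)%:C%C * v (a g^-1%g x)) /\ nm w' <= e * nm v.
  have [gl|gl] := boolP (g \in map snd l); last by exists 0.
  have [|x|w' h1 h2] := @l2_dominated (pi g v)
      (fun x => if x \in B then 0 else (1 - k g x)%:C%C * v (a g^-1%g x)) e.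
  - exact: ltW.
  - case: ifPn => xB; first by rewrite mag0 mulr_ge0 ?mag_ge0// ltW.
    by rewrite magM magC distrC ler_wpM2r ?mag_ge0// kE.
  by exists w' => _; split=> //; rewrite nm_urep in h2.
have -> : glrep pi l v - prj B (glrep pi l v) = (w - prj B w) + \sum_(p <- l) p.1 *: D p.2.
  apply: l2E => x; rewrite !(l2_addE, l2_oppE, prjE).
  have -> : (\sum_(p <- l) p.1 *: D p.2 : l2 R X) x =
      \sum_(p <- l) if x \in B then 0 else p.1 * ((1 - k p.2 x)%:C%C * v (a p.2^-1%g x)).
    rewrite l2_sumE big_seq [RHS]big_seq; apply: eq_bigr => p pl.
    rewrite l2_scaleE; have [-> _] := hD p.2 (map_f _ pl).
    by case: ifP; rewrite ?mulr0.
  case: ifP => xB; first by rewrite !subrr add0r big1.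
  rewrite !subr0 wE -big_split /= l2_sumE; apply: eq_bigr => p _.
  have piE g : (pi g v : l2 R X) x = v (a g^-1%g x) by [].
  by rewrite l2_scaleE piE rmorphB rmorph1 -/(k p.2 x); ring.
apply: le_trans (nmD _ _) _; rewrite mulrDl; apply: lerD.
  exact: le_trans (coprj_le _ _) hw.
apply: le_trans (nm_sum _ _ _) _.
apply: (@le_trans _ _ (\sum_(p <- l) mag p.1 * (e * nm v))).
  rewrite big_seq [leRHS]big_seq; apply: ler_sum => p pl; rewrite nmZ ler_wpM2l ?mag_ge0//.
  by have [] := hD p.2 (map_f _ pl).
rewrite -mulr_suml -/(gln l) mulrA ler_wpM2r ?nm_ge0// /e mulrCA ler_piMr ?(ltW d0)//.
by rewrite ler_pdivrMr// mul1r lerDl.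
Qed.

End AlmostEquivariant.

(** * The rank-one projection and non-amenability *)

Section RankOneProjection.
Variables (R : realType) (Gam G : groupType) (X : choiceType) (a : gaction G X) (x0 : X).
Variable iota : Gam -> G.
Local Notation C := (R[i]).
Local Notation HX := (l2_hilbert R X).
Local Notation pi := (perm_rep R a).
Hypothesis iotaM : {morph iota : g h / (g * h)%g}.
Hypothesis fix_x0 : forall g, a (iota g) x0 = x0.
Hypothesis free : forall g x, x <> x0 -> a (iota g) x = x -> g = 1%g.

Let iota1 : iota 1%g = 1%g.
Proof. by apply: (mulgI (iota 1)); rewrite -iotaM !mulg1. Qed.

Let iotaV g : iota g^-1%g = (iota g)^-1%g.
Proof. by apply: (mulgI (iota g)); rewrite mulgV -iotaM mulgV iota1. Qed.

(** Choosing a point in each orbit other than that of x0 identifies the orbit with Gam, by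
    freeness. *)
Lemma free_section : exists rho : X -> Gam, forall g x, x <> x0 ->
  rho (a (iota g) x) = (g * rho x)%g.
Proof.
pose orb x := [set y | exists g, a (iota g) y = x].
pose t x := xget x0 (orb x).
pose rho x := xget 1%g [set g | a (iota g) (t x) = x].
have orbE g x : orb (a (iota g) x) = orb x.
  apply/seteqP; split=> y [h hy].
    by exists (g^-1 * h)%g; rewrite iotaM gactM hy -gactM -iotaM mulVg iota1 gact1.
  by exists (g * h)%g; rewrite iotaM gactM hy.
have rhoE x : a (iota (rho x)) (t x) = x.
  have [g hg] : exists g, a (iota g) (t x) = x.
    by apply: (xgetPex x0 (P := orb x)); exists x, 1%g; rewrite iota1 gact1.
  by apply: (xgetPex 1%g (P := [set g | a (iota g) (t x) = x])); exists g.
exists rho => g x xn; have tE : t (a (iota g) x) = t x by rewrite /t orbE.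
have tn : t x <> x0 by move=> tx; apply: xn; rewrite -(rhoE x) tx fix_x0.
have := rhoE (a (iota g) x); rewrite tE => e.
have := @free ((rho (a (iota g) x))^-1 * (g * rho x))%g _ tn.
rewrite !iotaM !gactM rhoE -{2}e -gactM iotaV mulVg gact1 => /(_ erefl) /mulg1_eq.
by rewrite invgK.
Qed.

Definition mass (P : set X) (v : HX) : R := fine (nsum (fun x => if `[< P x >] then sqn (v x) else 0)).

Lemma mass_fin P (v : HX) : nsum (fun x => if `[< P x >] then sqn (v x) else 0) \is a fin_num.
Proof.
apply: nsum_fin => [x|]; first by case: ifP => // _; exact: sqn_ge0.
apply: le_lt_trans (l2_fin v); apply: le_nsum => x; case: ifP => // _; exact: sqn_ge0.
Qed.

Lemma massE P (v : HX) : mass P v = nm (restr P v) ^+ 2.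
Proof.
apply: EFin_inj; rewrite nm2_l2 l2_sq_nsum /mass fineK ?mass_fin//.
by congr nsum; apply/funext => x; rewrite restrE; case: ifP => // _; rewrite sqn0.
Qed.

Lemma mass_ge0 P v : 0 <= mass P v.
Proof. by rewrite massE; exact: sqr_ge0. Qed.

Lemma mass_le P v : mass P v <= nm v ^+ 2.
Proof.
rewrite -lee_fin fineK ?mass_fin// nm2_l2 l2_sq_nsum; apply: le_nsum => x.
by case: ifP => // _; exact: sqn_ge0.
Qed.

Lemma massT v : mass setT v = nm v ^+ 2.
Proof. by rewrite massE; congr (nm _ ^+ 2); apply: l2E => x; rewrite restrE asboolT. Qed.

Lemma massU P Q v : P `&` Q = set0 -> mass (P `|` Q) v = mass P v + mass Q v.
Proof.
move=> PQ; apply: EFin_inj; rewrite EFinD !fineK ?mass_fin// -nsumD.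
- congr nsum; apply/funext => x; case: asboolP => [[Px|Qx]|h].
  + rewrite (asboolT Px) asboolF ?addr0// => Qx.
    by have : (P `&` Q) x by []; rewrite PQ.
  + rewrite (asboolT Qx) asboolF ?add0r// => Px.
    by have : (P `&` Q) x by []; rewrite PQ.
  + by rewrite !asboolF ?addr0// => h'; apply: h; [right|left].
- by move=> x; case: ifP => // _; exact: sqn_ge0.
- by move=> x; case: ifP => // _; exact: sqn_ge0.
Qed.

Lemma mass_close P (v w : HX) : nm v <= 1 -> nm w <= 1 -> `|mass P v - mass P w| <= 2 * nm (v - w).
Proof.
move=> v1 w1; pose v' := restr P v; pose w' := restr P w.
have dd : restr P (v - w) = v' - w'.
  by apply: l2E => x; rewrite /v' /w' !(l2_addE, l2_oppE, restrE); case: ifP; rewrite ?subrr.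
have hn (u : HX) : nm (restr P u) <= nm u.
  by rewrite -(@ler_pXn2r _ 2) ?nnegrE ?nm_ge0// -massE; exact: mass_le.
rewrite !massE -/v' -/w'.
have h1 : nm v' <= nm v := hn v; have h2 : nm w' <= nm w := hn w.
have h3 := hn (v - w); rewrite dd in h3.
have t1 : nm v' <= nm w' + nm (v' - w').
  by rewrite -{1}(subrK w' v') addrC; exact: nmD.
have t2 : nm w' <= nm v' + nm (v' - w').
  by rewrite nm_distC -{1}(subrK v' w') addrC; exact: nmD.
have p0 := nm_ge0 v'; have q0 := nm_ge0 w'.
move: h1 h2 h3 t1 t2 p0 q0 v1 w1; clear -R.
move: (nm (v' - w')) (nm v') (nm w') (nm v) (nm w) (nm (v - w)) => r p q s t u.
move=> h1 h2 h3 t1 t2 p0 q0 v1 w1.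
have p1 : p <= 1 by lra.
have q1 : q <= 1 by lra.
have r0 : 0 <= r by lra.
have h : `|p ^+ 2 - q ^+ 2| <= 2 * r.
  rewrite subr_sqr normrM [in X in _ * X]ger0_norm ?addr_ge0// mulrC.
  by apply: ler_pM; rewrite ?addr_ge0//; [lra|rewrite ler_norml; apply/andP; split; lra].
by apply: le_trans h _; lra.
Qed.

Definition almost_invariant (E : seq Gam) (d : R) (v : HX) := [/\ v x0 = 0, nm v = 1 &
  forall g, g \in E -> nm (pi (iota g) v - v) <= d].

(** The probabilities |v_n|^2 are pushed to Gam along the equivariant map rho, and their limit along
    an ultrafilter is an invariant mean. *)
Lemma amenable_of_almost_invariant : countable [set: Gam] ->
  (forall E d, 0 < d -> exists v, almost_invariant E d v) -> amenable R Gam.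
Proof.
move=> cG hai; have [rho rhoE] := free_section.
have [E hE] := countable_exhaust (1%g : Gam) cG.
have /choice[v hv] (n : nat) : exists v, almost_invariant (E n) n.+1%:R^-1 v.
  by apply: hai; rewrite invr_gt0.
have [U [UU hU]] := nat_ultra.
pose m (A : set Gam) := ulim U (fun n => mass (rho @^-1` A) (v n)).
have bm A : bdd (fun n => mass (rho @^-1` A) (v n)).
  exists 1 => n; rewrite ger0_norm ?mass_ge0//; apply: le_trans (mass_le _ _) _.
  by have [_ -> _] := hv n; rewrite expr1n.
exists m; split.
- rewrite /m (_ : (fun n => _) = fun=> 1) ?ulim_cst//.
  by apply/funext => n; rewrite preimage_setT massT; have [_ -> _] := hv n; rewrite expr1n.
- move=> A; apply: ulim_ge => //; apply: filterS (@filterT _ U _) => n _; exact: mass_ge0.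
- move=> A B AB; rewrite /m -ulimD//; congr (ulim U); apply/funext => n.
  by rewrite preimage_setU massU// -preimage_setI AB preimage_set0.
move=> g A; apply/eqP; rewrite -subr_eq0 -normr_eq0; apply/eqP.
rewrite /m -(ulimN UU (bm A)) -ulimD//; last exact: bddN.
rewrite -(ulim_norm UU); last by apply: bddD => //; exact: bddN.
apply/eqP; rewrite eq_le; apply/andP; split; last first.
  by apply: ulim_ge; [apply: bdd_norm; apply: bddD => //; exact: bddN|apply: filterS (@filterT _ U _) => n _ /=].
apply/ler_addgt0Pl => e e0; rewrite addr0.
apply: ulim_le; first by apply: bdd_norm; apply: bddD => //; exact: bddN.
(* Translating the set by g amounts to acting on v by g^-1. *)
have [N hN] := hE g^-1%g.
have ei : 0 <= (e / 2)^-1 by rewrite invr_ge0 divr_ge0// ltW.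
apply: filterS (hU (maxn N (Num.bound (e / 2)^-1))) => n /=.
rewrite geq_max => /andP[Nn Bn]; have [v0 v1 vi] := hv n.
have -> : mass (rho @^-1` left_coset A g) (v n) = mass (rho @^-1` A) (pi (iota g^-1%g) (v n)).
  rewrite /mass -(nsum_gact a _ (iota g)); congr (fine (nsum _)); apply/funext => x.
  have -> : (pi (iota g^-1%g) (v n) : l2 R X) x = v n (a (iota g) x).
    by rewrite /= iotaV invgK.
  have [->|xn] := pselect (x = x0); first by rewrite fix_x0 v0 sqn0; do 2 case: ifP.
  congr (if _ then _ else _); apply/asboolP/asboolP; rewrite /preimage /= rhoE//.
    by move=> [h Ah /mulgI <-].
  by move=> Ah; exists (rho x).
apply: le_trans (mass_close _ _ _) _; rewrite ?nm_urep ?v1//.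
have := vi _ (hN n Nn); set q := nm _ => hq.
have : n.+1%:R^-1 <= e / 2.
  rewrite -[e / 2]invrK lef_pV2 ?posrE ?invr_gt0 ?divr_gt0 ?ltr0n//.
  by apply: le_trans (ltW (archi_boundP ei)) _; rewrite ler_nat ltnW.
by move=> /(le_trans hq) /(ler_wpM2l (ler0n _ 2)); rewrite [2 * (e / 2)]mulrCA divff ?mulr1.
Qed.

(** The identity takes part in the average: paired with some g that moves v by d |v| or more, the
    parallelogram law bounds v + g v by (2 - d^2 / 4) |v|, while the other terms have norm |v|. *)
Lemma uniform_contraction (E : seq Gam) (d : R) : 0 < d -> d <= 1 ->
  (forall v : HX, v x0 = 0 -> nm v = 1 -> exists2 g, g \in E & d <= nm (pi (iota g) v - v)) ->
  exists l (k : R), [/\ 0 <= k, k < 1,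
    forall v : HX, v x0 = 0 -> nm (glrep pi l v) <= k * nm v,
    forall v : HX, v x0 = 0 -> (glrep pi l v : l2 R X) x0 = 0 &
    glrep pi l (delta R x0) = delta R x0].
Proof.
move=> d0 d1 hE; pose n : R := (size E).+1%:R; have n0 : 0 < n by rewrite ltr0n.
pose l := [seq ((n^-1)%:C%C, iota g) | g <- 1%g :: E].
have lE v : glrep pi l v = (n^-1)%:C%C *: \sum_(g <- 1%g :: E) pi (iota g) v.
  by rewrite /glrep big_map scaler_sumr.
have d2 : 0 <= d ^+ 2 / 4 <= 1 / 4.
  by rewrite divr_ge0 ?sqr_ge0//= ler_pM2r// expr_le1// ltW.
have n1 : 1 <= n by rewrite ler1n.
exists l, ((n - d ^+ 2 / 4) / n); split.
- by rewrite divr_ge0 ?(ltW n0)//; lra.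
- by rewrite ltr_pdivrMr// mul1r gtrBl divr_gt0// exprn_gt0.
- move=> v v0; have [/nm_eq0 ->|vn] := eqVneq (nm v) 0.
    by rewrite (lin0 (glrep_linear _ _)) nm0 mulr0.
  have vp : 0 < nm v by rewrite lt0r vn nm_ge0.
  have [g gE hg] : exists2 g, g \in E & d * nm v <= nm (pi (iota g) v - v).
    have [||g gE hg] := hE ((nm v)^-1%:C%C *: v).
    + by rewrite l2_scaleE v0 mulr0.
    + by rewrite nmZr ger0_norm ?invr_ge0 ?nm_ge0// mulVf.
    exists g => //; move: hg; rewrite urep_scale -scalerBr nmZr ger0_norm ?invr_ge0 ?nm_ge0//.
    by rewrite ler_pdivlMl// mulrC.
  have h2 : nm (v + pi (iota g) v) <= (2 - d ^+ 2 / 4) * nm v.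
    rewrite -(@ler_pXn2r _ 2) ?nnegrE ?mulr_ge0 ?nm_ge0//; last by lra.
    have : (d * nm v) ^+ 2 <= nm (pi (iota g) v - v) ^+ 2.
      by rewrite ler_pXn2r ?nnegrE ?mulr_ge0 ?nm_ge0// ltW.
    rewrite !nm2D nmN nm_urep; have -> : Re (inner HX (pi (iota g) v) (- v)) = - Re (inner HX v (pi (iota g) v)).
      rewrite -scaleN1r innerZr innerC.
      by case: (inner HX v _) => p q /=; ring.
    rewrite !exprMn; have -> : (2 - d ^+ 2 / 4) ^+ 2 * nm v ^+ 2 =
      (4 - d ^+ 2) * nm v ^+ 2 + (d ^+ 2 / 4) ^+ 2 * nm v ^+ 2 by field.
    have : 0 <= (d ^+ 2 / 4) ^+ 2 * nm v ^+ 2 by rewrite mulr_ge0 ?sqr_ge0.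
    rewrite mulrBl; clear.
    by move: ((d ^+ 2 / 4) ^+ 2 * nm v ^+ 2) (d ^+ 2 * nm v ^+ 2) (nm v ^+ 2) (Re _) => A B p r; lra.
  rewrite lE nmZr ger0_norm ?invr_ge0 ?(ltW n0)// ler_pdivrMl//.
  have -> : n * ((n - d ^+ 2 / 4) / n * nm v) = (n - d ^+ 2 / 4) * nm v by field; rewrite gt_eqF.
  rewrite big_cons (perm_big _ (perm_to_rem gE)) big_cons iota1 (urep1 pi) addrA; apply: le_trans (nmD _ _) _.
  apply: (@le_trans _ _ ((2 - d ^+ 2 / 4) * nm v + \sum_(h <- rem g E) nm v)).
    apply: lerD => //; apply: le_trans (nm_sum _ _ _) _.
    by apply: ler_sum => h _; rewrite nm_urep.
  rewrite big_const_seq count_predT iter_addr_0 -[_ *+ size _]mulr_natl -mulrDl ler_wpM2r ?nm_ge0//.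
  rewrite size_rem// /n -(@prednK (size E)); last by case: (E) gE.
  by rewrite [(_.+2)%:R]mulrSr [(_.+1)%:R]mulrSr; lra.
- move=> v v0; rewrite lE l2_scaleE l2_sumE big1 ?mulr0// => g _.
  by rewrite /= -iotaV fix_x0.
rewrite lE (eq_bigr (fun=> delta R x0 : HX)); last first.
  move=> g _; apply: l2E => x; have -> : (pi (iota g) (delta R x0) : l2 R X) x = delta R x0 (a (iota g^-1%g) x).
    by rewrite /= iotaV.
  rewrite !deltaE; congr (_%:R); congr nat_of_bool; apply/eqP/eqP => [h|->]; last exact: fix_x0.
  by rewrite -(gactK a (iota g^-1%g) x) h -iotaV fix_x0.
rewrite big_const_seq count_predT iter_addr_0 -[_ *+ _]scaler_nat scalerA.
have -> : (size (1%g :: E))%:R = n%:C%C :> C by rewrite rmorph_nat.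
by rewrite -rmorphM /= mulVf ?scale1r// gt_eqF.
Qed.

Lemma full_image_rank_one : countable [set: Gam] -> ~ amenable R Gam -> full_image pi (eu x0 x0).
Proof.
move=> cG nam.
have [E [d [d0 d1 hE]]] : exists (E : seq Gam) (d : R), [/\ 0 < d, d <= 1 &
    forall v : HX, v x0 = 0 -> nm v = 1 -> exists2 g, g \in E & d <= nm (pi (iota g) v - v)].
  apply: contrapT => h; apply: nam; apply: amenable_of_almost_invariant => // E d d0.
  apply: contrapT => nv; apply: h; exists E, (Num.min d 1); split.
  - by rewrite lt_min d0 ltr01.
  - by rewrite ge_min lexx orbT.
  move=> v v0 v1; apply: contrapT => hg; apply: nv; exists v; split=> // g gE.
  rewrite leNgt; apply/negP => dg; apply: hg; exists g => //.
  by rewrite ge_min (ltW dg).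
have [l [k [k0 k1 hl l0 ld]]] := uniform_contraction d0 d1 hE.
apply/full_imageP; split; first exact: eu_bounded.
move=> e e0; have [N hN] := expr_small k0 k1 e0.
exists (iter N (glmul l) (gl1 R G)).
apply: opb_ge0_le (hN N (leqnn N)) _ => v.
pose v' : HX := v - (v x0 : C) *: (delta R x0 : HX).
have v'0 : v' x0 = 0 by rewrite l2_addE l2_oppE l2_scaleE deltaE eqxx mulr1 subrr.
have v'v : nm v' <= nm v.
  apply: le_trans (coprj_le [:: x0] v); rewrite le_eqVlt; apply/orP; left; apply/eqP; congr nm.
  by rewrite prj_sum// big_seq1.
apply: (@le_trans _ _ (k ^+ N * nm v')); last by rewrite ler_wpM2l ?exprn_ge0.
suff [-> _ h] : [/\ (glrep pi (iter N (glmul l) (gl1 R G)) - eu x0 x0) v = iter N (glrep pi l) v',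
    (iter N (glrep pi l) v' : l2 R X) x0 = 0 & nm (iter N (glrep pi l) v') <= k ^+ N * nm v'] by [].
elim: (N) => [|M [e1 e2 e3]].
  by split=> //; [rewrite -[LHS]/(glrep pi (gl1 R G) v - _) glrep1|rewrite expr0 mul1r].
rewrite !iterS; split.
- rewrite -e1 -[LHS]/(glrep pi (glmul l (iter M (glmul l) (gl1 R G))) v - eu x0 x0 v).
  rewrite -[(glrep pi _ - eu x0 x0) v]/(glrep pi _ v - eu x0 x0 v).
  by rewrite glrep_mul (linB (glrep_linear pi l)) {2}/eu (linZ (glrep_linear pi l)) ld.
- exact: l0.
by apply: le_trans (hl _ e2) _; rewrite exprS -mulrA ler_wpM2l.
Qed.

End RankOneProjection.

Lemma freeprod_ideals (R : realType) (Gam Lam : groupType) :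
  countable [set: Gam] -> infinite_set [set: Lam] -> ~ amenable R Gam ->
  cstar_simple R (freeprod Gam Lam) -> propA R (freeprod Gam Lam) -> forall I,
  nontrivial_ideal (full_image (quasi_regular R (range (@freeprod_inl Gam Lam)))) I <->
  I = @compact_ops R _.
Proof.
move=> cG iL nam cs pA I; pose x0 : coset_space (range (@freeprod_inl Gam Lam)) := gcoset 1%g.
apply: (@nontrivial_ideal_compact R _ _ _ x0) => //.
- apply: (full_image_rank_one (iota := @freeprod_inl Gam Lam)) => //.
  + exact: freeprod_inlM.
  + exact: gcoset1_inl.
  + by move=> g x; exact: inl_free.
- by move=> x; have [b ->] := gcosetP x; exists b; rewrite gcoset_act mulg1.
- move=> fX; apply: iL.
  have := @finite_preimage _ _ setT (fun h : Lam => gcoset (freeprod_inr Gam h)).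
  by rewrite preimage_setT; apply=> // h h' _ _; exact: gcoset_inr_inj.
- by move=> l c c0; apply: (essle_of_propA (@csection_almost_equivariant Gam Lam)).
Qed.

(** * Free groups *)

Section ParentMap.
Variable G : groupType.
Local Open Scope group_scope.

(* A rooted tree structure on a Cayley graph of G: q moves every vertex towards the root, along
   edges, and every edge joins a vertex to its parent. *)
Definition tree_structure (S : seq G) (q : G -> G) := [/\ 1 \notin S, q 1 = 1,
  forall P : G -> Prop, P 1 -> (forall s x, s \in S -> P x -> P (s * x)) -> forall x, P x,
  forall x, q x = x \/ exists2 s, s \in S & q x = s * x &
  forall s x, s \in S -> q (s * x) = x \/ q x = s * x].

Definition tree_like := exists S q, tree_structure S q.

Variables (R : realType) (S : seq G) (q : G -> G).
Hypothesis tr : tree_structure S q.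
Local Open Scope ring_scope.

(** Counts the passages through y of the path from x to the root during n steps; divided by n, it is
    the measure of property A at x. *)
Definition visits n x y : R := \sum_(i < n) (iter i q x == y)%:R.

(** Starting the path one step later changes only its two ends. *)
Lemma visits_parent n x y : visits n (q x) y - visits n x y = (iter n q x == y)%:R - (x == y)%:R.
Proof.
elim: n => [|n IH]; first by rewrite /visits !big_ord0 !subrr.
rewrite /visits !big_ord_recr /= -/(visits n _ _) -/(visits n _ _) opprD addrACA IH -iterSr /=.
by ring.
Qed.

Lemma sum_indicator_le (B : seq G) (z : G) : uniq B -> \sum_(y <- B) ((z == y)%:R : R) <= 1.
Proof.
move=> uB; have [zB|zB] := boolP (z \in B).
  rewrite (bigD1_seq z)//= eqxx big1 ?addr0// => y; rewrite eq_sym => /negbTE -> //.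
rewrite big_seq big1 ?ler01// => y yB; case: eqP => // zy.
by move: zB; rewrite zy yB.
Qed.

(** By induction on a word for g: each letter crosses one edge, at a cost of at most 2 whatever n
    is. *)
Lemma visits_close (g : G) : exists c : nat, forall n x (B : seq G), uniq B ->
  \sum_(y <- B) `|visits n (g * x)%g y - visits n x y| <= c%:R.
Proof.
have [_ _ gen _ adj] := tr; elim/gen: g => [|s g sS [c hc]].
  by exists 0%N => n x B uB; rewrite mul1g big1// => y _; rewrite subrr normr0.
exists c.+2 => n x B uB.
have par z z' : q z = z' -> \sum_(y <- B) `|visits n z y - visits n z' y| <= 2.
  move=> <-; apply: (@le_trans _ _ (\sum_(y <- B) ((iter n q z == y)%:R + (z == y)%:R))).
    apply: ler_sum => y _; rewrite distrC visits_parent; apply: le_trans (ler_normB _ _) _.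
    by rewrite !ger0_norm.
  rewrite big_split /=; have := lerD (sum_indicator_le (iter n q z) uB) (sum_indicator_le z uB).
  by [].
have {par} h : \sum_(y <- B) `|visits n (s * (g * x))%g y - visits n (g * x)%g y| <= 2.
  case: (adj s (g * x)%g sS) => h; first exact: par h.
  by under eq_bigr do rewrite distrC; exact: par h.
apply: (@le_trans _ _ (\sum_(y <- B) (`|visits n (s * (g * x))%g y - visits n (g * x)%g y| +
    `|visits n (g * x)%g y - visits n x y|))).
  by apply: ler_sum => y _; rewrite -mulgA; exact: ler_distD.
rewrite big_split /=; apply: le_trans (lerD h (hc n x B uB)) _.
by rewrite -natrD add2n.
Qed.

Lemma ancestor_finite n : exists F : seq G, forall x i, (i <= n)%N -> (x * (iter i q x)^-1)%g \in F.
Proof.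
have [_ _ _ nbr _] := tr; elim: n => [|n [F hF]].
  by exists [:: 1%g] => x [|i]//= _; rewrite mulgV mem_seq1.
exists (F ++ [seq (f * s^-1)%g | f <- F, s <- S]) => x i.
rewrite leq_eqVlt ltnS => /orP[/eqP ->|/hF xF]; last by rewrite mem_cat xF.
rewrite mem_cat /=; case: (nbr (iter n q x)) => [->|[s sS ->]]; first by rewrite hF.
apply/orP; right; apply/allpairsP; exists ((x * (iter n q x)^-1)%g, s) => /=.
by split=> //; [exact: hF|rewrite invgM mulgA].
Qed.

Lemma propA_of_tree : propA R G.
Proof.
move=> E e e0; have /choice[c hc] := visits_close.
pose C : R := \sum_(g <- E) (c g)%:R.
have C0 : 0 <= C by apply: sumr_ge0.
have Ce : 0 <= C / e by rewrite divr_ge0// ltW.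
(* C bounds the cost of each g in E, so a path of length n with C / n <= e suffices. *)
pose n := (Num.bound (C / e)).+1; have n0 : 0 < n%:R :> R by rewrite ltr0n.
have [F hF] := ancestor_finite n.
have v0 x h : h \notin F -> visits n x (h^-1 * x)%g = 0.
  move=> hy; rewrite /visits big1// => i _; case: eqP => // e1; case/negP: hy.
  have -> : h = (x * (iter i q x)^-1)%g by rewrite e1 invgM invgK mulVKg.
  by apply: hF; exact: ltnW.
have vge m x y : 0 <= visits m x y by apply: sumr_ge0.
exists (undup F), (fun x h => visits n x (h^-1 * x)%g / n%:R); split.
- exact: undup_uniq.
- by move=> x h; rewrite divr_ge0.
- by move=> x h; rewrite mem_undup => /v0 ->; rewrite mul0r.
- move=> x; rewrite -mulr_suml /visits exchange_big /=.
  rewrite (eq_bigr (fun=> 1)) => [|i _]; first by rewrite sumr_const card_ord divff// gt_eqF.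
  have xF : (x * (iter i q x)^-1)%g \in undup F by rewrite mem_undup; apply: hF; exact: ltnW.
  rewrite (bigD1_seq _ xF) ?undup_uniq//= invgM invgK mulgVK eqxx big1 ?addr0// => h hn.
  case: eqP => // e1; case/eqP: hn.
  by rewrite e1 invgM invgK mulVKg.
move=> g x B gE uB.
have -> : \sum_(h <- B) `|visits n (g * x)%g (h^-1 * (g * x))%g / n%:R -
      visits n x ((g^-1 * h)^-1 * x)%g / n%:R| =
    (\sum_(y <- [seq (h^-1 * (g * x))%g | h <- B]) `|visits n (g * x)%g y - visits n x y|) / n%:R.
  rewrite big_map mulr_suml; apply: eq_bigr => h _.
  by rewrite invgM invgK -mulgA -mulrBl normrM [`|n%:R^-1|]ger0_norm// invr_ge0 ltW.
rewrite ler_pdivrMr//; apply: le_trans (hc g n x _ _) _.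
  by rewrite map_inj_uniq// => h h' /mulIg /invg_inj.
apply: (@le_trans _ _ C).
  by rewrite /C (big_rem g)//= lerDl sumr_ge0.
rewrite mulrC -ler_pdivrMr//; apply: le_trans (ltW (archi_boundP Ce)) _.
by rewrite ler_nat.
Qed.

End ParentMap.

Section TreeFreeProduct.
Variables G H : groupType.
Local Open Scope group_scope.
Local Notation FP := (freeprod G H).
Local Notation il := (@freeprod_inl G H).
Local Notation ir := (@freeprod_inr G H).

(** The parent of x is obtained by moving the first letter of its normal form towards the root of
    its factor. Thus the free product of two free groups is treated without identifying it with a
    free group. *)
Lemma tree_freeprod : tree_like G -> tree_like H -> tree_like FP.
Proof.
move=> [S [q [S1 q1 Sgen Snbr Sadj]]] [T [p [T1 p1 Tgen Tnbr Tadj]]].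
pose Q (x : FP) : FP := match nf x with
  | inl g :: _ => il (q g * g^-1) * x
  | inr h :: _ => ir (p h * h^-1) * x
  | [::] => 1 end.
exists (map il S ++ map ir T), Q; split.
- rewrite mem_cat negb_or; apply/andP; split; apply/mapP => -[s sS].
    by rewrite -(freeprod_inl1 G H) => /freeprod_inl_inj e; move: S1; rewrite e sS.
  by move=> /esym/freeprod_inr_eq1 e; move: T1; rewrite -e sS.
- by rewrite /Q nf1.
- move=> P P1 PS; elim/freeprod_ind => // [g x Px|h x Px].
    elim/Sgen: g => [|s g sS IH]; first by rewrite freeprod_inl1 mul1g.
    by rewrite freeprod_inlM -mulgA; apply: PS => //; rewrite mem_cat map_f.
  elim/Tgen: h => [|s h sS IH]; first by rewrite freeprod_inr1 mul1g.
  by rewrite freeprod_inrM -mulgA; apply: PS => //; rewrite mem_cat map_f ?orbT.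
- move=> x; rewrite /Q; case xw: (nf x) => [|[g|h] w]; first by left; rewrite -(nfK x) xw.
    case: (Snbr g) => [->|[s sS ->]]; first by left; rewrite mulgV freeprod_inl1 mul1g.
    by right; exists (il s); [rewrite mem_cat map_f|rewrite mulgK].
  case: (Tnbr h) => [->|[s sS ->]]; first by left; rewrite mulgV freeprod_inr1 mul1g.
  by right; exists (ir s); [rewrite mem_cat map_f ?orbT|rewrite mulgK].
move=> s x; rewrite mem_cat => /orP[] /mapP[t tS ->] {s}.
  have t1 : t != 1 by apply: contraNneq S1 => <-.
  have qt : q t = 1 by case: (Sadj t 1 tS); rewrite ?mulg1// q1 => e; move: t1; rewrite -e eqxx.
  rewrite /Q nf_inl; have := nf_reduced x; case: (nf x) => [|[g|h] w] /=.
  + by rewrite t1 qt mul1g freeprod_inlV mulKg; left.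
  + rewrite reduced_cons => /and3P[/= g1 _ _]; have [tg|tg] := eqVneq (t * g) 1.
      case: (Sadj t g tS) => [|->]; first by rewrite tg q1 => e; move: g1; rewrite -e eqxx.
      by rewrite mulgK; right.
    case: (Sadj t g tS) => [->|->]; last by rewrite mulgK; right.
    by left; rewrite invgM mulVKg freeprod_inlV mulKg.
  + by rewrite t1 qt mul1g freeprod_inlV mulKg; left.
have t1 : t != 1 by apply: contraNneq T1 => <-.
have qt : p t = 1 by case: (Tadj t 1 tS); rewrite ?mulg1// p1 => e; move: t1; rewrite -e eqxx.
rewrite /Q nf_inr; have := nf_reduced x; case: (nf x) => [|[g|h] w] /=.
+ by rewrite t1 qt mul1g freeprod_inrV mulKg; left.
+ by rewrite t1 qt mul1g freeprod_inrV mulKg; left.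
rewrite reduced_cons => /and3P[/= g1 _ _]; have [tg|tg] := eqVneq (t * h) 1.
  case: (Tadj t h tS) => [|->]; first by rewrite tg p1 => e; move: g1; rewrite -e eqxx.
  by rewrite mulgK; right.
case: (Tadj t h tS) => [->|->]; last by rewrite mulgK; right.
by left; rewrite invgM mulVKg freeprod_inrV mulKg.
Qed.

End TreeFreeProduct.

Section FreeGroupWords.
Variable n : nat.
Local Open Scope group_scope.
Local Notation L := ('I_n * bool)%type.
Local Notation linv := (fun x : L => (x.1, ~~ x.2)).
Local Notation cl := (pres_class linv (fun _ _ => False)).
Local Notation F := (free_group n).
Implicit Types (x y : L) (u v w : seq L) (a : F).

Lemma linvK : involutive linv.
Proof. by case=> i b /=; rewrite negbK. Qed.

Definition free_push x w := if w is y :: w' then if y == linv x then w' else x :: w else [:: x].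
Definition free_reduced w := sorted (fun x y => y != linv x) w.
Definition free_nf a : seq L := foldr free_push [::] (repr a).

Lemma free_push_reduced x w : free_reduced w -> free_reduced (free_push x w).
Proof. by case: w => //= y w yw; case: eqP => [_|/eqP h] /=; [exact: path_sorted yw|rewrite h]. Qed.

Lemma free_pushes_reduced u w : free_reduced w -> free_reduced (foldr free_push w u).
Proof. by move=> rw; elim: u => //= x u; exact: free_push_reduced. Qed.

Lemma free_pushK x w : free_reduced w -> free_push x (free_push (linv x) w) = w.
Proof.
case: w => [|y w] rw; first by rewrite /= eqxx.
rewrite [free_push (linv x) _]/= linvK; have [e|yx] := eqVneq y x; last by rewrite /= eqxx.
by move: rw; rewrite e; case: w => [|z w] //= /andP[/negbTE -> _].
Qed.

Lemma free_pushes_cong u v : pres_cong linv (fun _ _ => False) u v ->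
  forall w, free_reduced w -> foldr free_push w u = foldr free_push w v.
Proof.
elim=> {u v} [//|x|x|//|u v _ IH|u v w _ IH1 _ IH2|u u' v v' _ IH1 _ IH2] w' rw.
- exact: free_pushK.
- by have := free_pushK (linv x) rw; rewrite linvK.
- by rewrite IH.
- by rewrite IH1// IH2.
- by rewrite !foldr_cat IH2// IH1// free_pushes_reduced.
Qed.

Lemma free_nf_cl u : free_nf (cl u) = foldr free_push [::] u.
Proof. by apply: free_pushes_cong => //; exact: pres_repr_class. Qed.

Lemma free_nf1 : free_nf 1 = [::].
Proof. exact: free_nf_cl [::]. Qed.

Lemma free_nf_letter x a : free_nf (cl [:: x] * a) = free_push x (free_nf a).
Proof. by rewrite -[a]pres_reprK [_ * _]pres_mulE !free_nf_cl. Qed.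

Lemma free_cl_cons x w : cl (x :: w) = cl [:: x] * cl w.
Proof. by rewrite [RHS]pres_mulE. Qed.

Lemma free_letterV x : cl [:: linv x] = (cl [:: x])^-1.
Proof.
apply: (mulgI (cl [:: x])); rewrite mulgV [LHS]pres_mulE.
exact/pres_classP/pres_invr.
Qed.

Lemma free_cl_push x w : cl (free_push x w) = cl (x :: w).
Proof.
case: w => [|y w] //=; case: eqP => // ->.
by rewrite free_cl_cons (free_cl_cons (linv x)) free_letterV mulVKg.
Qed.

Lemma free_nfK a : cl (free_nf a) = a.
Proof.
rewrite -[RHS]pres_reprK /free_nf; elim: (repr a) => //= x u IH.
by rewrite free_cl_push free_cl_cons IH -free_cl_cons.
Qed.

Lemma free_nf_reducedE w : free_reduced w -> free_nf (cl w) = w.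
Proof.
rewrite free_nf_cl; elim: w => //= x w IH rw; rewrite IH; last exact: path_sorted rw.
by case: w rw {IH} => //= y w /andP[/negbTE ->].
Qed.

Lemma tree_free_group : tree_like F.
Proof.
pose S : seq F := [seq cl [:: x] | x <- enum {: L}].
have letS x : (cl [:: x] : F) \in S by apply: map_f; rewrite mem_enum.
exists S, (fun a => cl (behead (free_nf a))); split.
- by apply/mapP => -[x _ /(congr1 free_nf)]; rewrite free_nf1 free_nf_cl.
- by rewrite free_nf1.
- move=> P P1 PS a; rewrite -(free_nfK a); elim: (free_nf a) => // x w IH.
  by rewrite free_cl_cons; apply: PS (letS x) IH.
- move=> a; case aw: (free_nf a) => [|x w]; first by left; rewrite -(free_nfK a) aw.
  right; exists (cl [:: linv x]); first exact: letS.
  by rewrite -(free_nfK a) aw (free_cl_cons x) free_letterV mulKg.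
move=> _ a /mapP[x _ ->]; rewrite free_nf_letter.
case aw: (free_nf a) => [|y w] /=; first by left; rewrite -(free_nfK a) aw.
case: eqP => [yx|_]; last by left; rewrite -aw free_nfK.
by right; rewrite -[X in _ * X](free_nfK a) aw yx (free_cl_cons (linv x)) free_letterV mulVKg.
Qed.

Lemma countable_free_group : countable [set: F].
Proof.
apply/countable_injP; exists (fun a => pickle (free_nf a)) => a b _ _ ab.
rewrite -(free_nfK a) -(free_nfK b); congr pres_class.
by apply: pcan_inj ab; exact: pickleK.
Qed.

Lemma infinite_free_group : (0 < n)%N -> infinite_set [set: F].
Proof.
move=> n0 fF; pose x : L := (Ordinal n0, true).
have red k : free_reduced (nseq k x).
  by case: k => //= k; elim: k => //= k ->.
apply: infinite_nat.
have := @finite_preimage _ _ setT (fun k => cl (nseq k x)).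
rewrite preimage_setT; apply=> // k k' _ _ /(congr1 free_nf).
by rewrite !free_nf_reducedE// => /(congr1 size); rewrite !size_nseq.
Qed.

(** Paradoxical decomposition: the group is the union of W x and the translate by x of W x^-1, so
    these two sets have total mass at least 1; two generators give four disjoint sets of mass at
    least 2. *)
Lemma free_group_nonamenable (R : realType) : (1 < n)%N -> ~ amenable R F.
Proof.
move=> n1 [m [m1 m0 mU mI]].
pose W x : set F := [set a | ohead (free_nf a) = Some x].
have mM A B : A `<=` B -> (m A <= m B)%R.
  move=> AB; rewrite -(setDUK AB) mU ?setDIK// lerDl; exact: m0.
have two x : (1 <= m (W x) + m (W (linv x)))%R.
  rewrite -(mI (cl [:: x]) (W (linv x))) -m1.
  have -> : [set: F] = W x `|` (left_coset (W (linv x)) (cl [:: x]) `\` W x).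
    apply/seteqP; split=> // a _; have [h|h] := pselect (W x a); first by left.
    right; split=> //; exists (cl [:: linv x] * a); last by rewrite free_letterV mulVKg.
    rewrite /W /= free_nf_letter; case aw: (free_nf a) => [|y w] //=.
    rewrite linvK; case: eqP => // yx; case: h.
    by rewrite /W /= aw yx.
  by rewrite mU ?setDIK// lerD2l; apply: mM => a [].
pose x : L := (Ordinal (ltnW n1), true); pose y : L := (Ordinal n1, true).
have disj z z' : z != z' -> W z `&` W z' = set0.
  move=> zz; apply/seteqP; split=> // a []; rewrite /W /= => -> [] e.
  by move: zz; rewrite e eqxx.
have : (m (((W x `|` W (linv x)) `|` W y) `|` W (linv y)) <= 1)%R.
  by rewrite -m1; apply: mM.
rewrite !mU ?setIUl ?disj ?setU0//.
have := two x; have := two y.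
have px : (0 <= 1 :> R)%R by exact: ler01.
by move: (m (W x)) (m (W (linv x))) (m (W y)) (m (W (linv y))) => a b c d; lra.
Qed.

End FreeGroupWords.

(** * Averages of conjugates and simplicity *)

Section DisjointSupports.
Variables (R : realType) (X : choiceType) (T : choiceType) (ts : seq T) (P : T -> set X).
Local Notation HX := (l2_hilbert R X).
Hypotheses (uts : uniq ts)
  (disj : forall t t' x, t \in ts -> t' \in ts -> P t x -> P t' x -> t = t').

Lemma sum_restr_le (v : HX) : \sum_(t <- ts) nm (restr (P t) v) ^+ 2 <= nm v ^+ 2.
Proof.
rewrite -lee_fin -sumEFin nm2_l2 l2_sq_nsum; under eq_bigr do rewrite nm2_l2 l2_sq_nsum.
rewrite -nsum_sum => [|t x]; last exact: sqn_ge0.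
apply: le_nsum => x; have [[t0 t0s Px]|nP] := pselect (exists2 t0, t0 \in ts & P t0 x).
  rewrite (bigD1_seq t0)//= asboolT// big_seq_cond big1 ?addr0// => t /andP[tts /eqP tt0].
  by rewrite asboolF ?sqn0// => Pt; apply: tt0; exact: disj Pt Px.
rewrite big_seq big1 ?sqn_ge0// => t tts; rewrite restrE asboolF ?sqn0// => Pt.
by apply: nP; exists t.
Qed.

Lemma nm2_sum_orth (w : T -> HX) : (forall t x, t \in ts -> ~ P t x -> w t x = 0) ->
  nm (\sum_(t <- ts) w t) ^+ 2 <= \sum_(t <- ts) nm (w t) ^+ 2.
Proof.
move=> hw; rewrite -lee_fin -sumEFin nm2_l2 l2_sq_nsum; under [in leRHS]eq_bigr do rewrite nm2_l2 l2_sq_nsum.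
rewrite -nsum_sum => [|t x]; last exact: sqn_ge0.
apply: le_nsum => x; rewrite l2_sumE.
have [[t0 t0s Px]|nP] := pselect (exists2 t0, t0 \in ts & P t0 x).
  have h t : t \in ts -> t != t0 -> w t x = 0.
    by move=> tts /eqP tt0; apply: hw => // Pt; apply: tt0; exact: disj Pt Px.
  rewrite (bigD1_seq t0)//= [in leRHS](bigD1_seq t0)//= big_seq_cond big1 => [|t /andP[? ?]]; last exact: h.
  by rewrite addr0 lerDl; apply: sumr_ge0 => t _; exact: sqn_ge0.
rewrite big_seq big1 ?sqn0 => [|t tts]; first by apply: sumr_ge0 => t _; exact: sqn_ge0.
by apply: hw => // Pt; apply: nP; exists t.
Qed.

End DisjointSupports.

Lemma sqr_sum_le (R : realFieldType) (T : Type) (ts : seq T) (a : T -> R) :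
  (\sum_(t <- ts) a t) ^+ 2 <= (size ts)%:R * \sum_(t <- ts) a t ^+ 2.
Proof.
have [|n0] := posnP (size ts); first by move/size0nil => ->; rewrite !big_nil mulr0 expr0n.
have N0 : 0 < (size ts)%:R :> R by rewrite ltr0n.
pose A := \sum_(t <- ts) a t; rewrite -subr_ge0 -(pmulr_rge0 _ N0).
have sqE (s : R) : \sum_(t <- ts) ((size ts)%:R * a t - s) ^+ 2 =
    (size ts)%:R ^+ 2 * \sum_(t <- ts) a t ^+ 2 - 2 * (size ts)%:R * s * \sum_(t <- ts) a t + (size ts)%:R * s ^+ 2.
  have -> : (size ts)%:R * s ^+ 2 = \sum_(t <- ts) s ^+ 2.
    by rewrite big_const_seq count_predT iter_addr_0 mulr_natl.
  by rewrite !mulr_sumr -sumrB -big_split /=; apply: eq_bigr => t _; ring.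
have : 0 <= \sum_(t <- ts) ((size ts)%:R * a t - A) ^+ 2 by apply: sumr_ge0 => t _; exact: sqr_ge0.
rewrite sqE -/A; congr (_ <= _); ring.
Qed.

Section Powers.
Variables (R : realType) (G : groupType).
Local Notation C := (R[i]).
Local Notation HG := (l2_hilbert R G).
Local Notation lam := (left_regular R G).

(** Off P t the conjugate by t maps into vectors supported on P t; these sets are disjoint, so the
    corresponding sum is orthogonal and costs c |v|. On P t it is the restrictions of v that are
    orthogonal, and Cauchy-Schwarz costs c |v| again. *)
Lemma powers_bound (W : set G) (g : G) (ts : seq G) (c : R) (v : HG) : uniq ts ->
  (forall x, ~ W x -> W (g * x)%g) ->
  (forall t t' x, t \in ts -> t' \in ts -> W (t^-1 * x)%g -> W (t'^-1 * x)%g -> t = t') ->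
  0 <= c -> (size ts)%:R <= c ^+ 2 ->
  nm (\sum_(t <- ts) lam (t * g * t^-1)%g v) <= (2 * c * nm v).
Proof.
move=> uts gW disj c0 nc; pose P t : set G := [set x | W (t^-1 * x)%g].
have lamE h (y : HG) x : (lam h y : l2 R G) x = y (h^-1 * x)%g by [].
have -> : (\sum_(t <- ts) lam (t * g * t^-1)%g v = \sum_(t <- ts) lam (t * g * t^-1)%g (v - restr (P t) v) +
    \sum_(t <- ts) lam (t * g * t^-1)%g (restr (P t) v)).
  by rewrite -big_split; apply: eq_bigr => t _; rewrite -[RHS]/(lam _ _ + lam _ _) -urep_add subrK.
have n0 : (0 <= c * nm v) by rewrite mulr_ge0 ?nm_ge0.
apply: le_trans (nmD _ _) _; rewrite -mulrA mulr2n mulrDl mul1r; apply: lerD.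
  rewrite -(@ler_pXn2r _ 2) ?nnegrE ?nm_ge0//.
  apply: le_trans (nm2_sum_orth (P := P) uts disj _) _.
    move=> t x tts nP; rewrite lamE l2_addE l2_oppE restrE !invgM invgK.
    rewrite asboolT ?subrr// /P /= !mulgA mulVg mul1g; apply: contrapT => nW; apply: nP.
    by have := gW _ nW; rewrite -!mulgA mulVKg.
  apply: (@le_trans _ _ (\sum_(t <- ts) nm v ^+ 2)).
    apply: ler_sum => t _; rewrite nm_urep ler_pXn2r ?nnegrE ?nm_ge0//.
    apply: nm_l2_le; first exact: nm_ge0.
    rewrite nm2_l2 l2_sq_nsum; apply: le_nsum => x; rewrite l2_addE l2_oppE restrE.
    by case: ifP => _; rewrite ?subrr ?sqn0 ?sqn_ge0// subr0.
  rewrite big_const_seq count_predT iter_addr_0 -[(_ *+ size ts)]mulr_natl exprMn.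
  by rewrite ler_wpM2r ?sqr_ge0.
rewrite -(@ler_pXn2r _ 2) ?nnegrE ?nm_ge0//.
apply: (@le_trans _ _ ((\sum_(t <- ts) nm (restr (P t) v)) ^+ 2)).
  have s0 : 0 <= \sum_(t <- ts) nm (restr (P t) v) by apply: sumr_ge0 => t _; exact: nm_ge0.
  rewrite ler_pXn2r ?nnegrE ?nm_ge0//.
  by apply: le_trans (nm_sum _ _ _) _; apply: ler_sum => t _; rewrite nm_urep.
apply: le_trans (sqr_sum_le _ _) _; rewrite exprMn.
apply: ler_pM => //; last exact: sum_restr_le.
by apply: sumr_ge0 => t _; exact: sqr_ge0.
Qed.

Hypothesis powers : forall (E : seq G) (n : nat), 1%g \notin E ->
  exists (W : set G) (h : G) (ts : seq G), [/\ uniq ts, size ts = n,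
    forall g x, g \in E -> ~ W x -> W (h * g * h^-1 * x)%g &
    forall t t' x, t \in ts -> t' \in ts -> W (t^-1 * x)%g -> W (t'^-1 * x)%g -> t = t'].

(* Averaging the conjugates by ts of an element with trace one brings it close to the identity. *)
Lemma powers_simple : cstar_simple R G.
Proof.
rewrite /cstar_simple reduced_cstarE => I cI.
have [I0|In] := pselect (I = [set 0]); [by left|right].
have [IA [Iz ID] IZ IM _] := cI.
have bA := @full_image_bounded _ _ _ lam.
have nI : norm_closed I by apply: closed_ideal_norm_closed cI; [exact: bA|exact: full_image_closed].
suff Iid : I id.
  by apply/seteqP; split=> // S AS; exact: (IM S id AS Iid).1.
have Alam g : full_image lam (lam g).
  have -> : lam g = glrep lam [:: (1, g)] by apply/funext => v; rewrite /glrep big_seq1 scale1r.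
  exact: full_image_glrep.
have lamE h (y : HG) x : (lam h y : l2 R G) x = y (h^-1 * x)%g by [].
(* Translations on both sides move a nonzero matrix entry of T to the position of the trace, and a
   scalar makes it 1. *)
have [S IS S1] : exists2 S, I S & (S (delta R 1%g) : l2 R G) 1%g = 1.
  have [T IT Tn] : exists2 T, I T & T <> 0.
    apply: contrapT => h; apply: In; apply/seteqP; split=> [T IT /=|_ -> //].
    by apply: contrapT => Tn; apply: h; exists T.
  have [lT [M M0 hM]] := (bounded_opsP T).1 (bA _ (IA T IT)).
  have [z [x Tzx]] := op_delta_neq0 lT M0 hM Tn.
  exists ((T (delta R z) x : C)^-1 *: (lam x^-1%g \o (T \o lam z))).
    by apply: IZ; apply: (IM _ _ (Alam _) _).1; exact: (IM _ _ (Alam _) IT).2.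
  have dz : lam z (delta R 1%g) = delta R z :> HG.
    apply: l2E => y; rewrite lamE !deltaE; congr (_%:R); congr nat_of_bool.
    by apply/eqP/eqP => [/mulg1_eq|->]; rewrite ?invgK ?mulVg.
  rewrite -[X in (X : l2 R G) _]/(_ *: lam x^-1%g (T (lam z (delta R 1%g)))) dz.
  by rewrite l2_scaleE lamE invgK mulg1 mulVf.
have [lS _] := (bounded_opsP S).1 (bA _ (IA S IS)).
have q0 : 0 < 8^-1 :> R by rewrite invr_gt0.
have /full_imageP[_ /(_ _ q0)[l hl]] := IA S IS.
(* With m^2 conjugates every nontrivial group element averages to norm at most 2 / m, so these terms
   of l contribute at most 2 gln l / m <= 1/8. *)
pose m := (Num.bound (16 * gln l)).+1; have m0 : 0 < m%:R :> R by rewrite ltr0n.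
have ml : 16 * gln l <= m%:R.
  apply: le_trans (ltW (archi_boundP _)) _; first by rewrite mulr_ge0 ?gln_ge0.
  by rewrite ler_nat.
pose E := [seq g <- map snd l | g != 1%g].
have [|W [h [ts [uts sts hW disj]]]] := @powers E (m * m)%N.
  by rewrite mem_filter eqxx.
pose n : R := (m * m)%:R; have n0 : 0 < n by rewrite ltr0n muln_gt0.
pose kap : C := (glrep lam l (delta R 1%g) : l2 R G) 1%g.
have kapE : kap = \sum_(p <- l) p.1 * (p.2 == 1%g)%:R.
  rewrite /kap /glrep l2_sumE; apply: eq_bigr => p _.
  by rewrite l2_scaleE lamE mulg1 deltaE invg_eq1.
have kap1 : mag (1 - kap) <= 8^-1.
  rewrite -S1 -magN opprB.
  have := hl (delta R 1%g); rewrite nm_delta mulr1; apply: le_trans.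
  exact: (nm_coord (glrep lam l (delta R 1%g) - S (delta R 1%g) : l2 R G) 1%g).
pose cj t (T : HG -> HG) : HG -> HG := lam (t * h)%g \o (T \o lam (t * h)^-1%g).
pose D : HG -> HG := (n^-1)%:C%C *: \sum_(t <- ts) cj t S.
have ID' : I D.
  apply: IZ; apply: (big_ind I) => // t _.
  by apply: (IM _ _ (Alam _) _).1; exact: (IM _ _ (Alam _) IS).2.
have k1 : (1 / 2 : R) < 1 by lra.
have k0 : 0 <= (1 / 2 : R) by lra.
apply: (ideal_near_id bA cI nI (full_image_id lam) ID' k0 k1) => v.
have avg (f : G -> HG) (c : R) : (forall t, t \in ts -> nm (f t) <= c) -> nm ((n^-1)%:C%C *: \sum_(t <- ts) f t) <= c.
  move=> hf; rewrite nmZr ger0_norm ?invr_ge0 ?(ltW n0)// ler_pdivrMl//.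
  apply: le_trans (nm_sum _ _ _) _; apply: (@le_trans _ _ (\sum_(t <- ts) c)).
    by rewrite big_seq [leRHS]big_seq; exact: ler_sum.
  by rewrite big_const_seq count_predT iter_addr_0 -[(_ *+ size ts)]mulr_natl sts.
(* The error has three parts, each at most 1/8: the trace of l against 1, the approximation of S by
   l in [X1], and the averages of the nontrivial terms of l in [X2]. *)
pose X1 : HG := (n^-1)%:C%C *: \sum_(t <- ts) cj t (glrep lam l - S) v.
pose X2 : HG := \sum_(p <- l) p.1 *:
   ((p.2 == 1%g)%:R *: v - (n^-1)%:C%C *: \sum_(t <- ts) lam (t * (h * p.2 * h^-1) * t^-1)%g v).
have -> : (id - D) v = (1 - kap) *: v + X1 + X2.
  have cjE t : cj t (glrep lam l) v = \sum_(p <- l) p.1 *: lam (t * (h * p.2 * h^-1) * t^-1)%g v.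
    rewrite -[LHS]/(lam (t * h)%g (glrep lam l (lam (t * h)^-1%g v))) /glrep urep_sum; apply: eq_bigr => p _; rewrite urep_scale -!urepM.
    by congr (_ *: lam _ v); rewrite invgM !mulgA.
  have X2E : X2 = kap *: v - (n^-1)%:C%C *: \sum_(t <- ts) cj t (glrep lam l) v.
    rewrite kapE scaler_suml (eq_bigr _ (fun t _ => cjE t)) exchange_big /= scaler_sumr -sumrB; apply: eq_bigr => p _.
    rewrite scalerBr !scalerA; congr (_ - _).
    by rewrite -scaler_sumr scalerA mulrC.
  have X1E : X1 = (n^-1)%:C%C *: \sum_(t <- ts) cj t (glrep lam l) v - D v.
    rewrite /X1 -[D v]/((n^-1)%:C%C *: (\sum_(t <- ts) cj t S) v) fct_sumE -scalerBr -sumrB.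
    congr (_ *: _); apply: eq_bigr => t _.
    by rewrite -(linB (urep_linear lam _)).
  rewrite X1E X2E -[LHS]/(v - D v) scalerBl scale1r.
  move: (kap *: v) (D v) ((n^-1)%:C%C *: _) => p q r.
  by rewrite [RHS]addrAC [v - p + (p - r)]addrA subrK addrA subrK.
have h1 : nm X1 <= 8^-1 * nm v.
  by apply: avg => t _; rewrite nm_urep; apply: le_trans (hl _) _; rewrite nm_urep.
have h2 : nm X2 <= 8^-1 * nm v.
  rewrite /X2; apply: le_trans (nm_sum _ _ _) _.
  apply: (@le_trans _ _ (\sum_(p <- l) mag p.1 * (2 / m%:R * nm v))).
    rewrite big_seq [leRHS]big_seq; apply: ler_sum => p pl; rewrite nmZ ler_wpM2l ?mag_ge0//.
    have [p1|p1] := eqVneq p.2 1%g.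
      rewrite p1 scale1r; under eq_bigr do rewrite mulg1 mulgV mulg1 mulgV urep1.
      rewrite big_const_seq count_predT iter_addr_0 -[v *+ _]scaler_nat scalerA sts.
      rewrite -[(m * m)%:R]/((m * m)%:R : C) -(rmorph_nat (real_complex R)) -rmorphM /= mulVf ?gt_eqF//.
      by rewrite scale1r subrr nm0 mulr_ge0 ?nm_ge0 ?divr_ge0.
    rewrite scale0r sub0r nmN nmZr ger0_norm ?invr_ge0 ?(ltW n0)// ler_pdivrMl//.
    have -> : n * (2 / m%:R * nm v) = 2 * m%:R * nm v by rewrite /n natrM; field; rewrite gt_eqF.
    apply: powers_bound uts _ disj _ _; rewrite ?sts ?natrM ?expr2//.
    move=> x; apply: hW; rewrite mem_filter p1; exact: map_f.
  rewrite -mulr_suml -/(gln l) mulrA ler_wpM2r ?nm_ge0//.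
  rewrite mulrA ler_pdivrMr// mulrC; lra.
have h3 : nm ((1 - kap) *: v) <= 8^-1 * nm v by rewrite nmZ ler_wpM2r ?nm_ge0.
apply: le_trans (nmD _ _) _; apply: le_trans (lerD (nmD _ _) (lexx _)) _.
have := nm_ge0 v; move: h1 h2 h3; clear; set a := nm X1; set b := nm X2; set c := nm (_ *: _); lra.
Qed.

End Powers.

Section FreeProductPowers.
Variables (G H : groupType).
Local Open Scope group_scope.
Local Notation L := (G + H)%type.
Local Notation FP := (freeprod G H).
Local Notation il := (@freeprod_inl G H).
Local Notation ir := (@freeprod_inr G H).
Implicit Types (x y : L) (u v w : seq L).

Definition starts_inl w := if w is x :: _ then is_left x else false.
Definition starts_inr w := if w is x :: _ then ~~ is_left x else false.

Lemma reduced_glue u x y w : reduced (rcons u x) -> is_left x = is_left y -> reduced (y :: w) ->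
  reduced (u ++ y :: w).
Proof.
move=> ru xy rw; elim: u ru => //= a u IH; rewrite !reduced_cons => /and3P[-> /IH -> h] /=.
by move: h; case: (u) => //= ; rewrite xy.
Qed.

Lemma pushes_reduced_cat u w : reduced (u ++ w) -> pushes u w = u ++ w.
Proof.
elim: u => //= x u IH rw; rewrite IH ?(reduced_tl rw)//.
move: rw; rewrite reduced_cons; case: x (u ++ w) => [g|h] [|[g'|h'] v] /and3P[] //= ->; by [].
Qed.

Lemma pushes_rcons_inl u y (c : G) w : reduced (rcons u y) -> reduced (inl c :: w) ->
  (if y is inl k then k * c != 1 else true) ->
  pushes (rcons u y) (inl c :: w) =
    u ++ match y with inl k => inl (k * c) :: w | inr h => inr h :: inl c :: w end.
Proof.
move=> ru rw yc; rewrite /pushes foldr_rcons -/(pushes _ _).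
case: y ru yc => [k|h] ru yc.
  have rk : reduced (inl (k * c) :: w).
    by move: rw; rewrite !reduced_cons /= yc => /and3P[_ -> ->].
  by rewrite /= (negbTE yc) pushes_reduced_cat//; apply: reduced_glue ru _ rk.
have h1 : h != 1 by move: ru; rewrite /reduced all_rcons => /andP[/andP[]].
rewrite /= h1 pushes_reduced_cat//; apply: reduced_glue ru _ _ => //.
by rewrite reduced_cons [nontriv _]h1 rw.
Qed.

(** Excluded are g = 1, the inverse of a first letter of a in G, and a last letter of a in G. For
    any other g the conjugate keeps a nontrivial first letter in G, whatever word starting in H
    follows it. *)
Lemma conjugate_starts_inl (a : FP) : a != 1 -> exists B : seq G, forall g, g \notin B ->
  forall b, starts_inr (nf b) -> starts_inl (nf (il g * a * (il g)^-1 * b)).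
Proof.
move=> a1; have ra := nf_reduced a.
have un : nf a != [::] by apply: contraNneq a1 => e; rewrite -(nfK a) e.
pose hd := if nf a is inl k :: _ then [:: k^-1] else [::].
pose tl := if last (inl 1) (nf a) is inl k then [:: k] else [::].
exists (1 :: hd ++ tl) => g; rewrite inE mem_cat !negb_or => /and3P[g1 ghd gtl] b.
set w := nf b => sw; have rw : reduced w by exact: nf_reduced.
have gV : g^-1 != 1 by rewrite invg_eq1.
have rgw : reduced (inl g^-1 :: w) by rewrite reduced_cons /= gV rw; case: (w) sw => //= y v.
have ngb : nf ((il g)^-1 * b) = inl g^-1 :: w.
  by rewrite -freeprod_inlV nf_inl -/w; case: (w) sw => [|[k|k] v] //= _; rewrite gV.
have : if nf (a * ((il g)^-1 * b)) is y :: _ then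
    if y is inl k then g * k != 1 else true else false.
  rewrite -{1}(nfK a) nf_mul ngb; move: ghd gtl ra un; rewrite /hd /tl.
  case/lastP: (nf a) => [//|u y]; rewrite last_rcons => ghd gtl ra _.
  rewrite pushes_rcons_inl//; last first.
    by case: y gtl {ra ghd} => // k; rewrite mem_seq1 divg_eq1 eq_sym.
  case: u ghd ra => [|[k|k] u] //= ghd ra; last first.
    by apply: contraNneq ghd => e; rewrite mem_seq1 -(mulg1_eq e) invgK.
  case: y ra {gtl ghd} => // k; rewrite /reduced /= !andbT => k1.
  by rewrite mulgA divg_eq1; apply: contraNneq k1 => /(canRL (mulKg g)); rewrite mulVg => ->.
rewrite -!mulgA nf_inl; case: (nf _) => [|[k|k] v] //=; last by rewrite g1.
by move=> /negbTE ->.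
Qed.

Lemma infinite_uniq_notin (T : choiceType) (B : seq T) n : infinite_set [set: T] ->
  exists s : seq T, [/\ uniq s, size s = n & forall t, t \in s -> t \notin B].
Proof.
move=> iT; elim: n => [|n [s [us sn sB]]]; first by exists [::].
have [t] := infinite_notin iT (s ++ B); rewrite mem_cat negb_or => /andP[ts tB].
exists (t :: s); split=> /=; [by rewrite ts|by rewrite sn|].
by move=> t'; rewrite inE => /orP[/eqP ->|/sB].
Qed.

(** Ping-pong with W the words starting in H. For x outside W, k^-1 x starts in H, a conjugate by a
    generic g of G makes it start in G, and k brings it into W. Translates of W by distinct
    nontrivial elements of G are disjoint because these elements are the first letters of their
    words. *)
Lemma freeprod_powers : infinite_set [set: G] -> (exists k : H, k != 1) ->
  forall (E : seq FP) (n : nat), 1 \notin E ->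
  exists (W : set FP) (h : FP) (ts : seq FP), [/\ uniq ts, size ts = n,
    forall g (x : FP), g \in E -> ~ W x -> W (h * g * h^-1 * x) &
    forall t t' (x : FP), t \in ts -> t' \in ts -> W (t^-1 * x) -> W (t'^-1 * x) -> t = t'].
Proof.
move=> iG [k k1] E n E1.
have /choice[B hB] a : exists B : seq G, a != 1 -> forall g, g \notin B ->
    forall b, starts_inr (nf b) -> starts_inl (nf (il g * a * (il g)^-1 * b)).
  have [->|/conjugate_starts_inl[B hB]] := eqVneq a 1; first by exists [::].
  by exists B.
have [g gB] := infinite_notin iG (flatten [seq B a | a <- E]).
have [ts [uts sts ts1]] := infinite_uniq_notin [:: 1] n iG.
exists [set x | starts_inr (nf x)], (ir k * il g), (map il ts); split.
- by rewrite map_inj_uniq//; exact: freeprod_inl_inj.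
- by rewrite size_map.
- move=> a x aE /= nx; have a1 : a != 1 by apply: contraNneq E1 => <-.
  have kV : k^-1 != 1 by rewrite invg_eq1.
  have h1 : starts_inr (nf ((ir k)^-1 * x)).
    by rewrite -freeprod_inrV nf_inr; case: (nf x) nx => [|[z|z] v] //= nx; rewrite kV.
  have gBa : g \notin B a.
    by apply: contra gB => gBa; apply/flattenP; exists (B a) => //; exact: map_f.
  have := hB a a1 g gBa _ h1.
  have -> : ir k * il g * a * (ir k * il g)^-1 * x = ir k * (il g * a * (il g)^-1 * ((ir k)^-1 * x)).
    by rewrite invgM !mulgA.
  by rewrite (nf_inr k); case: (nf _) => [|[z|z] v] //= _; rewrite k1.
have st t (x : FP) : t != 1 -> starts_inr (nf ((il t)^-1 * x)) -> exists v, nf x = inl t :: v.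
  move=> t1 h; exists (nf ((il t)^-1 * x)); rewrite -{1}(mulVKg (il t) x) nf_inl.
  by case: (nf _) h => [|[z|z] v] //= _; rewrite t1.
move=> _ _ x /mapP[t tts ->] /mapP[t' t'ts ->] /= h h'.
have t1 : t != 1 by have := ts1 _ tts; rewrite mem_seq1.
have t'1 : t' != 1 by have := ts1 _ t'ts; rewrite mem_seq1.
have [v e] := st t x t1 h; have [v' e'] := st t' x t'1 h'.
by move: e'; rewrite e => -[->].
Qed.

End FreeProductPowers.

Lemma free_freeprod_ideals (R : realType) (r s : nat) : (2 <= r)%N -> (2 <= s)%N -> forall I,
  nontrivial_ideal (full_image (quasi_regular R
    (range (@freeprod_inl (free_group r) (free_group s))))) I <-> I = @compact_ops R _.
Proof.
move=> r2 s2; apply: freeprod_ideals.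
- exact: countable_free_group.
- by apply: infinite_free_group; exact: ltnW.
- exact: free_group_nonamenable.
- apply/powers_simple/freeprod_powers; first by apply: infinite_free_group; exact: ltnW.
  have iF := @infinite_free_group s (ltnW s2).
  by have [k] := infinite_notin iF [:: 1%g]; rewrite mem_seq1 => k1; exists k.
- have [S [q tr]] := tree_freeprod (tree_free_group r) (tree_free_group s).
  exact: propA_of_tree tr.
Qed.

Theorem theorem3p2 (R : realType) :
  (forall Gamma Lambda : groupType,
     countable [set: Gamma] -> countable [set: Lambda] ->
     infinite_set [set: Lambda] ->
     (forall Upsilon : groupClosed (freeprod Gamma Lambda),
        has_AP R (subgroup Upsilon) ->
        topologically_amenable R
          (restrict_action Upsilon
             (boundary_action
                (coset_action (range (@freeprod_inl Gamma Lambda))))))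
     /\
     (~ amenable R Gamma ->
      cstar_simple R (freeprod Gamma Lambda) ->
      has_AP R (freeprod Gamma Lambda) ->
      forall I,
        nontrivial_ideal
          (full_image (quasi_regular R (range (@freeprod_inl Gamma Lambda)))) I
        <-> I = @compact_ops R _))
  /\
  (forall r s : nat, (2 <= r)%N -> (2 <= s)%N ->
     exists! I,
       nontrivial_ideal
         (full_image (quasi_regular R
            (range (@freeprod_inl (free_group r) (free_group s))))) I).
Proof.
split=> [Gamma Lambda cG cL iL|r s r2 s2].
  have cF := countable_freeprod cG cL; split=> [Upsilon AP|nam cs AP I].
    by apply: boundary_amenable => //; apply: propA_of_AP AP _; exact: countable_subgroup.
  by apply: freeprod_ideals => //; exact: propA_of_AP AP cF.
have h := @free_freeprod_ideals R r s r2 s2.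
by exists (@compact_ops R _); split=> [|I /h ->//]; exact/h.
Qed.
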